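(* Let $0<s<\frac12$. Then: (1) The Bargmann transform $\mathfrak V_d$ is a topological isomorphism from $\boldsymbol{\mathcal S}_s(\mathbf R^d)$ onto $\mathcal A_s(\mathbf C^d)$. (2) The Bargmann transform $\mathfrak V_d$ is a topological isomorphism from $\boldsymbol\Sigma_s(\mathbf R^d)$ onto $\mathcal A_{0,s}(\mathbf C^d)$.
   Context: The Bargmann transform of $f$ is the entire function $$\mathfrak V_df(z)=\pi^{-d/4}\int_{\mathbf R^d}\exp\Big(-\tfrac12\big(\langle z,z\rangle+|y|^2\big)+\sqrt2\,\langle z,y\rangle\Big)f(y)\,dy,\quad z\in\mathbf C^d,$$ where $\langle z,w\rangle=\sum_jz_jw_j$; it maps the normalized Hermite function $h_\alpha$ to $z^\alpha/\sqrt{\alpha!}$. Let $H=|x|^2-\Delta$ be the harmonic oscillator on $\mathbf R^d$. For $h>0$ consider the norm $$\|f\|_{(s,h)}=\sup_{N\ge0}\frac{\|H^Nf\|_{L^\infty}}{h^N(N!)^{2s}},\quad f\in C^\infty(\mathbf R^d).$$ The Pilipović space $\boldsymbol{\mathcal S}_s(\mathbf R^d)$ of Roumieu type (resp. $\boldsymbol\Sigma_s(\mathbf R^d)$ of Beurling type) is the set of all $f\in C^\infty(\mathbf R^d)$ such that $\|f\|_{(s,h)}<\infty$ for some $h>0$ (resp. for every $h>0$), with the inductive (resp. projective) limit topology with respect to $h>0$. Let $A(\mathbf C^d)$ be the set of entire functions on $\mathbf C^d$ and, for $z\in\mathbf C^d$ (a single argument), $\langle z\rangle=(1+|z|^2)^{1/2}$.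 For $0<s<\frac12$ and $R>0$ consider the norm $$\|F\|_{[R]}=\sup_{z\in\mathbf C^d}|F(z)|\,e^{-R(\log\langle z\rangle)^{\frac1{1-2s}}},\quad F\in A(\mathbf C^d).$$ Then $\mathcal A_s(\mathbf C^d)$ is the set of all $F\in A(\mathbf C^d)$ with $\|F\|_{[R]}<\infty$ for some $R>0$, with the inductive limit topology with respect to $R>0$; and $\mathcal A_{0,s}(\mathbf C^d)$ is the set of all $F\in A(\mathbf C^d)$ with $\|F\|_{[R]}<\infty$ for every $R>0$, with the projective limit topology with respect to $R>0$. *)

(* Defs.v *)
(* R^d is 'rV[R]_d and C^d is 'rV[R[i]]_d, for any d : nat.  Complex-valued
   functions have codomain R[i]^o, the normed module R[i] over itself: R[i] alone
   carries the structure of a module over R. *)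
From HB Require Import structures.
From mathcomp Require Import all_boot all_order all_algebra.
From mathcomp Require Import complex ring.
From mathcomp Require Import all_classical all_reals all_analysis ess_sup_inf.
Set Implicit Arguments.
Unset Strict Implicit.
Unset Printing Implicit Defensive.
Import Order.TTheory GRing.Theory Num.Theory.
Import numFieldNormedType.Exports.
Local Open Scope classical_set_scope.
Local Open Scope ring_scope.
Local Open Scope complex_scope.

Section complex_functions.
Variable R : realType.
Local Notation C := (R[i]^o).
Local Notation Re := complex.Re.
Local Notation Im := complex.Im.
Local Notation normc := ComplexField.Normc.normc.

Section smooth.
Variable d : nat.
Implicit Type f : 'rV[R]_d -> C.

Definition Rebasis (i : 'I_d) : 'rV[R]_d := delta_mx ord0 i.

Definition re_part f : 'rV[R]_d -> R := fun x => Re (f x).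
Definition im_part f : 'rV[R]_d -> R := fun x => Im (f x).

(* Continuity and directional derivatives of a complex-valued function on R^d
   are taken on its real and imaginary parts. *)
Definition continuousC f :=
  continuous (re_part f) /\ continuous (im_part f).

Definition partial_derivable f := forall i x,
  derivable (re_part f) x (Rebasis i) /\ derivable (im_part f) x (Rebasis i).

Definition partial (i : 'I_d) f : 'rV[R]_d -> C := fun x =>
  'D_(Rebasis i) (re_part f) x +i* 'D_(Rebasis i) (im_part f) x.

(* All iterated partial derivatives exist and are continuous. *)
Definition smooth f := forall s : seq 'I_d,
  continuousC (foldr partial f s) /\ partial_derivable (foldr partial f s).

Definition laplacian f : 'rV[R]_d -> C := fun x =>
  \sum_i partial i (partial i f) x.

Definition enorm2 (x : 'rV[R]_d) : R := \sum_i x ord0 i ^+ 2.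

Definition harmonic_oscillator f : 'rV[R]_d -> C :=
  fun x => (enorm2 x)%:C * f x - laplacian f x.

End smooth.

Section entire.
Variable d : nat.
Implicit Types (F G : 'rV[R[i]]_d -> C) (a : R[i]).

(* Complex (Frechet) differentiability: the scalar field is R[i]. *)
Definition entire F := forall z, differentiable F z.

Definition japanese (z : 'rV[R[i]]_d) : R :=
  Num.sqrt (1 + \sum_j normc (z ord0 j) ^+ 2).

Definition growth_norm (s r : R) F : \bar R :=
  ereal_sup (range (fun z =>
    (normc (F z) * expR (- (r * (ln (japanese z)) `^ (1 - 2 * s)^-1)))%:E)).

Definition cexp (z : R[i]) : R[i] :=
  (expR (Re z) * cos (Im z)) +i* (expR (Re z) * sin (Im z)).

(* Bilinear: no conjugation. *)
Definition cdot (z w : 'rV[R[i]]_d) : R[i] := \sum_j z ord0 j * w ord0 j.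

Definition complexify (y : 'rV[R]_d) : 'rV[R[i]]_d := map_mx (real_complex R) y.

Lemma entire0 : entire (0 : 'rV[R[i]]_d -> C).
Proof. by move=> z; exact: differentiable_cst. Qed.

Lemma entire_lin a F G : entire F -> entire G -> entire (a *: F + G).
Proof.
move=> dF dG z; have H := differentiableD (differentiableZ a (dF z)) (dG z).
exact H.
Qed.

End entire.
End complex_functions.

Section smooth_theory.
Variables (R : realType) (d : nat).
Local Notation C := (R[i]^o).
Local Notation Re := complex.Re.
Local Notation Im := complex.Im.
Local Notation normc := ComplexField.Normc.normc.
Implicit Types (f g : 'rV[R]_d -> C) (i j : 'I_d) (a : R[i]).

Let comb (u v : R) (p q r : 'rV[R]_d -> R) : 'rV[R]_d -> R :=
  (u \*: p + v \*: q) + r.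

Let comb_continuous u v p q r : continuous p -> continuous q -> continuous r ->
  continuous (comb u v p q r).
Proof.
move=> cp cq cr x; apply: cvgD (cr x).
by apply: cvgD; apply: cvgZr; [exact: cp|exact: cq].
Qed.

Let comb_derivable u v p q r x w :
  derivable p x w -> derivable q x w -> derivable r x w ->
  derivable (comb u v p q r) x w.
Proof.
move=> dp dq dr.
have H := derivableD (derivableD (derivableZ (k:=u) dp) (derivableZ (k:=v) dq)) dr.
exact H.
Qed.

Let comb_derive u v p q r x w :
  derivable p x w -> derivable q x w -> derivable r x w ->
  'D_w (comb u v p q r) x = u * 'D_w p x + v * 'D_w q x + 'D_w r x.
Proof.
move=> dp dq dr.
have H := deriveD (derivableD (derivableZ (k:=u) dp) (derivableZ (k:=v) dq)) dr.
rewrite (deriveD (derivableZ (k:=u) dp) (derivableZ (k:=v) dq)) in H.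
rewrite (deriveZ u dp) (deriveZ v dq) in H.
exact H.
Qed.

Let ReE a f g : re_part (a *: f + g) =
  comb (Re a) (- Im a) (re_part f) (im_part f) (re_part g).
Proof.
apply/funext => x; rewrite /comb /re_part /im_part !fctE /=.
by case: a (f x) (g x) => [? ?] [? ?] [? ?] /=; rewrite scaleNr.
Qed.

Let ImE a f g : im_part (a *: f + g) =
  comb (Re a) (Im a) (im_part f) (re_part f) (im_part g).
Proof.
apply/funext => x; rewrite /comb /re_part /im_part !fctE /=.
by case: a (f x) (g x) => [? ?] [? ?] [? ?].
Qed.

Lemma continuousC_lin a f g :
  continuousC f -> continuousC g -> continuousC (a *: f + g).
Proof.
move=> [f1 f2] [g1 g2]; split; first by rewrite ReE; exact: comb_continuous.
by rewrite ImE; exact: comb_continuous.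
Qed.

Lemma partial_derivable_lin a f g :
  partial_derivable f -> partial_derivable g -> partial_derivable (a *: f + g).
Proof.
move=> df dg i x; have [f1 f2] := df i x; have [g1 g2] := dg i x.
by split; [rewrite ReE|rewrite ImE]; exact: comb_derivable.
Qed.

Lemma partial_lin a f g i : partial_derivable f -> partial_derivable g ->
  partial i (a *: f + g) = a *: partial i f + partial i g.
Proof.
move=> df dg; apply/funext => x; have [f1 f2] := df i x; have [g1 g2] := dg i x.
rewrite /partial ReE ImE !comb_derive// !fctE mulNr.
by case: (a) => u v.
Qed.

Lemma smooth_lin a f g : smooth f -> smooth g -> smooth (a *: f + g).
Proof.
move=> sf sg s; suff -> : foldr (@partial R d) (a *: f + g) s =
    a *: foldr (@partial R d) f s + foldr (@partial R d) g s.
  have [? ?] := sf s; have [? ?] := sg s.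
  by split; [exact: continuousC_lin|exact: partial_derivable_lin].
elim: s => //= i s ->; apply: partial_lin; [exact: (sf s).2|exact: (sg s).2].
Qed.

Lemma smooth0 : smooth (0 : 'rV[R]_d -> C).
Proof.
have p0 i : partial i (0 : 'rV[R]_d -> C) = 0.
  by apply/funext => x; rewrite /partial !derive_cst.
move=> s; have -> : foldr (@partial R d) (0 : 'rV[R]_d -> C) s = 0.
  by elim: s => //= i s ->.
have r0 : re_part (0 : 'rV[R]_d -> C) = cst 0 by [].
have i0 : im_part (0 : 'rV[R]_d -> C) = cst 0 by [].
split; first by split; rewrite ?r0 ?i0; exact: cst_continuous.
by move=> i x; rewrite r0 i0; split; exact: derivable_cst.
Qed.

Lemma smooth_partial f i : smooth f -> smooth (partial i f).
Proof. by move=> sf s; have := sf (rcons s i); rewrite foldr_rcons. Qed.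

Lemma smooth_coind (P : set ('rV[R]_d -> C)) :
  (forall f, P f -> [/\ continuousC f, partial_derivable f &
                      forall i, P (partial i f)]) ->
  P `<=` @smooth R d.
Proof.
move=> HP f Pf s; suff /HP[] : P (foldr (@partial R d) f s) by [].
by elim: s => //= i s /HP[].
Qed.

Let coordmul j f : 'rV[R]_d -> C := fun x => (x ord0 j)%:C * f x.

Let coord_differentiable j (x : 'rV[R]_d) :
  differentiable (fun y : 'rV[R]_d => y ord0 j : R) x.
Proof. exact: differentiable_coord. Qed.

Let coord_derivable j (x w : 'rV[R]_d) :
  derivable (fun y : 'rV[R]_d => y ord0 j : R) x w.
Proof. exact: diff_derivable. Qed.

Let coord_derive j x w :
  'D_w (fun y : 'rV[R]_d => y ord0 j : R) x = w ord0 j.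
Proof.
rewrite deriveE//.
pose f := fun y : 'rV[R]_d => y ord0 j : R.
have lf : linear f by move=> k u v; rewrite /f !mxE.
pose lf' := GRing.isLinear.Build R 'rV[R]_d R _ f lf.
pose L : {linear 'rV[R]_d -> R} := HB.pack f lf'.
have -> : (fun y : 'rV[R]_d => y ord0 j : R) = L by [].
rewrite diff_lin// => z; exact: coord_continuous.
Qed.

Let mulc j (p : 'rV[R]_d -> R) : 'rV[R]_d -> R :=
  (fun y : 'rV[R]_d => y ord0 j : R) * p.

Let mulc_continuous j p : continuous p -> continuous (mulc j p).
Proof.
move=> cp x; apply: continuousM; last exact: cp.
exact: (differentiable_continuous (@coord_differentiable j x)).
Qed.

Let mulc_derivable j p x w : derivable p x w -> derivable (mulc j p) x w.
Proof. by move=> dp; have H := derivableM (@coord_derivable j x w) dp; exact H. Qed.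

Let mulc_derive j p x w : derivable p x w ->
  'D_w (mulc j p) x = x ord0 j * 'D_w p x + p x * w ord0 j.
Proof.
move=> dp; have H := deriveM (@coord_derivable j x w) dp.
by rewrite coord_derive in H; exact H.
Qed.

Let re_coordmul j f : re_part (coordmul j f) = mulc j (re_part f).
Proof.
apply/funext => x; rewrite /mulc /re_part /coordmul mulrfctE.
by case: (f x) => u v /=; rewrite mul0r subr0.
Qed.

Let im_coordmul j f : im_part (coordmul j f) = mulc j (im_part f).
Proof.
apply/funext => x; rewrite /mulc /im_part /coordmul mulrfctE.
by case: (f x) => u v /=; rewrite mul0r addr0.
Qed.

Let coordmul_continuous j f : continuousC f -> continuousC (coordmul j f).
Proof.
by move=> [f1 f2]; split; rewrite ?re_coordmul ?im_coordmul; exact: mulc_continuous.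
Qed.

Let coordmul_derivable j f : partial_derivable f -> partial_derivable (coordmul j f).
Proof.
move=> df i x; have [f1 f2] := df i x; rewrite re_coordmul im_coordmul.
by split; exact: mulc_derivable.
Qed.

Let coordmul_partial i j f : partial_derivable f ->
  partial i (coordmul j f) = (i == j)%:R *: f + coordmul j (partial i f).
Proof.
move=> df; apply/funext => x; have [f1 f2] := df i x.
rewrite /partial re_coordmul im_coordmul !mulc_derive//.
rewrite /Rebasis !mxE eqxx/= eq_sym /coordmul !fctE /re_part /im_part.
case: (f x) => u v /=.
by case: eqP => _; congr Complex => /=; ring.
Qed.

Inductive coord_closure : set ('rV[R]_d -> C) :=
| coord_closure_smooth f of smooth f : coord_closure f
| coord_closure_lin a f g of coord_closure f & coord_closure g :
    coord_closure (a *: f + g)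
| coord_closure_mul j f of coord_closure f : coord_closure (coordmul j f).

Let coord_closure_subsmooth : coord_closure `<=` @smooth R d.
Proof.
apply: smooth_coind => f; elim=> {f} [f sf|a f g cf [f1 f2 f3] cg [g1 g2 g3]|j f cf [f1 f2 f3]].
- have [? ?] := sf [::]; split => // i.
  by apply: coord_closure_smooth; exact: smooth_partial.
- split; [exact: continuousC_lin|exact: partial_derivable_lin|move=> i].
  by rewrite partial_lin//; exact: coord_closure_lin.
- split; [exact: coordmul_continuous|exact: coordmul_derivable|move=> i].
  by rewrite coordmul_partial//; apply: coord_closure_lin => //; exact: coord_closure_mul.
Qed.

Lemma smooth_sum (F : 'I_d -> 'rV[R]_d -> C) :
  (forall i, smooth (F i)) -> smooth (\sum_i F i).
Proof.
move=> sF; elim/big_ind: _ => [|f g sf sg|//]; first exact: smooth0.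
by rewrite -[f]scale1r; exact: smooth_lin.
Qed.

Let harmonicE f : harmonic_oscillator f =
  (-1) *: (\sum_i partial i (partial i f)) + \sum_i coordmul i (coordmul i f).
Proof.
apply/funext => x; rewrite /harmonic_oscillator /laplacian !fctE !fct_sumE.
rewrite scaleN1r addrC; congr (_ + _).
rewrite /enorm2 rmorph_sum mulr_suml; apply: eq_bigr => i _.
by rewrite /coordmul rmorphXn mulrA -expr2.
Qed.

Lemma smooth_harmonic f : smooth f -> smooth (harmonic_oscillator f).
Proof.
move=> sf; rewrite harmonicE; apply: smooth_lin; apply: smooth_sum => i.
  by do 2!apply: smooth_partial.
apply: coord_closure_subsmooth; do 2!apply: coord_closure_mul.
exact: coord_closure_smooth.
Qed.

Let harmonic_alg (e a u v l m : R[i]) :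
  e * (a * u + v) - (a * l + m) = a * (e * u - l) + (e * v - m).
Proof. ring. Qed.

Lemma harmonic_lin a f g : smooth f -> smooth g ->
  harmonic_oscillator (a *: f + g) =
  a *: harmonic_oscillator f + harmonic_oscillator g.
Proof.
move=> sf sg; have D h (sh : smooth h) : partial_derivable h := (sh [::]).2.
apply/funext => x.
have L : laplacian (a *: f + g) x = a * laplacian f x + laplacian g x.
  rewrite /laplacian mulr_sumr -big_split; apply: eq_bigr => i _.
  rewrite partial_lin; [|exact: D..].
  by rewrite partial_lin; [|by apply: D; exact: smooth_partial..].
rewrite [LHS]/harmonic_oscillator L.
exact (harmonic_alg _ _ _ _ _ _).
Qed.

Lemma smooth_iter_harmonic N f : smooth f -> smooth (iter N (@harmonic_oscillator R d) f).
Proof. by move=> sf; elim: N => [|N IH]; [exact sf|exact (smooth_harmonic IH)]. Qed.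

Lemma iter_harmonic_lin N a f g : smooth f -> smooth g ->
  iter N (@harmonic_oscillator R d) (a *: f + g) =
  a *: iter N (@harmonic_oscillator R d) f + iter N (@harmonic_oscillator R d) g.
Proof.
move=> sf sg; elim: N => [|N IH]; first by [].
rewrite !iterS IH.
exact (harmonic_lin a (smooth_iter_harmonic N sf) (smooth_iter_harmonic N sg)).
Qed.

Lemma iter_harmonic0 N : iter N (@harmonic_oscillator R d) 0 = 0.
Proof.
elim: N => [|N IH]; first by [].
have H := @harmonic_lin (-1) 0 0 smooth0 smooth0.
by rewrite iterS IH -[in LHS](addr0 0) -[X in X + _](scaler0 _ (-1)) H scaleN1r addNr.
Qed.

End smooth_theory.

(* The Borel sigma-algebra of R^d, generated by the coordinate projections. *)
Section measurable_rV.
Variables (R : realType) (d : nat).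

Let coord (i : 'I_d) (x : 'rV[R]_d) : measurableTypeR R := x ord0 i.

Let rV_set0 : g_sigma_preimage coord set0.
Proof. exact: sigma_algebra0. Qed.

Let rV_setC A : g_sigma_preimage coord A -> g_sigma_preimage coord (~` A).
Proof. exact: sigma_algebraC. Qed.

Let rV_bigcup (F : (set 'rV[R]_d)^nat) : (forall i, g_sigma_preimage coord (F i)) ->
  g_sigma_preimage coord (\bigcup_i (F i)).
Proof. exact: sigma_algebra_bigcup. Qed.

HB.instance Definition _ := @isMeasurable.Build default_measure_display
  'rV[R]_d (g_sigma_preimage coord) rV_set0 rV_setC rV_bigcup.

End measurable_rV.

Section measurable_fun_rV.
Context {R : realType}.

Lemma measurable_coord n (i : 'I_n) :
  measurable_fun [set: 'rV[R]_n] (fun x => x ord0 i : measurableTypeR R).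
Proof.
move=> _ Y mY; rewrite setTI; apply: sub_sigma_algebra => /=.
rewrite -bigcup_seq/=; exists i => /=; first by rewrite mem_index_enum.
by exists Y => //; rewrite setTI.
Qed.

Lemma measurable_fun_rV d1 (T1 : measurableType d1) n (f : T1 -> 'rV[R]_n) :
  (forall i, measurable_fun [set: T1] (fun t => f t ord0 i : measurableTypeR R)) ->
  measurable_fun [set: T1] f.
Proof.
move=> mf.
have pS : g_sigma_preimage (fun i t => f t ord0 i : measurableTypeR R) `<=` measurable.
  apply: smallest_sub; first exact: sigma_algebra_measurable.
  case: n => [|n] in f mf *; first by rewrite big_ord0.
  rewrite -bigcup_mkord_ord; apply: bigcup_sub => i Ii.
  by move=> A [B mB <-]; exact: mf.
move=> _ A mA; apply: pS.
by rewrite (g_sigma_preimage_comp (fun i (x : 'rV[R]_n) => x ord0 i : measurableTypeR R) f); exists A.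
Qed.

Definition consrV n (p : measurableTypeR R * 'rV[R]_n) : 'rV[R]_n.+1 :=
  row_mx (p.1 : R)%:M p.2.

Definition unconsrV n (x : 'rV[R]_n.+1) : measurableTypeR R * 'rV[R]_n :=
  (x ord0 ord0, \row_j x ord0 (lift ord0 j)).

Lemma consrVK n : cancel (@consrV n) (@unconsrV n).
Proof.
move=> [t x]; congr pair => /=.
  have -> : ord0 = lshift n (ord0 : 'I_1) by exact/val_inj.
  by apply: etrans (row_mxEl _ _ _ _) _; rewrite mxE eqxx.
apply/rowP => j; rewrite mxE.
have -> : lift ord0 j = rshift 1 j by exact/val_inj.
exact: row_mxEr.
Qed.

Lemma unconsrVK n : cancel (@unconsrV n) (@consrV n).
Proof.
move=> x; rewrite /consrV /unconsrV /=.
rewrite -[RHS](@hsubmxK _ 1 1 n); congr (@row_mx R 1 1 n _ _).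
  by apply/rowP => j; rewrite !ord1 !mxE eqxx; congr (x _ _); exact/val_inj.
by apply/rowP => j; rewrite !mxE; congr (x _ _); exact/val_inj.
Qed.

Lemma measurable_consrV n : measurable_fun setT (@consrV n).
Proof.
apply: measurable_fun_rV => i; rewrite /consrV.
under eq_fun do rewrite mxE.
case: splitP => j ij.
  under eq_fun do rewrite !ord1 mxE eqxx mulr1n.
  exact: measurable_fst.
exact: measurableT_comp (measurable_coord j) measurable_snd.
Qed.

Lemma measurable_unconsrV n : measurable_fun setT (@unconsrV n).
Proof.
apply/measurable_fun_pairP; split; first exact: measurable_coord.
apply: measurable_fun_rV => i /=.
under eq_fun do rewrite mxE.
exact: measurable_coord.
Qed.
End measurable_fun_rV.

Section lebesgue_step.
Context {R : realType} (n : nat) (m : {sigma_finite_measure set 'rV[R]_n -> \bar R}).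

Definition lebesgue_step : set 'rV[R]_n.+1 -> \bar R :=
  pushforward (lebesgue_measure \x m)%E (@consrV R n).

Let mu : {measure set 'rV[R]_n.+1 -> \bar R} :=
  measure_function_pushforward__canonical__measure_function_Measure
    (lebesgue_measure \x m)%E (@measurable_consrV R n).

HB.instance Definition _ := isMeasure.Build _ _ _ lebesgue_step
  (measure0 mu) (measure_ge0 mu) (@measure_semi_sigma_additive _ _ _ mu).

Let sigma_finite_step : sigma_finite setT lebesgue_step.
Proof.
have /sigma_finiteP[F [TF ndF Foo]] := sigma_finiteT (@lebesgue_measure R).
have /sigma_finiteP[G [TG ndG Goo]] := sigma_finiteT m.
exists (fun k => @unconsrV R n @^-1` (F k `*` G k)).
  rewrite -preimage_bigcup [X in _ @^-1` X](_ : _ = setT) ?preimage_setT//.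
  apply/seteqP; split=> // -[x y] _.
  have [k _ Fkx] : (\bigcup_k F k) x by rewrite -TF.
  have [l _ Gly] : (\bigcup_k G k) y by rewrite -TG.
  exists (maxn k l) => //; split=> /=.
  - by move: x Fkx; exact/subsetPset/ndF/leq_maxl.
  - by move: y Gly; exact/subsetPset/ndG/leq_maxr.
move=> k; have [? ?] := Foo k; have [? ?] := Goo k; split.
  rewrite -[X in measurable X]setTI; apply: measurable_unconsrV => //.
  exact: measurableX.
rewrite /lebesgue_step /pushforward -comp_preimage.
rewrite (_ : _ \o _ = id); last by apply/funext => p /=; rewrite consrVK.
by rewrite preimage_id product_measure1E// lte_mul_pinfty// ge0_fin_numE.
Qed.

HB.instance Definition _ := Measure_isSigmaFinite.Build _ _ _ lebesgue_step
  sigma_finite_step.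
End lebesgue_step.

(* Lebesgue measure on R^d: the iterated product measure, transported along
   R * 'rV_n -> 'rV_n.+1 at each step. *)
Fixpoint lebesgue_rV {R : realType} (d : nat) :
    {sigma_finite_measure set 'rV[R]_d -> \bar R} :=
  if d is n.+1 then lebesgue_step (lebesgue_rV n) else dirac (0 : 'rV[R]_0).

Section norms_and_transform.
Variables (R : realType) (d : nat).
Local Notation C := (R[i]^o).
Local Notation normc := ComplexField.Normc.normc.

Definition Linfty_norm (f : 'rV[R]_d -> C) : \bar R :=
  Lnorm (lebesgue_rV d) +oo%E (fun x => (normc (f x))%:E).

Definition pilipovic_norm (s h : R) (f : 'rV[R]_d -> C) : \bar R :=
  ereal_sup (range (fun N : nat =>
    ((h ^+ N * (N`!%:R) `^ (2 * s))^-1)%:E *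
    Linfty_norm (iter N (@harmonic_oscillator R d) f)))%E.

Definition integralC (g : 'rV[R]_d -> R[i]) : R[i] :=
  Rintegral (lebesgue_rV d) setT (re_part g) +i*
  Rintegral (lebesgue_rV d) setT (im_part g).

Definition bargmann (f : 'rV[R]_d -> C) : 'rV[R[i]]_d -> C := fun z =>
  (pi `^ (- (d%:R / 4)))%:C *
  integralC (fun y =>
    cexp (- (2^-1)%:C * (cdot z z + (enorm2 y)%:C) +
          (Num.sqrt 2)%:C * cdot z (complexify y)) * f y).

End norms_and_transform.

(* A family of [0, +oo]-valued norms on a space V of functions, decreasing in
   the parameter h > 0, together with a submodule scale_dom of admissible
   functions.  The normed space with parameter h is
   E_h = {f in scale_dom | scale_norm h f < +oo}. *)
Section scales.
Variable R : realType.

Record norm_scale (V : lmodType R[i]) := NormScale {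
  scale_dom : set V;
  scale_norm : R -> V -> \bar R;
  scale_dom0 : scale_dom 0;
  scale_domP : forall a f g,
    scale_dom f -> scale_dom g -> scale_dom (a *: f + g);
  scale_norm0 : forall h, 0 < h -> scale_norm h 0 = 0%E;
  scale_normP : forall h a f g, 0 < h -> scale_dom f -> scale_dom g ->
    (scale_norm h (a *: f + g)%R <=
     (ComplexField.Normc.normc a)%:E * scale_norm h f + scale_norm h g)%E;
  scale_norm_le : forall h k f, 0 < h -> h <= k ->
    (scale_norm k f <= scale_norm h f)%E
}.

Section roumieu.
Context {V : lmodType R[i]} (E : norm_scale V).

(* The union of the E_h. *)
Definition roumieu : {pred V} := mem [set f : V |
  scale_dom E f /\ exists2 h, 0 < h & (scale_norm E h f < +oo)%E].

Lemma roumieu_submod_closed : submod_closed roumieu.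
Proof.
split.
  apply/mem_set; split; first exact: scale_dom0.
  by exists 1 => //; rewrite scale_norm0.
move=> a f g /set_mem[Df [h h0 hf]] /set_mem[Dg [k k0 kg]].
apply/mem_set; split; first exact: scale_domP.
have hm : 0 < Num.max h k by rewrite lt_max h0.
exists (Num.max h k) => //; apply: le_lt_trans (scale_normP a hm Df Dg) _.
apply: lte_add_pinfty; last first.
  by apply: le_lt_trans kg; rewrite scale_norm_le// le_max lexx orbT.
apply: lte_mul_pinfty => //; first by rewrite lee_fin; case: (a) => *; exact: sqrtr_ge0.
by apply: le_lt_trans hf; rewrite scale_norm_le// le_max lexx.
Qed.

HB.instance Definition _ := GRing.isSubmodClosed.Build _ _ roumieu
  roumieu_submod_closed.

Record roumieu_space := RoumieuSpace {
  roumieu_val :> V; _ : roumieu_val \in roumieu }.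
HB.instance Definition _ := [isSub for roumieu_val].
HB.instance Definition _ := [Choice of roumieu_space by <:].
HB.instance Definition _ := [SubChoice_isSubLmodule of roumieu_space by <:].

(* The inductive limit topology in the category of locally convex spaces: a
   base of neighbourhoods of 0 is given by the absolutely convex sets U whose
   trace on every E_h is a neighbourhood of 0 in E_h. *)
Definition absolutely_convex (U : set roumieu_space) :=
  forall (a b : R[i]) u v, `|a| + `|b| <= 1 -> U u -> U v -> U (a *: u + b *: v).

Definition roumieu_nbhs0 (U : set roumieu_space) :=
  forall h, 0 < h -> exists2 e : R, 0 < e &
    forall f : roumieu_space, (scale_norm E h f < e%:E)%E -> U f.

Definition roumieu_open (O : set roumieu_space) :=
  forall f, O f -> exists U,
    [/\ absolutely_convex U, roumieu_nbhs0 U & forall g, U g -> O (f + g)].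

Let roumieu_openT : roumieu_open setT.
Proof. by move=> f _; exists setT; split => // h _; exists 1. Qed.

Let roumieu_openI : setI_closed roumieu_open.
Proof.
move=> A B oA oB f [/oA[U [cU nU UA]] /oB[W [cW nW WB]]].
exists (U `&` W); split.
- by move=> a b u v ab [? ?] [? ?]; split; [exact: cU|exact: cW].
- move=> h h0; have [e e0 eU] := nU h h0; have [e' e'0 eW] := nW h h0.
  exists (Num.min e e'); first by rewrite lt_min e0.
  by move=> g; rewrite EFin_min lt_min => /andP[? ?]; split; [exact: eU|exact: eW].
- by move=> g [? ?]; split; [exact: UA|exact: WB].
Qed.

Let roumieu_open_bigU (I : Type) (F : I -> set roumieu_space) :
  (forall i, roumieu_open (F i)) -> roumieu_open (\bigcup_i F i).
Proof.
move=> oF f [i _ Fif]; have [U [cU nU UF]] := oF i f Fif.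
by exists U; split => // g Ug; exists i => //; exact: UF.
Qed.

HB.instance Definition _ := isOpenTopological.Build roumieu_space
  roumieu_openT roumieu_openI roumieu_open_bigU.
End roumieu.

Section beurling.
Context {V : lmodType R[i]} (E : norm_scale V).

(* The intersection of the E_h. *)
Definition beurling : {pred V} := mem [set f : V |
  scale_dom E f /\ forall h, 0 < h -> (scale_norm E h f < +oo)%E].

Lemma beurling_submod_closed : submod_closed beurling.
Proof.
split.
  apply/mem_set; split; first exact: scale_dom0.
  by move=> h h0; rewrite scale_norm0.
move=> a f g /set_mem[Df hf] /set_mem[Dg hg].
apply/mem_set; split; first exact: scale_domP.
move=> h h0; apply: le_lt_trans (scale_normP a h0 Df Dg) _.
apply: lte_add_pinfty; last exact: hg.
apply: lte_mul_pinfty => //; last exact: hf.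
by rewrite lee_fin; case: (a) => ? ?; exact: sqrtr_ge0.
Qed.

HB.instance Definition _ := GRing.isSubmodClosed.Build _ _ beurling
  beurling_submod_closed.

Record beurling_space := BeurlingSpace {
  beurling_val :> V; _ : beurling_val \in beurling }.
HB.instance Definition _ := [isSub for beurling_val].
HB.instance Definition _ := [Choice of beurling_space by <:].
HB.instance Definition _ := [SubChoice_isSubLmodule of beurling_space by <:].

(* The projective limit topology, i.e. the initial topology for the inclusions
   into the E_h.  As the norms decrease in h, a finite intersection of balls
   contains a single ball, so that balls form a base of neighbourhoods. *)
Definition beurling_open (O : set beurling_space) :=
  forall f, O f -> exists h e : R, [/\ 0 < h, 0 < e &
    forall g : beurling_space,
      (scale_norm E h (beurling_val g - beurling_val f) < e%:E)%E -> O g].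

Let beurling_openT : beurling_open setT.
Proof. by move=> f _; exists 1, 1; split. Qed.

Let beurling_openI : setI_closed beurling_open.
Proof.
move=> A B oA oB f [/oA[h [e [h0 e0 hA]]] /oB[k [e' [k0 e'0 kB]]]].
exists (Num.min h k), (Num.min e e'); split; rewrite ?lt_min ?h0 ?e0//.
have m0 : 0 < Num.min h k by rewrite lt_min h0.
move=> g; rewrite EFin_min lt_min => /andP[mA mB]; split.
  by apply: hA; apply: le_lt_trans mA; rewrite scale_norm_le// ge_min lexx.
by apply: kB; apply: le_lt_trans mB; rewrite scale_norm_le// ge_min lexx orbT.
Qed.

Let beurling_open_bigU (I : Type) (F : I -> set beurling_space) :
  (forall i, beurling_open (F i)) -> beurling_open (\bigcup_i F i).
Proof.
move=> oF f [i _ Fif]; have [h [e [h0 e0 hF]]] := oF i f Fif.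
by exists h, e; split => // g hg; exists i => //; exact: hF.
Qed.

HB.instance Definition _ := isOpenTopological.Build beurling_space
  beurling_openT beurling_openI beurling_open_bigU.
End beurling.
End scales.

Section scale_instances.
Variables (R : realType) (d : nat).
Local Notation C := (R[i]^o).
Local Notation normc := ComplexField.Normc.normc.
Implicit Types (f g : 'rV[R]_d -> C) (F G : 'rV[R[i]]_d -> C) (a : R[i]).

Let normc_ge0 a : 0 <= normc a.
Proof. by case: a => u v; exact: sqrtr_ge0. Qed.

Let normc_lin a (u v : R[i]) : normc (a * u + v) <= normc a * normc u + normc v.
Proof. by apply: le_trans (le_normcD _ _) _; rewrite ComplexField.Normc.normcM. Qed.

Let sup_range0 T (x : T) (h : T -> \bar R) :
  (forall y, h y = 0%E) -> ereal_sup (range h) = 0%E.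
Proof.
move=> h0; apply/eqP; rewrite eq_le; apply/andP; split.
  by apply: ge_ereal_sup => _ [y _ <-]; rewrite h0.
by apply: ereal_sup_ubound; exists x.
Qed.

Lemma Linfty_norm_ge0 f : (0 <= Linfty_norm f)%E.
Proof. exact: Lnorm_ge0. Qed.

Lemma Linfty_norm0 : Linfty_norm (0 : 'rV[R]_d -> C) = 0%E.
Proof.
rewrite /Linfty_norm -(@Lnorm0 _ _ _ (lebesgue_rV d) +oo%E)//.
by apply: eq_Lnorm => x /=; rewrite expr0n/= addr0 sqrtr0.
Qed.

Lemma Linfty_norm_lin a f g :
  (Linfty_norm (a *: f + g)%R <= (normc a)%:E * Linfty_norm f + Linfty_norm g)%E.
Proof.
rewrite /Linfty_norm unlock; case: ifPn => [mu0|_]; last by rewrite mule0 adde0.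
rewrite -ess_supZl//.
apply: le_trans (ess_supD _ _ _); apply: le_ess_sup; apply: nearW => x /=.
rewrite -EFinM -EFinD lee_fin !ger0_norm//; exact: normc_lin.
Qed.

Let pilipovic_coef (s h : R) (N : nat) : R := (h ^+ N * (N`!%:R) `^ (2 * s))^-1.

Let pilipovic_coef_ge0 s h N : 0 < h -> 0 <= pilipovic_coef s h N.
Proof. by move=> h0; rewrite invr_ge0 mulr_ge0 ?powR_ge0// exprn_ge0// ltW. Qed.

Lemma pilipovic_norm0 s h : 0 < h -> pilipovic_norm s h (0 : 'rV[R]_d -> C) = 0%E.
Proof.
move=> _; apply: (sup_range0 0) => N; rewrite -[X in iter N _ X]/(0 : 'rV[R]_d -> C).
by rewrite iter_harmonic0 Linfty_norm0 mule0.
Qed.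

Lemma pilipovic_normP s h a f g : 0 < h -> smooth f -> smooth g ->
  (pilipovic_norm s h (a *: f + g)%R <=
   (normc a)%:E * pilipovic_norm s h f + pilipovic_norm s h g)%E.
Proof.
move=> h0 sf sg; apply: ge_ereal_sup => _ [N _ <-].
rewrite (iter_harmonic_lin N a sf sg).
set u := iter N _ f; set v := iter N _ g.
have c0 := pilipovic_coef_ge0 s N h0; rewrite -/(pilipovic_coef s h N).
apply: (@le_trans _ _ ((pilipovic_coef s h N)%:E *
    ((normc a)%:E * Linfty_norm u + Linfty_norm v))%E).
  by apply: lee_wpmul2l; [rewrite lee_fin|exact: Linfty_norm_lin].
rewrite ge0_muleDr ?mule_ge0 ?Linfty_norm_ge0 ?lee_fin// muleCA.
apply: leeD; last by apply: ereal_sup_ubound; exists N.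
apply: lee_wpmul2l; first by rewrite lee_fin.
by apply: ereal_sup_ubound; exists N.
Qed.

Lemma pilipovic_norm_le s h k f : 0 < h -> h <= k ->
  (pilipovic_norm s k f <= pilipovic_norm s h f)%E.
Proof.
move=> h0 hk; apply: ge_ereal_sup => _ [N _ <-].
apply: (@le_trans _ _ ((pilipovic_coef s h N)%:E *
    Linfty_norm (iter N (@harmonic_oscillator R d) f))%E); last first.
  by apply: ereal_sup_ubound; exists N.
apply: lee_wpmul2r; first exact: Linfty_norm_ge0.
have fact0 : 0 < (N`!%:R : R) `^ (2 * s) by rewrite powR_gt0// ltr0n fact_gt0.
rewrite lee_fin lef_pV2 ?posrE ?mulr_gt0 ?exprn_gt0//; last exact: lt_le_trans hk.
by rewrite ler_pM2r// lerXn2r// nnegrE ltW//; exact: lt_le_trans hk.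
Qed.

Definition pilipovic_scale (s : R) : norm_scale ('rV[R]_d -> C) :=
  @NormScale _ _ (@smooth R d) (@pilipovic_norm R d s)
    (@smooth0 R d) (@smooth_lin R d) (@pilipovic_norm0 s) (@pilipovic_normP s)
    (@pilipovic_norm_le s).

Let growth (s r : R) (z : 'rV[R[i]]_d) : R :=
  expR (- (r * (ln (japanese z)) `^ (1 - 2 * s)^-1)).

Lemma growth_norm0 s r : 0 < r -> growth_norm s r (0 : 'rV[R[i]]_d -> C) = 0%E.
Proof.
move=> _; apply: (sup_range0 0) => z.
by rewrite /= expr0n/= addr0 sqrtr0 mul0r.
Qed.

Lemma growth_normP s r a F G : 0 < r -> entire F -> entire G ->
  (growth_norm s r (a *: F + G)%R <=
   (normc a)%:E * growth_norm s r F + growth_norm s r G)%E.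
Proof.
move=> _ _ _; apply: ge_ereal_sup => _ [z _ <-]; rewrite -/(growth s r z).
apply: (@le_trans _ _ ((normc a)%:E * (normc (F z) * growth s r z)%:E +
   (normc (G z) * growth s r z)%:E)%E).
  rewrite -EFinM -EFinD lee_fin mulrA -mulrDl ler_wpM2r ?expR_ge0//.
  exact: normc_lin.
apply: leeD; last by apply: ereal_sup_ubound; exists z.
apply: lee_wpmul2l; first by rewrite lee_fin.
by apply: ereal_sup_ubound; exists z.
Qed.

Lemma growth_norm_le s r t F : 0 < r -> r <= t ->
  (growth_norm s t F <= growth_norm s r F)%E.
Proof.
move=> r0 rt; apply: ge_ereal_sup => _ [z _ <-].
apply: (@le_trans _ _ (normc (F z) * growth s r z)%:E); last first.
  by apply: ereal_sup_ubound; exists z.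
rewrite lee_fin ler_wpM2l// ler_expR lerN2 ler_wpM2r// powR_ge0//.
Qed.

Definition growth_scale (s : R) : norm_scale ('rV[R[i]]_d -> C) :=
  @NormScale _ _ (@entire R d) (@growth_norm R d s)
    (@entire0 R d) (@entire_lin R d) (@growth_norm0 s) (@growth_normP s) (@growth_norm_le s).
End scale_instances.

Definition topological_isomorphism (K : numDomainType)
    (E F : preTopologicalLmodType K) (T : {linear E -> F}) :=
  continuous T /\
  exists S : F -> E, [/\ cancel T S, cancel S T & continuous S].

(* The Pilipovic spaces of Roumieu type S_s and of Beurling type Sigma_s, and
   the spaces A_s and A_{0,s} of entire functions. *)
Definition pilipovic_S (R : realType) (d : nat) (s : R) :=
  roumieu_space (pilipovic_scale d s).
Definition pilipovic_Sigma (R : realType) (d : nat) (s : R) :=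
  beurling_space (pilipovic_scale d s).
Definition entire_A (R : realType) (d : nat) (s : R) :=
  roumieu_space (growth_scale d s).
Definition entire_A0 (R : realType) (d : nat) (s : R) :=
  beurling_space (growth_scale d s).

(* Main.v *)
(* For complex t put v(t) = e^(dt) (Vf)(e^(2t) z).  Integration by parts against
   the kernel gives v^(N)(t) = e^(dt) V(H^N f)(e^(2t) z): bounds on all H^N f
   yield, by the Taylor series of v along the ray through z/<z>, the growth bound
   on Vf.
   V is injective because Vf = 0 makes f e^(-|y|^2/2) orthogonal to all Gaussians
   e^(-n|x-y|^2) (obtained from the kernel by a Fourier integral), which
   concentrate at x.
   The inverse is
     QF(y) = c e^(-|y|^2/2) int F(sqrt 2 y + i xi) e^(-|xi|^2/2) dxi.
   It satisfies H QF = Q(P F), where P = sum_j (1 + 2 z_j d/dz_j) generates the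
   dilations F |-> e^(dt) F(e^(2t) z).  Iterating Cauchy's estimate N times with
   steps r/N in t, and choosing r = (N/A)^(1-2s) for a suitable A, bounds P^N F
   by (const)^N (N!)^(2s) times a subgaussian factor, whence the bounds on
   H^N QF.  Both estimates map each parameter of one scale to one of the other and
   reach all parameters, which gives both isomorphisms. *)
Require Import Defs.
From HB Require Import structures.
From mathcomp Require Import all_boot all_order all_algebra.
From mathcomp Require Import complex ring lra.
From mathcomp Require Import all_classical all_reals all_analysis ess_sup_inf measurable_realfun.
Set Implicit Arguments.
Unset Strict Implicit.
Unset Printing Implicit Defensive.
Import Order.TTheory GRing.Theory Num.Theory.
Import numFieldNormedType.Exports.
Local Open Scope classical_set_scope.
Local Open Scope ring_scope.
Local Open Scope complex_scope.

(** * Complex numbers and the exponential *)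

(** Nothing is differentiated under an integral sign by a general theorem: derivatives come from
    remainders bounded by a constant times h^2, and such pointwise bounds integrate against a
    Gaussian. That Q is a right inverse rests on Q turning z_j into (y_j - d/dy_j) / sqrt 2, which V
    turns back into z_j; F can then be contracted to the constant F(z). That it is a left inverse
    follows from injectivity, since V (Q V f - f) = 0. All this takes place on the functions bounded
    by M e^(b|z|^2) for every b > 0: their Gaussian integrals converge, the class is stable under
    every operator in use, and it contains both growth spaces. The exponent p = 1/(1-2s) comes in
    both directions from y^N / N! <= e^y: for x = y^(1-2s) the quantity x^N (N!)^(2s) / N! is the
    power 1-2s of the left side. The obstacle in V H f is that f and H f are bounded but the first
    derivatives of f need not be; Green's formula is arranged so that these occur only inside a
    divergence. *)

Section complex_numbers.
Variable R : realType.
Local Notation C := (R[i]).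
Local Notation Re := complex.Re.
Local Notation Im := complex.Im.
Local Notation normc := ComplexField.Normc.normc.
Implicit Types (a u v w z : C) (x t : R).

Lemma normc_ge0 z : 0 <= normc z.
Proof. by case: z => a b; exact: sqrtr_ge0. Qed.

Lemma normc_sqr z : normc z ^+ 2 = Re z ^+ 2 + Im z ^+ 2.
Proof. by case: z => a b /=; rewrite sqr_sqrtr// addr_ge0// sqr_ge0. Qed.

Lemma ler_Re_normc z : `|Re z| <= normc z.
Proof.
rewrite -(@ler_pXn2r _ 2) ?nnegrE ?normc_ge0//.
by rewrite normc_sqr real_normK ?num_real// lerDl sqr_ge0.
Qed.

Lemma ler_Im_normc z : `|Im z| <= normc z.
Proof.
rewrite -(@ler_pXn2r _ 2) ?nnegrE ?normc_ge0//.
by rewrite normc_sqr real_normK ?num_real// lerDr sqr_ge0.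
Qed.

Lemma normc_real x : normc (x%:C) = `|x|.
Proof. by rewrite /= expr0n /= addr0 sqrtr_sqr. Qed.

Lemma normc_sum I (r : seq I) (P : pred I) (F : I -> C) :
  normc (\sum_(i <- r | P i) F i) <= \sum_(i <- r | P i) normc (F i).
Proof.
elim/big_ind2: _ => //; first by rewrite ComplexField.Normc.normc0.
by move=> x1 x2 y1 y2 h1 h2; apply: le_trans (le_normcD _ _) (lerD h1 h2).
Qed.

Lemma normcX z n : normc (z ^+ n) = normc z ^+ n.
Proof.
elim: n => [|n IH]; first by rewrite !expr0 ComplexField.Normc.normc1.
by rewrite !exprS ComplexField.Normc.normcM IH.
Qed.

Lemma normc_gt0 z : (0 < normc z) = (z != 0).
Proof.
rewrite lt_def normc_ge0 andbT; congr negb.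
apply/eqP/eqP => [/ComplexField.Normc.eq0_normc//|->].
exact: ComplexField.Normc.normc0.
Qed.

Lemma normc_dir z : exists2 a, normc a = 1 & Re (a * z) = normc z.
Proof.
have [->|z0] := eqVneq z 0.
  by exists 1; [exact: ComplexField.Normc.normc1|rewrite mulr0 ComplexField.Normc.normc0].
have nz : normc z != 0 by rewrite gt_eqF// normc_gt0.
exists ((normc z)^-1%:C * z^*%C).
  rewrite ComplexField.Normc.normcM normc_real ger0_norm ?invr_ge0 ?normc_ge0//.
  have -> : normc z^*%C = normc z by case: (z) => p q /=; rewrite sqrrN.
  by rewrite mulVf.
have -> : Re ((normc z)^-1%:C * z^*%C * z) = (normc z)^-1 * (normc z ^+ 2).
  rewrite normc_sqr; case: (z) => p q /=; ring.
by rewrite expr2 mulrA mulVf// mul1r.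
Qed.

(** The modulus is attained by Re (a z) for some unit a. This turns bounds for complex integrals,
    increments and Taylor sums into one-sided bounds for real functions, where the mean value
    theorem is available. *)
Lemma normc_leP z x : (forall a, normc a = 1 -> Re (a * z) <= x) -> normc z <= x.
Proof. by move=> h; have [a a1 <-] := normc_dir z; exact: h. Qed.

Lemma Re_mul_le a z : normc a = 1 -> Re (a * z) <= normc z.
Proof.
move=> a1; apply: le_trans (ler_norm _) _; apply: le_trans (ler_Re_normc _) _.
by rewrite ComplexField.Normc.normcM a1 mul1r.
Qed.

Lemma cexp0 : cexp (0 : C) = 1.
Proof. by rewrite /cexp /= expR0 cos0 sin0 mulr1 mulr0. Qed.

Lemma cexpD u v : cexp (u + v) = cexp u * cexp v.
Proof.
case: u v => [a b] [c e]; rewrite /cexp /= expRD cosD sinD.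
congr Complex => /=; ring.
Qed.

Lemma normc_cexp z : normc (cexp z) = expR (Re z).
Proof.
rewrite /cexp /=; set x := Re z; set y := Im z.
have -> : (expR x * cos y) ^+ 2 + (expR x * sin y) ^+ 2 = expR x ^+ 2.
  by rewrite !exprMn -mulrDr cos2Dsin2 mulr1.
by rewrite sqrtr_sqr ger0_norm// expR_ge0.
Qed.

Lemma cexp_neq0 z : cexp z != 0.
Proof. by rewrite -normc_gt0 normc_cexp expR_gt0. Qed.

Lemma cexpN z : cexp (- z) = (cexp z)^-1.
Proof.
apply: (mulfI (cexp_neq0 z)).
by rewrite mulfV ?cexp_neq0// -cexpD subrr cexp0.
Qed.

Lemma cexp_real x : cexp (x%:C) = (expR x)%:C.
Proof. by rewrite /cexp /= cos0 sin0 mulr1 mulr0. Qed.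

Lemma is_derive_Re_cexp a u t :
  is_derive t (1:R) (fun t => Re (a * cexp (t%:C * u))) (Re (a * u * cexp (t%:C * u))).
Proof.
case: a u => [p q] [b c].
have -> : (fun t => Re ((p +i* q) * cexp (t%:C * (b +i* c)))) =
   (fun t : R => p * (expR (t * b) * cos (t * c)) - q * (expR (t * b) * sin (t * c))).
  by apply/funext => s /=; rewrite !mul0r subr0 addr0.
apply: is_derive_eq; rewrite /= /GRing.scale /=.
rewrite !mul0r subr0 addr0; ring.
Qed.

End complex_numbers.

(** * One-sided Taylor bounds *)

Section taylor.
Variable R : realType.

Lemma is_derive_scaledX (c t : R) n :
  is_derive t (1:R) (fun t => c * t ^+ n.+1) (c * (n.+1%:R * t ^+ n)).
Proof.
have H := @is_deriveZ _ _ _ _ c _ _ _ (@is_deriveX _ _ id n.+1 _ _ _ (is_derive_id t (1:R))).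
rewrite /GRing.scale /= mulr1 in H; rewrite (_ : (fun _ => _) = c \*: (id : R -> R) ^+ n.+1)//.
by apply/funext => x; rewrite /= !fctE.
Qed.

Lemma ler_of_derive (f g f' g' : R -> R) (b : R) : 0 <= b ->
  (forall t : R, is_derive t (1:R) f (f' t)) -> (forall t : R, is_derive t (1:R) g (g' t)) ->
  (forall t : R, 0 <= t <= b -> f' t <= g' t) -> f 0 <= g 0 -> f b <= g b.
Proof.
move=> b0 df dg fg f0; rewrite le_eqVlt in b0; case/predU1P: b0 fg => [<-//|b0] fg.
have d t : is_derive t (1:R) (g \- f) (g' t - f' t) by exact: is_deriveB.
have c : {within `[0, b], continuous (g \- f)}.
  apply: derivable_within_continuous => t _; exact: ex_derive.
have [t] := MVT b0 (fun t _ => d t) c.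
rewrite in_itv /= => /andP[t0 tb] e.
have : 0 <= (g' t - f' t) * (b - 0).
  by rewrite mulr_ge0 ?subr_ge0 ?fg ?ltW//.
by rewrite -e /= => h; lra.
Qed.

(** The sequence [v] stands for a function with its successive derivatives. Induction on n: the
    bound for the shifted sequence on every [0, t] says that the first derivative is at most that of
    the Taylor polynomial with remainder, and [ler_of_derive] integrates this. Only an upper bound
    of the last derivative is asked, since only an upper bound results. *)
Lemma taylor_seq (v : nat -> R -> R) (b B : R) n : 0 <= b ->
  (forall n (t : R), is_derive t (1:R) (v n) (v n.+1 t)) ->
  (forall t : R, 0 <= t <= b -> v n t <= B) ->
  v 0%N b <= \sum_(k < n) v k 0 * b ^+ k / k`!%:R + B * b ^+ n / n`!%:R.
Proof.
elim: n v b => [|n IH] v b b0 dv vB.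
  by rewrite big_ord0 add0r expr0 mulr1 divr1; apply: vB; rewrite b0 lexx.
pose p := fun t => \sum_(k < n.+1) v k 0 * t ^+ k / k`!%:R + B * t ^+ n.+1 / n.+1`!%:R.
pose p' := fun t => \sum_(k < n) v k.+1 0 * t ^+ k / k`!%:R + B * t ^+ n / n`!%:R.
have fct k : (k.+1%:R : R) / k.+1`!%:R = k`!%:R^-1.
  rewrite factS natrM invfM mulrA mulfV ?mul1r//.
have dp t : is_derive t (1:R) p (p' t).
  have dt (c : R) k : is_derive t (1:R) (fun t => c * t ^+ k.+1 / k.+1`!%:R) (c * t ^+ k / k`!%:R).
    rewrite -(fct k).
    rewrite (_ : (fun _ => _) = (fun t => c / k.+1`!%:R * t ^+ k.+1)).
      apply: (is_derive_eq (is_derive_scaledX _ _ _)).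
      move: (k.+1%:R) (_`!%:R) => m1 m2; ring.
    by apply/funext => x; rewrite mulrAC.
  rewrite /p /p'; under eq_fun do rewrite big_ord_recl /= expr0 mulr1 divr1.
  rewrite -[X in is_derive _ _ _ X]add0r addrA.
  apply: is_deriveD => //; apply: is_deriveD => //.
  under eq_fun do under eq_bigr do rewrite /bump /= add1n.
  rewrite (_ : (fun _ => _) = \sum_(i < n) (fun x => v i.+1 0 * x ^+ i.+1 / i.+1`!%:R)).
    by apply: is_derive_sum => i; exact: dt.
  by apply/funext => x; rewrite fct_sumE.
apply: (@ler_of_derive _ p _ p' b b0 (dv 0%N) dp).
  move=> t /andP[t0 tb]; rewrite /p'.
  apply: (IH (fun k => v k.+1)) => // u /andP[u0 ut]; apply: vB.
  by rewrite u0 /= (le_trans ut).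
rewrite /p big_ord_recl /= expr0 mulr1 divr1 big1 ?addr0; last first.
  by move=> i _; rewrite /bump /= expr0n /= mulr0 mul0r.
by rewrite expr0n /= mulr0 mul0r addr0.
Qed.

End taylor.

Section cexp_taylor.
Variable R : realType.
Local Notation C := (R[i]).
Local Notation Re := complex.Re.
Local Notation normc := ComplexField.Normc.normc.

(** Order two of [taylor_seq] on [0, 1] for t -> Re (a cexp (t u)) with unit a, whose n-th
    derivative only gains the factor u^n; the 1/2 is given away. The quadratic estimates for the
    kernels start here. *)
Lemma cexp_taylor2 (u : C) :
  normc (cexp u - 1 - u) <= normc u ^+ 2 * expR (normc u).
Proof.
apply: normc_leP => a a1.
have d n t : is_derive t (1:R) (fun t => Re (a * u ^+ n * cexp (t%:C * u)))
    (Re (a * u ^+ n.+1 * cexp (t%:C * u))).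
  rewrite exprSr (mulrA a); exact: is_derive_Re_cexp.
have := @taylor_seq R _ 1 (normc u ^+ 2 * expR (normc u)) 2 ler01 d.
rewrite !big_ord_recr big_ord0 /= add0r !expr1n !mulr1 !divr1 !mul1r !mul0r.
rewrite cexp0 !mulr1 expr1 (_ : 2`! = 2%N)// => H.
have -> : Re (a * (cexp u - 1 - u)) = Re (a * cexp u) - Re a - Re (a * u).
  by case: (a) (cexp u) (u) => [? ?] [? ?] [? ?] /=; ring.
have {}H : Re (a * cexp u) <= Re a + Re (a * u) + normc u ^+ 2 * expR (normc u) / 2.
  apply: H => t /andP[t0 t1].
  apply: le_trans (ler_norm _) _; apply: le_trans (ler_Re_normc _) _.
  rewrite (ComplexField.Normc.normcM (a * _)) (ComplexField.Normc.normcM a) a1 mul1r normc_cexp.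
  rewrite normcX ler_wpM2l ?exprn_ge0 ?normc_ge0// ler_expR.
  have -> : Re (t%:C * u) = t * Re u by case: (u) => ? ? /=; rewrite mul0r subr0.
  apply: le_trans (ler_norm _) _; rewrite normrM ger0_norm//.
  apply: le_trans (ler_wpM2r _ t1) _ => //; rewrite mul1r; exact: ler_Re_normc.
have : 0 <= normc u ^+ 2 * expR (normc u).
  by rewrite mulr_ge0 ?expR_ge0 ?exprn_ge0 ?normc_ge0.
lra.
Qed.

End cexp_taylor.

(** * Complex-valued integrals *)

Section complex_integral.
Context d (T : measurableType d) (R : realType).
Variable mu : {measure set T -> \bar R}.
Local Notation C := (R[i]).
Local Notation Re := complex.Re.
Local Notation Im := complex.Im.
Local Notation normc := ComplexField.Normc.normc.
Implicit Types (f g : T -> C) (a : C) (p q : T -> R).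

Definition cmeas f :=
  measurable_fun setT (fun x => Re (f x)) /\ measurable_fun setT (fun x => Im (f x)).

Definition integ p := mu.-integrable setT (fun x => (p x)%:E).

Definition cinteg f := integ (fun x => Re (f x)) /\ integ (fun x => Im (f x)).

Definition cint f : C :=
  (\int[mu]_x Re (f x)) +i* (\int[mu]_x Im (f x)).

Lemma integ_meas p : integ p -> measurable_fun setT p.
Proof. by move=> /integrableP[/measurable_EFinP]. Qed.

Lemma integ_lin (u v : R) p q : integ p -> integ q ->
  integ (fun x => u * p x + v * q x).
Proof.
move=> ip iq; rewrite /integ; under eq_fun do rewrite EFinD !EFinM.
by apply: integrableD => //; exact: integrableZl.
Qed.

Lemma integD p q : integ p -> integ q -> integ (fun x => p x + q x).
Proof. by move=> ip iq; have := integ_lin 1 1 ip iq; under eq_fun do rewrite !mul1r. Qed.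

Lemma integZ (u : R) p : integ p -> integ (fun x => u * p x).
Proof.
move=> ip; have := integ_lin u 0 ip ip.
by under eq_fun do rewrite mul0r addr0.
Qed.

Lemma integN p : integ p -> integ (fun x => - p x).
Proof. by move=> ip; have := integZ (-1) ip; under eq_fun do rewrite mulN1r. Qed.

Lemma Rint_lin (u v : R) p q : integ p -> integ q ->
  \int[mu]_x (u * p x + v * q x) = u * \int[mu]_x p x + v * \int[mu]_x q x.
Proof.
move=> ip iq; rewrite RintegralD//; [|exact: integZ..].
by rewrite !RintegralZl.
Qed.

Lemma integ_dom p q : measurable_fun setT p -> integ q ->
  (forall x, `|p x| <= q x) -> integ p.
Proof.
move=> mp iq pq; apply: le_integrable iq => //; first exact/measurable_EFinP.
move=> x _; rewrite /= lee_fin; apply: le_trans (pq x) _; exact: ler_norm.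
Qed.

Lemma Rint_le p q : integ p -> integ q -> (forall x, p x <= q x) ->
  \int[mu]_x p x <= \int[mu]_x q x.
Proof. by move=> ip iq pq; apply: le_Rintegral. Qed.

Lemma Rint_ge0 p : (forall x, 0 <= p x) -> 0 <= \int[mu]_x p x.
Proof. by move=> p0; apply: Rintegral_ge0. Qed.

Lemma cmeasM f g : cmeas f -> cmeas g -> cmeas (fun x => f x * g x).
Proof.
move=> [f1 f2] [g1 g2]; split.
  rewrite (_ : (fun x => _) = (fun x => Re (f x)) \* (fun x => Re (g x)) \-
     (fun x => Im (f x)) \* (fun x => Im (g x))).
    by apply: measurable_funB; exact: measurable_funM.
  by apply/funext => x /=; case: (f x) (g x) => [? ?] [? ?].
rewrite (_ : (fun x => _) = (fun x => Re (f x)) \* (fun x => Im (g x)) \+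
     (fun x => Im (f x)) \* (fun x => Re (g x))).
  by apply: measurable_funD; exact: measurable_funM.
by apply/funext => x /=; case: (f x) (g x) => [? ?] [? ?] /=.
Qed.

Lemma cmeas_cst a : cmeas (fun=> a).
Proof. by split; exact: measurable_cst. Qed.

Lemma cmeas_real p : measurable_fun setT p -> cmeas (fun x => (p x)%:C).
Proof. by move=> mp; split => //=; exact: measurable_cst. Qed.

Lemma cmeas_cexp f : cmeas f -> cmeas (fun x => cexp (f x)).
Proof.
move=> [f1 f2]; split => /=; apply: measurable_funM.
- exact: measurableT_comp.
- by apply: measurableT_comp => //; apply: continuous_measurable_fun; exact: continuous_cos.
- exact: measurableT_comp.
- by apply: measurableT_comp => //; apply: continuous_measurable_fun; exact: continuous_sin.
Qed.

Lemma cinteg_dom f q : cmeas f -> integ q -> (forall x, normc (f x) <= q x) -> cinteg f.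
Proof.
move=> [mf1 mf2] iq fq; split; apply: integ_dom iq _ => // x; apply: le_trans (fq x).
  exact: ler_Re_normc.
exact: ler_Im_normc.
Qed.

Let Re_lin a f g x : Re (a * f x + g x) =
  (Re a * Re (f x) + - Im a * Im (f x)) + Re (g x).
Proof. by case: a (f x) (g x) => [? ?] [? ?] [? ?] /=; rewrite mulNr. Qed.

Let Im_lin a f g x : Im (a * f x + g x) =
  (Re a * Im (f x) + Im a * Re (f x)) + Im (g x).
Proof. by case: a (f x) (g x) => [? ?] [? ?] [? ?]. Qed.

Lemma cinteg_lin a f g : cinteg f -> cinteg g -> cinteg (fun x => a * f x + g x).
Proof.
move=> [f1 f2] [g1 g2]; split.
  by under eq_fun do rewrite Re_lin; apply: integD => //; exact: integ_lin.
by under eq_fun do rewrite Im_lin; apply: integD => //; exact: integ_lin.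
Qed.

Lemma cint_lin a f g : cinteg f -> cinteg g ->
  cint (fun x => a * f x + g x) = a * cint f + cint g.
Proof.
move=> [f1 f2] [g1 g2]; rewrite /cint.
under eq_Rintegral do rewrite Re_lin.
under [X in _ +i* X]eq_Rintegral do rewrite Im_lin.
rewrite (RintegralD measurableT (integ_lin (Re a) (- Im a) f1 f2) g1).
rewrite (RintegralD measurableT (integ_lin (Re a) (Im a) f2 f1) g2).
rewrite !Rint_lin//.
by case: a => u v /=; rewrite mulNr.
Qed.

Lemma cint0 : cint (fun=> 0) = 0.
Proof. by rewrite /cint /= Rintegral_cst// mul0r. Qed.

Lemma cinteg0 : cinteg (fun=> 0).
Proof. by split; exact: integrable0. Qed.

Lemma cintegZ a f : cinteg f -> cinteg (fun x => a * f x).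
Proof. by move=> cf; have := cinteg_lin a cf cinteg0; under eq_fun do rewrite addr0. Qed.

Lemma cintegD f g : cinteg f -> cinteg g -> cinteg (fun x => f x + g x).
Proof. by move=> cf cg; have := cinteg_lin 1 cf cg; under eq_fun do rewrite mul1r. Qed.

Lemma cintegB f g : cinteg f -> cinteg g -> cinteg (fun x => f x - g x).
Proof. by move=> cf cg; have := cinteg_lin (-1) cg cf; under eq_fun do rewrite mulN1r addrC. Qed.

Lemma eq_cint f g : (forall x, f x = g x) -> cint f = cint g.
Proof. by move=> /funext ->. Qed.

Lemma cintZ a f : cinteg f -> cint (fun x => a * f x) = a * cint f.
Proof.
move=> cf; rewrite -[RHS]addr0 -cint0 -cint_lin//; last exact: cinteg0.
by apply: eq_cint => x; rewrite addr0.
Qed.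

Lemma cintD f g : cinteg f -> cinteg g -> cint (fun x => f x + g x) = cint f + cint g.
Proof.
move=> cf cg; rewrite -[X in _ = X + _]mul1r -cint_lin//.
by apply: eq_cint => x; rewrite mul1r.
Qed.

Lemma cintB f g : cinteg f -> cinteg g -> cint (fun x => f x - g x) = cint f - cint g.
Proof.
move=> cf cg; rewrite addrC -mulN1r -cint_lin//.
by apply: eq_cint => x; rewrite mulN1r addrC.
Qed.

Lemma cinteg_sum I (r : seq I) (F : I -> T -> C) :
  (forall i, cinteg (F i)) -> cinteg (fun x => \sum_(i <- r) F i x).
Proof.
move=> cF; elim: r => [|i r IH].
  by under eq_fun do rewrite big_nil; exact: cinteg0.
by under eq_fun do rewrite big_cons; exact: cintegD.
Qed.

Lemma cint_sum I (r : seq I) (F : I -> T -> C) :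
  (forall i, cinteg (F i)) -> cint (fun x => \sum_(i <- r) F i x) = \sum_(i <- r) cint (F i).
Proof.
move=> cF; elim: r => [|i r IH].
  by under eq_fun do rewrite big_nil; rewrite cint0 big_nil.
by under eq_fun do rewrite big_cons; rewrite cintD// ?IH ?big_cons//; exact: cinteg_sum.
Qed.

(** A unit factor rotating the integral onto the positive axis passes under the integral sign, where
    the real part is at most q. *)
Lemma normc_cint f q : cinteg f -> integ q -> (forall x, normc (f x) <= q x) ->
  normc (cint f) <= \int[mu]_x q x.
Proof.
move=> cf iq fq; apply: normc_leP => a a1.
have := cintegZ a cf => -[i1 _].
have -> : Re (a * cint f) = \int[mu]_x Re (a * f x) by rewrite -cintZ.
apply: Rint_le => // x; apply: le_trans (fq x); exact: Re_mul_le.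
Qed.

Lemma cint_real p : cint (fun x => (p x)%:C) = (\int[mu]_x p x)%:C.
Proof. by rewrite /cint /= Rintegral_cst// mul0r. Qed.

Lemma cinteg_real p : integ p -> cinteg (fun x => (p x)%:C).
Proof. by move=> ip; split => //=; exact: integrable0. Qed.

End complex_integral.

(** * Lebesgue measure on R^d *)

Section lebesgue_rV_tools.
Variable R : realType.
Local Notation C := (R[i]).
Local Notation Re := complex.Re.
Local Notation Im := complex.Im.
Local Notation normc := ComplexField.Normc.normc.
Local Notation leb := (@lebesgue_measure R).

(** The sigma-algebra is generated by the coordinates, so an open set has to be exhausted by
    countably many cubes: those with rational centre and radius 1/(n+1) that lie in O. *)
Lemma open_measurable_rV d (O : set 'rV[R]_d) : open O -> measurable O.
Proof.
move=> oO.
pose D := ('rV[rat]_d * nat)%type.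
pose q (k : D) : 'rV[R]_d := map_mx ratr k.1.
pose r (k : D) : R := k.2.+1%:R^-1.
pose B (k : D) : set 'rV[R]_d := [set x | forall i, `|x ord0 i - q k ord0 i| < r k].
have mB k : measurable (B k).
  have -> : B k = \bigcap_(i in [set: 'I_d]) [set x | `|x ord0 i - q k ord0 i| < r k].
    by apply/seteqP; split=> x /= h i => [_|]; [exact: h|exact: (h i I)].
  apply: fin_bigcap_measurable => // i _.
  pose h := fun x : 'rV[R]_d => `|x ord0 i - q k ord0 i|.
  have mh : measurable_fun setT h.
    apply: measurableT_comp => //; apply: measurable_funB => //; exact: measurable_coord.
  have := mh measurableT `]-oo, r k[%classic (measurable_itv _).
  have E : h @^-1` `]-oo, r k[%classic = [set x | `|x ord0 i - q k ord0 i| < r k].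
    by apply/seteqP; split => x /=; rewrite in_itv /=.
  by rewrite setTI E.
have -> : O = \bigcup_k (if pselect (B k `<=` O) then B k else set0).
  apply/seteqP; split => [x Ox|x [k _]]; last by case: pselect => // h /h.
  have /nbhs_ballP[e /= e0 eO] : nbhs x O by rewrite nbhsE; exists O.
  (* Half of e: the rational centre is within 1/(n+1) of x and the cube has that radius, so its
     points are within 2/(n+1) < e of x. *)
  have [n ne] : exists n : nat, (n.+1%:R^-1 : R) < e / 2.
    have e2 : 0 < e / 2 by rewrite divr_gt0.
    exists (Num.truncn (e / 2)^-1); rewrite -[ltRHS]invrK ltf_pV2 ?posrE ?invr_gt0//.
    exact: truncnS_gt.
  have n0 : (0 : R) < n.+1%:R^-1 by rewrite invr_gt0.
  have [y yP] : exists y : 'rV[rat]_d, forall i, `|x ord0 i - ratr (y ord0 i)| < n.+1%:R^-1.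
    have h i : exists p : rat, `|x ord0 i - ratr p| < n.+1%:R^-1.
      have lt : x ord0 i - n.+1%:R^-1 < x ord0 i + n.+1%:R^-1 by move: n0; set u := _^-1; lra.
      have [p] := rat_in_itvoo lt; rewrite in_itv /= => /andP[p1 p2].
      by exists p; rewrite ltr_norml; move: p1 p2; set u := _^-1 => p1 p2; apply/andP; split; lra.
    have [y yP] := choice h.
    by exists (\row_i y i) => i; rewrite mxE.
  exists (y, n) => //.
  rewrite /=; case: pselect => [hh|h] /=.
    by move=> i; rewrite mxE; exact: yP.
  exfalso; apply: h => z Bz; apply: eO; rewrite -ball_normE /= /ball_ /=.
  apply: (@le_lt_trans _ _ (2 * n.+1%:R^-1)); last by move: ne; set u := _^-1; lra.
  rewrite [leLHS]mx_normrE.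
  apply: bigmax_le => [|[i j] _ /=]; first by move: n0; set u := _^-1; lra.
  rewrite ord1 !mxE; have := Bz j; have := yP j; rewrite /q /r /= !mxE; set u := _^-1 => h1 h2.
  rewrite (_ : x ord0 j - z ord0 j = (x ord0 j - ratr (y ord0 j)) - (z ord0 j - ratr (y ord0 j))); last by ring.
  apply: le_trans (ler_normB _ _) _; lra.
apply: countable_bigcupT_measurable => [|k]; first exact: countableP.
by case: (pselect (B k `<=` O)) => /= h.
Qed.

Lemma continuous_measurable_rV d (f : 'rV[R]_d -> R) :
  continuous f -> measurable_fun setT f.
Proof.
move=> cf; apply: (measurability _ (@RGenOpens.measurableE R)).
move=> _ [_ [a [b ->] <-]]; rewrite setTI; apply: open_measurable_rV.
by apply: open_comp => //; exact: interval_open.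
Qed.

Lemma continuous_cmeas d (f : 'rV[R]_d -> C) : continuousC f -> cmeas f.
Proof. by move=> [c1 c2]; split; exact: continuous_measurable_rV. Qed.

Lemma integral_rVS n (f : 'rV[R]_n.+1 -> \bar R) : measurable_fun setT f ->
  (forall x, 0 <= f x)%E ->
  (\int[lebesgue_rV n.+1]_x f x = \int[leb]_t \int[lebesgue_rV n]_x f (consrV (t, x)))%E.
Proof.
move=> mf f0.
transitivity (\int[pushforward (leb \x lebesgue_rV n) (@consrV R n)]_x f x)%E.
  apply: eq_measure_integral => [|A mA _ //]; exact: measurable_consrV.
rewrite ge0_integral_pushforward//; last exact: measurable_consrV.
rewrite preimage_setT fubini_tonelli1//; last by move=> x; exact: f0.
by apply: measurableT_comp => //; exact: measurable_consrV.
Qed.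

Lemma integ_rVS n (f : 'rV[R]_n.+1 -> R) : integ (lebesgue_rV n.+1) f ->
  integ (leb \x lebesgue_rV n)%E (fun p => f (consrV p)).
Proof.
move=> /integrableP[mf foo]; apply/integrableP; split.
  by apply: (measurableT_comp mf); exact: measurable_consrV.
apply: le_lt_trans foo; rewrite le_eqVlt; apply/orP; left; apply/eqP.
transitivity (\int[pushforward (leb \x lebesgue_rV n) (@consrV R n)]_x `|(f x)%:E|)%E; last first.
  by apply: eq_measure_integral => [|A mA _ //]; exact: measurable_consrV.
rewrite ge0_integral_pushforward//; first exact: measurable_consrV.
exact: measurableT_comp.
Qed.

(** Every slice, not almost every one, is integrable: then the real inner integral equals the
    extended one at each t, and Fubini's theorem transfers without an exceptional set. The slices
    met below have explicit dominating functions. *)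
Lemma Rint_prod12 d1 d2 (T1 : measurableType d1) (T2 : measurableType d2)
    (m1 : {sigma_finite_measure set T1 -> \bar R}) (m2 : {sigma_finite_measure set T2 -> \bar R})
    (f : T1 * T2 -> R) : integ (m1 \x m2)%E f ->
  (forall t, integ m2 (fun x => f (t, x))) ->
  integ m1 (fun t => \int[m2]_x f (t, x)) /\
  \int[(m1 \x m2)%E]_p f p = \int[m1]_t \int[m2]_x f (t, x).
Proof.
move=> intf fs.
have E t : ((\int[m2]_x f (t, x))%:E = fubini_F m2 (EFin \o f) t)%E.
  by rewrite /Rintegral fineK//; apply: integrable_fin_num => //; exact: fs.
split.
  by rewrite /integ; under eq_fun do rewrite E; exact: integrable_fubini_F.
rewrite [RHS]/Rintegral; under eq_integral do rewrite E.
by rewrite integral12_prod_meas1.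
Qed.

Lemma Rint_prod21 d1 d2 (T1 : measurableType d1) (T2 : measurableType d2)
    (m1 : {sigma_finite_measure set T1 -> \bar R}) (m2 : {sigma_finite_measure set T2 -> \bar R})
    (f : T1 * T2 -> R) : integ (m1 \x m2)%E f ->
  (forall x, integ m1 (fun t => f (t, x))) ->
  \int[(m1 \x m2)%E]_p f p = \int[m2]_x \int[m1]_t f (t, x).
Proof.
move=> intf fs.
have E x : ((\int[m1]_t f (t, x))%:E = fubini_G m1 (EFin \o f) x)%E.
  by rewrite /Rintegral fineK//; apply: integrable_fin_num => //; exact: fs.
rewrite [RHS]/Rintegral; under eq_integral do rewrite E.
by rewrite integral21_prod_meas1.
Qed.

Lemma cint_prod12 d1 d2 (T1 : measurableType d1) (T2 : measurableType d2)
    (m1 : {sigma_finite_measure set T1 -> \bar R}) (m2 : {sigma_finite_measure set T2 -> \bar R})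
    (f : T1 * T2 -> C) : cinteg (m1 \x m2)%E f ->
  (forall t, cinteg m2 (fun x => f (t, x))) ->
  cint (m1 \x m2)%E f = cint m1 (fun t => cint m2 (fun x => f (t, x))).
Proof.
move=> [f1 f2] fs; rewrite /cint.
have [_ ->] := Rint_prod12 f1 (fun t => (fs t).1).
by have [_ ->] := Rint_prod12 f2 (fun t => (fs t).2).
Qed.

Lemma cint_prod21 d1 d2 (T1 : measurableType d1) (T2 : measurableType d2)
    (m1 : {sigma_finite_measure set T1 -> \bar R}) (m2 : {sigma_finite_measure set T2 -> \bar R})
    (f : T1 * T2 -> C) : cinteg (m1 \x m2)%E f ->
  (forall x, cinteg m1 (fun t => f (t, x))) ->
  cint (m1 \x m2)%E f = cint m2 (fun x => cint m1 (fun t => f (t, x))).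
Proof.
move=> [f1 f2] fs; rewrite /cint.
by rewrite (Rint_prod21 f1 (fun t => (fs t).1)) (Rint_prod21 f2 (fun t => (fs t).2)).
Qed.

Lemma cint_rVS n (f : 'rV[R]_n.+1 -> C) : cinteg (lebesgue_rV n.+1) f ->
  cint (lebesgue_rV n.+1) f = cint (leb \x lebesgue_rV n)%E (fun p => f (consrV p)).
Proof.
have E (g : 'rV[R]_n.+1 -> R) : integ (lebesgue_rV n.+1) g ->
    \int[lebesgue_rV n.+1]_x g x = \int[(leb \x lebesgue_rV n)%E]_p g (consrV p).
  move=> ig; rewrite /Rintegral; congr fine.
  transitivity (\int[pushforward (leb \x lebesgue_rV n) (@consrV R n)]_x (g x)%:E)%E.
    by apply: eq_measure_integral => [|A mA _ //]; exact: measurable_consrV.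
  rewrite integral_pushforward//.
  - exact: measurable_consrV.
  - by apply/measurable_EFinP; exact: integ_meas ig.
  - by rewrite preimage_setT; exact: integ_rVS.
by move=> [f1 f2]; rewrite /cint !E.
Qed.

(** Product weights serve as dominating functions on R^d: Gaussians and indicators of cubes have
    this shape, and their integrals and slices factor. *)
Definition prodw (w : R -> R) d (y : 'rV[R]_d) : R := \prod_i w (y ord0 i).

Lemma prodw_cons w n t (x : 'rV[R]_n) : prodw w (consrV (t, x)) = w t * prodw w x.
Proof.
rewrite /prodw big_ord_recl; have := consrVK (t, x); rewrite /unconsrV => -[h1 /rowP h2].
by rewrite h1; congr (_ * _); apply: eq_bigr => i _; rewrite -[in RHS]h2 mxE.
Qed.

Lemma measurable_prodw (w : R -> R) d : measurable_fun setT w -> measurable_fun setT (@prodw w d).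
Proof.
move=> mw; rewrite /prodw; apply: measurable_prod => i _.
by apply: measurableT_comp => //; exact: measurable_coord.
Qed.

Lemma prodw_ge0 (w : R -> R) d (y : 'rV[R]_d) : (forall t : R, 0 <= w t) -> 0 <= prodw w y.
Proof. by move=> w0; apply: prodr_ge0. Qed.

Lemma integral_prodw (w : R -> R) d (I : R) : measurable_fun setT w -> (forall t : R, 0 <= w t) ->
  (\int[leb]_t (w t)%:E = I%:E)%E ->
  (\int[lebesgue_rV d]_y (prodw w y)%:E = (I ^+ d)%:E)%E.
Proof.
move=> mw w0 wI; elim: d => [|d IH].
  rewrite expr0 /=.
  rewrite [LHS](_ : _ = (\int[dirac (0%R : 'rV[R]_0)]_y (prodw w y)%:E)%E); last first.
    by apply: eq_measure_integral => A mA _.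
  rewrite integral_dirac//; last by apply/measurable_EFinP; exact: measurable_prodw.
  by rewrite diracT mul1e /prodw big_ord0.
rewrite integral_rVS; last first.
- by move=> x; rewrite lee_fin prodw_ge0.
- by apply/measurable_EFinP; exact: measurable_prodw.
under eq_integral => t _.
  under eq_integral do rewrite prodw_cons EFinM.
  rewrite ge0_integralZl//; last 3 first.
  - by apply/measurable_EFinP; exact: measurable_prodw.
  - by move=> x _; rewrite lee_fin prodw_ge0.
  - by rewrite lee_fin.
  rewrite IH; over.
have I0 : 0 <= I by rewrite -lee_fin -wI; apply: integral_ge0 => t _; rewrite lee_fin.
rewrite ge0_integralZr//.
- by rewrite wI exprS EFinM.
- exact/measurable_EFinP.
- by move=> t _; rewrite lee_fin.
- by rewrite lee_fin exprn_ge0.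
Qed.

Lemma integ_prodw (w : R -> R) d : (forall t : R, 0 <= w t) -> integ leb w ->
  integ (lebesgue_rV d) (@prodw w d) /\
  \int[lebesgue_rV d]_y prodw w y = (\int[leb]_t w t) ^+ d.
Proof.
move=> w0 iw; have mw := integ_meas iw.
have wI : (\int[leb]_t (w t)%:E = (\int[leb]_t w t)%:E)%E.
  by rewrite /Rintegral fineK//; exact: integrable_fin_num iw.
have E := integral_prodw d mw w0 wI.
split; last by rewrite {1}/Rintegral E.
apply/integrableP; split; first by apply/measurable_EFinP; exact: measurable_prodw.
under eq_integral do rewrite gee0_abs ?lee_fin ?prodw_ge0//.
by rewrite E ltry.
Qed.

Definition gaussw (b : R) d (y : 'rV[R]_d) : R := expR (- (b * enorm2 y)).

Lemma gaussw_prodw b d (y : 'rV[R]_d) : gaussw b y = prodw (fun t => expR (- (b * t ^+ 2))) y.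
Proof. by rewrite /gaussw /prodw /enorm2 mulr_sumr -sumrN expR_sum. Qed.

Lemma integ_gauss1 (b : R) : 0 < b -> integ leb (fun t : R => expR (- (b * t ^+ 2))).
Proof.
(* With variance 1/(2b) the normal density is a constant times exp (- b t^2). *)
move=> b0; pose s := Num.sqrt (b^-1 / 2).
have s2 : s ^+ 2 *+ 2 = b^-1.
  rewrite sqr_sqrtr ?divr_ge0 ?invr_ge0 ?ltW// mulr2n; lra.
have s0 : s != 0 by rewrite gt_eqF// sqrtr_gt0 divr_gt0 ?invr_gt0.
have := @integrable_normal_pdf R 0 s.
have E t : normal_pdf 0 s t = normal_peak s * expR (- (b * t ^+ 2)).
  rewrite normal_pdfE// /normal_fun s2 subr0 invrK; congr (_ * expR _); ring.
have p0 := normal_peak_gt0 s0.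
move=> /(integrableZl measurableT (normal_peak s)^-1) /=; rewrite /integ; apply: eq_integrable => //.
by move=> t _; rewrite /= E -EFinM mulrA mulVf ?mul1r// gt_eqF.
Qed.

Lemma integ_gaussw b d : 0 < b -> integ (lebesgue_rV d) (@gaussw b d).
Proof.
move=> b0; rewrite (_ : @gaussw b d = prodw (fun t => expR (- (b * t ^+ 2))) (d:=d)); last first.
  by apply/funext => y; exact: gaussw_prodw.
apply: (integ_prodw _ _ _).1; first by move=> t; exact: expR_ge0.
exact: integ_gauss1.
Qed.

Lemma Rint_gaussw1 d : \int[lebesgue_rV d]_y gaussw 1 y = Num.sqrt pi ^+ d.
Proof.
under eq_Rintegral do rewrite gaussw_prodw.
rewrite (integ_prodw _ _ _).2; [|by move=> t; exact: expR_ge0|exact: integ_gauss1].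
congr (_ ^+ _); rewrite -[RHS]/(fine (Num.sqrt pi)%:E) -integralT_gauss /Rintegral; congr fine; apply: eq_integral => t _.
by rewrite /gauss_fun mul1r.
Qed.

(** A cube written by coordinates: its measurability is read off the generators, and under [consrV]
    it is a product, which yields the positivity of its measure by induction. *)
Definition rVball d (x : 'rV[R]_d) (r : R) : set 'rV[R]_d :=
  [set y | forall i, `|y ord0 i - x ord0 i| < r].

Lemma rVball_measurable d (x : 'rV[R]_d) r : measurable (rVball x r).
Proof.
have -> : rVball x r = \bigcap_(i in [set: 'I_d]) [set y | `|y ord0 i - x ord0 i| < r].
  by apply/seteqP; split=> y /= h i => [_|]; [exact: h|exact: (h i I)].
apply: fin_bigcap_measurable => // i _.
pose h := fun y : 'rV[R]_d => `|y ord0 i - x ord0 i|.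
have mh : measurable_fun setT h.
  apply: measurableT_comp => //; apply: measurable_funB => //; exact: measurable_coord.
have := mh measurableT `]-oo, r[%classic (measurable_itv _).
have E : h @^-1` `]-oo, r[%classic = [set y | `|y ord0 i - x ord0 i| < r].
  by apply/seteqP; split => y /=; rewrite in_itv /=.
by rewrite setTI E.
Qed.

Lemma rVball_nbhs d (x : 'rV[R]_d) (A : set 'rV[R]_d) : nbhs x A ->
  exists2 r : R, 0 < r & rVball x r `<=` A.
Proof.
move=> /nbhs_ballP[e /= e0 eA]; exists (e / 2); first by rewrite divr_gt0.
move=> y xy; apply: eA; rewrite -ball_normE /= /ball_ /=.
apply: (@le_lt_trans _ _ (e / 2)); last by lra.
rewrite [leLHS]mx_normrE; apply: bigmax_le => [|[i j] _ /=]; first by lra.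
by rewrite ord1 !mxE distrC ltW.
Qed.

Lemma consrV0 n (t : R) (x : 'rV[R]_n) : consrV (t, x) ord0 ord0 = t.
Proof. by have := congr1 (fun p : measurableTypeR R * 'rV[R]_n => p.1) (consrVK (t, x)). Qed.

Lemma consrVS n (t : R) (x : 'rV[R]_n) k : consrV (t, x) ord0 (lift ord0 k) = x ord0 k.
Proof.
have := congr1 (fun p : measurableTypeR R * 'rV[R]_n => p.2 ord0 k) (consrVK (t, x)).
by rewrite /= mxE.
Qed.

Lemma rVball_measure_gt0 d (x : 'rV[R]_d) r : 0 < r ->
  (0 < lebesgue_rV d (rVball x r))%E.
Proof.
move=> r0; elim: d x => [|d IH] x.
  rewrite [X in (_ < X)%E](_ : _ = \d_(0 : 'rV[R]_0) (rVball x r))//.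
  by rewrite diracE mem_set// => -[].
rewrite [X in (_ < X)%E](_ : _ = (leb \x lebesgue_rV d)%E
   (ball (x ord0 ord0) r `*` rVball (\row_j x ord0 (lift ord0 j)) r)).
  rewrite product_measure1E//; last exact: rVball_measurable.
  rewrite [X in (_ < X * _)%E](lebesgue_measure_ball (x ord0 ord0) (ltW r0)) mule_gt0//.
    by rewrite lte_fin mulrn_wgt0.
  exact: measurable_ball.
rewrite [LHS](_ : _ = (leb \x lebesgue_rV d)%E (@consrV R d @^-1` rVball x r))//.
congr (_ _); apply/seteqP; split=> -[t y] /=.
  move=> h; split; first by have := h ord0; rewrite consrV0 /ball /= distrC.
  by move=> i; have := h (lift ord0 i); rewrite consrVS mxE.
move=> [h1 h2] i; case: (unliftP ord0 i) => [j ->|->].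
  by have := h2 j; rewrite mxE consrVS.
by rewrite consrV0 distrC.
Qed.

Lemma lebesgue_rV_gt0 d : (0 < lebesgue_rV d [set: 'rV[R]_d])%E.
Proof.
apply: lt_le_trans (rVball_measure_gt0 (0 : 'rV[R]_d) ltr01) _.
by apply: le_measure => //; rewrite ?inE//; exact: rVball_measurable.
Qed.

(** The powers of k peak at x0. If g(x0) > 0, then g k^n is at least c q'^n on a small cube around
    x0 and at least - |g| q^n away from it, with q < q' < 1; the integral would be positive for
    large n. *)
Lemma concentration d (g k : 'rV[R]_d -> R) x0 :
  integ (lebesgue_rV d) g -> measurable_fun setT k ->
  {for x0, continuous g} -> {for x0, continuous k} -> k x0 = 1 ->
  (forall y, 0 <= k y <= 1) ->
  (forall e : R, 0 < e -> exists q, [/\ 0 <= q, q < 1 &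
     forall y, ~ rVball x0 e y -> k y <= q]) ->
  (forall n, \int[lebesgue_rV d]_y (g y * k y ^+ n) = 0) -> g x0 = 0.
Proof.
wlog gx0 : g / 0 <= g x0.
  move=> wl ig mk cg ck k1 k01 kq gk0.
  have [|/ltW gx0] := leP 0 (g x0); first by move=> ?; exact: wl gk0.
  apply/eqP; rewrite -oppr_eq0; apply/eqP.
  apply: (wl (fun y => - g y)) => //.
  - by rewrite oppr_ge0.
  - exact: integN.
  - exact: (continuousN cg).
  - move=> n; have ign : integ (lebesgue_rV d) (fun y => g y * k y ^+ n).
      apply: (@integ_dom _ _ _ _ _ (fun y => `|g y|)).
      + apply: measurable_funM; first exact: integ_meas ig.
        exact: measurable_funX.
      + exact: (integrable_norm ig).
      + move=> y; rewrite normrM ler_piMr// normrX exprn_ile1//.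
        by have /andP[h1 h2] := k01 y; rewrite ger0_norm.
    under eq_Rintegral do rewrite mulNr -mulN1r.
    by rewrite RintegralZl// gk0 mulr0.
move=> ig mk cg ck k1 k01 kq gk0; apply/eqP; apply: contraT => gn0.
have {gn0} gx0 : 0 < g x0 by rewrite lt_def gn0.
pose c := g x0 / 2.
have c0 : 0 < c by rewrite divr_gt0.
have [e e0 eg] : exists2 e : R, 0 < e & rVball x0 e `<=` [set y | c < g y].
  apply: rVball_nbhs; apply: (cg [set t | c < t]); apply: lt_nbhsr; rewrite /c; lra.
have [q [q0 q1 kyq]] := kq _ e0.
pose q' := (1 + q) / 2.
have [e' e'0 ek] : exists2 e : R, 0 < e & rVball x0 e `<=` [set y | q' < k y].
  apply: rVball_nbhs; apply: (ck [set t | q' < t]); apply: lt_nbhsr; rewrite k1 /q'; lra.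
pose B := rVball x0 (Num.min e e').
have Be y : B y -> c < g y.
  move=> By; apply: eg => i; apply: lt_le_trans (By i) _; by rewrite ge_min lexx.
have Be' y : B y -> q' < k y.
  move=> By; apply: ek => i; apply: lt_le_trans (By i) _; by rewrite ge_min lexx orbT.
have mB : measurable B by exact: rVball_measurable.
have ing : integ (lebesgue_rV d) (fun y => `|g y|) by exact: (integrable_norm ig).
have iB : integ (lebesgue_rV d) (fun y => \1_B y).
  apply: (@integ_dom _ _ _ _ _ (fun y => c^-1 * `|g y|)).
  - exact: measurable_indic.
  - exact: integZ.
  - move=> y; rewrite indicE; case: (boolP (y \in B)) => yB.
      rewrite normr1 -(mulVf (lt0r_neq0 c0)) ler_wpM2l ?invr_ge0 ?ltW//.
      by apply: lt_le_trans (Be _ (set_mem yB)) _; exact: ler_norm.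
    by rewrite normr0 mulr_ge0// invr_ge0 ltW.
pose v := \int[lebesgue_rV d]_y \1_B y.
have v0 : 0 < v.
  have E : (\int[lebesgue_rV d]_y (\1_B y)%:E = lebesgue_rV d B)%E.
    by rewrite integral_indic// setIT.
  have fin : (lebesgue_rV d B \is a fin_num)%E.
    by rewrite -E; exact: integrable_fin_num iB.
  rewrite /v /Rintegral E fine_gt0//; apply/andP; split.
    by apply: rVball_measure_gt0; rewrite lt_min e0.
  by rewrite ltey_eq fin.
pose G := \int[lebesgue_rV d]_y `|g y|.
(* B is a cube where both g > c and k > q'. Points of the cube of radius e outside B contribute a
   nonnegative amount, as g > c > 0 there, and are dropped. *)
have H n : c * q' ^+ n * v <= q ^+ n * G.
  have i1 : integ (lebesgue_rV d) (fun y => g y * k y ^+ n).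
    apply: (@integ_dom _ _ _ _ _ (fun y => `|g y|)) => //.
      apply: measurable_funM; first exact: integ_meas ig.
      exact: measurable_funX.
    move=> y; rewrite normrM ler_piMr// normrX exprn_ile1//.
    by have /andP[h1 h2] := k01 y; rewrite ger0_norm.
  have := Rint_le (integ_lin (c * q' ^+ n) (- q ^+ n) iB ing) i1.
  rewrite gk0 Rint_lin// -/v -/G => h.
  suff h0 : c * q' ^+ n * v + - q ^+ n * G <= 0 by move: h0; rewrite mulNr subr_le0.
  apply: h => y; have /andP[k0 k1'] := k01 y.
  have q'0 : 0 <= q' by rewrite /q'; lra.
  have [yB|yB] := pselect (B y).
    rewrite indicE mem_set// mulr1.
    apply: (@le_trans _ _ (c * q' ^+ n)).
      by rewrite gerDl mulNr oppr_le0 mulr_ge0// exprn_ge0.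
    apply: ler_pM; [exact: ltW|exact: exprn_ge0|exact/ltW/Be|].
    by rewrite lerXn2r ?nnegrE// ltW// Be'.
  rewrite indicE memNset// mulr0 add0r.
  have [ye|ye] := pselect (rVball x0 e y).
    apply: (@le_trans _ _ 0); first by rewrite mulNr oppr_le0 mulr_ge0// exprn_ge0.
    by rewrite mulr_ge0 ?exprn_ge0// ltW// (lt_trans c0)//; exact: eg.
  have ky := kyq y ye.
  rewrite mulNr lerNl -mulNr.
  apply: (@le_trans _ _ (`|g y| * k y ^+ n)).
    by rewrite ler_wpM2r ?exprn_ge0// -normrN ler_norm.
  by rewrite mulrC ler_wpM2r// lerXn2r ?nnegrE.
have q'0 : 0 < q' by rewrite /q'; lra.
have G0 : 0 <= G by apply: Rint_ge0.
have qq0 : 0 <= q / q' by apply: divr_ge0 => //; exact: ltW.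
have qq1 : `|q / q'| < 1.
  by rewrite (ger0_norm qq0) ltr_pdivrMr// mul1r /q'; lra.
have : (fun n => (q / q') ^+ n * G) @ \oo --> (0 : R).
  by rewrite -[X in _ --> X](mul0r G); apply: cvgMl; exact: cvg_expr.
move=> /cvgr0Pnorm_lt /(_ (c * v)) []; first by rewrite mulr_gt0.
move=> n _ /(_ n (leqnn n)) /=; rewrite ger0_norm; last first.
  by rewrite mulr_ge0// exprn_ge0.
rewrite ltNge expr_div_n [X in _ <= X]mulrAC ler_pdivlMr ?exprn_gt0// [X in X <= _]mulrAC.
by rewrite H.
Qed.

Lemma continuous_normc d (f : 'rV[R]_d -> C) : continuousC f ->
  continuous (fun x => normc (f x)).
Proof.
move=> [c1 c2] x.
rewrite (_ : (fun x => _) = (fun x => Num.sqrt (re_part f x ^+ 2 + im_part f x ^+ 2))); last first.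
  by apply/funext => y; rewrite /re_part /im_part; case: (f y).
apply: (@continuous_comp _ _ _ (fun x => re_part f x ^+ 2 + im_part f x ^+ 2) Num.sqrt).
  exact: (cvgD (cvgM (c1 x) (c1 x)) (cvgM (c2 x) (c2 x))).
exact: sqrt_continuous.
Qed.

(** A continuous function that exceeds M in modulus at one point does so on a cube, and cubes have
    positive measure, so the essential supremum is the supremum. Positivity of the total measure
    enters because the norm with infinite exponent is 0 on a null space. *)
Lemma Linfty_norm_leP d (f : 'rV[R]_d -> (R[i])^o) (M : R) : continuousC f ->
  (Linfty_norm f <= M%:E)%E <-> (forall y, normc (f y) <= M).
Proof.
move=> cf; rewrite /Linfty_norm unlock lebesgue_rV_gt0; split=> [/ess_supP|] h.
  move=> y; rewrite leNgt; apply/negP => My.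
  have [r r0 rM] : exists2 r : R, 0 < r & rVball y r `<=` [set y | M < normc (f y)].
    by apply: rVball_nbhs; apply: (@continuous_normc d f cf y [set t | M < t]); exact: lt_nbhsr.
  have [B [mB B0 BM]] := h.
  have : (lebesgue_rV d (rVball y r) <= lebesgue_rV d B)%E.
    apply: le_measure; rewrite ?inE//; first exact: rVball_measurable.
    move=> u /rM /= Mu; apply: BM => /=; rewrite lee_fin ger0_norm ?normc_ge0// => h1.
    by move: Mu; rewrite ltNge h1.
  by rewrite B0 leNgt rVball_measure_gt0.
apply/ess_supP; apply: nearW => y /=; rewrite lee_fin ger0_norm ?normc_ge0//.
Qed.

End lebesgue_rV_tools.

(** * Partial derivatives and integration by parts *)

Section derivatives.
Variable R : realType.
Local Notation C := (R[i]).
Local Notation Re := complex.Re.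
Local Notation Im := complex.Im.
Local Notation normc := ComplexField.Normc.normc.
Local Notation leb := (@lebesgue_measure R).

Lemma is_derive_line (V : normedModType R) (f : V -> R) (x v : V) (l : R) :
  is_derive x v f l <-> is_derive (0 : R) (1 : R) (fun t : R => f (t *: v + x)) l.
Proof.
have E : (fun h : R => h^-1 *: (((fun t : R => f (t *: v + x)) \o shift 0) (h *: (1 : R)) - f (0 *: v + x)))
  = (fun h : R => h^-1 *: ((f \o shift x) (h *: v) - f x)).
  by apply/funext => h /=; rewrite scale0r add0r /GRing.scale /= mulr1 addr0.
split=> -[d e]; split.
- by rewrite /derivable E.
- by rewrite /derive E.
- by move: d; rewrite /derivable E.
- by move: e; rewrite /derive E.
Qed.

(** The source of the derivatives of functions given by integrals: a quadratic remainder that holds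
    pointwise under the integral can be integrated with a dominating weight. *)
Lemma is_derive1_quad (f : R -> R) (x l c : R) : 0 <= c ->
  (forall h : R, `|h| <= 1 -> `|f (h + x) - f x - h * l| <= c * h ^+ 2) ->
  is_derive x (1:R) f l.
Proof.
move=> c0 H.
have cv : (fun h : R => h^-1 *: ((f \o shift x) (h *: (1:R)) - f x)) @ 0^' --> l.
  apply/cvgrPdist_lt => e e0; near=> h.
  have h0 : h != 0 by near: h; exact: nbhs_dnbhs_neq.
  have h1 : `|h| <= 1.
    near: h; apply: dnbhs0_le; exact: ltr01.
  have he : `|h| < e / (c + 1).
    near: h; apply: dnbhs0_lt; rewrite divr_gt0// ltr_wpDl//.
  rewrite /GRing.scale /= mulr1.
  rewrite (_ : l - _ = - (h^-1 * (f (h + x) - f x - h * l))); last by field.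
  rewrite normrN normrM normfV ltr_pdivrMl ?normr_gt0//.
  apply: le_lt_trans (H h h1) _; rewrite -real_normK ?num_real// expr2 mulrCA.
  rewrite ltr_pM2l ?normr_gt0//; apply: le_lt_trans (_ : (c + 1) * `|h| < e).
    by rewrite ler_wpM2r// lerDl.
  by rewrite mulrC -ltr_pdivlMr// ltr_wpDl.
split; first by apply/cvg_ex; exists l.
exact: cvg_lim.
Unshelve. all: by end_near. Qed.

Section real_continuity.
Variable T : topologicalType.
Implicit Types f g : T -> R.

Lemma rcontD f g : continuous f -> continuous g -> continuous (fun x => f x + g x).
Proof. by move=> cf cg x; exact: (cvgD (cf x) (cg x)). Qed.

Lemma rcontB f g : continuous f -> continuous g -> continuous (fun x => f x - g x).
Proof. by move=> cf cg x; exact: (cvgB (cf x) (cg x)). Qed.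

Lemma rcontM f g : continuous f -> continuous g -> continuous (fun x => f x * g x).
Proof. by move=> cf cg x; exact: (cvgM (cf x) (cg x)). Qed.

Lemma rcont_cst (a : R) : continuous (fun _ : T => a).
Proof. exact: cst_continuous. Qed.

Lemma rcont_comp f (g : R -> R) : continuous f -> continuous g -> continuous (fun x => g (f x)).
Proof. by move=> cf cg x; exact: (continuous_comp (cf x) (cg (f x))). Qed.

Lemma rcontX f n : continuous f -> continuous (fun x => f x ^+ n).
Proof.
move=> cf; elim: n => [|n IH]; first exact: rcont_cst.
by under eq_fun do rewrite exprS; exact: rcontM.
Qed.

Lemma rcont_sum (I : Type) (r : seq I) (F : I -> T -> R) :
  (forall k, continuous (F k)) -> continuous (fun y => \sum_(k <- r) F k y).
Proof.
move=> cF; elim: r => [|k r IH].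
  by under [X in continuous X]eq_fun do rewrite big_nil; exact: cst_continuous.
by under [X in continuous X]eq_fun do rewrite big_cons; exact: rcontD.
Qed.
End real_continuity.

(** * Partial derivatives of complex-valued functions *)

Section partials.
Variable d : nat.
Implicit Types (f g : 'rV[R]_d -> C^o) (x : 'rV[R]_d) (i : 'I_d).

Definition cderiv i f x (l : C) :=
  is_derive x (Rebasis R i) (re_part f) (Re l) /\
  is_derive x (Rebasis R i) (im_part f) (Im l).

Lemma cderiv_partial i f x l : cderiv i f x l -> partial i f x = l.
Proof.
by move=> [[_ d1] [_ d2]]; rewrite /partial d1 d2; case: (l).
Qed.

Lemma partial_cderiv f : partial_derivable f -> forall i x, cderiv i f x (partial i f x).
Proof. by move=> df i x; have [d1 d2] := df i x; split; split. Qed.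

Lemma cderiv_derivable f (f' : 'I_d -> 'rV[R]_d -> C) :
  (forall i x, cderiv i f x (f' i x)) -> partial_derivable f.
Proof. by move=> df i x; have [[d1 _] [d2 _]] := df i x. Qed.

Lemma cderiv_eq i f x l l' : cderiv i f x l -> l = l' -> cderiv i f x l'.
Proof. by move=> ? <-. Qed.

Lemma cderiv_ext i f g x l : (forall y, f y = g y) -> cderiv i f x l -> cderiv i g x l.
Proof. by move=> /funext ->. Qed.

Lemma cderiv_quad i f x (l : C) (c : R) : 0 <= c ->
  (forall t : R, `|t| <= 1 ->
    normc (f (t *: Rebasis R i + x) - f x - t%:C * l) <= c * t ^+ 2) ->
  cderiv i f x l.
Proof.
move=> c0 H; split; apply/is_derive_line; apply: (is_derive1_quad c0) => h h1.
  apply: le_trans (H h h1); apply: le_trans (ler_Re_normc _).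
  rewrite /re_part addr0 scale0r add0r; case: (f _) (f _) (l) => [? ?] [? ?] [? ?] /=.
  by rewrite mul0r subr0.
apply: le_trans (H h h1); apply: le_trans (ler_Im_normc _).
rewrite /im_part addr0 scale0r add0r; case: (f _) (f _) (l) => [? ?] [? ?] [? ?] /=.
by rewrite mul0r addr0.
Qed.

Lemma cderivD i f g x l m : cderiv i f x l -> cderiv i g x m ->
  cderiv i (fun y => f y + g y) x (l + m).
Proof.
move=> [f1 f2] [g1 g2]; split.
  rewrite (_ : re_part _ = re_part f + re_part g); last first.
    by apply/funext => y; rewrite /re_part !fctE; case: (f y) (g y) => [? ?] [? ?].
  rewrite (_ : Re (l + m) = Re l + Re m); last by case: (l) (m) => [? ?] [? ?].
  exact: is_deriveD.
rewrite (_ : im_part _ = im_part f + im_part g); last first.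
  by apply/funext => y; rewrite /im_part !fctE; case: (f y) (g y) => [? ?] [? ?].
rewrite (_ : Im (l + m) = Im l + Im m); last by case: (l) (m) => [? ?] [? ?].
exact: is_deriveD.
Qed.

Lemma cderiv_cst i (a : C) x : cderiv i (fun=> a) x 0.
Proof. by split; exact: is_derive_cst. Qed.

Lemma cderivM i f g x l m : cderiv i f x l -> cderiv i g x m ->
  cderiv i (fun y => f y * g y) x (l * g x + f x * m).
Proof.
move=> [f1 f2] [g1 g2]; split.
  rewrite (_ : re_part _ = re_part f * re_part g - im_part f * im_part g); last first.
    apply/funext => y; rewrite /re_part /im_part !fctE.
    by case: (f y) (g y) => [? ?] [? ?].
  apply: (is_derive_eq (is_deriveB (is_deriveM f1 g1) (is_deriveM f2 g2))).
  rewrite /GRing.scale /= /re_part /im_part.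
  by case: (l) (m) (f x) (g x) => [? ?] [? ?] [? ?] [? ?] /=; ring.
rewrite (_ : im_part _ = re_part f * im_part g + im_part f * re_part g); last first.
  apply/funext => y; rewrite /re_part /im_part !fctE.
  by case: (f y) (g y) => [? ?] [? ?].
apply: (is_derive_eq (is_deriveD (is_deriveM f1 g2) (is_deriveM f2 g1))).
rewrite /GRing.scale /= /re_part /im_part.
by case: (l) (m) (f x) (g x) => [? ?] [? ?] [? ?] [? ?] /=; ring.
Qed.

Lemma cderiv_real i (p : 'rV[R]_d -> R) x (l : R) : is_derive x (Rebasis R i) p l ->
  cderiv i (fun y => (p y)%:C) x l%:C.
Proof. by move=> dp; split => //; exact: is_derive_cst. Qed.

Lemma cderivZ i (a : C) f x l : cderiv i f x l -> cderiv i (fun y => a * f y) x (a * l).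
Proof.
move=> df; apply: cderiv_eq (cderivM (cderiv_cst i a x) df) _.
by rewrite mul0r add0r.
Qed.

Lemma coord_shift i j (t : R) x :
  (t *: Rebasis R i + x) ord0 j = (i == j)%:R * t + x ord0 j.
Proof. by rewrite !mxE eqxx /= eq_sym mulrC. Qed.

Lemma enorm2_shift i (t : R) x :
  enorm2 (t *: Rebasis R i + x) = enorm2 x + 2 * t * x ord0 i + t ^+ 2.
Proof.
rewrite /enorm2 (bigD1 i)//= [in RHS](bigD1 i)//= coord_shift eqxx mul1r.
rewrite (eq_bigr (fun j => x ord0 j ^+ 2)); last first.
  by move=> j ji; rewrite coord_shift eq_sym (negPf ji) mul0r add0r.
ring.
Qed.

Lemma enorm2_ge0 x : 0 <= enorm2 x.
Proof. by apply: sumr_ge0 => i _; exact: sqr_ge0. Qed.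

Lemma coord_le_enorm2 x i : x ord0 i ^+ 2 <= enorm2 x.
Proof.
rewrite /enorm2 (bigD1 i)//= lerDl; apply: sumr_ge0 => j _; exact: sqr_ge0.
Qed.

Lemma continuousCM f g : continuousC f -> continuousC g -> continuousC (fun y => f y * g y).
Proof.
move=> [f1 f2] [g1 g2]; split => x.
  rewrite (_ : re_part _ = re_part f * re_part g - im_part f * im_part g); last first.
    apply/funext => y; rewrite /re_part /im_part !fctE.
    by case: (f y) (g y) => [? ?] [? ?].
  exact: (cvgB (cvgM (f1 x) (g1 x)) (cvgM (f2 x) (g2 x))).
rewrite (_ : im_part _ = re_part f * im_part g + im_part f * re_part g); last first.
  apply/funext => y; rewrite /re_part /im_part !fctE.
  by case: (f y) (g y) => [? ?] [? ?].
exact: (cvgD (cvgM (f1 x) (g2 x)) (cvgM (f2 x) (g1 x))).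
Qed.

Lemma continuousCD f g : continuousC f -> continuousC g -> continuousC (fun y => f y + g y).
Proof.
move=> cf cg; have := continuousC_lin 1 cf cg.
by rewrite (_ : 1 *: f + g = (fun y => f y + g y))//; apply/funext => y; rewrite scale1r.
Qed.

Lemma continuousC_cst (a : C) : continuousC ((fun=> a) : 'rV[R]_d -> C^o).
Proof. by split; exact: cst_continuous. Qed.

Lemma continuousC_real (p : 'rV[R]_d -> R) : continuous p -> continuousC (fun y => (p y)%:C : C^o).
Proof. by move=> cp; split => //; exact: cst_continuous. Qed.

Lemma continuousC_sum (I : Type) (r : seq I) (F : I -> 'rV[R]_d -> C^o) :
  (forall k, continuousC (F k)) -> continuousC (fun y => \sum_(k <- r) F k y).
Proof.
move=> cF; elim: r => [|k r IH].
  under [X in continuousC X]eq_fun do rewrite big_nil; exact: continuousC_cst.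
by under [X in continuousC X]eq_fun do rewrite big_cons; exact: continuousCD.
Qed.

Lemma continuousC_cexp f : continuousC f -> continuousC (fun y => cexp (f y) : C^o).
Proof.
move=> [f1 f2]; split; apply: rcontM.
- exact: (rcont_comp f1 (@continuous_expR R)).
- exact: (rcont_comp f2 (@continuous_cos R)).
- exact: (rcont_comp f1 (@continuous_expR R)).
- exact: (rcont_comp f2 (@continuous_sin R)).
Qed.

Lemma continuous_enorm2 : continuous (@enorm2 R d).
Proof. by apply: rcont_sum => i; apply: rcontX; exact: coord_continuous. Qed.

End partials.

Definition pos (u : R) : R := Num.max u 0.

Lemma pos_ge0 u : 0 <= pos u. Proof. by rewrite le_max lexx orbT. Qed.

Lemma posE u : pos u = if u <= 0 then 0 else u.
Proof. by rewrite /pos maxEle. Qed.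

Lemma continuous_pos : continuous pos.
Proof.
have -> : pos = (fun u => (u + `|u|) / 2).
  apply/funext => u; rewrite posE; case: ifPn => [u0|]; first by rewrite ler0_norm// subrr mul0r.
  by rewrite -ltNge => u0; rewrite gtr0_norm//; lra.
apply: rcontM; last exact: rcont_cst.
by apply: rcontD; [move=> x; exact: cvg_id|exact: norm_continuous].
Qed.

Lemma is_derive_pos3 u : is_derive u (1:R) (fun u => pos u ^+ 3) (3 * pos u ^+ 2).
Proof.
apply: (@is_derive1_quad _ _ _ (3 * `|u| + 3)); first by have := normr_ge0 u; lra.
move=> h h1; have [h2 h3] : -1 <= h /\ h <= 1 by move: h1; rewrite ler_norml => /andP.
rewrite !posE; case: (leP (h + u) 0) => hu; case: (leP u 0) => u0.
- by rewrite !expr0n /= !mulr0 !subr0 normr0 mulr_ge0 ?sqr_ge0//; have := normr_ge0 u; lra.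
- rewrite expr0n /= (ger0_norm (ltW u0)).
  have -> : 0 - u ^+ 3 - h * (3 * u ^+ 2) = u ^+ 2 * (- (3 * h) - u) by ring.
  rewrite ger0_norm; last by rewrite mulr_ge0 ?sqr_ge0//; lra.
  have : u ^+ 2 <= h ^+ 2 by rewrite -[h ^+ 2]sqrrN lerXn2r ?nnegrE//; lra.
  have : u ^+ 2 >= 0 by exact: sqr_ge0.
  by move: (u ^+ 2) (h ^+ 2) => a b a0 ab; nra.
- rewrite !expr0n /= !mulr0 !subr0 ger0_norm; last by rewrite exprn_ge0// ltW.
  have : (h + u) ^+ 2 <= h ^+ 2 by rewrite lerXn2r ?nnegrE//; lra.
  have : (h + u) ^+ 2 >= 0 by exact: sqr_ge0.
  rewrite (exprSr _ 2); have := normr_ge0 u; move: (`|u|) => v v0.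
  by move: ((h + u) ^+ 2) (h ^+ 2) => a b a0 ab; nra.
- rewrite (ger0_norm (ltW u0)).
  have -> : (h + u) ^+ 3 - u ^+ 3 - h * (3 * u ^+ 2) = h ^+ 2 * (3 * u + h) by ring.
  have h0 := sqr_ge0 h; rewrite normrM (ger0_norm h0) mulrC ler_wpM2r//.
  by rewrite ler_norml; apply/andP; split; lra.
Qed.

Lemma is_derive_pos2 u : is_derive u (1:R) (fun u => pos u ^+ 2) (2 * pos u).
Proof.
apply: (@is_derive1_quad _ _ _ 2); first by [].
move=> h h1; have [h2 h3] : -1 <= h /\ h <= 1 by move: h1; rewrite ler_norml => /andP.
have h0 := sqr_ge0 h.
rewrite !posE; case: (leP (h + u) 0) => hu; case: (leP u 0) => u0.
- by rewrite !expr0n /= !mulr0 !subr0 normr0 mulr_ge0.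
- rewrite expr0n /= ler_norml; apply/andP; split; nra.
- by rewrite !expr0n /= !mulr0 !subr0 ler_norml; apply/andP; split; nra.
- by rewrite ler_norml; apply/andP; split; nra.
Qed.

(** * Compactly supported cutoffs *)

Section cutoff.
Variable d : nat.
Implicit Types (x y : 'rV[R]_d).

(* The exponent 3 makes the cutoff twice continuously differentiable. *)
Definition cutoff (e : R) x : R := pos (1 - e * enorm2 x) ^+ 3.
Definition cutoff1 (e : R) i x : R := - 6 * e * x ord0 i * pos (1 - e * enorm2 x) ^+ 2.
Definition cutoff2 (e : R) i x : R := - 6 * e * pos (1 - e * enorm2 x) ^+ 2 +
  24 * e ^+ 2 * x ord0 i ^+ 2 * pos (1 - e * enorm2 x).

Lemma is_derive_enorm2 i x : is_derive x (Rebasis R i) (@enorm2 R d) (2 * x ord0 i).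
Proof.
apply/is_derive_line; apply: (@is_derive1_quad _ _ _ 1) => // h _.
rewrite addr0 scale0r add0r enorm2_shift mul1r.
rewrite (_ : _ - _ - _ = h ^+ 2); last by ring.
by rewrite ger0_norm// sqr_ge0.
Qed.

Lemma is_derive_rcoord i j x : is_derive x (Rebasis R i) (fun y => y ord0 j) ((i == j)%:R : R).
Proof.
apply/is_derive_line; apply: (@is_derive1_quad _ _ _ 0) => // h _.
by rewrite addr0 scale0r add0r coord_shift mul0r mulrC addrK subrr normr0.
Qed.

Lemma is_derive_chain (V : normedModType R) (f : V -> R) (g : R -> R) (x v : V) (a b : R) :
  is_derive x v f a -> is_derive (f x) (1:R) g b -> is_derive x v (g \o f) (b * a).
Proof.
move=> /is_derive_line df dg; apply/is_derive_line.
have E : f (0 *: v + x) = f x by rewrite scale0r add0r.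
rewrite -E in dg.
have := @is_derive1_comp R g (fun t => f (t *: v + x)) 0 _ _ dg df.
by rewrite /GRing.scale /=.
Qed.

Let d1 e i x : is_derive x (Rebasis R i) (fun x => 1 - e * enorm2 x) (- (e * (2 * x ord0 i))).
Proof.
have -> : (fun x => 1 - e * enorm2 x) = cst 1 - e \*: (@enorm2 R d) by [].
apply: (is_derive_eq (is_deriveB (is_derive_cst _ _ _) (is_deriveZ e (is_derive_enorm2 i x)))).
by rewrite sub0r.
Qed.

Lemma is_derive_cutoff e i x : is_derive x (Rebasis R i) (cutoff e) (cutoff1 e i x).
Proof.
apply: (is_derive_eq (is_derive_chain (d1 e i x) (is_derive_pos3 _))).
by rewrite /cutoff1; ring.
Qed.

Lemma is_derive_cutoff1 e i x : is_derive x (Rebasis R i) (cutoff1 e i) (cutoff2 e i x).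
Proof.
have -> : cutoff1 e i = (- 6 * e) \*: ((fun y => y ord0 i : R) * ((fun u => pos u ^+ 2) \o (fun x => 1 - e * enorm2 x))).
  by apply/funext => y; rewrite /cutoff1 -mulrA.
apply: (is_derive_eq (is_deriveZ _ (is_deriveM (is_derive_rcoord i i x) (is_derive_chain (d1 e i x) (is_derive_pos2 _))))).
by rewrite /cutoff2 eqxx /GRing.scale /=; ring.
Qed.

Lemma continuous_pos_enorm2 e : continuous (fun x => pos (1 - e * enorm2 x)).
Proof.
apply: (rcont_comp _ continuous_pos); apply: rcontB; first exact: rcont_cst.
by apply: rcontM; [exact: rcont_cst|exact: continuous_enorm2].
Qed.

Lemma continuous_cutoff e : continuous (cutoff e).
Proof. by apply: rcontX; exact: continuous_pos_enorm2. Qed.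

Lemma continuous_cutoff1 e i : continuous (cutoff1 e i).
Proof.
apply: rcontM; last by apply: rcontX; exact: continuous_pos_enorm2.
by apply: rcontM; [exact: rcont_cst|exact: coord_continuous].
Qed.

Lemma continuous_cutoff2 e i : continuous (cutoff2 e i).
Proof.
apply: rcontD; apply: rcontM.
- exact: rcont_cst.
- by apply: rcontX; exact: continuous_pos_enorm2.
- by apply: rcontM; [exact: rcont_cst|apply: rcontX; exact: coord_continuous].
- exact: continuous_pos_enorm2.
Qed.

Lemma pos_le1 e x : 0 <= e -> pos (1 - e * enorm2 x) <= 1.
Proof. by move=> e0; rewrite ge_max ler01 andbT gerBl mulr_ge0// enorm2_ge0. Qed.

Lemma cutoff_le1 e x : 0 <= e -> cutoff e x <= 1.
Proof. by move=> e0; rewrite exprn_ile1 ?pos_ge0 ?pos_le1. Qed.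

(** Bernoulli's inequality. The error made by the cutoff is e times a polynomial, and a Gaussian
    will absorb the polynomial. *)
Lemma cutoff_ge e x : 0 <= e -> 1 - cutoff e x <= 3 * e * enorm2 x.
Proof.
move=> e0; have N := enorm2_ge0 x; have : 0 <= e * enorm2 x by rewrite mulr_ge0.
rewrite /cutoff posE -mulrA; move: (e * _) => u u0.
case: (leP (1 - u) 0) => h; first by rewrite expr0n /= subr0; lra.
rewrite (_ : 1 - (1 - u) ^+ 3 = 3 * u - u ^+ 2 * (2 + (1 - u))); last by ring.
by rewrite gerBl mulr_ge0 ?sqr_ge0//; lra.
Qed.

Lemma cutoff1_le e i x : 0 <= e -> `|cutoff1 e i x| <= 6 * e * `|x ord0 i|.
Proof.
move=> e0; rewrite /cutoff1 !normrM (_ : `|-6 : R| = 6); last by rewrite normrN ger0_norm.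
rewrite (ger0_norm e0) ler_piMr//; first by rewrite !mulr_ge0.
by rewrite !(ger0_norm (pos_ge0 _)) mulr_ile1 ?pos_ge0 ?pos_le1.
Qed.

Lemma cutoff2_le e i x : 0 <= e -> `|cutoff2 e i x| <= 30 * e.
Proof.
move=> e0; rewrite /cutoff2; set p := pos _.
have p0 : 0 <= p by exact: pos_ge0. have p1 : p <= 1 by exact: pos_le1.
(* Where p > 0 one has e |x|^2 < 1, so the second term is at most 24 e; the first contributes 6
   e. *)
have xp : e * x ord0 i ^+ 2 * p <= 1.
  have xn := coord_le_enorm2 x i; rewrite /p posE; case: (leP (1 - e * enorm2 x) 0) => h.
    by rewrite mulr0.
  have : e * x ord0 i ^+ 2 <= 1 by apply: le_trans (ler_wpM2l e0 xn) _; lra.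
  have : 0 <= e * x ord0 i ^+ 2 by apply: mulr_ge0 => //; exact: sqr_ge0.
  have : 0 <= e * enorm2 x by rewrite mulr_ge0// enorm2_ge0.
  move: (e * _) (e * _) => a b; nra.
have xp0 : 0 <= e * x ord0 i ^+ 2 * p.
  by apply: mulr_ge0 => //; apply: mulr_ge0 => //; exact: sqr_ge0.
rewrite (_ : 24 * e ^+ 2 * x ord0 i ^+ 2 * p = 24 * e * (e * x ord0 i ^+ 2 * p)); last by ring.
have : p ^+ 2 <= 1 by rewrite exprn_ile1.
have : 0 <= p ^+ 2 by rewrite sqr_ge0.
move: xp xp0; move: (p ^+ 2) (e * _ * _) => a b b1 b0 a0 a1.
by rewrite ler_norml; apply/andP; split; nra.
Qed.

Lemma cutoff_supp e x i : 0 < e -> e^-1 < x ord0 i ^+ 2 -> pos (1 - e * enorm2 x) = 0.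
Proof.
move=> e0 h; rewrite /pos; apply/max_idPr; rewrite subr_le0.
rewrite -ler_pdivrMl// mulr1; apply: le_trans (ltW h) _; exact: coord_le_enorm2.
Qed.

End cutoff.

Lemma FTC_compact_support (f f' : R -> R) (a b : R) : a < b ->
  (forall t, is_derive t (1:R) f (f' t)) -> continuous f' ->
  (forall t, t < a \/ b < t -> f' t = 0) -> f a = 0 -> f b = 0 ->
  \int[leb]_t f' t = 0.
Proof.
move=> ab df cf' supp fa fb.
have -> : \int[leb]_t f' t = \int[leb]_(t in `[a, b]) f' t.
  rewrite [RHS]Rintegral_mkcond; congr (Rintegral _ _ _); apply/funext => t.
  rewrite patchE; case: ifPn => // /negP tab; apply: supp.
  have [ta|ta] := ltP t a; first by left.
  right; rewrite ltNge; apply/negP => tb; apply: tab.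
  by rewrite inE /= in_itv /= ta.
rewrite /Rintegral (@continuous_FTC2 _ f' f)// ?fa ?fb ?subee//.
- exact: continuous_subspaceT.
- have cf : continuous f.
    by move=> t; apply/differentiable_continuous/derivable1_diffP; exact: ex_derive.
  by split => [t _||]; [exact: ex_derive|exact/cvg_at_right_filter/cf|exact/cvg_at_left_filter/cf].
- by move=> t _; rewrite derive1E derive_val.
Qed.

Lemma consrV_shift0 n (t s : R) (x : 'rV[R]_n) :
  s *: Rebasis R ord0 + consrV (t, x) = consrV (s + t, x).
Proof.
have [h1 h2] := (consrVK (t, x), consrVK (s + t, x)).
apply/rowP => j; rewrite coord_shift.
case: (unliftP ord0 j) => [k ->|->].
  rewrite (negPf (neq_lift _ _)) mul0r add0r.
  have := congr1 (fun p : measurableTypeR R * 'rV[R]_n => p.2 ord0 k) h1.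
  have := congr1 (fun p : measurableTypeR R * 'rV[R]_n => p.2 ord0 k) h2.
  by rewrite /= [in X in X -> _]mxE [in X in _ -> X -> _]mxE => -> ->.
have := congr1 (fun p : measurableTypeR R * 'rV[R]_n => p.1) h1.
have := congr1 (fun p : measurableTypeR R * 'rV[R]_n => p.1) h2.
by rewrite eqxx mul1r /= => -> ->.
Qed.

Lemma consrV_shiftS n (t s : R) (x : 'rV[R]_n) (k : 'I_n) :
  s *: Rebasis R (lift ord0 k) + consrV (t, x) = consrV (t, s *: Rebasis R k + x).
Proof.
have [h1 h2] := (consrVK (t, x), consrVK (t, s *: Rebasis R k + x)).
apply/rowP => j; rewrite coord_shift.
case: (unliftP ord0 j) => [l ->|->].
  have := congr1 (fun p : measurableTypeR R * 'rV[R]_n => p.2 ord0 l) h1.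
  have := congr1 (fun p : measurableTypeR R * 'rV[R]_n => p.2 ord0 l) h2.
  rewrite /= [in X in X -> _]mxE [in X in _ -> X -> _]mxE => -> ->.
  by rewrite coord_shift (inj_eq lift_inj).
have := congr1 (fun p : measurableTypeR R * 'rV[R]_n => p.1) h1.
have := congr1 (fun p : measurableTypeR R * 'rV[R]_n => p.1) h2.
rewrite eq_sym (negPf (neq_lift _ _)) mul0r add0r /= => -> ->//.
Qed.

Lemma continuous_rV (T : topologicalType) n (f : T -> 'rV[R]_n) :
  (forall i, continuous (fun x => f x ord0 i)) -> continuous f.
Proof.
move=> cf x; apply/cvg_ballP => e e0; near=> y.
rewrite -ball_normE /= /ball_ /=.
apply: (@le_lt_trans _ _ (e / 2)); last by rewrite ltr_pdivrMr// ltr_pMr// ltr1n.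
rewrite [leLHS]mx_normrE; apply: bigmax_le => [|[i j] _ /=]; first by rewrite divr_ge0// ltW.
rewrite ord1 !mxE; apply: ltW; move: i j => _ j; move: (j).
near: y; apply: filter_forall => j'.
have /cvgrPdist_lt/(_ (e / 2)) := cf j' x; apply; by rewrite divr_gt0.
Unshelve. all: by end_near. Qed.

Lemma continuous_consrV_r n (t : R) : continuous (fun x : 'rV[R]_n => consrV (t, x) : 'rV[R]_n.+1).
Proof.
apply: continuous_rV => i; case: (unliftP ord0 i) => [j ->|->].
  by under eq_fun do rewrite consrVS; exact: coord_continuous.
by under eq_fun do rewrite consrV0; exact: cst_continuous.
Qed.

Lemma continuous_consrV_l n (x : 'rV[R]_n) : continuous (fun t : R => consrV (t, x) : 'rV[R]_n.+1).
Proof.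
apply: continuous_rV => i; case: (unliftP ord0 i) => [j ->|->].
  by under eq_fun do rewrite consrVS; exact: cst_continuous.
by under eq_fun do rewrite consrV0; move=> t; exact: cvg_id.
Qed.

(* The dominating weight makes all slices integrable, as Fubini requires. *)
Lemma Rint_partial0 d (f f' : 'rV[R]_d -> R) (i : 'I_d) (w : R -> R) (M b : R) :
  (forall x : 'rV[R]_d, is_derive x (Rebasis R i) f (f' x)) -> continuous f' ->
  (forall t : R, 0 <= w t) -> integ leb w -> 0 <= M -> 0 < b ->
  (forall x : 'rV[R]_d, `|f' x| <= M * prodw w x) ->
  (forall x : 'rV[R]_d, b <= `|x ord0 i| -> f x = 0) ->
  (forall x : 'rV[R]_d, b <= `|x ord0 i| -> f' x = 0) ->
  \int[lebesgue_rV d]_x f' x = 0.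
Proof.
move=> + + w0 iw; elim: d => [|d IH] in f f' i M *; first by case: i.
move=> df cf' M0 b0 bnd fs f's.
have if' : integ (lebesgue_rV d.+1) f'.
  apply: (@integ_dom _ _ _ _ _ (fun x => M * prodw w x)) => //.
    exact: continuous_measurable_rV.
  by apply: integZ; exact: (integ_prodw _ _ _).1.
have E : \int[lebesgue_rV d.+1]_x f' x = \int[(leb \x lebesgue_rV d)%E]_p f' (consrV p).
  have [i1 _] := cinteg_real if'.
  by have := congr1 (@complex.Re R) (cint_rVS (cinteg_real if')); rewrite !cint_real.
rewrite E.
have if2 := integ_rVS if'.
(* If i is not the first coordinate, the first one is frozen at t and the induction hypothesis
   applies to the slice, with the constant [M * w t]. If it is, the first coordinate is integrated
   innermost, by the fundamental theorem of calculus. *)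
case: (unliftP ord0 i) => [k ik|i0].
  have sl t : integ (lebesgue_rV d) (fun x => f' (consrV (t, x))).
    apply: (@integ_dom _ _ _ _ _ (fun x => (M * w t) * prodw w x)) => //.
    - apply: continuous_measurable_rV => x.
      exact: (continuous_comp (@continuous_consrV_r d t x) (cf' _)).
    - by apply: integZ; exact: (integ_prodw _ _ _).1.
    - by move=> x; apply: le_trans (bnd _) _; rewrite prodw_cons mulrA.
  have [_ ->] := Rint_prod12 if2 sl.
  rewrite (_ : (fun t => _) = cst 0); first by rewrite Rintegral_cst// mul0r.
  apply/funext => t /=.
  apply: (IH (fun x => f (consrV (t, x))) (fun x => f' (consrV (t, x))) k (M * w t)) => //.
  - move=> x; have /is_derive_line := df (consrV (t, x)); rewrite ik => H.
    apply/is_derive_line; rewrite (_ : (fun s : R => _) = (fun s => f (s *: Rebasis R (lift ord0 k) + consrV (t, x))))//.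
    by apply/funext => s; rewrite consrV_shiftS.
  - by move=> x; exact: (continuous_comp (@continuous_consrV_r d t x) (cf' _)).
  - exact: mulr_ge0.
  - by move=> x; apply: le_trans (bnd _) _; rewrite prodw_cons mulrA.
  - by move=> x bx; apply: fs; rewrite ik consrVS.
  - by move=> x bx; apply: f's; rewrite ik consrVS.
have sl x : integ leb (fun t => f' (consrV (t, x))).
  have iq : integ leb (fun t : R => (M * prodw w x) * w t) by exact: integZ.
  apply: (integ_dom _ iq).
  - apply: continuous_measurable_fun => t.
    exact: (continuous_comp (@continuous_consrV_l d x t) (cf' _)).
  - by move=> t; apply: le_trans (bnd _) _; rewrite prodw_cons mulrCA mulrC.
rewrite (Rint_prod21 if2 sl).
rewrite (_ : (fun t => _) = cst 0); first by rewrite Rintegral_cst// mul0r.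
apply/funext => x /=.
apply: (@FTC_compact_support (fun t => f (consrV (t, x))) _ (- b) b).
- by rewrite gtrN.
- move=> t; have /is_derive_line := df (consrV (t, x)); rewrite i0 => H.
  apply/is_derive_line; rewrite (_ : (fun s : R => _) = (fun s => f (s *: Rebasis R ord0 + consrV (t, x))))//.
  by apply/funext => s; rewrite consrV_shift0 /GRing.scale /= mulr1.
- by move=> t; exact: (continuous_comp (@continuous_consrV_l d x t) (cf' _)).
- move=> t h; apply: f's; rewrite i0 consrV0.
  case: h => h; last by apply: le_trans (ltW h) (ler_norm _).
  by rewrite -normrN; apply: le_trans (ler_norm _); lra.
- by apply: fs; rewrite i0 consrV0 normrN ler_norm.
- by apply: fs; rewrite i0 consrV0 ler_norm.
Qed.

Lemma rVbox_bounded d (B : R) (g : 'rV[R]_d -> R) : continuous g ->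
  exists2 M : R, 0 <= M & forall x : 'rV[R]_d, (forall i, `|x ord0 i| <= B) -> `|g x| <= M.
Proof.
move=> cg.
have cK : compact [set x : 'rV[R]_d | forall i, `[- B, B]%classic (x ord0 i)].
  exact: (@rV_compact _ d (fun=> `[- B, B]%classic) (fun=> @segment_compact _ _ _)).
have : bounded_set (g @` [set x : 'rV[R]_d | forall i, `[- B, B]%classic (x ord0 i)]).
  by apply: compact_bounded; apply: continuous_compact => //; exact: continuous_subspaceT.
move=> [M [_ /(_ (`|M| + 1))]] H; exists (`|M| + 1); first by rewrite addr_ge0.
move=> x xB; apply: H; first by apply: le_lt_trans (ler_norm M) _; rewrite ltrDl.
exists x => // i /=; rewrite in_itv /=; have := xB i; by rewrite ler_norml.
Qed.

Lemma integ_indic_itv (B : R) : integ leb (fun t => \1_`[- B, B]%classic t : R).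
Proof.
apply/integrableP; split; first by apply/measurable_EFinP; exact: measurable_indic.
under eq_integral do rewrite gee0_abs ?lee_fin//.
rewrite integral_indic// setIT.
rewrite [X in (X < _)%E](lebesgue_measure_itv `[- B, B]) /=.
by case: ifP => _; rewrite ?ltry// -EFinB ltry.
Qed.

Lemma cint_partial0 d (i : 'I_d) (W W' : 'rV[R]_d -> C^o) (B : R) : 0 < B ->
  (forall x : 'rV[R]_d, cderiv i W x (W' x)) -> continuousC W' ->
  (forall (x : 'rV[R]_d) j, B <= `|x ord0 j| -> W x = 0 /\ W' x = 0) ->
  cinteg (lebesgue_rV d) W' /\ cint (lebesgue_rV d) W' = 0.
Proof.
move=> B0 dW cW' supp.
(* On the box the product of these weights is 1 and off it the functions vanish, so a bound on the
   compact box is a domination by [prodw w]. *)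
pose w := fun t : R => \1_`[- B, B]%classic t : R.
have w0 t : 0 <= w t by rewrite /w indicE.
have iw : integ leb w by exact: integ_indic_itv.
have bnd (g : 'rV[R]_d -> R) : continuous g -> (forall (x : 'rV[R]_d) j, B <= `|x ord0 j| -> g x = 0) ->
    exists2 M : R, 0 <= M & forall x, `|g x| <= M * prodw w x.
  move=> cg g0; have [M M0 gM] := rVbox_bounded B cg; exists M => // x.
  have [xB|] := pselect (forall j, `|x ord0 j| <= B).
    rewrite /prodw big1 ?mulr1; first exact: gM.
    move=> j _; rewrite /w indicE mem_set//= in_itv /=; by have := xB j; rewrite ler_norml.
  move=> /existsNP[j /negP]; rewrite -ltNge => xj.
  by rewrite (g0 x j (ltW xj)) normr0 mulr_ge0// prodw_ge0.
have [c1 c2] := cW'.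
have s1 (x : 'rV[R]_d) j : B <= `|x ord0 j| -> re_part W' x = 0 by move=> /supp[_ e]; rewrite /re_part e.
have s2 (x : 'rV[R]_d) j : B <= `|x ord0 j| -> im_part W' x = 0 by move=> /supp[_ e]; rewrite /im_part e.
have [M1 M10 b1] := bnd _ c1 s1; have [M2 M20 b2] := bnd _ c2 s2.
have ip := (integ_prodw d w0 iw).1.
split.
  split.
    by apply: (integ_dom (continuous_measurable_rV c1) (integZ M1 ip)).
  by apply: (integ_dom (continuous_measurable_rV c2) (integZ M2 ip)).
have i1 : \int[lebesgue_rV d]_x re_part W' x = 0.
  apply: (@Rint_partial0 d (re_part W) (re_part W') i w M1 B) => //.
  - by move=> x; have [] := dW x.
  - by move=> x /supp[e _]; rewrite /re_part e.
  - by move=> x; exact: s1.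
have i2 : \int[lebesgue_rV d]_x im_part W' x = 0.
  apply: (@Rint_partial0 d (im_part W) (im_part W') i w M2 B) => //.
  - by move=> x; have [] := dW x.
  - by move=> x /supp[e _]; rewrite /im_part e.
  - by move=> x; exact: s2.
by rewrite /cint i1 i2.
Qed.

Lemma le_eps (x K : R) : (forall e, 0 < e -> e <= 1 -> x <= e * K) -> x <= 0.
Proof.
move=> h; rewrite leNgt; apply/negP => x0.
have h1 := h 1 ltr01 (lexx _); rewrite mul1r in h1.
have K0 : 0 < K by exact: lt_le_trans h1.
have := h (x / (2 * K)); rewrite divr_gt0 ?mulr_gt0// => /(_ isT).
rewrite ler_pdivrMr ?mulr_gt0// mul1r => /(_ _) /=.
have e : x / (2 * K) * K = x / 2 by field; rewrite gt_eqF.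
rewrite e => /(_ ltac:(lra)); lra.
Qed.

(** * Integration by parts under Gaussian bounds *)

Section gauss_ibp.
Variable d : nat.
Implicit Types (x y : 'rV[R]_d) (i : 'I_d).
Local Notation mu := (lebesgue_rV d).

Lemma gaussw_gt0 b y : 0 < gaussw b y. Proof. exact: expR_gt0. Qed.
Lemma gaussw_ge0 b y : 0 <= gaussw b y. Proof. exact: expR_ge0. Qed.

Lemma gaussw_le b c y : b <= c -> gaussw c y <= gaussw b y.
Proof. by move=> bc; rewrite ler_expR lerN2 ler_wpM2r// enorm2_ge0. Qed.

(** Half of the exponent absorbs the quadratic factor, by u <= e^u at u = b |y|^2 / 2. Each use of
    this halves the rate b. *)
Lemma enorm2_gaussw b y : 0 < b -> enorm2 y * gaussw b y <= (2 / b) * gaussw (b / 2) y.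
Proof.
move=> b0; rewrite /gaussw.
have -> : expR (- (b / 2 * enorm2 y)) = expR (b / 2 * enorm2 y) * expR (- (b * enorm2 y)).
  by rewrite -expRD; congr expR; lra.
rewrite mulrA ler_wpM2r ?expR_ge0//.
rewrite -ler_pdivrMl ?divr_gt0// invf_div.
apply: le_trans (expR_ge1Dx _); lra.
Qed.

Lemma cutoff_supp_box e x i : 0 < e -> e^-1 + 1 <= `|x ord0 i| -> pos (1 - e * enorm2 x) = 0.
Proof.
move=> e0 h; apply: (cutoff_supp (i := i)) => //.
rewrite -real_normK ?num_real//; have : 0 < e^-1 by rewrite invr_gt0.
by move: h; move: (e^-1) (`|_|) => u v; nra.
Qed.

Lemma cutoff1_le1 e i x : 0 <= e -> e <= 1 -> `|cutoff1 e i x| <= 6 * e * (1 + enorm2 x).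
Proof.
move=> e0 e1; apply: le_trans (cutoff1_le i x e0) _; rewrite ler_wpM2l ?mulr_ge0//.
have := coord_le_enorm2 x i; rewrite -real_normK ?num_real//.
by move: (enorm2 x) (`|_|) => u v; nra.
Qed.

Lemma le_poly_gaussw b y : 0 < b -> (1 + enorm2 y) * gaussw b y <= (1 + 2 / b) * gaussw (b / 2) y.
Proof.
move=> b0; rewrite (mulrDl 1) [in leRHS](mulrDl 1) !mul1r; apply: lerD; last exact: enorm2_gaussw.
by apply: gaussw_le; lra.
Qed.

(** The derivative of [cutoff e] times W integrates to 0 and differs from W' by at most e times an
    integrable function, whence the claim as e tends to 0. *)
Lemma cint_partial_gauss i (W W' : 'rV[R]_d -> C^o) (M b : R) : 0 < b -> 0 <= M ->
  (forall x, cderiv i W x (W' x)) -> continuousC W -> continuousC W' ->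
  (forall x, normc (W x) <= M * gaussw b x) ->
  (forall x, normc (W' x) <= M * gaussw b x) ->
  cint mu W' = 0.
Proof.
move=> b0 M0 dW cW cW' bW bW'; apply/eqP; rewrite -[_ == _]negbK -normc_gt0 -leNgt.
have ig := @integ_gaussw R (b / 2) d (divr_gt0 b0 (ltr0Sn _ _)).
have ig' := @integ_gaussw R b d b0.
(* 9 = 3 + 6 collects the constants of [cutoff_ge] and [cutoff1_le1], and 1 + 2 / b is that of
   [le_poly_gaussw]. *)
pose K := \int[mu]_y (9 * (M * (1 + 2 / b)) * gaussw (b / 2) y).
apply: (@le_eps _ K) => e e0 e1; have e0' := ltW e0.
pose G y : C^o := (cutoff e y)%:C * W y.
pose G1 y : C^o := (cutoff1 e i y)%:C * W y.
pose G' y : C^o := G1 y + (cutoff e y)%:C * W' y.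
have [iG' G'0] : cinteg mu G' /\ cint mu G' = 0.
  apply: (@cint_partial0 d i G G' (e^-1 + 1)).
  - by rewrite addr_gt0// invr_gt0.
  - by move=> x; apply: cderivM => //; apply: cderiv_real; exact: is_derive_cutoff.
  - apply: continuousCD; apply: continuousCM => //; apply: continuousC_real.
      exact: continuous_cutoff1.
    exact: continuous_cutoff.
  - move=> x j xj; have p0 := cutoff_supp_box e0 xj.
    by rewrite /G /G' /G1 /cutoff1 /cutoff p0 !expr0n /= mulr0 !mul0r addr0.
have iW' : cinteg mu W'.
  exact: (cinteg_dom (continuous_cmeas cW') (integZ M ig')).
have E : cint mu W' = cint mu (fun y => (W' y - G' y)).
  by rewrite cintB// G'0 subr0.
rewrite E; apply: (@le_trans _ _ (\int[mu]_y (e * (9 * (M * (1 + 2 / b)) * gaussw (b / 2) y)))); last first.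
  by rewrite RintegralZl//; exact: integZ.
apply: normc_cint; [exact: cintegB|by do 2!apply: integZ|].
move=> y; have -> : W' y - G' y = (1 - cutoff e y)%:C * W' y - (cutoff1 e i y)%:C * W y.
  by rewrite /G' /G1 rmorphB rmorph1; ring.
apply: le_trans (le_normcD _ _) _; rewrite normcN !ComplexField.Normc.normcM !normc_real.
have c1 : `|1 - cutoff e y| <= 3 * e * (1 + enorm2 y).
  rewrite ger0_norm ?subr_ge0 ?cutoff_le1//; apply: le_trans (cutoff_ge y e0') _.
  by rewrite ler_wpM2l ?mulr_ge0// lerDr.
have c2 := cutoff1_le1 i y e0' e1.
apply: (@le_trans _ _ (9 * e * (1 + enorm2 y) * (M * gaussw b y))).
  have := ler_pM (normr_ge0 _) (normc_ge0 _) c1 (bW' y).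
  have := ler_pM (normr_ge0 _) (normc_ge0 _) c2 (bW y).
  lra.
have := ler_wpM2l (mulr_ge0 (mulr_ge0 (ler0n R 9) e0') M0) (le_poly_gaussw y b0).
by lra.
Qed.

(** Green's second identity, with f and H f bounded but no bound on the first derivatives of f.
    These enter only through the fluxes [G i], whose divergences have integral 0, so they never have
    to be estimated. *)
Lemma cint_laplacian (phi : 'rV[R]_d -> C^o) (phi1 phi2 : 'I_d -> 'rV[R]_d -> C^o)
    (f : 'rV[R]_d -> C^o) (A M b : R) : 0 < b -> 0 <= M -> 0 <= A -> smooth f ->
  (forall i x, cderiv i phi x (phi1 i x)) ->
  (forall i x, cderiv i (phi1 i) x (phi2 i x)) ->
  continuousC phi -> (forall i, continuousC (phi1 i)) -> (forall i, continuousC (phi2 i)) ->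
  (forall x, normc (phi x) <= M * gaussw b x) ->
  (forall i x, normc (phi1 i x) <= M * gaussw b x) ->
  (forall i x, normc (phi2 i x) <= M * gaussw b x) ->
  (forall x, normc (f x) <= A) ->
  (forall x, normc (harmonic_oscillator f x) <= A) ->
  cint mu (fun x => phi x * harmonic_oscillator f x) =
  cint mu (fun x => ((enorm2 x)%:C * phi x - \sum_i phi2 i x) * f x).
Proof.
move=> b0 M0 A0 sf d1 d2 c0 c1 c2 b_0 b_1 b_2 bf bH.
have cf : continuousC f by have [] := sf [::].
have cH : continuousC (harmonic_oscillator f) by have [] := smooth_harmonic sf [::].
have cfi i : continuousC (partial i f) by have [] := smooth_partial i sf [::].
have cfii i : continuousC (partial i (partial i f)).
  by have [] := smooth_partial i (smooth_partial i sf) [::].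
have df i x : cderiv i f x (partial i f x) by apply: partial_cderiv; exact: (sf [::]).2.
have dfi i x : cderiv i (partial i f) x (partial i (partial i f) x).
  by apply: partial_cderiv; exact: (smooth_partial i sf [::]).2.
have ig2 : integ mu (gaussw (b / 2) (d:=d)) by apply: integ_gaussw; rewrite divr_gt0.
(* The rate is halved twice: |x|^2 is absorbed once in the bound for N and once in the error of the
   cutoff. *)
pose b4 := b / 2 / 2.
have b40 : 0 < b4 by rewrite !divr_gt0.
have ig4 : integ mu (gaussw b4 (d:=d)) by exact: integ_gaussw.
pose L x : C := phi x * harmonic_oscillator f x.
pose N x : C := ((enorm2 x)%:C * phi x - \sum_i phi2 i x) * f x.
pose D := (1 + d%:R + 1 : R).
have D0 : 0 <= D by rewrite !addr_ge0.
pose K0 := D * M * A * (1 + 2 / b).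
have K00 : 0 <= K0 by rewrite !mulr_ge0// addr_ge0// divr_ge0// ltW.
have cN : continuousC N.
  apply: continuousCM => //; apply: continuousCD.
    by apply: continuousCM => //; apply: continuousC_real; exact: continuous_enorm2.
  under eq_fun do rewrite -mulN1r; apply: continuousCM; first exact: continuousC_cst.
  exact: continuousC_sum.
have cL : continuousC L by exact: continuousCM.
have g0 x : 0 <= gaussw b x by exact: gaussw_ge0.
have bL x : normc (L x) <= M * A * gaussw b x.
  rewrite ComplexField.Normc.normcM mulrAC.
  by apply: ler_pM; rewrite ?normc_ge0.
have bs2 x : normc (\sum_i phi2 i x) <= d%:R * (M * gaussw b x).
  apply: le_trans (normc_sum _ _ _) _.
  apply: (@le_trans _ _ (\sum_(i < d) (M * gaussw b x))); first by apply: ler_sum.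
  by rewrite sumr_const card_ord mulr_natl.
have bN x : normc (N x) <= M * A * ((1 + d%:R) * ((1 + enorm2 x) * gaussw b x)).
  rewrite ComplexField.Normc.normcM.
  apply: (@le_trans _ _ ((1 + d%:R) * ((1 + enorm2 x) * gaussw b x) * M * A)); last by lra.
  apply: ler_pM; rewrite ?normc_ge0//.
  apply: le_trans (le_normcD _ _) _; rewrite normcN ComplexField.Normc.normcM normc_real.
  rewrite (ger0_norm (enorm2_ge0 x)).
  have h1 := ler_wpM2l (enorm2_ge0 x) (b_0 x); have h2 := bs2 x.
  have h3 : 0 <= enorm2 x * (M * gaussw b x) * d%:R by rewrite !mulr_ge0// enorm2_ge0.
  have h4 : 0 <= M * gaussw b x by rewrite mulr_ge0.
  lra.
have bLN x : normc (L x - N x) <= K0 * gaussw (b / 2) x.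
  apply: le_trans (le_normcD _ _) _; rewrite normcN.
  have h1 := bL x; have h2 := bN x.
  have h3 : 0 <= M * A * (enorm2 x * gaussw b x) by rewrite !mulr_ge0// enorm2_ge0.
  have := ler_wpM2l (mulr_ge0 D0 (mulr_ge0 M0 A0)) (le_poly_gaussw x b0).
  rewrite /K0 /D; lra.
have iL : cinteg mu L.
  apply: (cinteg_dom (continuous_cmeas cL) (integZ (M * A) (integ_gaussw d b0))) => x.
  exact: bL.
have iN : cinteg mu N.
  apply: (cinteg_dom (continuous_cmeas cN) (integZ K0 ig2)) => x; apply: le_trans (bN x) _.
  have h3 : 0 <= M * A * ((1 + enorm2 x) * gaussw b x).
    by rewrite !mulr_ge0// addr_ge0// enorm2_ge0.
  have := ler_wpM2l (mulr_ge0 D0 (mulr_ge0 M0 A0)) (le_poly_gaussw x b0).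
  rewrite /K0 /D; lra.
apply/eqP; rewrite -subr_eq0 -cintB// -[_ == _]negbK -normc_gt0 -leNgt.
pose K := \int[mu]_y ((3 * K0 * (1 + 2 / (b / 2)) + d%:R * (42 * (M * A) * (1 + 2 / b))) * gaussw b4 y).
apply: (@le_eps _ K) => e e0 e1; have e0' := ltW e0.
pose X1 x : C := (cutoff e x)%:C. 
(* The i-th component of X grad f - f grad X for the product X of the cutoff and phi. In its
   derivative [G' i] the first derivatives of f cancel; [Q i] gathers the terms in which the cutoff
   is differentiated. *)
pose G i x : C^o := (cutoff e x)%:C * phi x * partial i f x
   - ((cutoff1 e i x)%:C * phi x + (cutoff e x)%:C * phi1 i x) * f x.
pose Q i x : C^o := ((cutoff2 e i x)%:C * phi x + 2 * ((cutoff1 e i x)%:C * phi1 i x)) * f x.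
pose G' i x : C^o := (cutoff e x)%:C * phi x * partial i (partial i f) x
   - (cutoff e x)%:C * phi2 i x * f x - Q i x.
have CR (p : 'rV[R]_d -> R) : continuous p -> continuousC (fun x => (p x)%:C : C^o).
  exact: continuousC_real.
have cx0 := CR _ (@continuous_cutoff d e).
have cx1 i := CR _ (@continuous_cutoff1 d e i).
have cx2 i := CR _ (@continuous_cutoff2 d e i).
have cNeg (g : 'rV[R]_d -> C^o) : continuousC g -> continuousC (fun x => - g x : C^o).
  by move=> cg; under eq_fun do rewrite -mulN1r; apply: continuousCM => //; exact: continuousC_cst.
have cQ i : continuousC (Q i).
  apply: continuousCM => //; apply: continuousCD; first exact: continuousCM.
  by apply: continuousCM; [exact: continuousC_cst|exact: continuousCM].
have G'0 i : cinteg mu (G' i) /\ cint mu (G' i) = 0.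
  apply: (@cint_partial0 d i (G i) (G' i) (e^-1 + 1)).
  - by rewrite addr_gt0// invr_gt0.
  - move=> x.
    have dx0 : cderiv i (fun x => (cutoff e x)%:C : C^o) x (cutoff1 e i x)%:C.
      by apply: cderiv_real; exact: is_derive_cutoff.
    have dx1 : cderiv i (fun x => (cutoff1 e i x)%:C : C^o) x (cutoff2 e i x)%:C.
      by apply: cderiv_real; exact: is_derive_cutoff1.
    have T1 := cderivM (cderivM dx0 (d1 i x)) (dfi i x).
    have T2 := cderivM (cderivD (cderivM dx1 (d1 i x)) (cderivM dx0 (d2 i x))) (df i x).
    have T3 := cderivD T1 (cderivZ (-1) T2).
    apply: (@cderiv_ext _ _ _ _ _ _ _ (cderiv_eq T3 _)); first by move=> y; rewrite mulN1r.
    by rewrite /G' /Q; ring.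
  - apply: continuousCD; last exact: cNeg.
    apply: continuousCD; first by do 2!apply: continuousCM => //.
    by apply: cNeg; apply: continuousCM => //; exact: continuousCM.
  - move=> x j xj; have p0 := cutoff_supp_box e0 xj.
    rewrite /G /G' /Q /cutoff2 /cutoff1 /cutoff p0 !expr0n /= !mulr0 addr0.
    by rewrite !(mul0r, mulr0, addr0, subr0).
have E0 : cint mu (fun x => \sum_i G' i x) = 0.
  rewrite cint_sum; last by move=> i; have [] := G'0 i.
  by rewrite big1// => i _; have [] := G'0 i.
have iS : cinteg mu (fun x => \sum_i G' i x) by apply: cinteg_sum => i; have [] := G'0 i.
have iLN := cintegB iL iN.
(* In L - N the terms |x|^2 phi f cancel; what remains, multiplied by the cutoff, is opposite to the
   main part of the sum of the [G' i]. *)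
have key x : (L x - N x) + \sum_i G' i x =
    (1 - cutoff e x)%:C * (L x - N x) - \sum_i Q i x.
  rewrite /G' !sumrB -mulr_sumr -mulr_suml -mulr_sumr /L /N /harmonic_oscillator /laplacian.
  rewrite rmorphB rmorph1; ring.
have -> : cint mu (fun x => L x - N x) = cint mu (fun x => (L x - N x) + \sum_i G' i x).
  apply/esym; apply: etrans (cintD iLN iS) _; rewrite -[RHS]addr0; congr (_ + _); exact: E0.
rewrite /K; set c := 3 * K0 * _ + _.
apply: (@le_trans _ _ (\int[mu]_y (e * (c * gaussw b4 y)))); last first.
  by rewrite (RintegralZl e measurableT (integZ c ig4)).
apply: normc_cint; [exact: cintegD|by do 2!apply: integZ|] => x.
rewrite key; apply: le_trans (le_normcD _ _) _; rewrite normcN.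
have k1 : normc ((1 - cutoff e x)%:C * (L x - N x)) <= e * (3 * K0 * (1 + 2 / (b / 2)) * gaussw b4 x).
  rewrite ComplexField.Normc.normcM normc_real ger0_norm ?subr_ge0 ?cutoff_le1//.
  have h1 : 1 - cutoff e x <= 3 * e * (1 + enorm2 x).
    apply: le_trans (cutoff_ge x e0') _.
    by rewrite ler_wpM2l ?mulr_ge0// lerDr.
  apply: le_trans (ler_pM _ (normc_ge0 _) h1 (bLN x)) _; first by rewrite subr_ge0 cutoff_le1.
  have := ler_wpM2l (mulr_ge0 (mulr_ge0 (ler0n R 3) e0') K00) (le_poly_gaussw x (divr_gt0 b0 (ltr0Sn R 1))).
  rewrite -/b4; lra.
(* 42 = 30 + 2 * 6, from [cutoff2_le] and twice [cutoff1_le1]. *)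
have k2 : normc (\sum_i Q i x) <= d%:R * (e * (42 * (M * A) * (1 + 2 / b) * gaussw (b / 2) x)).
  apply: le_trans (normc_sum _ _ _) _.
  apply: (@le_trans _ _ (\sum_(i < d) (e * (42 * (M * A) * (1 + 2 / b) * gaussw (b / 2) x)))).
    apply: ler_sum => i _; rewrite /Q ComplexField.Normc.normcM.
    apply: (@le_trans _ _ ((42 * e * (1 + enorm2 x) * (M * gaussw b x)) * A)).
      apply: ler_pM; rewrite ?normc_ge0//; apply: le_trans (le_normcD _ _) _.
      rewrite !ComplexField.Normc.normcM !normc_real.
      have -> : normc (2 : C) = 2 by rewrite (_ : 2 = 2%:R%:C) ?normc_real ?ger0_norm// rmorph_nat.
      have := ler_pM (normr_ge0 _) (normc_ge0 _) (cutoff1_le1 i x e0' e1) (b_1 i x).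
      have := ler_pM (normr_ge0 _) (normc_ge0 _) (cutoff2_le i x e0') (b_0 x).
      have : 0 <= e * enorm2 x * (M * gaussw b x) by rewrite !mulr_ge0// enorm2_ge0.
      lra.
    have := ler_wpM2l (mulr_ge0 (mulr_ge0 (ler0n R 42) e0') (mulr_ge0 M0 A0)) (le_poly_gaussw x b0).
    lra.
  by rewrite sumr_const card_ord -[leLHS]mulr_natl.
apply: le_trans (lerD k1 k2) _; rewrite /c.
have h4 : gaussw (b / 2) x <= gaussw b4 x by apply: gaussw_le; rewrite /b4; lra.
have b20 : 0 <= 1 + 2 / b by rewrite addr_ge0// divr_ge0// ltW.
have h5 : 0 <= d%:R * (e * (42 * (M * A) * (1 + 2 / b) * (gaussw b4 x - gaussw (b / 2) x))).
  by rewrite !mulr_ge0// subr_ge0.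
move: h5; move: (gaussw b4 x) (gaussw (b / 2) x) (1 + 2 / b) (1 + 2 / (b / 2)) (d%:R : R).
by move=> u1 u2 u3 u4 u5; lra.
Qed.

End gauss_ibp.
End derivatives.

(** * Growth of the Bargmann transform *)

Section differentiable_quad.
Variable K : numFieldType.

Lemma coord_le_mx_norm m n (x : 'M[K]_(m, n)) i j : `|x i j| <= `|x|.
Proof.
have : mx_norm x <= mx_norm x by [].
by rewrite !mx_normE num_le => /bigmax_leP[_ /(_ (i, j) isT)]; rewrite -num_le.
Qed.

Lemma differentiable_quad d (F : 'rV[K]_d -> K^o) (z : 'rV[K]_d) (P : 'I_d -> K) (B : K) :
  0 <= B ->
  (forall h : 'rV[K]_d, `|h| <= 1 ->
     `|F (z + h) - F z - \sum_j h ord0 j * P j| <= B * `|h| ^+ 2) ->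
  differentiable F z.
Proof.
move=> B0 H.
pose L0 (h : 'rV[K]_d) : K^o := \sum_j h ord0 j * P j.
have L0lin : linear L0.
  move=> k u v; rewrite /L0 scaler_sumr -big_split; apply: eq_bigr => j _ /=.
  by rewrite !mxE mulrDl -mulrA.
pose L : {linear 'rV[K]_d -> K^o} := HB.pack L0 (GRing.isLinear.Build _ _ _ _ L0 L0lin).
have cL : continuous (L : 'rV[K]_d -> K^o).
  have -> : (L : 'rV[K]_d -> K^o) = (fun h => \sum_j h ord0 j * P j) by [].
  elim: (index_enum _) => [|k s IH].
    by under [X in continuous X]eq_fun do rewrite big_nil; exact: cst_continuous.
  under [X in continuous X]eq_fun do rewrite big_cons.
  have c1 : continuous (fun h : 'rV[K]_d => h ord0 k * P k : K^o).
    have c0 : continuous (fun h : 'rV[K]_d => h ord0 k * P k).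
      by move=> h; exact: (cvgM (@coord_continuous K 1 d ord0 k h) (cvg_cst (P k))).
    exact: c0.
  by move=> h; exact: (cvgD (c1 h) (IH h)).
have E : F \o shift z = cst (F z) + (L : 'rV[K]_d -> K^o) +o_ (0 : 'rV[K]_d) id.
  apply/eqaddoP => e e0.
  have N1 : \forall h \near (0 : 'rV[K]_d), `|h| <= 1.
    by have H1 := @nbhs0_le K 'rV[K]_d 1 ltr01; exact: H1.
  have N2 : \forall h \near (0 : 'rV[K]_d), `|h| <= e / (B + 1).
    have eB : 0 < e / (B + 1) by rewrite divr_gt0// ltr_wpDl.
    by have H2 := @nbhs0_le K 'rV[K]_d _ eB; exact: H2.
  suff S : \forall h \near (0 : 'rV[K]_d), `|(F \o shift z - (cst (F z) + (L : 'rV[K]_d -> K^o))) h| <= e * `|h|.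
    exact: S.
  apply: filterS2 N1 N2 => h h1 h2.
  have -> : (F \o shift z - (cst (F z) + (L : 'rV[K]_d -> K^o))) h =
      F (z + h) - F z - \sum_j h ord0 j * P j.
    by rewrite !fctE /= opprD addrA [h + z]addrC.
  apply: le_trans (H h h1) _; rewrite expr2 mulrA ler_wpM2r//.
  apply: (@le_trans _ _ ((B + 1) * `|h|)); first by rewrite ler_wpM2r// lerDl.
  by rewrite mulrC -ler_pdivlMr// ltr_wpDl.
by apply/diff_locallyP; rewrite (diff_unique cL E); split.
Qed.

End differentiable_quad.

(** * The kernel, its derivatives and the dilation identity *)

Section bargmann_kernel.
Variables (R : realType) (d : nat).
Local Notation C := (R[i]).
Local Notation Re := complex.Re.
Local Notation Im := complex.Im.
Local Notation normc := ComplexField.Normc.normc.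
Local Notation mu := (lebesgue_rV d).
Implicit Types (z h : 'rV[R[i]]_d) (y : 'rV[R]_d) (f : 'rV[R]_d -> C^o) (r : R).

Definition bker z y : C :=
  cexp (- (2^-1)%:C * (cdot z z + (enorm2 y)%:C) + (Num.sqrt 2)%:C * cdot z (complexify y)).

Lemma cdot_complexify z y : cdot z (complexify y) = \sum_j z ord0 j * (y ord0 j)%:C.
Proof. by apply: eq_bigr => j _; rewrite mxE. Qed.

Lemma sqrt2C : (Num.sqrt 2)%:C * (Num.sqrt 2)%:C = 2 :> C.
Proof. by rewrite -rmorphM -expr2 sqr_sqrtr// rmorph_nat. Qed.

Lemma half2C : (2^-1)%:C * 2 = 1 :> C.
Proof. by rewrite -(rmorph_nat (real_complex R) 2) -rmorphM mulVf// rmorph1. Qed.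

Lemma sqrt2_le2 : Num.sqrt 2 <= 2 :> R.
Proof.
have -> : (2 : R) = Num.sqrt (2 ^+ 2) by rewrite sqrtr_sqr ger0_norm.
by rewrite ler_sqrt ?exprn_ge0//; rewrite [in leLHS](_ : Num.sqrt (2 ^+ 2) = 2) ?sqrtr_sqr ?ger0_norm//; lra.
Qed.

Lemma normc_bker z y r : 0 <= r -> (forall j, normc (z ord0 j) <= r) ->
  normc (bker z y) <= expR (3 * d%:R * r ^+ 2) * gaussw (1 / 4) y.
Proof.
move=> r0 zr; rewrite normc_cexp /gaussw -expRD ler_expR.
have -> : - (2^-1)%:C * (cdot z z + (enorm2 y)%:C) + (Num.sqrt 2)%:C * cdot z (complexify y) =
  \sum_j (- (2^-1)%:C * (z ord0 j * z ord0 j + (y ord0 j ^+ 2)%:C) +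
           (Num.sqrt 2)%:C * (z ord0 j * (y ord0 j)%:C)).
  rewrite cdot_complexify big_split /= -!mulr_sumr big_split /=; congr (_ * (_ + _) + _).
  by rewrite /enorm2 rmorph_sum.
rewrite raddf_sum /=.
have -> : 3 * d%:R * r ^+ 2 - 1 / 4 * enorm2 y = \sum_j (3 * r ^+ 2 - 1 / 4 * y ord0 j ^+ 2).
  by rewrite sumrB sumr_const card_ord -mulr_sumr -mulr_natr; congr (_ - _); ring.
apply: ler_sum => j _; have := zr j; move: (z ord0 j) (y ord0 j) => [a b] t zj.
have s2 : Num.sqrt 2 ^+ 2 = 2 :> R by rewrite sqr_sqrtr.
have ab : a ^+ 2 + b ^+ 2 <= r ^+ 2.
  have := normc_sqr (Complex a b); rewrite /= => <-.
  by rewrite lerXn2r ?nnegrE ?sqrtr_ge0.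
rewrite /= !(mul0r, mulr0, subr0, addr0, oppr0).
(* Completing the square gives sqrt 2 a t <= 2 a^2 + t^2 / 4, so the real part of one coordinate's
   exponent is at most 3 a^2 / 2 + b^2 / 2 - t^2 / 4. *)
have := sqr_ge0 (Num.sqrt 2 * a - t / 2); have := sqr_ge0 b; have := sqr_ge0 a.
move: (Num.sqrt 2) s2 => q q2.
rewrite -!expr2; nra.
Qed.

Lemma bker_shift z h y : bker (z + h) y = bker z y *
  cexp (- cdot z h - (2^-1)%:C * cdot h h + (Num.sqrt 2)%:C * cdot h (complexify y)).
Proof.
rewrite /bker -cexpD; congr cexp.
have E1 : cdot (z + h) (complexify y) = cdot z (complexify y) + cdot h (complexify y).
  by rewrite /cdot -big_split; apply: eq_bigr => j _; rewrite !mxE mulrDl.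
have E2 : cdot (z + h) (z + h) = cdot z z + 2 * cdot z h + cdot h h.
  rewrite /cdot mulr_sumr -!big_split; apply: eq_bigr => j _; rewrite !mxE /=; ring.
have := half2C; rewrite E1 E2; move: (2^-1)%:C (Num.sqrt 2)%:C => u v uv.
transitivity (- u * (cdot z z + (enorm2 y)%:C) + v * cdot z (complexify y) +
   (- (u * 2) * cdot z h - u * cdot h h + v * cdot h (complexify y))); first by ring.
by rewrite uv mulN1r.
Qed.

(** The derivative of the kernel in z_j. *)
Definition bker1 j z y : C := (- z ord0 j + (Num.sqrt 2)%:C * (y ord0 j)%:C) * bker z y.

(* The constant in the quadratic Taylor estimate of the kernel in z. *)
Definition bker_cst r : R :=
  expR (3 * d%:R * r ^+ 2) * (2 * expR (d%:R * (2 * r + 34)) + d%:R).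

Lemma bker_cst_ge0 r : 0 <= bker_cst r.
Proof. by rewrite /bker_cst mulr_ge0 ?expR_ge0// addr_ge0// mulr_ge0// expR_ge0. Qed.

(** Dividing by the kernel at z leaves cexp u - 1 - u and a term quadratic in h, where u is affine
    in y and of size e. The factor e^(2S) that [cexp_taylor2] brings in is exponential in |y| and
    costs half of the Gaussian rate 1/4. *)
Lemma bker_taylor z h y r e : 0 <= r -> 0 <= e -> e <= 1 ->
  (forall j, normc (z ord0 j) <= r) -> (forall j, normc (h ord0 j) <= e) ->
  normc (bker (z + h) y - bker z y - \sum_j h ord0 j * bker1 j z y) <=
    e ^+ 2 * (bker_cst r * gaussw (1 / 8) y).
Proof.
move=> r0 e0 e1 zr he.
set ell := - cdot z h + (Num.sqrt 2)%:C * cdot h (complexify y).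
set u := - cdot z h - (2^-1)%:C * cdot h h + (Num.sqrt 2)%:C * cdot h (complexify y).
have uE : u = ell - (2^-1)%:C * cdot h h by rewrite /u /ell; ring.
have -> : bker (z + h) y - bker z y - \sum_j h ord0 j * bker1 j z y =
    bker z y * ((cexp u - 1 - u) - (2^-1)%:C * cdot h h).
  have -> : \sum_j h ord0 j * bker1 j z y = bker z y * ell.
    rewrite /ell cdot_complexify /cdot -sumrN mulr_sumr -big_split /= mulr_sumr.
    by apply: eq_bigr => j _; rewrite /bker1; ring.
  by rewrite bker_shift -/u uE; ring.
rewrite ComplexField.Normc.normcM.
have hh : normc ((2^-1)%:C * cdot h h) <= e ^+ 2 * d%:R.
  rewrite ComplexField.Normc.normcM normc_real ger0_norm ?invr_ge0//.
  apply: (@le_trans _ _ (normc (cdot h h))); first by rewrite ler_piMl ?normc_ge0//; lra.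
  apply: le_trans (normc_sum _ _ _) _.
  apply: (@le_trans _ _ (\sum_(j < d) e ^+ 2)).
    by apply: ler_sum => j _; rewrite ComplexField.Normc.normcM expr2 ler_pM ?normc_ge0.
  by rewrite sumr_const card_ord mulr_natr.
pose S := \sum_(j < d) (r + 1 + 2 * `|y ord0 j|).
have uS : normc u <= e * S.
  have -> : u = \sum_j (- (z ord0 j * h ord0 j) - (2^-1)%:C * (h ord0 j * h ord0 j) +
      (Num.sqrt 2)%:C * (h ord0 j * (y ord0 j)%:C)).
    by rewrite /u cdot_complexify /cdot -sumrN !mulr_sumr -sumrB -big_split.
  apply: le_trans (normc_sum _ _ _) _; rewrite /S mulr_sumr; apply: ler_sum => j _.
  apply: le_trans (le_normcD _ _) _; apply: le_trans (lerD (le_normcD _ _) (lexx _)) _.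
  rewrite !normcN !ComplexField.Normc.normcM !normc_real.
  rewrite (ger0_norm (_ : 0 <= 2^-1))// (ger0_norm (sqrtr_ge0 _)).
  have a1 := ler_pM (normc_ge0 _) (normc_ge0 _) (zr j) (he j).
  have a2 := ler_pM (normc_ge0 _) (normc_ge0 _) (he j) (he j).
  have a3 : normc (h ord0 j) * `|y ord0 j| <= e * `|y ord0 j| by rewrite ler_wpM2r.
  have a4 := ler_pM (sqrtr_ge0 _) (mulr_ge0 (normc_ge0 _) (normr_ge0 _)) sqrt2_le2 a3.
  have a5 : e * e <= e by rewrite ler_piMl.
  have : 0 <= e * e by rewrite mulr_ge0.
  lra.
have S0 : 0 <= S by apply: sumr_ge0 => j _; rewrite !addr_ge0// mulr_ge0.
have uS1 : normc u <= S by apply: le_trans uS _; rewrite ler_piMl.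
have t2 : normc (cexp u - 1 - u) <= e ^+ 2 * (2 * expR (2 * S)).
  apply: le_trans (cexp_taylor2 u) _.
  apply: (@le_trans _ _ ((e * S) ^+ 2 * expR S)).
    apply: ler_pM; rewrite ?exprn_ge0 ?normc_ge0 ?expR_ge0 ?ler_expR//.
    by rewrite lerXn2r ?nnegrE ?normc_ge0 ?mulr_ge0.
  rewrite exprMn -mulrA ler_wpM2l ?exprn_ge0//.
  rewrite (_ : 2 * S = S + S); last by ring.
  rewrite expRD mulrA ler_wpM2r ?expR_ge0//.
  have := expR_ge1Dxn 1 S0; rewrite (_ : 2`! = 2%N)//.
  by move: (S ^+ 2) => s2; lra.
(* 4 |y_j| <= 32 + y_j^2 / 8, whence 34 = 2 + 32. *)
have ES : expR (2 * S) <= expR (d%:R * (2 * r + 34)) * expR (1 / 8 * enorm2 y).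
  rewrite -expRD ler_expR.
  have -> : d%:R * (2 * r + 34) + 1 / 8 * enorm2 y = \sum_(j < d) (2 * r + 34 + 1 / 8 * y ord0 j ^+ 2).
    by rewrite big_split /= sumr_const card_ord -mulr_sumr; congr (_ + _); exact: mulr_natl.
  rewrite /S mulr_sumr; apply: ler_sum => j _.
  rewrite -(real_normK (num_real (y ord0 j))); have := sqr_ge0 (`|y ord0 j| - 16).
  by move: (`|_|) => t; nra.
have g1 : 1 <= expR (1 / 8 * enorm2 y).
  by rewrite -expR0 ler_expR mulr_ge0// enorm2_ge0.
set E8 := expR (1 / 8 * enorm2 y) in ES g1 *.
have t3 : normc (cexp u - 1 - u - (2^-1)%:C * cdot h h) <=
    e ^+ 2 * ((2 * expR (d%:R * (2 * r + 34)) + d%:R) * E8).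
  apply: le_trans (le_normcD _ _) _; rewrite normcN.
  apply: le_trans (lerD t2 hh) _; rewrite -mulrDr ler_wpM2l ?exprn_ge0//.
  have d1 : d%:R <= d%:R * E8 :> R by rewrite ler_peMr.
  by move: ES d1; move: (expR (2 * S)) (expR (_ * _)) => v1 v2; lra.
apply: le_trans (ler_pM (normc_ge0 _) (normc_ge0 _) (normc_bker y r0 zr) t3) _.
have <- : gaussw (1 / 4) y * E8 = gaussw (1 / 8) y.
  by rewrite /gaussw /E8 -expRD; congr expR; lra.
rewrite /bker_cst le_eqVlt; apply/orP; left; apply/eqP; ring.
Qed.

Lemma normc_bker1 j z y r : 0 <= r -> (forall j, normc (z ord0 j) <= r) ->
  normc (bker1 j z y) <= (9 * (r + 2) * expR (3 * d%:R * r ^+ 2)) * gaussw (1 / 8) y.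
Proof.
move=> r0 zr; rewrite ComplexField.Normc.normcM.
have h1 : normc (- z ord0 j + (Num.sqrt 2)%:C * (y ord0 j)%:C) <= (r + 2) * (1 + enorm2 y).
  apply: le_trans (le_normcD _ _) _; rewrite normcN ComplexField.Normc.normcM !normc_real.
  rewrite (ger0_norm (sqrtr_ge0 _)).
  have := zr j; have s2 := ler_wpM2r (normr_ge0 (y ord0 j)) sqrt2_le2.
  have := coord_le_enorm2 y j; rewrite -(real_normK (num_real (y ord0 j))).
  move: s2; set sq := Num.sqrt 2 * `|y ord0 j|.
  have := mulr_ge0 r0 (enorm2_ge0 y).
  move: sq (`|y ord0 j|) (enorm2 y) (normc (z ord0 j)) => s t E n.
  have := sqr_ge0 (t - 1); nra.
apply: le_trans (ler_pM (normc_ge0 _) (normc_ge0 _) h1 (normc_bker y r0 zr)) _.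
have p4 : (0 : R) < 1 / 4 by lra.
have := le_poly_gaussw y p4.
have -> : (1 + 2 / (1 / 4)) = 9 :> R by lra.
have -> : 1 / 4 / 2 = 1 / 8 :> R by lra.
move=> h2; have h3 : 0 <= (r + 2) * expR (3 * d%:R * r ^+ 2) by rewrite mulr_ge0 ?expR_ge0// addr_ge0.
have := ler_wpM2l h3 h2; lra.
Qed.

Lemma continuous_bker z : continuousC (bker z : 'rV[R]_d -> C^o).
Proof.
apply: continuousC_cexp; apply: continuousCD; apply: continuousCM.
- exact: continuousC_cst.
- apply: continuousCD; first exact: continuousC_cst.
  by apply: continuousC_real; exact: continuous_enorm2.
- exact: continuousC_cst.
- under eq_fun do rewrite cdot_complexify; apply: continuousC_sum => k.
  by apply: continuousCM; [exact: continuousC_cst|apply: continuousC_real; exact: coord_continuous].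
Qed.

Lemma continuous_bker1 j z : continuousC (bker1 j z : 'rV[R]_d -> C^o).
Proof.
apply: continuousCM; last exact: continuous_bker.
apply: continuousCD; first exact: continuousC_cst.
by apply: continuousCM; [exact: continuousC_cst|apply: continuousC_real; exact: coord_continuous].
Qed.

Lemma row_bound z : exists2 r, 0 <= r & forall j, normc (z ord0 j) <= r.
Proof.
exists (\sum_j normc (z ord0 j)); first by apply: sumr_ge0 => j _; exact: normc_ge0.
by move=> j; rewrite (bigD1 j)//= lerDl; apply: sumr_ge0 => k _; exact: normc_ge0.
Qed.

Section bounded_function.
Variables (f : 'rV[R]_d -> C^o) (A : R).
Hypotheses (cf : continuousC f) (A0 : 0 <= A) (fA : forall y, normc (f y) <= A).

Lemma cinteg_bker z : cinteg mu (fun y => bker z y * f y).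
Proof.
have [r r0 zr] := row_bound z.
have ig : integ mu (fun y => (expR (3 * d%:R * r ^+ 2) * A) * gaussw (1 / 4) y).
  by apply: integZ; apply: integ_gaussw; lra.
apply: (cinteg_dom _ ig); first exact: (cmeasM (continuous_cmeas (continuous_bker z)) (continuous_cmeas cf)).
move=> y; rewrite ComplexField.Normc.normcM mulrAC.
by rewrite ler_pM ?normc_ge0// normc_bker.
Qed.

Lemma cinteg_bker1 j z : cinteg mu (fun y => bker1 j z y * f y).
Proof.
have [r r0 zr] := row_bound z.
have ig : integ mu (fun y => ((9 * (r + 2) * expR (3 * d%:R * r ^+ 2)) * A) * gaussw (1 / 8) y).
  by apply: integZ; apply: integ_gaussw; lra.
apply: (cinteg_dom _ ig); first exact: (cmeasM (continuous_cmeas (continuous_bker1 j z)) (continuous_cmeas cf)).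
move=> y; rewrite ComplexField.Normc.normcM mulrAC.
by rewrite ler_pM ?normc_ge0// normc_bker1.
Qed.

Definition bcst : C := (pi `^ (- (d%:R / 4)))%:C.

Lemma bargmannE z : bargmann f z = bcst * cint mu (fun y => bker z y * f y).
Proof. by []. Qed.

(** By [bargmann_taylor] this is the derivative of the transform in z_j. *)
Definition bargmann1 j z : C := bcst * cint mu (fun y => bker1 j z y * f y).

Lemma normc_bargmann z r : 0 <= r -> (forall j, normc (z ord0 j) <= r) ->
  normc (bargmann f z) <= normc bcst * (expR (3 * d%:R * r ^+ 2) * A *
     \int[mu]_y gaussw (1 / 4) y).
Proof.
move=> r0 zr; rewrite bargmannE ComplexField.Normc.normcM ler_wpM2l ?normc_ge0//.
have p4 : (0 : R) < 1 / 4 by lra.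
have ig := integ_gaussw d p4.
rewrite -(RintegralZl _ measurableT ig).
apply: normc_cint; [exact: cinteg_bker|exact: integZ|].
move=> y; rewrite ComplexField.Normc.normcM mulrAC.
by rewrite ler_pM ?normc_ge0// normc_bker.
Qed.

Lemma bargmann_taylor z h r e : 0 <= r -> 0 <= e -> e <= 1 ->
  (forall j, normc (z ord0 j) <= r) -> (forall j, normc (h ord0 j) <= e) ->
  normc (bargmann f (z + h) - bargmann f z - \sum_j h ord0 j * bargmann1 j z) <=
  e ^+ 2 * (normc bcst * (bker_cst r * A * \int[mu]_y gaussw (1 / 8) y)).
Proof.
move=> r0 e0 e1 zr he.
have p8 : (0 : R) < 1 / 8 by lra.
have ig := integ_gaussw d p8.
have iS : cinteg mu (fun y => \sum_j h ord0 j * (bker1 j z y * f y)).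
  by apply: cinteg_sum => j; apply: cintegZ; exact: cinteg_bker1.
have -> : bargmann f (z + h) - bargmann f z - \sum_j h ord0 j * bargmann1 j z =
   bcst * cint mu (fun y => (bker (z + h) y * f y - bker z y * f y) - \sum_j h ord0 j * (bker1 j z y * f y)).
  rewrite cintB//; last by apply: cintegB; exact: cinteg_bker.
  rewrite cintB//; [|exact: cinteg_bker|exact: cinteg_bker].
  rewrite cint_sum; last by move=> j; apply: cintegZ; exact: cinteg_bker1.
  rewrite !bargmannE !mulrBr; congr (_ - _); rewrite mulr_sumr; apply: eq_bigr => j _.
  by rewrite cintZ; [rewrite /bargmann1 mulrCA|exact: cinteg_bker1].
rewrite ComplexField.Normc.normcM mulrCA ler_wpM2l ?normc_ge0//.
rewrite mulrA -(RintegralZl _ measurableT ig).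
apply: normc_cint; [|exact: integZ|].
  by apply: cintegB => //; apply: cintegB; exact: cinteg_bker.
move=> y.
have -> : bker (z + h) y * f y - bker z y * f y - \sum_j h ord0 j * (bker1 j z y * f y) =
    (bker (z + h) y - bker z y - \sum_j h ord0 j * bker1 j z y) * f y.
  rewrite !mulrBl; congr (_ - _); rewrite mulr_suml; apply: eq_bigr => j _; exact: mulrA.
rewrite ComplexField.Normc.normcM.
apply: le_trans (ler_pM (normc_ge0 _) (normc_ge0 _) (bker_taylor y r0 e0 e1 zr he) (fA y)) _.
by rewrite le_eqVlt; apply/orP; left; apply/eqP; ring.
Qed.

End bounded_function.

Lemma normCE (w : C) : `|w| = (normc w)%:C.
Proof. by case: w => a b. Qed.

Lemma le_normC (a b : R) : (a%:C <= b%:C :> C) = (a <= b).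
Proof. exact: lecR. Qed.

(** A quadratic remainder controlled by the maximum of the coordinates gives Frechet
    differentiability; the work is only to pass from real bounds to norms valued in R[i]. *)
Lemma entire_of_taylor (F : 'rV[R[i]]_d -> C^o) :
  (forall z, exists (P : 'I_d -> C) (B : R), 0 <= B /\ forall h (e : R), 0 <= e -> e <= 1 ->
     (forall j, normc (h ord0 j) <= e) ->
     normc (F (z + h) - F z - \sum_j h ord0 j * P j) <= B * e ^+ 2) ->
  entire F.
Proof.
move=> H z; have [P [B [B0 HB]]] := H z.
apply: (@differentiable_quad _ _ _ _ P B%:C); first by rewrite (_ : 0 = 0%:C)// le_normC.
move=> h h1.
have [e hE] : exists e : R, `|h| = e%:C.
  have := normr_ge0 h; move: `|h| => -[a b].
  by rewrite lecE /= => /andP[/eqP /= -> _]; exists a.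
have e0 : 0 <= e by rewrite -le_normC -hE normr_ge0.
have e1 : e <= 1 by rewrite -le_normC -hE.
rewrite hE normCE -rmorphXn -rmorphM le_normC; apply: HB => // j.
by rewrite -le_normC -normCE -hE; exact: coord_le_mx_norm.
Qed.

(* d/dy_i of the logarithm of the kernel. *)
Definition kfac i z y : C := (Num.sqrt 2)%:C * z ord0 i - (y ord0 i)%:C.

Lemma kfacE i z : kfac i z = (fun y => (Num.sqrt 2)%:C * z ord0 i + -1 * (y ord0 i)%:C).
Proof. by apply/funext => y; rewrite mulN1r. Qed.

Section harmonic.
Variables (f : 'rV[R]_d -> C^o) (A : R).
Hypotheses (sf : smooth f) (A0 : 0 <= A) (fA : forall y, normc (f y) <= A)
  (HA : forall y, normc (harmonic_oscillator f y) <= A).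

Let cf : continuousC f. Proof. by have [] := sf [::]. Qed.

Lemma entire_bargmann_bounded : entire (bargmann f).
Proof.
apply: entire_of_taylor => z; have [r r0 zr] := row_bound z.
exists (fun j => bargmann1 f j z), (normc bcst * (bker_cst r * A * \int[mu]_y gaussw (1 / 8) y)).
split.
  apply: mulr_ge0; first exact: normc_ge0.
  apply: mulr_ge0; first by apply: mulr_ge0 => //; exact: bker_cst_ge0.
  by apply: Rint_ge0 => y; exact: gaussw_ge0.
move=> h e e0 e1 he; rewrite [leRHS]mulrC.
by apply: bargmann_taylor.
Qed.

Let bker_shift_y i z y (t : R) : bker z (t *: Rebasis R i + y) =
  bker z y * cexp (t%:C * kfac i z y - (2^-1)%:C * (t ^+ 2)%:C).
Proof.
rewrite /bker -cexpD; congr cexp.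
have E : cdot z (complexify (t *: Rebasis R i + y)) = cdot z (complexify y) + t%:C * z ord0 i.
  rewrite !cdot_complexify (bigD1 i)//= [in RHS](bigD1 i)//= coord_shift eqxx mul1r.
  rewrite (eq_bigr (fun j => z ord0 j * (y ord0 j)%:C)); first by rewrite rmorphD; ring.
  by move=> j ji; rewrite coord_shift eq_sym (negPf ji) mul0r add0r.
rewrite E enorm2_shift /kfac !rmorphD !rmorphM /= (rmorph_nat (real_complex R) 2).
have := half2C; move: (2^-1)%:C (Num.sqrt 2)%:C (t%:C) ((y ord0 i)%:C) => u v w x uv.
transitivity (- u * (cdot z z + (enorm2 y)%:C) + v * cdot z (complexify y) +
  (w * (v * z ord0 i) - (u * 2) * w * x - u * w ^+ 2)); first by ring.
by rewrite uv; ring.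
Qed.

Lemma cderiv_bker i z y : cderiv i (bker z : 'rV[R]_d -> C^o) y (kfac i z y * bker z y).
Proof.
set c := kfac i z y; pose n := normc c + 1.
have n0 : 0 <= n by rewrite addr_ge0// normc_ge0.
apply: (@cderiv_quad _ _ _ _ _ _ (normc (bker z y) * (n ^+ 2 * expR n + 1))).
  by rewrite mulr_ge0 ?normc_ge0// addr_ge0// mulr_ge0 ?expR_ge0 ?exprn_ge0.
move=> t t1; rewrite bker_shift_y -/c; set u := t%:C * c - _.
have -> : bker z y * cexp u - bker z y - t%:C * (c * bker z y) =
   bker z y * ((cexp u - 1 - u) - (2^-1)%:C * (t ^+ 2)%:C).
  by rewrite /u; ring.
rewrite ComplexField.Normc.normcM -mulrA ler_wpM2l ?normc_ge0//.
have hq : normc ((2^-1)%:C * (t ^+ 2)%:C) <= t ^+ 2.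
  rewrite ComplexField.Normc.normcM !normc_real (ger0_norm (sqr_ge0 _)) ger0_norm ?invr_ge0//.
  by rewrite ler_piMl ?sqr_ge0//; lra.
have uu : normc u <= `|t| * n.
  apply: le_trans (le_normcD _ _) _; rewrite normcN ComplexField.Normc.normcM normc_real.
  rewrite /n mulrDr mulr1 lerD2l; apply: le_trans hq _.
  by rewrite -(real_normK (num_real t)) expr2 ler_piMl.
have un : normc u <= n by apply: le_trans uu _; rewrite ler_piMl.
apply: le_trans (le_normcD _ _) _; rewrite normcN mulrDl mul1r; apply: lerD => //.
apply: le_trans (cexp_taylor2 u) _.
rewrite [leRHS]mulrAC; apply: ler_pM; rewrite ?exprn_ge0 ?normc_ge0 ?expR_ge0 ?ler_expR//.
rewrite -(real_normK (num_real t)) -exprMn mulrC lerXn2r ?nnegrE ?normc_ge0 ?mulr_ge0//.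
Qed.

Lemma cderiv_kfac i z y : cderiv i (kfac i z : 'rV[R]_d -> C^o) y (-1).
Proof.
have H := cderivD (cderiv_cst i ((Num.sqrt 2)%:C * z ord0 i) y)
  (cderivZ (-1) (cderiv_real (is_derive_rcoord i i y))).
rewrite kfacE; apply: (cderiv_eq H); by rewrite eqxx add0r mulr1.
Qed.

Lemma continuous_kfac i z : continuousC (kfac i z : 'rV[R]_d -> C^o).
Proof.
rewrite kfacE.
apply: continuousCD; first exact: continuousC_cst.
apply: continuousCM; first exact: continuousC_cst.
by apply: continuousC_real; exact: coord_continuous.
Qed.

(** [cint_laplacian] moves H onto the kernel, where |y|^2 - sum_i d^2/dy_i^2 acts as d + 2 sum_j z_j
    d/dz_j, because the squares of [kfac i z y] add up to |y|^2 - 2 sum_j z_j (- z_j + sqrt 2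
    y_j). *)
Lemma bargmann_harmonic z : bargmann (harmonic_oscillator f) z =
  d%:R * bargmann f z + 2 * \sum_j z ord0 j * bargmann1 f j z.
Proof.
have [r r0 zr] := row_bound z.
pose phi1 i y : C^o := kfac i z y * bker z y.
pose phi2 i y : C^o := (kfac i z y * kfac i z y - 1) * bker z y.
(* (8 r^2 + 4) (1 + |y|^2) dominates 1, |k| and |k|^2 + 1 for k = [kfac i z y], and 9 = 1 + 2 /
   (1/4) is the price of absorbing it into the Gaussian of rate 1/4. *)
pose M := expR (3 * d%:R * r ^+ 2) * (9 * (8 * r ^+ 2 + 4)).
have e0 := expR_ge0 (3 * d%:R * r ^+ 2).
have M0 : 0 <= M by rewrite !mulr_ge0// addr_ge0// mulr_ge0// sqr_ge0.
have p4 : (0 : R) < 1 / 4 by lra.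
have p8 : (0 : R) < 1 / 8 by lra.
have polyb (q : R) y : 0 <= q -> q <= (8 * r ^+ 2 + 4) * (1 + enorm2 y) ->
    q * normc (bker z y) <= M * gaussw (1 / 8) y.
  move=> q0 qb.
  apply: le_trans (ler_pM q0 (normc_ge0 _) qb (normc_bker y r0 zr)) _.
  have h3 : 0 <= (8 * r ^+ 2 + 4) * expR (3 * d%:R * r ^+ 2).
    by rewrite mulr_ge0// addr_ge0// mulr_ge0// sqr_ge0.
  have := ler_wpM2l h3 (le_poly_gaussw y p4).
  have -> : (1 + 2 / (1 / 4)) = 9 :> R by lra.
  have -> : 1 / 4 / 2 = 1 / 8 :> R by lra.
  by rewrite /M; lra.
have kb i y : normc (kfac i z y) ^+ 2 <= 8 * r ^+ 2 + 2 * enorm2 y.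
  have h1 : normc (kfac i z y) <= 2 * r + `|y ord0 i|.
    apply: le_trans (le_normcD _ _) _; rewrite normcN ComplexField.Normc.normcM !normc_real.
    by rewrite (ger0_norm (sqrtr_ge0 _)) lerD2r ler_pM ?normc_ge0 ?sqrtr_ge0 ?sqrt2_le2.
  have := coord_le_enorm2 y i; rewrite -(real_normK (num_real (y ord0 i))).
  have := normc_ge0 (kfac i z y); move: (normc _) (`|y ord0 i|) h1 (normr_ge0 (y ord0 i)) (enorm2 y) => k t h1 t0 E k0 tE.
  have := sqr_ge0 (2 * r - t); nra.
have H := @cint_laplacian R d (bker z) phi1 phi2 f A M (1 / 8) p8 M0 A0 sf.
rewrite bargmannE [X in _ * X]H; clear H.
- have E y : ((enorm2 y)%:C * bker z y - \sum_i phi2 i y) * f y =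
     d%:R * (bker z y * f y) + 2 * \sum_j z ord0 j * (bker1 j z y * f y).
    have -> : \sum_i phi2 i y = (\sum_i (kfac i z y * kfac i z y)) * bker z y - d%:R * bker z y.
      rewrite /phi2 -mulr_suml sumrB sumr_const card_ord mulrBl; congr (_ - _ * _).
    have -> : \sum_j z ord0 j * (bker1 j z y * f y) =
        (\sum_j z ord0 j * (- z ord0 j + (Num.sqrt 2)%:C * (y ord0 j)%:C)) * (bker z y * f y).
      by rewrite mulr_suml; apply: eq_bigr => j _; rewrite /bker1; ring.
    have -> : \sum_i kfac i z y * kfac i z y = (enorm2 y)%:C -
         2 * \sum_j z ord0 j * (- z ord0 j + (Num.sqrt 2)%:C * (y ord0 j)%:C).
      rewrite /enorm2 rmorph_sum mulr_sumr -sumrB; apply: eq_bigr => j _.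
      rewrite /kfac rmorphXn /=; have := sqrt2C; move: (Num.sqrt 2)%:C (y ord0 j)%:C => v x vv.
      transitivity ((v * v) * z ord0 j ^+ 2 - 2 * v * z ord0 j * x + x ^+ 2); first by ring.
      by rewrite vv; ring.
    ring.
  rewrite (eq_cint mu E) cintD; last 2 first.
  + by apply: cintegZ; exact: (cinteg_bker cf fA).
  + apply: cintegZ; apply: cinteg_sum => j; apply: cintegZ.
    exact: (cinteg_bker1 cf fA).
  rewrite cintZ; last exact: (cinteg_bker cf fA).
  rewrite cintZ; last by apply: cinteg_sum => j; apply: cintegZ; exact: (cinteg_bker1 cf fA).
  rewrite cint_sum; last by move=> j; apply: cintegZ; exact: (cinteg_bker1 cf fA).
  rewrite mulrDr bargmannE; congr (_ + _); first exact: mulrCA.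
  rewrite mulrCA; congr (_ * _); rewrite mulr_sumr; apply: eq_bigr => j _.
  by rewrite cintZ; [rewrite /bargmann1 mulrCA|exact: (cinteg_bker1 cf fA)].
- move=> i y; exact: cderiv_bker.
- move=> i y; have H := cderivM (cderiv_kfac i z y) (cderiv_bker i z y).
  by apply: cderiv_eq H _; rewrite /phi2; ring.
- exact: continuous_bker.
- by move=> i; apply: continuousCM; [exact: continuous_kfac|exact: continuous_bker].
- move=> i; apply: continuousCM; last exact: continuous_bker.
  apply: continuousCD; last exact: continuousC_cst.
  by apply: continuousCM; exact: continuous_kfac.
- move=> y; rewrite -[leLHS]mul1r; apply: polyb => //.
  have := enorm2_ge0 y; have := sqr_ge0 r; move: (r ^+ 2) (enorm2 y) => a b; nra.
- move=> i y; rewrite ComplexField.Normc.normcM; apply: polyb; first exact: normc_ge0.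
  have := kb i y; have := enorm2_ge0 y; have := sqr_ge0 r; have := sqr_ge0 (normc (kfac i z y) - 1).
  move: (r ^+ 2) (enorm2 y) (normc _) => a b k h1 h2 h3.
  have := mulr_ge0 h2 h3; nra.
- move=> i y; rewrite ComplexField.Normc.normcM; apply: polyb; first exact: normc_ge0.
  apply: le_trans (le_normcD _ _) _; rewrite normcN ComplexField.Normc.normc1 ComplexField.Normc.normcM -expr2.
  have := kb i y; have := enorm2_ge0 y; have := sqr_ge0 r.
  move: (r ^+ 2) (enorm2 y) (normc _ ^+ 2) => a b k h2 h3.
  have := mulr_ge0 h2 h3; nra.
- exact: fA.
- exact: HA.
Qed.

End harmonic.

Lemma is_derive_expRM (c t : R) : is_derive t (1:R) (fun t : R => expR (c * t)) (c * expR (c * t)).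
Proof.
have H : is_derive t (1:R) (fun t : R => c * t) c.
  have H := is_deriveZ c (is_derive_id t (1:R)).
  by apply: (is_derive_eq H); rewrite /GRing.scale /= mulr1.
have H2 := is_derive_chain H (is_derive_expR (c * t)).
by apply: (is_derive_eq H2); rewrite mulrC.
Qed.

(** The factor e^(d t) produces the term d Vf of [bargmann_harmonic], and the chain rule for e^(2t)
    z the term 2 sum_j z_j d/dz_j Vf. *)
Lemma ray_derive (f : 'rV[R]_d -> C^o) (A : R) z (a : C) (t : R) :
  smooth f -> 0 <= A -> (forall y, normc (f y) <= A) ->
  (forall y, normc (harmonic_oscillator f y) <= A) ->
  normc a = 1 -> (forall j, normc (z ord0 j) <= 1) ->
  is_derive t (1:R) (fun t => Re (a * ((expR (d%:R * t))%:C * bargmann f ((expR (2 * t))%:C *: z))))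
    (Re (a * ((expR (d%:R * t))%:C * bargmann (harmonic_oscillator f) ((expR (2 * t))%:C *: z)))).
Proof.
move=> sf A0 fA HA a1 z1.
have cf : continuousC f by have [] := sf [::].
pose phi (s : R) := Re (a * bargmann f (s%:C *: z)).
pose phi' (s : R) := Re (a * \sum_j z ord0 j * bargmann1 f j (s%:C *: z)).
have dphi s : is_derive s (1:R) phi (phi' s).
  have [r r0 zr] := row_bound (s%:C *: z).
  pose B := normc bcst * (bker_cst r * A * \int[mu]_y gaussw (1 / 8) y).
  apply: (@is_derive1_quad _ _ _ _ B).
    apply: mulr_ge0; first exact: normc_ge0.
    apply: mulr_ge0; first by apply: mulr_ge0 => //; exact: bker_cst_ge0.
    by apply: Rint_ge0 => y; exact: gaussw_ge0.
  move=> h h1.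
  have hz j : normc ((h%:C *: z) ord0 j) <= `|h|.
    by rewrite mxE ComplexField.Normc.normcM normc_real ler_piMr.
  have := bargmann_taylor cf fA r0 (normr_ge0 h) h1 zr hz.
  rewrite real_normK ?num_real// mulrC; apply: le_trans.
  rewrite -[leRHS]mul1r -a1 -ComplexField.Normc.normcM.
  apply: le_trans (ler_Re_normc _); rewrite /phi /phi'.
  have -> : \sum_j (h%:C *: z) ord0 j * bargmann1 f j (s%:C *: z) =
      h%:C * \sum_j z ord0 j * bargmann1 f j (s%:C *: z).
    by rewrite mulr_sumr; apply: eq_bigr => j _; rewrite mxE mulrA.
  have -> : (h + s)%:C *: z = s%:C *: z + h%:C *: z by rewrite rmorphD scalerDl addrC.
  rewrite le_eqVlt; apply/orP; left; apply/eqP; congr (`|_|).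
  set u := bargmann f (s%:C *: z + h%:C *: z); set v := bargmann f (s%:C *: z); set w := \sum_j _.
  move: u v w => u v w.
  by case: (a) u v w => [? ?] [? ?] [? ?] [? ?] /=; ring.
have dE2 := is_derive_expRM 2 t; have dEd := is_derive_expRM d%:R t.
have H := is_deriveM dEd (is_derive_chain dE2 (dphi (expR (2 * t)))).
rewrite (_ : (fun t => Re _) = (fun t => expR (d%:R * t)) * (phi \o (fun t => expR (2 * t)))); last first.
  apply/funext => s; rewrite !fctE /phi /=.
  by case: (a) (bargmann _ _) => [? ?] [? ?] /=; ring.
apply: (is_derive_eq H); rewrite (bargmann_harmonic sf A0 fA HA) /phi /phi' /=.
have -> : \sum_j ((expR (2 * t))%:C *: z) ord0 j * bargmann1 f j ((expR (2 * t))%:C *: z) =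
    (expR (2 * t))%:C * \sum_j z ord0 j * bargmann1 f j ((expR (2 * t))%:C *: z).
  by rewrite mulr_sumr; apply: eq_bigr => j _; rewrite mxE mulrA.
rewrite -(rmorph_nat (real_complex R) d) -(rmorph_nat (real_complex R) 2).
move: (_ *: z) => Z; rewrite /GRing.scale /=.
set u := bargmann f Z; set w := \sum_j _; move: u w (d%:R : R) (2%:R : R) => u w dd two.
by case: (a) u w => [? ?] [? ?] [? ?] /=; ring.
Qed.

(** For y = x^p with p = 1/(1-2s) both sides are powers of exponent 1-2s, namely of y^k / k! and
    e^y. This is how bounds with (N!)^(2s) become growth in (log <z>)^p. *)
Lemma powR_fact_le (s x : R) (k : nat) : 0 < s -> s < 2^-1 -> 0 <= x ->
  x ^+ k * (k`!%:R) `^ (2 * s) / k`!%:R <= expR ((1 - 2 * s) * x `^ (1 - 2 * s)^-1).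
Proof.
move=> s0 s2 x0; set q := 1 - 2 * s; set F : R := k`!%:R; set y := x `^ q^-1.
have q0 : 0 < q by rewrite /q; lra.
have F0 : 0 < F by rewrite ltr0n fact_gt0.
have y0 : 0 <= y by exact: powR_ge0.
have Fq0 : 0 < F `^ q by rewrite powR_gt0.
have FE : F = F `^ (2 * s) * F `^ q.
  rewrite -powRD; last by rewrite (gt_eqF F0) implybT.
  by rewrite /q addrC subrK powRr1// ltW.
have xE : x = y `^ q by rewrite /y -powRrM mulVf ?gt_eqF// powRr1.
have xkE : x ^+ k = (y ^+ k) `^ q.
  rewrite {1}xE; elim: k {F F0 Fq0 FE} => [|k IH]; first by rewrite !expr0 powR1.
  by rewrite !exprS IH powRM// exprn_ge0.
have yk : y ^+ k <= F * expR y.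
  rewrite mulrC -ler_pdivrMr//; case: k @F {F0 Fq0 FE xkE} => [|k] F.
    by rewrite expr0 /F fact0 divr1 -expR0 ler_expR.
  by apply: le_trans (expR_ge1Dxn k y0); rewrite lerDr.
rewrite -mulrA (_ : F `^ (2 * s) / F = (F `^ q)^-1); last first.
  by rewrite {2}FE invfM mulrA mulfV ?mul1r// gt_eqF// powR_gt0.
rewrite ler_pdivrMr// xkE.
have -> : expR (q * y) * F `^ q = (F * expR y) `^ q.
  rewrite powRM ?expR_ge0 ?ltW// mulrC; congr (_ * _).
  by rewrite /powR gt_eqF ?expR_gt0// expRK.
apply: ge0_ler_powR; [exact: ltW|by rewrite nnegrE exprn_ge0| |exact: yk].
by rewrite nnegrE mulr_ge0 ?expR_ge0// ltW.
Qed.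

Lemma japanese_ge1 z : 1 <= japanese z.
Proof.
rewrite /japanese -[leLHS]sqrtr1 ler_sqrt ?lerDl; last first.
  by rewrite addr_ge0// sumr_ge0// => j _; exact: sqr_ge0.
by apply: sumr_ge0 => j _; exact: sqr_ge0.
Qed.

Lemma normc_le_japanese z j : normc (z ord0 j) <= japanese z.
Proof.
rewrite /japanese -[leLHS]ger0_norm ?normc_ge0// -sqrtr_sqr ler_sqrt; last first.
  by rewrite addr_ge0// sumr_ge0// => k _; exact: sqr_ge0.
rewrite (bigD1 j)//= addrCA lerDl addr_ge0// sumr_ge0// => k _; exact: sqr_ge0.
Qed.

(* Along the ray t |-> exp(2t) z the operator H becomes d/dt (ray_derive), so
   that the Taylor series at t = 0 has coefficients controlled by H^N f. *)
Lemma bargmann_growth (s h M : R) (f : 'rV[R]_d -> C^o) : 0 < s -> s < 2^-1 -> 0 < h -> 0 <= M ->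
  smooth f ->
  (forall N y, normc (iter N (@harmonic_oscillator R d) f y) <= M * (h ^+ N * (N`!%:R) `^ (2 * s))) ->
  forall z, normc (bargmann f z) <=
    3 * (normc bcst * (expR (3 * d%:R) * \int[mu]_y gaussw (1 / 4) y)) * M *
    expR ((1 - 2 * s) * h `^ (1 - 2 * s)^-1 * (ln (japanese z)) `^ (1 - 2 * s)^-1).
Proof.
move=> s0 s2 h0 M0 sf Hf z.
set I4 := \int[mu]_y _; set p := (1 - 2 * s)^-1.
have J1 := japanese_ge1 z; have J0 : 0 < japanese z by exact: lt_le_trans J1.
(* The time at which the dilation e^(2t) carries z / <z>, whose coordinates have modulus at most 1,
   to z. *)
pose tau := ln (japanese z) / 2.
have tau0 : 0 <= tau by rewrite divr_ge0// ln_ge0.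
pose z' : 'rV[R[i]]_d := ((japanese z)^-1)%:C *: z.
have zE : z = (expR (2 * tau))%:C *: z'.
  rewrite scalerA -rmorphM /tau mulrCA mulfV// mulr1 lnK ?posrE// mulfV ?gt_eqF//.
  by rewrite rmorph1 scale1r.
have z'1 j : normc (z' ord0 j) <= 1.
  have j0 : 0 <= (japanese z)^-1 by rewrite invr_ge0 ltW.
  rewrite mxE ComplexField.Normc.normcM normc_real (ger0_norm j0).
  by rewrite mulrC ler_pdivrMr// mul1r normc_le_japanese.
pose g N := iter N (@harmonic_oscillator R d) f.
have sg N : smooth (g N) by exact: smooth_iter_harmonic.
pose c N := h ^+ N * (N`!%:R) `^ (2 * s).
have c0 N : 0 <= c N by rewrite mulr_ge0 ?powR_ge0// exprn_ge0// ltW.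
pose w N (t : R) : C := (expR (d%:R * t))%:C * bargmann (g N) ((expR (2 * t))%:C *: z').
have I40 : 0 <= I4 by apply: Rint_ge0 => y; exact: gaussw_ge0.
have b0 : 0 <= normc (bcst : C) by exact: normc_ge0.
pose C1 := normc bcst * (expR (3 * d%:R) * I4).
have C10 : 0 <= C1 by rewrite !mulr_ge0// expR_ge0.
have wb N (t r : R) : 0 <= t -> 1 <= r -> expR (2 * t) <= r ->
    normc (w N t) <= expR (d%:R * t) * (normc bcst * (expR (3 * d%:R * r ^+ 2) * I4)) * (M * c N).
  move=> t0 r1 tr; have r0 : 0 <= r by exact: le_trans r1.
  rewrite ComplexField.Normc.normcM normc_real ger0_norm ?expR_ge0//.
  rewrite -mulrA ler_wpM2l ?expR_ge0//.
  have zr j : normc (((expR (2 * t))%:C *: z') ord0 j) <= r.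
    rewrite mxE ComplexField.Normc.normcM normc_real ger0_norm ?expR_ge0//.
    by rewrite -[leRHS]mulr1; apply: ler_pM; rewrite ?expR_ge0 ?normc_ge0.
  have cg : continuousC (g N) by have [] := sg N [::].
  apply: le_trans (normc_bargmann cg (Hf N) r0 zr) _.
  by rewrite le_eqVlt; apply/orP; left; apply/eqP; rewrite -/I4 -/(c N); ring.
have w0 N : normc (w N 0) <= C1 * (M * c N).
  have := @wb N 0 1 (lexx _) (lexx _); rewrite mulr0 expR0 => /(_ (lexx _)).
  by rewrite mulr0 expR0 expr1n mulr1 mul1r.
pose r := expR (2 * tau).
pose D := expR (d%:R * tau) * (normc bcst * (expR (3 * d%:R * r ^+ 2) * I4)).
have D0 : 0 <= D by rewrite !mulr_ge0 ?expR_ge0.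
have wD N t : 0 <= t -> t <= tau -> normc (w N t) <= D * (M * c N).
  move=> t0 tt; apply: le_trans (@wb N t r t0 _ _) _.
  - by rewrite /r -expR0 ler_expR mulr_ge0.
  - by rewrite ler_expR ler_wpM2l.
  apply: ler_wpM2r; first by rewrite mulr_ge0.
  rewrite /D; apply: ler_wpM2r; first by rewrite !mulr_ge0 ?expR_ge0.
  by rewrite ler_expR ler_wpM2l.
(* [powR_fact_le] is used at x = 2 h tau = h log <z> rather than at h tau: the extra factor 2^k, a
   gift of the dilation e^(2t), makes the Taylor terms decay geometrically. *)
pose E := expR ((1 - 2 * s) * (2 * h * tau) `^ p).
have cE k : c k * tau ^+ k / k`!%:R <= E / 2 ^+ k.
  have ht0 : 0 <= 2 * h * tau by apply: mulr_ge0 => //; apply: mulr_ge0 => //; exact: ltW.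
  have := powR_fact_le k s0 s2 ht0; rewrite -/E -/p.
  rewrite ler_pdivlMr ?exprn_gt0//; apply: le_trans.
  by rewrite le_eqVlt; apply/orP; left; apply/eqP; rewrite /c !exprMn; ring.
have -> : expR ((1 - 2 * s) * h `^ p * (ln (japanese z)) `^ p) = E.
  have -> : ln (japanese z) = 2 * tau by rewrite /tau; lra.
  have t20 : 0 <= 2 * tau by apply: mulr_ge0.
  by rewrite /E -mulrA -(powRM _ (ltW h0) t20) [2 * h]mulrC -mulrA.
have E0 : 0 <= E by exact: expR_ge0.
(* The Taylor terms at 0 are dominated by a geometric series of sum at most 2. The remainder carries
   the constant D, which depends badly on z, but it is divided by 2^n and vanishes in the limit. *)
have key n : normc (w 0%N tau) <= 2 * C1 * M * E + D * M * E / 2 ^+ n.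
  apply: normc_leP => a a1.
  have dv N t : is_derive t (1:R) (fun t => Re (a * w N t)) (Re (a * w N.+1 t)).
    have A0 : 0 <= M * c N + M * c N.+1 by rewrite addr_ge0// mulr_ge0.
    apply: (@ray_derive (g N) _ z' a t (sg N) A0) => //.
      by move=> y; apply: le_trans (Hf N y) _; rewrite lerDl mulr_ge0.
    by move=> y; apply: le_trans (Hf N.+1 y) _; rewrite lerDr mulr_ge0.
  have vB t : 0 <= t <= tau -> Re (a * w n t) <= D * (M * c n).
    by move=> /andP[t0 tt]; apply: le_trans (Re_mul_le _ a1) _; exact: wD.
  apply: le_trans (taylor_seq tau0 dv vB) _; apply: lerD.
    apply: (@le_trans _ _ (\sum_(k < n) (C1 * M * E) * 2^-1 ^+ k)).
      apply: ler_sum => k _.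
      have h1 : Re (a * w k 0) <= C1 * (M * c k).
        by apply: le_trans (Re_mul_le _ a1) _; exact: w0.
      have tk : 0 <= tau ^+ k / k`!%:R by rewrite divr_ge0// exprn_ge0.
      have h2 := ler_wpM2l (mulr_ge0 C10 M0) (cE k).
      have h3 := ler_wpM2r tk h1; rewrite -[leLHS]mulrA; apply: le_trans h3 _.
      rewrite exprVn -[leRHS]mulrA; apply: le_trans h2.
      by rewrite le_eqVlt; apply/orP; left; apply/eqP; ring.
    rewrite -mulr_sumr [leRHS](_ : _ = (C1 * M * E) * 2); last by ring.
    rewrite ler_wpM2l ?mulr_ge0//.
    have -> : \sum_(k < n) 2^-1 ^+ k = 2 - 2 * 2^-1 ^+ n :> R.
      elim: n {vB} => [|n IH]; first by rewrite big_ord0 expr0; lra.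
      by rewrite big_ord_recr /= IH exprS; lra.
    by rewrite gerBl mulr_ge0// exprn_ge0.
  have h2 := ler_wpM2l (mulr_ge0 D0 M0) (cE n).
  rewrite -[leRHS]mulrA; apply: le_trans h2.
  by rewrite le_eqVlt; apply/orP; left; apply/eqP; ring.
have main : normc (w 0%N tau) <= 2 * C1 * M * E.
  apply/ler_addgt0Pr => e e0.
  have : (fun n => D * M * E * 2^-1 ^+ n) @ \oo --> (0 : R).
    rewrite -[X in _ --> X](mulr0 (D * M * E)); apply: cvgM; first exact: cvg_cst.
    by apply: cvg_expr; rewrite ger0_norm//; lra.
  move=> /cvgr0Pnorm_lt /(_ _ e0)[n _ /(_ n (leqnn n))] /=.
  move=> /ltW /(le_trans (ler_norm _)) h1.
  by apply: le_trans (key n) _; rewrite lerD2l -exprVn.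
have wF : w 0%N tau = (expR (d%:R * tau))%:C * bargmann f z by rewrite /w -zE.
have : normc (bargmann f z) <= normc (w 0%N tau).
  rewrite wF; move: (bargmann f z) => u.
  rewrite ComplexField.Normc.normcM normc_real ger0_norm ?expR_ge0//.
  by rewrite ler_peMl ?normc_ge0// -expR0 ler_expR mulr_ge0.
move=> /le_trans /(_ main) /le_trans; apply.
have : 0 <= C1 * M * E by apply: mulr_ge0 => //; apply: mulr_ge0.
rewrite -/C1 -[2 * C1 * M * E]mulrA -[3 * C1 * M * E]mulrA -[2 * C1 * (M * E)]mulrA -[3 * C1 * (M * E)]mulrA.
by move: (C1 * (M * E)) (C1 * M * E) (mulrA C1 M E) => u v -> ?; lra.
Qed.

End bargmann_kernel.

(** * Injectivity of the Bargmann transform *)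

Section injectivity.
Variables (R : realType).
Local Notation C := (R[i]).
Local Notation Re := complex.Re.
Local Notation Im := complex.Im.
Local Notation normc := ComplexField.Normc.normc.

(** Meant for values of a transform along a line on which all first order terms have been shown to
    vanish. *)
Lemma cst_quad (phi : R -> C) :
  (forall t : R, exists2 B : R, 0 <= B & forall h : R, `|h| <= 1 -> normc (phi (h + t) - phi t) <= B * h ^+ 2) ->
  forall s t, phi s = phi t.
Proof.
move=> H s t; apply/eqP; rewrite -subr_eq0 -[_ == 0]negbK -normc_gt0 -leNgt.
apply: normc_leP => a a1.
have D (x : R) : is_derive x (1:R) (fun t : R => Re (a * phi t)) 0.
  have [B B0 HB] := H x; apply: (@is_derive1_quad _ _ _ _ B) => // h h1.
  rewrite mulr0 subr0; apply: le_trans (HB h h1).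
  rewrite -[leRHS]mul1r -a1 -ComplexField.Normc.normcM; apply: le_trans (ler_Re_normc _).
  by rewrite le_eqVlt; apply/orP; left; apply/eqP; congr (`|_|); case: (a) (phi _) (phi x) => [? ?] [? ?] [? ?] /=; ring.
have := is_derive_0_is_cst s t D; rewrite mulrBr.
by move: (a * phi s) (a * phi t) => [? ?] [? ?] /= ->; rewrite subrr.
Qed.

Lemma integ_prod d1 d2 (T1 : measurableType d1) (T2 : measurableType d2)
    (m1 : {sigma_finite_measure set T1 -> \bar R}) (m2 : {sigma_finite_measure set T2 -> \bar R})
    (p : T1 -> R) (q : T2 -> R) : integ m1 p -> integ m2 q ->
  (forall x, 0 <= p x) -> (forall y, 0 <= q y) ->
  integ (m1 \x m2)%E (fun xy => p xy.1 * q xy.2).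
Proof.
move=> ip iq p0 q0; have mp := integ_meas ip; have mq := integ_meas iq.
have mpq : measurable_fun setT (fun xy : T1 * T2 => p xy.1 * q xy.2).
  by apply: measurable_funM; apply: measurableT_comp.
apply/integrableP; split; first exact/measurable_EFinP.
under eq_integral do rewrite gee0_abs ?lee_fin ?mulr_ge0//.
rewrite fubini_tonelli1//; last 2 first.
- exact/measurable_EFinP.
- by move=> x; rewrite lee_fin mulr_ge0.
have fq : (\int[m2]_y (q y)%:E \is a fin_num)%E by exact: integrable_fin_num.
have fp : (\int[m1]_y (p y)%:E \is a fin_num)%E by exact: integrable_fin_num.
have E x : fubini_F m2 (fun z : T1 * T2 => (p z.1 * q z.2)%:E) x =
    ((p x)%:E * \int[m2]_y (q y)%:E)%E.
  rewrite /fubini_F -ge0_integralZl//; last 3 first.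
  - exact/measurable_EFinP.
  - by move=> y _; rewrite lee_fin.
  - by rewrite lee_fin.
under eq_integral do rewrite E.
rewrite ge0_integralZr//; last 3 first.
- exact/measurable_EFinP.
- by move=> y _; rewrite lee_fin.
- by apply: integral_ge0 => y _; rewrite lee_fin.
by rewrite -(fineK fq) -(fineK fp) -EFinM ltry.
Qed.

(** * Gaussian transforms and injectivity *)

Section ground.
Variable d : nat.
Local Notation mu := (lebesgue_rV d).
Implicit Types (z h : 'rV[R[i]]_d) (x y v xi : 'rV[R]_d).

(** For b = 1/2 this is the ground state of H, up to normalization. *)
Definition groundC (b : R) y : C := (gaussw b y)%:C.

Lemma cderiv_groundC b i y : cderiv i (groundC b : 'rV[R]_d -> C^o) y ((- (2 * b * y ord0 i))%:C * groundC b y).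
Proof.
rewrite /groundC -rmorphM; apply: cderiv_real.
have H := is_derive_chain (is_derive_enorm2 i y) (is_derive_expRM (- b) (enorm2 y)).
have E : (fun t : R => expR (- b * t)) \o (@enorm2 R d) = @gaussw R b d.
  by apply/funext => u; rewrite /gaussw /= mulNr.
rewrite E in H; apply: (is_derive_eq H); rewrite /gaussw [- b * enorm2 y]mulNr; ring.
Qed.

Lemma continuous_gaussw b : continuous (@gaussw R b d).
Proof.
have c1 : continuous (fun y : 'rV[R]_d => - b * enorm2 y).
  by apply: rcontM; [exact: rcont_cst|exact: continuous_enorm2].
have -> : @gaussw R b d = (fun y => expR (- b * enorm2 y)).
  by apply/funext => u; rewrite /gaussw mulNr.
by apply: rcont_comp c1 _; exact: continuous_expR.
Qed.

Lemma continuous_groundC b : continuousC (groundC b : 'rV[R]_d -> C^o).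
Proof. by apply: continuousC_real; exact: continuous_gaussw. Qed.

Lemma normc_groundC b y : normc (groundC b y) = gaussw b y.
Proof. by rewrite normc_real ger0_norm// gaussw_ge0. Qed.

Lemma gaussw_le1 b y : 0 <= b -> gaussw b y <= 1.
Proof.
by move=> b0; rewrite /gaussw -[leRHS]expR0 ler_expR oppr_le0 mulr_ge0// enorm2_ge0.
Qed.

(** Differentiating kernel times ground state in y_j brings down the factor sqrt 2 z_j - 2 y_j = -
    sqrt 2 (- z_j + sqrt 2 y_j), so the integrand is a multiple of a total derivative. *)
Lemma bargmann1_ground j z : bargmann1 (groundC (1 / 2)) j z = 0.
Proof.
have [r r0 zr] := row_bound z.
have p4 : (0 : R) < 1 / 4 by lra.
have p8 : (0 : R) < 1 / 8 by lra.
have g1 y : gaussw (1 / 2 : R) y <= 1 by apply: gaussw_le1; lra.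
pose W y : C^o := bker z y * groundC (1 / 2) y.
pose W' y : C^o := - (Num.sqrt 2)%:C * (bker1 j z y * groundC (1 / 2) y).
have H : cint mu W' = 0.
  apply: (@cint_partial_gauss R d j W W' (expR (3 * d%:R * r ^+ 2) + Num.sqrt 2 * (9 * (r + 2) * expR (3 * d%:R * r ^+ 2))) (1 / 8)) => //.
  - by rewrite addr_ge0 ?expR_ge0 ?mulr_ge0 ?expR_ge0 ?sqrtr_ge0// addr_ge0.
  - move=> y; have H := cderivM (cderiv_bker j z y) (cderiv_groundC (1 / 2) j y).
    apply: (cderiv_eq H); rewrite /W' /bker1 /kfac /= /groundC.
    have -> : - (2 * (1 / 2) * y ord0 j) = - y ord0 j by lra.
    rewrite rmorphN; have := sqrt2C R; move: (Num.sqrt 2)%:C (bker z y) => v b vv.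
    transitivity ((v * z ord0 j - 2 * (y ord0 j)%:C) * b * (gaussw (1 / 2) y)%:C); first by ring.
    by rewrite -[X in _ - X * _]vv; ring.
  - by apply: continuousCM; [exact: continuous_bker|exact: continuous_groundC].
  - apply: continuousCM; first exact: continuousC_cst.
    by apply: continuousCM; [exact: continuous_bker1|exact: continuous_groundC].
  - move=> y; rewrite ComplexField.Normc.normcM normc_groundC.
    apply: (@le_trans _ _ (expR (3 * d%:R * r ^+ 2) * gaussw (1 / 8) y)).
      rewrite -[leRHS]mulr1; apply: ler_pM; rewrite ?normc_ge0 ?gaussw_ge0//.
      apply: le_trans (normc_bker y r0 zr) _; rewrite ler_wpM2l ?expR_ge0//.
      by apply: gaussw_le; lra.
    by rewrite ler_wpM2r ?gaussw_ge0// lerDl !mulr_ge0 ?expR_ge0 ?sqrtr_ge0// addr_ge0.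
  - move=> y; rewrite /W' ComplexField.Normc.normcM normcN normc_real ger0_norm ?sqrtr_ge0//.
    rewrite [normc (bker1 _ _ _ * _)]ComplexField.Normc.normcM normc_groundC.
    apply: (@le_trans _ _ (Num.sqrt 2 * (9 * (r + 2) * expR (3 * d%:R * r ^+ 2)) * gaussw (1 / 8) y)).
      rewrite -mulrA ler_wpM2l ?sqrtr_ge0//.
      rewrite -[leRHS]mulr1; apply: ler_pM; rewrite ?normc_ge0 ?gaussw_ge0//.
      exact: (normc_bker1 j y r0 zr).
    by rewrite ler_wpM2r ?gaussw_ge0// lerDr expR_ge0.
have A1 y : normc (groundC (1 / 2) y) <= 1 by rewrite normc_groundC.
have I1 := cinteg_bker1 (continuous_groundC (1 / 2)) A1 j z.
have : - (Num.sqrt 2)%:C * cint mu (fun y => bker1 j z y * groundC (1 / 2) y) = 0.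
  by rewrite -cintZ.
move=> /eqP; rewrite mulf_eq0 oppr_eq0 => /orP[/eqP E|/eqP E]; last by rewrite /bargmann1 E mulr0.
have := sqrt2C R; rewrite E mulr0 => /esym/eqP.
by rewrite -(rmorph_nat (real_complex R) 2) /= => /eqP[] /eqP; rewrite pnatr_eq0.
Qed.

(** All z-derivatives vanish, so the value is the one at z = 0, a Gaussian integral. Constancy is
    checked along the ray through z, scaled to have coordinates of modulus at most 1. *)
Lemma bargmann_ground z : bargmann (groundC (1 / 2)) z = bcst R d * (Num.sqrt pi ^+ d)%:C.
Proof.
have g1 y : gaussw (1 / 2 : R) y <= 1 by apply: gaussw_le1; lra.
have A1 y : normc (groundC (1 / 2) y) <= 1 by rewrite normc_groundC.
transitivity (bargmann (groundC (1 / 2)) (0 : 'rV[R[i]]_d)); last first.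
  rewrite bargmannE; congr (_ * _); rewrite -Rint_gaussw1 -cint_real; apply: eq_cint => y.
  have c0 w : cdot (0 : 'rV[R[i]]_d) w = 0 by apply: big1 => j _; rewrite mxE mul0r.
  rewrite /bker /groundC /gaussw !c0 mulr0 addr0 add0r -rmorphN -rmorphM cexp_real -rmorphM -expRD; congr ((expR _)%:C); lra.
have [r r0 zr] := row_bound z.
pose s := r + 1.
have s1 : 1 <= s by rewrite lerDr.
have s0 : 0 < s by exact: lt_le_trans s1.
pose z' : 'rV[R[i]]_d := (s^-1)%:C *: z.
have z'1 j : normc (z' ord0 j) <= 1.
  rewrite mxE ComplexField.Normc.normcM normc_real ger0_norm ?invr_ge0 ?(ltW s0)//.
  by rewrite ler_pdivrMl// mulr1; apply: le_trans (zr j) _; rewrite lerDl.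
have zE : z = s%:C *: z' by rewrite scalerA -rmorphM mulfV ?gt_eqF// rmorph1 scale1r.
pose phi (t : R) := bargmann (groundC (1 / 2)) (t%:C *: z').
have := @cst_quad phi _ s 0; rewrite /phi -zE rmorph0 scale0r; apply => t.
have [q q0 zq] := row_bound (t%:C *: z').
exists (normc (bcst R d) * (bker_cst d q * 1 * \int[mu]_y gaussw (1 / 8) y)).
  apply: mulr_ge0; first exact: normc_ge0.
  apply: mulr_ge0; first by rewrite mulr1; exact: bker_cst_ge0.
  by apply: Rint_ge0 => y; exact: gaussw_ge0.
move=> h h1.
have hz j : normc ((h%:C *: z') ord0 j) <= `|h|.
  by rewrite mxE ComplexField.Normc.normcM normc_real ler_piMr.
have := bargmann_taylor (continuous_groundC (1 / 2)) A1 q0 (normr_ge0 h) h1 zq hz.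
rewrite big1; last by move=> j _; rewrite bargmann1_ground mulr0.
rewrite subr0 -scalerDl -rmorphD (addrC t h) real_normK ?num_real// => H.
by rewrite [leRHS]mulrC.
Qed.

Definition ci : C := 0 +i* 1.

Lemma ciM : ci * ci = -1.
Proof. by rewrite /ci; congr (_ +i* _) => /=; ring. Qed.

Lemma cexp_ci (t : R) : normc (cexp (ci * t%:C)) = 1.
Proof. by rewrite normc_cexp /= mul0r mul1r subr0 expR0. Qed.

Definition ew z y : C := cexp ((Num.sqrt 2)%:C * cdot z (complexify y)).

Lemma bker_ew z y : bker z y = cexp (- (2^-1)%:C * cdot z z) * (ew z y * groundC (1 / 2) y).
Proof.
rewrite /groundC /gaussw -cexp_real /ew -!cexpD /bker; congr cexp.
have -> : - (1 / 2 * enorm2 y) = - 2^-1 * enorm2 y by lra.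
by rewrite rmorphM rmorphN mulrDr addrAC addrA.
Qed.

Definition dotr x y : R := \sum_j x ord0 j * y ord0 j.

(** An imaginary argument, scaled so that the exponential part [ew] of the kernel becomes the
    character y -> e^(2 i l <v, y>). *)
Definition gauss_freq (l : R) v : 'rV[R[i]]_d := \row_j (ci * (Num.sqrt 2 * l * v ord0 j)%:C).

Lemma ew_gauss_freq l v y : ew (gauss_freq l v) y = cexp (ci * (2 * l * dotr v y)%:C).
Proof.
rewrite /ew; congr cexp; rewrite /dotr cdot_complexify mulr_sumr mulr_sumr rmorph_sum mulr_sumr.
apply: eq_bigr => j _; rewrite mxE !rmorphM /= (rmorph_nat (real_complex R) 2).
have := sqrt2C R; move: (Num.sqrt 2)%:C => w; rewrite -(rmorph_nat (real_complex R) 2) => <-; ring.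
Qed.

Lemma cdot_gauss_freq l v : cdot (gauss_freq l v) (gauss_freq l v) = - (2 * (l ^+ 2 * enorm2 v))%:C.
Proof.
rewrite /cdot /enorm2 mulr_sumr mulr_sumr rmorph_sum -sumrN.
apply: eq_bigr => j _; rewrite !mxE !expr2 !rmorphM /= (rmorph_nat (real_complex R) 2).
transitivity (ci * ci * ((Num.sqrt 2)%:C * (Num.sqrt 2)%:C * (l%:C * l%:C * ((v ord0 j)%:C * (v ord0 j)%:C)))); first by ring.
by rewrite ciM sqrt2C mulN1r.
Qed.

Lemma bcst_neq0 : bcst R d != 0.
Proof.
by rewrite /bcst -normc_gt0 normc_real normr_gt0 gt_eqF// powR_gt0// pi_gt0.
Qed.

Lemma groundCM b c y : groundC b y * groundC c y = groundC (b + c) y.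
Proof. by rewrite /groundC -rmorphM /gaussw -expRD mulrDl opprD. Qed.

Lemma normc_ew_fz l v y : normc (ew (gauss_freq l v) y) = 1.
Proof. by rewrite ew_gauss_freq cexp_ci. Qed.

Lemma continuous_dotr v : continuous (dotr v).
Proof.
by apply: rcont_sum => j; apply: rcontM; [exact: rcont_cst|exact: coord_continuous].
Qed.

Lemma continuous_ew_fz l v : continuousC (ew (gauss_freq l v) : 'rV[R]_d -> C^o).
Proof.
have -> : ew (gauss_freq l v) = (fun y => cexp (ci * (2 * l * dotr v y)%:C)).
  by apply/funext => y; exact: ew_gauss_freq.
apply: continuousC_cexp; apply: continuousCM; first exact: continuousC_cst.
apply: continuousC_real; apply: rcontM; first exact: rcont_cst.
exact: continuous_dotr.
Qed.

Lemma cinteg_gauss b (g : 'rV[R]_d -> C^o) (A : R) : 0 < b -> continuousC g ->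
  (forall y, normc (g y) <= A) -> cinteg mu (fun y => g y * groundC b y).
Proof.
move=> b0 cg gA; have ig : integ mu (fun y => A * gaussw b y) by apply: integZ; exact: integ_gaussw.
apply: (cinteg_dom _ ig).
  by apply: cmeasM; apply: continuous_cmeas => //; exact: continuous_groundC.
by move=> y; rewrite ComplexField.Normc.normcM normc_groundC ler_wpM2r ?gaussw_ge0.
Qed.

(** The Fourier transform of e^(-|y|^2) at frequency 2 l v, read off from [bargmann_ground] at an
    imaginary point: there kernel times ground state is the character times e^(-|y|^2), up to a
    factor constant in y. *)
Lemma gauss_fourier l v : cint mu (fun y => ew (gauss_freq l v) y * groundC 1 y) =
  (Num.sqrt pi ^+ d)%:C * groundC (l ^+ 2) v.
Proof.
have := bargmann_ground (gauss_freq l v); rewrite bargmannE => /(mulfI bcst_neq0) H.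
have I : cinteg mu (fun y => ew (gauss_freq l v) y * groundC 1 y).
  apply: (cinteg_gauss (A := 1)) => //; first exact: continuous_ew_fz.
  by move=> y; rewrite normc_ew_fz.
have E y : bker (gauss_freq l v) y * groundC (1 / 2) y =
    cexp (- (2^-1)%:C * cdot (gauss_freq l v) (gauss_freq l v)) * (ew (gauss_freq l v) y * groundC 1 y).
  by rewrite bker_ew -!mulrA groundCM (_ : 1 / 2 + 1 / 2 = 1 :> R); [|lra].
rewrite (eq_cint mu E) cintZ// in H; rewrite -H cdot_gauss_freq mulrC mulrA.
move: (cint _ _) => I0; rewrite mulrA -[LHS]mul1r; congr (_ * _).
rewrite /groundC /gaussw -cexp_real -cexpD -cexp0; congr cexp.
rewrite mulNr mulrN opprK -rmorphM -rmorphD (_ : _ + _ = 0) ?rmorph0//.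
by field.
Qed.

Lemma dotrBl x y v : dotr (x - y) v = dotr x v + dotr (- v) y.
Proof. by rewrite /dotr -big_split; apply: eq_bigr => j _ /=; rewrite !mxE; ring. Qed.

Lemma measurable_dotr12 (x : 'rV[R]_d) :
  measurable_fun setT (fun p : 'rV[R]_d * 'rV[R]_d => dotr (x - p.1) p.2).
Proof.
apply: measurable_sum => j; apply: measurable_funM.
  apply: (measurableT_comp (f := fun y : 'rV[R]_d => (x - y) ord0 j)) => //.
  rewrite (_ : (fun y => _) = (fun y : 'rV[R]_d => x ord0 j - y ord0 j)); last by apply/funext => y; rewrite !mxE.
  by apply: measurable_funB => //; exact: measurable_coord.
by apply: (measurableT_comp (f := fun y : 'rV[R]_d => y ord0 j)) => //; exact: measurable_coord.
Qed.

Lemma continuous_gaussw_sub b x : continuous (fun y : 'rV[R]_d => gaussw b (x - y)).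
Proof.
have c1 : continuous (fun y : 'rV[R]_d => x - y).
  apply: continuous_rV => j.
  rewrite (_ : (fun y => _) = (fun y : 'rV[R]_d => x ord0 j - y ord0 j)); last by apply/funext => y; rewrite !mxE.
  by apply: rcontB; [exact: rcont_cst|exact: coord_continuous].
by move=> y; exact: (continuous_comp (c1 y) (@continuous_gaussw b (x - y))).
Qed.

Lemma bargmann_eq0 (f : 'rV[R]_d -> C^o) (A : R) : continuousC f ->
  (forall y, normc (f y) <= A) -> (forall z, bargmann f z = 0) -> forall x, f x = 0.
Proof.
move=> cf fA Hf x.
pose u y : C^o := f y * groundC (1 / 2) y.
have cu : continuousC u by apply: continuousCM => //; exact: continuous_groundC.
have p2 : (0 : R) < 1 / 2 by lra.
have uA y : normc (u y) <= A * gaussw (1 / 2) y.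
  by rewrite ComplexField.Normc.normcM normc_groundC ler_wpM2r ?gaussw_ge0.
have A0 : 0 <= A by apply: le_trans (fA 0); exact: normc_ge0.
have iA : integ mu (fun y => A * gaussw (1 / 2) y) by apply: integZ; exact: integ_gaussw.
have iu (g : 'rV[R]_d -> C^o) : continuousC g -> (forall y, normc (g y) <= 1) -> cinteg mu (fun y => g y * u y).
  move=> cg g1; apply: (cinteg_dom _ iA).
    by apply: cmeasM; exact: continuous_cmeas.
  by move=> y; rewrite ComplexField.Normc.normcM -[leRHS]mul1r ler_pM ?normc_ge0.
(* On imaginary arguments the vanishing of Vf says that the Fourier transform of u vanishes. *)
have U0 l v : cint mu (fun y => ew (gauss_freq l v) y * u y) = 0.
  have := Hf (gauss_freq l v); rewrite bargmannE => /eqP; rewrite mulf_eq0 (negPf bcst_neq0) /= => /eqP.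
  have E y : bker (gauss_freq l v) y * f y =
    cexp (- (2^-1)%:C * cdot (gauss_freq l v) (gauss_freq l v)) * (ew (gauss_freq l v) y * u y).
    by rewrite bker_ew /u; ring.
  rewrite (eq_cint mu E) cintZ; last first.
    by apply: iu; [exact: continuous_ew_fz|move=> y; rewrite normc_ew_fz].
  by move=> /eqP; rewrite mulf_eq0 (negPf (cexp_neq0 _)) => /eqP.
(* The Gaussian at x - y is written as a Fourier integral in xi by [gauss_fourier]; once the
   integrals are exchanged, the inner one over y is a value of the Fourier transform of u. *)
have key (l : R) : cint mu (fun y => u y * groundC (l ^+ 2) (x - y)) = 0.
  pose H (p : 'rV[R]_d * 'rV[R]_d) : C := u p.1 * (ew (gauss_freq l (x - p.1)) p.2 * groundC 1 p.2).
  have iH : cinteg (mu \x mu)%E H.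
    apply: (cinteg_dom (q := fun p => (A * gaussw (1 / 2) p.1) * gaussw 1 p.2)).
    - apply: cmeasM.
        have [m1 m2] := continuous_cmeas cu.
        by split; [exact: (measurableT_comp m1 measurable_fst)|exact: (measurableT_comp m2 measurable_fst)].
      apply: cmeasM; last first.
        apply: cmeas_real; apply: (measurableT_comp (f := @gaussw R 1 d)) => //.
        by apply: continuous_measurable_rV; exact: continuous_gaussw.
      under eq_fun do rewrite ew_gauss_freq.
      apply: cmeas_cexp; apply: cmeasM; first exact: cmeas_cst.
      by apply: cmeas_real; apply: measurable_funM => //; exact: measurable_dotr12.
    - have q0 y : 0 <= A * gaussw (1 / 2) y by rewrite mulr_ge0// gaussw_ge0.
      exact: (integ_prod iA (@integ_gaussw R 1 d ltr01) q0 (@gaussw_ge0 R d 1)).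
    - move=> p; rewrite ComplexField.Normc.normcM [normc (ew _ _ * _)]ComplexField.Normc.normcM normc_ew_fz mul1r normc_groundC.
      by rewrite ler_wpM2r ?gaussw_ge0.
  have iE v : cinteg mu (fun xi => ew (gauss_freq l v) xi * groundC 1 xi).
    apply: (cinteg_gauss (A := 1)) => //; first exact: continuous_ew_fz.
    by move=> y; rewrite normc_ew_fz.
  have F1 := cint_prod12 iH (fun y => cintegZ (u y) (iE (x - y))).
  have iY xi : cinteg mu (fun y => (ew (gauss_freq l x) xi * groundC 1 xi) * (ew (gauss_freq l (- xi)) y * u y)).
    apply: cintegZ; apply: iu; first exact: continuous_ew_fz.
    by move=> y; rewrite normc_ew_fz.
  have HE y xi : H (y, xi) = (ew (gauss_freq l x) xi * groundC 1 xi) * (ew (gauss_freq l (- xi)) y * u y).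
    rewrite /H /= [ew (gauss_freq l (x - y)) xi]ew_gauss_freq dotrBl mulrDr rmorphD mulrDr cexpD -!ew_gauss_freq; ring.
  have iY' xi : cinteg mu (fun y => H (y, xi)).
    by under eq_fun do rewrite HE; exact: iY.
  have F2 := cint_prod21 iH iY'.
  have Z : cint (mu \x mu)%E H = 0.
    rewrite F2 -[RHS](cint0 mu); apply: eq_cint => xi.
    rewrite (eq_cint mu (fun y => HE y xi)) cintZ ?U0 ?mulr0//.
    apply: iu; first exact: continuous_ew_fz.
    by move=> y; rewrite normc_ew_fz.
  rewrite F1 in Z.
  have P0 : (Num.sqrt pi ^+ d)%:C != 0 :> C.
    by rewrite -normc_gt0 normc_real normr_gt0 expf_neq0// gt_eqF// sqrtr_gt0 pi_gt0.
  apply/eqP; rewrite -[_ == 0](mulrI_eq0 _ (mulfI P0)); apply/eqP.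
  rewrite -Z -cintZ; last first.
    under eq_fun do rewrite mulrC; apply: iu; last first.
      by move=> y; rewrite normc_groundC gaussw_le1// sqr_ge0.
    by apply: continuousC_real; exact: continuous_gaussw_sub.
  apply: eq_cint => y; rewrite /H /= cintZ; last exact: iE.
  by rewrite gauss_fourier; ring.
(* Taking l^2 = n in [key] makes the Gaussian the n-th power of k, as [concentration] requires. *)
pose k y := gaussw 1 (x - y).
have kn n y : k y ^+ n = gaussw (Num.sqrt n%:R ^+ 2) (x - y).
  by rewrite /k /gaussw sqr_sqrtr ?ler0n// -expRM_natl mul1r mulrN mulrC -mulrN mulrC mulNr.
have kx : k x = 1 by rewrite /k /gaussw subrr /enorm2 big1 ?mulr0 ?oppr0 ?expR0// => j _; rewrite mxE expr0n.
have k01 y : 0 <= k y <= 1 by rewrite gaussw_ge0 gaussw_le1.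
have ck : continuous k by exact: continuous_gaussw_sub.
have kq (e : R) : 0 < e -> exists q, [/\ 0 <= q, q < 1 & forall y, ~ rVball x e y -> k y <= q].
  move=> e0; exists (expR (- e ^+ 2)); split; first exact: expR_ge0.
    by rewrite -[ltRHS]expR0 ltr_expR oppr_lt0 exprn_gt0.
  move=> y /existsNP[j /negP]; rewrite -leNgt => ej.
  rewrite /k /gaussw ler_expR mul1r lerN2; apply: le_trans (coord_le_enorm2 (x - y) j).
  rewrite !mxE -[leRHS]real_normK ?num_real// distrC lerXn2r ?nnegrE ?(ltW e0)//.
have iu1 : cinteg mu u by apply: (cinteg_dom _ iA uA); exact: continuous_cmeas.
have mk : measurable_fun setT k by exact: continuous_measurable_rV.
have [cu1 cu2] := cu; have [iu2 iu3] := iu1.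
have ReI n : \int[mu]_y (Re (u y) * k y ^+ n) = 0.
  have := congr1 (@complex.Re R) (key (Num.sqrt n%:R)); rewrite /= => H; rewrite -[RHS]H.
  by apply: eq_Rintegral => y _; rewrite kn /groundC; case: (u y) => [? ?] /=; ring.
have ImI n : \int[mu]_y (Im (u y) * k y ^+ n) = 0.
  have := congr1 (@complex.Im R) (key (Num.sqrt n%:R)); rewrite /= => H; rewrite -[RHS]H.
  by apply: eq_Rintegral => y _; rewrite kn /groundC; case: (u y) => [? ?] /=; ring.
have u1 := concentration iu2 mk (cu1 x) (ck x) kx k01 kq ReI.
have u2 := concentration iu3 mk (cu2 x) (ck x) kx k01 kq ImI.
have : u x = 0 by move: u1 u2; case: (u x) => [? ?] /= -> ->.
move=> /eqP; rewrite mulf_eq0 => /orP[/eqP//|].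
by rewrite -[_ == 0]negbK -normc_gt0 normc_groundC gaussw_gt0.
Qed.

End ground.
End injectivity.

(** * Cauchy's estimates in one variable *)

Section primitives.
Variable R : realType.
Local Notation leb := (@lebesgue_measure R).
Implicit Types f F : R -> R.

(** The integrals from -n to x, for varying n, differ by constants; subtracting the value at 0
    removes these, and the functions glue to one on the whole line. *)
Lemma antiderivative f : continuous f -> exists F, forall t : R, is_derive t (1:R) F (f t).
Proof.
move=> cf.
have int a b : leb.-integrable `[a, b] (EFin \o f).
  by apply: continuous_compact_integrable; [exact: segment_compact|exact: continuous_subspaceT].
pose G (n : nat) (x : R) : R := \int[leb]_(t in `[- n%:R, x]) f t.
have GD (n : nat) (x : R) : - n%:R < x -> is_derive x (1:R) (G n) (f x).
  move=> nx; have xx : x < x + 1 by rewrite ltrDl.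
  have [h1 h2] := continuous_FTC1_closed xx (int (- n%:R) (x + 1)) nx (cf x).
  by split; [exact: h1|rewrite -derive1E; exact: h2].
have shift (n m : nat) (x : R) : (n <= m)%N -> - n%:R <= x -> G m x = G m (- n%:R) + G n x.
  move=> nm nx; have nm' : - m%:R <= - n%:R :> R by rewrite lerN2 ler_nat.
  have := @Rintegral_itvB R f (BLeft (- m%:R)) (BRight x) (- n%:R) (int _ _).
  rewrite !bnd_simp => /(_ nm' nx) H; rewrite /G -(subrK (\int[leb]_(t in `[- m%:R, - n%:R]) f t) (\int[leb]_(t in `[- m%:R, x]) f t)).
  rewrite H addrC; congr (_ + _); apply: Rintegral_itv_obnd_cbnd.
  by apply: integrableS (int (- n%:R) x) => //; exact: subset_itv_oc_cc.
pose N (x : R) := (Num.truncn `|x|).+1.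
have xN x : - (N x)%:R <= x.
  by rewrite lerNl; apply: le_trans (ltW (truncnS_gt `|x|)); rewrite -normrN ler_norm.
pose F x := G (N x) x - G (N x) 0.
have FE (n : nat) (x : R) : (N x <= n)%N -> F x = G n x - G n 0.
  move=> Nn; rewrite (shift _ _ x Nn (xN x)) (shift _ _ 0 Nn); first by rewrite /F; ring.
  by rewrite oppr_le0.
exists F => x; pose m := (Num.truncn (`|x| + 1)).+1.
apply: (@near_eq_is_derive _ _ _ (fun t => G m t - G m 0)).
  have : \forall t \near x, `|x - t| < 1 by apply/nbhs_ballP; exists 1 => //= t; rewrite -ball_normE.
  apply: filterS => t xt; rewrite (FE m)//.
  rewrite ltnS; apply: le_truncn; rewrite -[leLHS](subrK `|x|) addrC lerD2l.
  by apply: le_trans (lerB_dist _ _) _; rewrite distrC ltW.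
have mx : - m%:R < x.
  rewrite ltrNl; apply: le_lt_trans (_ : `|x| + 1 < _); last exact: truncnS_gt.
  by apply: (@le_trans _ _ `|x|); [rewrite -normrN ler_norm|rewrite lerDl].
have H := is_deriveB (GD m x mx) (is_derive_cst (G m 0) x (1:R)).
by apply: (is_derive_eq H); rewrite subr0.
Qed.

(* A primitive of f; junk when f has none. *)
Definition prim f : R -> R := xget 0 [set F : R -> R | forall t : R, is_derive t (1:R) F (f t)].

(** An oriented integral whose additivity in the end points holds by definition, so that subdividing
    a rectangle is an algebraic identity. *)
Definition prim_int (a b : R) f : R := prim f b - prim f a.

Lemma prim_derive f : continuous f -> forall t : R, is_derive t (1:R) (prim f) (f t).
Proof. by move=> /antiderivative; exact: xgetPex. Qed.

Lemma mvt_le F f (a b M : R) : (forall t : R, is_derive t (1:R) F (f t)) -> a <= b ->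
  (forall t : R, a <= t <= b -> f t <= M) -> F b - F a <= M * (b - a).
Proof.
move=> dF ab fM.
have c : {within `[a, b], continuous F}.
  by apply: derivable_within_continuous => t _; exact: ex_derive.
have [t tab ->] := MVT_segment ab (fun t _ => dF t) c.
by rewrite ler_wpM2r ?subr_ge0// fM//; move: tab; rewrite in_itv.
Qed.

Lemma mvt_abs F f (a b M : R) : (forall t : R, is_derive t (1:R) F (f t)) -> a <= b ->
  (forall t : R, a <= t <= b -> `|f t| <= M) -> `|F b - F a| <= M * (b - a).
Proof.
move=> dF ab fM; rewrite ler_norml; apply/andP; split; last first.
  by apply: (mvt_le dF) => // t /fM; rewrite ler_norml => /andP[].
have dF' t : is_derive t (1:R) (- F) (- f t) by exact: is_deriveN.
have : (- F) b - (- F) a <= M * (b - a).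
  by apply: (mvt_le dF') => // t /fM; rewrite ler_norml lerNl => /andP[].
by rewrite !fctE => h; lra.
Qed.

Lemma prim_intE f F (a b : R) : continuous f -> (forall t : R, is_derive t (1:R) F (f t)) ->
  prim_int a b f = F b - F a.
Proof.
move=> cf dF.
have D (t : R) : is_derive t (1:R) (prim f - F) 0.
  by have H := is_deriveB (prim_derive cf t) (dF t); apply: (is_derive_eq H); rewrite subrr.
by have := is_derive_0_is_cst a b D; rewrite !fctE /prim_int => h; lra.
Qed.

Lemma prim_int_affine f (a b u al be M : R) : continuous f -> a <= b ->
  (forall t : R, a <= t <= b -> `|f t - (al + be * (t - u))| <= M) ->
  `|prim_int a b f - (al * (b - a) + be * (((b - u) ^+ 2 - (a - u) ^+ 2) / 2))| <= M * (b - a).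
Proof.
move=> cf ab fM.
pose A (t : R) := al * t + be / 2 * ((t - u) * (t - u)).
have dA (t : R) : is_derive t (1:R) A (al + be * (t - u)).
  have d0 := is_deriveB (is_derive_id t (1:R)) (is_derive_cst u t (1:R)).
  have d1 := is_deriveD (is_deriveZ al (is_derive_id t (1:R))) (is_deriveZ (be / 2) (is_deriveM d0 d0)).
  apply: (is_derive_eq d1); rewrite /GRing.scale /= !fctE /= /GRing.scale /=; by field.
have H := mvt_abs (fun t => is_deriveB (prim_derive cf t) (dA t)) ab fM.
move: H; rewrite !fctE /prim_int /A => H; apply: le_trans H.
by rewrite le_eqVlt; apply/orP; left; apply/eqP; congr (`|_|); field.
Qed.

Lemma nested_segments (a b : nat -> R) :
  (forall n, a n <= a n.+1) -> (forall n, b n.+1 <= b n) -> (forall n, a n <= b n) ->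
  exists u, forall n, a n <= u <= b n.
Proof.
move=> am bm ab.
have a_le m n : (m <= n)%N -> a m <= a n.
  by move=> /subnKC <-; elim: (n - m)%N => [|k IH]; rewrite ?addn0// addnS; exact: le_trans IH (am _).
have b_le m n : (m <= n)%N -> b n <= b m.
  by move=> /subnKC <-; elim: (n - m)%N => [|k IH]; rewrite ?addn0// addnS; exact: le_trans (bm _) IH.
have abmn m n : a m <= b n.
  have [mn|/ltnW nm] := leqP m n; first exact: le_trans (a_le _ _ mn) (ab n).
  exact: le_trans (ab m) (b_le _ _ nm).
exists (sup (range a)) => n; apply/andP; split.
  by apply: ub_le_sup; [exists (b 0%N) => _ [m _ <-]|exists n].
by apply: ge_sup; [exists (a 0%N), 0%N|move=> _ [m _ <-]].
Qed.

(** * Goursat's theorem on rectangles *)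

Section goursat.
Variables P Q : R -> R -> R.
Hypotheses (cP : forall y, continuous (P^~ y)) (cQ : forall x, continuous (Q x)).

(** The integral of P dx + Q dy along the boundary, counterclockwise. *)
Definition circulation (x0 x1 y0 y1 : R) : R :=
  prim_int x0 x1 (P^~ y0) + prim_int y0 y1 (Q x1) - prim_int x0 x1 (P^~ y1) - prim_int y0 y1 (Q x0).

Lemma circulation_split (x0 x1 x2 y0 y1 y2 : R) : circulation x0 x2 y0 y2 =
  circulation x0 x1 y0 y1 + circulation x1 x2 y0 y1 +
  circulation x0 x1 y1 y2 + circulation x1 x2 y1 y2.
Proof. by rewrite /circulation /prim_int; ring. Qed.

(** The coefficient py is common to the approximations of P and Q, so the affine parts form a closed
    differential form and have circulation 0; only the errors remain. *)
Lemma circulation_small (x0 x1 y0 y1 u v p px py q qy e : R) :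
  x0 <= u <= x1 -> y0 <= v <= y1 -> 0 <= e ->
  (forall x y, x0 <= x <= x1 -> y0 <= y <= y1 ->
     `|P x y - p - (px * (x - u) + py * (y - v))| <= e * (`|x - u| + `|y - v|) /\
     `|Q x y - q - (py * (x - u) + qy * (y - v))| <= e * (`|x - u| + `|y - v|)) ->
  `|circulation x0 x1 y0 y1| <= 2 * e * ((x1 - x0) + (y1 - y0)) ^+ 2.
Proof.
move=> /andP[xu ux] /andP[yv vy] e0 H.
have x01 : x0 <= x1 by exact: le_trans ux.
have y01 : y0 <= y1 by exact: le_trans vy.
pose M := e * ((x1 - x0) + (y1 - y0)).
have bx x y : x0 <= x <= x1 -> y0 <= y <= y1 -> e * (`|x - u| + `|y - v|) <= M.
  move=> /andP[? ?] /andP[? ?]; apply: ler_wpM2l => //; apply: lerD; rewrite ler_norml; apply/andP; split; lra.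
have hP y : y0 <= y <= y1 -> `|prim_int x0 x1 (P^~ y) -
    ((p + py * (y - v)) * (x1 - x0) + px * (((x1 - u) ^+ 2 - (x0 - u) ^+ 2) / 2))| <= M * (x1 - x0).
  move=> yy; apply: prim_int_affine => // x xx; apply: le_trans (bx x y xx yy).
  apply: le_trans (H x y xx yy).1; rewrite le_eqVlt; apply/orP; left; apply/eqP; congr (`|_|); ring.
have hQ x : x0 <= x <= x1 -> `|prim_int y0 y1 (Q x) -
    ((q + py * (x - u)) * (y1 - y0) + qy * (((y1 - v) ^+ 2 - (y0 - v) ^+ 2) / 2))| <= M * (y1 - y0).
  move=> xx; apply: prim_int_affine => // y yy; apply: le_trans (bx x y xx yy).
  apply: le_trans (H x y xx yy).2; rewrite le_eqVlt; apply/orP; left; apply/eqP; congr (`|_|); ring.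
have := hP y0; rewrite lexx y01 => /(_ isT).
have := hP y1; rewrite lexx y01 => /(_ isT).
have := hQ x0; rewrite lexx x01 => /(_ isT).
have := hQ x1; rewrite lexx x01 => /(_ isT).
rewrite /circulation; move: (prim_int _ _ _) (prim_int _ _ (P^~ y0)) (prim_int _ _ (P^~ y1)) (prim_int _ _ (Q x0)) => a b c d'.
rewrite !ler_norml => /andP[a1 a2] /andP[b1 b2] /andP[c1 c2] /andP[d1 d2].
by rewrite /M in a1 a2 b1 b2 c1 c2 d1 d2; apply/andP; split; nra.
Qed.

(** Subdivision into quarters, one of which keeps at least a quarter of the circulation. At the
    common point of the nested rectangles [circulation_small] bounds it by an arbitrarily small
    multiple of the squared size, itself of order 4^-n: a contradiction. *)
Lemma goursat (x0 x1 y0 y1 : R) : x0 <= x1 -> y0 <= y1 ->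
  (forall u v : R, exists p px py q qy : R, forall e : R, 0 < e -> exists2 D : R, 0 < D &
     forall x y : R, `|x - u| < D -> `|y - v| < D ->
     `|P x y - p - (px * (x - u) + py * (y - v))| <= e * (`|x - u| + `|y - v|) /\
     `|Q x y - q - (py * (x - u) + qy * (y - v))| <= e * (`|x - u| + `|y - v|)) ->
  circulation x0 x1 y0 y1 = 0.
Proof.
move=> x01 y01 PQ; apply/eqP; rewrite -normr_eq0; apply/negPn/negP => c0.
set c := `|_| in c0; have {c0} c0 : 0 < c by rewrite lt_def c0 normr_ge0.
pose L (n : nat) := (x1 - x0) / 2 ^+ n; pose K (n : nat) := (y1 - y0) / 2 ^+ n.
have L0 n : 0 <= L n by rewrite divr_ge0 ?subr_ge0 ?exprn_ge0.
have K0 n : 0 <= K n by rewrite divr_ge0 ?subr_ge0 ?exprn_ge0.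
have LS n : L n = L n.+1 + L n.+1 by rewrite /L exprS; field; rewrite expf_neq0.
have KS n : K n = K n.+1 + K n.+1 by rewrite /K exprS; field; rewrite expf_neq0.
pose j (n : nat) (p : R * R) := circulation p.1 (p.1 + L n) p.2 (p.2 + K n).
pose big n p := c / 4 ^+ n <= `|j n p|.
have step (np : nat * (R * R)) : exists q : R * R, big np.1 np.2 ->
    [/\ np.2.1 <= q.1, q.1 + L np.1.+1 <= np.2.1 + L np.1, np.2.2 <= q.2,
        q.2 + K np.1.+1 <= np.2.2 + K np.1 & big np.1.+1 q].
  case: np => n [x y] /=.
  have l0 := L0 n.+1; have k0 := K0 n.+1; have ls := LS n; have ks := KS n.
  have [b1|b1] := leP (c / 4 ^+ n.+1) `|j n.+1 (x, y)|.
    by exists (x, y) => _; split => //=; lra.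
  have [b2|b2] := leP (c / 4 ^+ n.+1) `|j n.+1 (x + L n.+1, y)|.
    by exists (x + L n.+1, y) => _; split => //=; lra.
  have [b3|b3] := leP (c / 4 ^+ n.+1) `|j n.+1 (x, y + K n.+1)|.
    by exists (x, y + K n.+1) => _; split => //=; lra.
  have [b4|b4] := leP (c / 4 ^+ n.+1) `|j n.+1 (x + L n.+1, y + K n.+1)|.
    by exists (x + L n.+1, y + K n.+1) => _; split => //=; lra.
  (* If all four quarters fall short, so does their sum, against H; the pair given here is a
     dummy. *)
  exists (x, y) => H; exfalso.
  suff E : `|j n (x, y)| < c / 4 ^+ n by have := le_lt_trans H E; rewrite ltxx.
  rewrite /j /= ls ks !addrA (circulation_split x (x + L n.+1) _ y (y + K n.+1)).
  have -> : c / 4 ^+ n = c / 4 ^+ n.+1 + c / 4 ^+ n.+1 + c / 4 ^+ n.+1 + c / 4 ^+ n.+1.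
    by rewrite exprS; field; rewrite expf_neq0.
  by do 3!(apply: le_lt_trans (ler_normD _ _) _; apply: ltrD => //).
have [g gP] := choice step.
pose s := fix s n := if n is m.+1 then g (m, s m) else (x0, y0).
have bs n : big n (s n).
  elim: n => [|n IH]; last by have [] := gP (n, s n) IH.
  by rewrite /big expr0 divr1 /j /= /L /K !expr0 !divr1 !subrKC.
have [u uP] := @nested_segments (fun n => (s n).1) (fun n => (s n).1 + L n)
  (fun n => let: And5 a _ _ _ _ := gP (n, s n) (bs n) in a)
  (fun n => let: And5 _ a _ _ _ := gP (n, s n) (bs n) in a)
  (fun n => ltac:(by rewrite lerDl)).
have [v vP] := @nested_segments (fun n => (s n).2) (fun n => (s n).2 + K n)
  (fun n => let: And5 _ _ a _ _ := gP (n, s n) (bs n) in a)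
  (fun n => let: And5 _ _ _ a _ := gP (n, s n) (bs n) in a)
  (fun n => ltac:(by rewrite lerDl)).
pose S := (x1 - x0) + (y1 - y0).
have S0 : 0 <= S by rewrite addr_ge0// subr_ge0.
(* With this e one has 2 e S^2 < c, which contradicts a circulation of at least c / 4^n. *)
have e0 : 0 < c / (2 * S ^+ 2 + 1) by rewrite divr_gt0// ltr_wpDl// mulr_ge0 ?sqr_ge0.
have [p [px [py [q [qy H]]]]] := PQ u v.
have [D D0 HD] := H _ e0.
have [n nD] : exists n : nat, S < D * 2 ^+ n.
  exists (Num.truncn (S / D)).+1; rewrite mulrC -ltr_pdivrMr//.
  apply: lt_trans (truncnS_gt _) _; rewrite -natrX ltr_nat; exact: ltn_expl.
have LKD : L n + K n < D by rewrite -mulrDl ltr_pdivrMr// exprn_gt0.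
have : `|j n (s n)| <= 2 * (c / (2 * S ^+ 2 + 1)) * (((s n).1 + L n - (s n).1) + ((s n).2 + K n - (s n).2)) ^+ 2.
  apply: (circulation_small (uP n) (vP n) (ltW e0)) => x y /andP[xa xb] /andP[ya yb].
  have /andP[ua ub] := uP n; have /andP[va vb] := vP n.
  have l0 := L0 n; have k0 := K0 n.
  apply: HD; rewrite ltr_norml; apply/andP; split; lra.
rewrite !(addrAC _ _ (- _)) !subrr !add0r.
have -> : L n + K n = S / 2 ^+ n by rewrite -mulrDl.
move=> /(le_trans (bs n)); apply/negP; rewrite -ltNge.
have -> : (4 : R) = 2 ^+ 2 by rewrite expr2 -natrM.
rewrite -exprM [(2 * n)%N]mulnC exprM expr_div_n mulrA.
rewrite mulrA ltr_pM2r ?invr_gt0 ?exprn_gt0// mulrAC.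
rewrite ltr_pdivrMr; last by rewrite ltr_wpDl// mulr_ge0 ?sqr_ge0.
by lra.
Qed.

End goursat.
End primitives.

(** * Complex differentiability and Cauchy's formula *)

Section cauchy.
Variable R : realType.
Local Notation C := (R[i]).
Local Notation Re := complex.Re.
Local Notation Im := complex.Im.
Local Notation normc := ComplexField.Normc.normc.
Implicit Types (phi psi : C -> C) (w z l m h : C) (e : R).
Local Notation normcM := ComplexField.Normc.normcM.

Lemma is_derive1_eps (f : R -> R) (x l : R) :
  (forall e : R, 0 < e -> exists2 D : R, 0 < D & forall h : R, `|h| < D ->
     `|f (h + x) - f x - h * l| <= e * `|h|) ->
  is_derive x (1:R) f l.
Proof.
move=> H.
have cv : (fun h : R => h^-1 *: ((f \o shift x) (h *: (1:R)) - f x)) @ 0^' --> l.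
  apply/cvgrPdist_le => e e0; have [D D0 HD] := H e e0; near=> h.
  have h0 : h != 0 by near: h; exact: nbhs_dnbhs_neq.
  have hD : `|h| < D by near: h; apply: dnbhs0_lt.
  rewrite /GRing.scale /= mulr1.
  rewrite (_ : l - _ = - (h^-1 * (f (h + x) - f x - h * l))); last by field.
  rewrite normrN normrM normfV ler_pdivrMl ?normr_gt0// [leRHS]mulrC; exact: HD.
split; first by apply/cvg_ex; exists l.
exact: cvg_lim.
Unshelve. all: by end_near. Qed.

Lemma continuous_lip (f : R -> R) :
  (forall u : R, exists K D : R, [/\ 0 <= K, 0 < D &
     forall x : R, `|x - u| < D -> `|f x - f u| <= K * `|x - u|]) -> continuous f.
Proof.
move=> H u; have [K [D [K0 D0 HD]]] := H u.
apply/cvgrPdist_le => e e0.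
have d0 : 0 < Num.min D (e / (K + 1)) by rewrite lt_min D0 divr_gt0// ltr_wpDl.
have N : \forall x \near (u : R), `|u - x| < Num.min D (e / (K + 1)).
  by apply/nbhs_ballP; exists (Num.min D (e / (K + 1))) => //= t; rewrite -ball_normE.
apply: filterS N => x; rewrite lt_min => /andP[x1 x2].
rewrite distrC; rewrite distrC in x1; apply: le_trans (HD x x1) _.
rewrite ltr_pdivlMr ?ltr_wpDl// in x2; rewrite distrC; apply: le_trans (ltW x2).
by rewrite mulrC ler_wpM2l// lerDl.
Qed.

(** Differentiability over R[i] in epsilon form, with real epsilon and real modulus, so that all
    estimates take place among reals. *)
Definition cdiff phi w l := forall e, 0 < e -> exists2 D : R, 0 < D &
  forall h, normc h < D -> normc (phi (w + h) - phi w - l * h) <= e * normc h.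

Lemma cdiff_lip phi w l : cdiff phi w l -> exists2 D : R, 0 < D &
  forall h, normc h < D -> normc (phi (w + h) - phi w) <= (normc l + 1) * normc h.
Proof.
move=> /(_ 1 ltr01)[D D0 HD]; exists D => // h /HD H.
rewrite -[X in normc X](subrK (l * h)); apply: le_trans (le_normcD _ _) _.
by rewrite normcM mulrDl addrC lerD2l.
Qed.

Lemma cdiff_eq phi w l m : cdiff phi w l -> l = m -> cdiff phi w m.
Proof. by move=> H <-. Qed.

Lemma cdiff_ext phi psi w l : (forall z, phi z = psi z) -> cdiff phi w l -> cdiff psi w l.
Proof. by move=> /funext ->. Qed.

Lemma cdiff_affine z l w : cdiff (fun w => z + l * w) w l.
Proof.
move=> e e0; exists 1 => // h _.
rewrite (_ : _ - _ - _ = 0); last by ring.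
by rewrite ComplexField.Normc.normc0 mulr_ge0 ?normc_ge0// ltW.
Qed.

Lemma cdiffD phi psi w l m : cdiff phi w l -> cdiff psi w m ->
  cdiff (fun w => phi w + psi w) w (l + m).
Proof.
move=> H1 H2 e e0; have e2 : 0 < e / 2 by rewrite divr_gt0.
have [D1 D10 HD1] := H1 _ e2; have [D2 D20 HD2] := H2 _ e2.
exists (Num.min D1 D2) => [|h]; first by rewrite lt_min D10.
rewrite lt_min => /andP[/HD1 h1 /HD2 h2].
rewrite (_ : _ - _ - _ = (phi (w + h) - phi w - l * h) + (psi (w + h) - psi w - m * h)); last by ring.
by apply: le_trans (le_normcD _ _) _; lra.
Qed.

Lemma cdiffM phi psi w l m : cdiff phi w l -> cdiff psi w m ->
  cdiff (fun w => phi w * psi w) w (l * psi w + phi w * m).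
Proof.
move=> H1 H2 e e0.
pose A := normc (phi w) + normc (psi w) + 1; pose B := (normc l + 1) * (normc m + 1).
have A0 : 0 < A by rewrite ltr_wpDl// addr_ge0// normc_ge0.
have B0 : 0 < B by rewrite mulr_gt0// ltr_wpDl// normc_ge0.
have e1 : 0 < e / (2 * A) by rewrite divr_gt0// mulr_gt0.
have [D1 D10 HD1] := H1 _ e1; have [D2 D20 HD2] := H2 _ e1.
have [D3 D30 HD3] := cdiff_lip H1; have [D4 D40 HD4] := cdiff_lip H2.
have e5 : 0 < e / (2 * B) by rewrite divr_gt0// mulr_gt0.
exists (Num.min (Num.min (Num.min D1 D2) (Num.min D3 D4)) (e / (2 * B))) => [|h].
  by rewrite !lt_min D10 D20 D30 D40.
rewrite !lt_min => /andP[/andP[/andP[/HD1 h1 /HD2 h2] /andP[/HD3 h3 /HD4 h4]] h5].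
rewrite (_ : _ - _ - _ = (phi (w + h) - phi w - l * h) * psi w +
  phi w * (psi (w + h) - psi w - m * h) + (phi (w + h) - phi w) * (psi (w + h) - psi w)); last by ring.
apply: le_trans (le_normcD _ _) _.
apply: (@le_trans _ _ (e / 2 * normc h + e / 2 * normc h)); last by rewrite -mulrDl -splitr.
apply: lerD.
  apply: le_trans (le_normcD _ _) _; rewrite !normcM.
  have i1 := ler_wpM2r (normc_ge0 (psi w)) h1; have i2 := ler_wpM2l (normc_ge0 (phi w)) h2.
  apply: le_trans (lerD i1 i2) _.
  rewrite (_ : _ + _ = e / 2 * normc h * ((normc (phi w) + normc (psi w)) / A)); last by rewrite /A; field; rewrite -/A gt_eqF.
  rewrite ler_piMr//; first by rewrite mulr_ge0 ?normc_ge0// ltW// divr_gt0.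
  by rewrite ler_pdivrMr// mul1r /A lerDl.
rewrite normcM; apply: le_trans (ler_pM (normc_ge0 _) (normc_ge0 _) h3 h4) _.
rewrite [leLHS](_ : _ = B * normc h * normc h); last by rewrite /B; ring.
rewrite ler_wpM2r ?normc_ge0//.
have B2 : 0 < 2 * B by rewrite mulr_gt0.
by move: (ltW h5); rewrite ler_pdivlMr//; move: (B) => b; lra.
Qed.

Lemma cdiff_comp phi psi w l m : cdiff psi w l -> cdiff phi (psi w) m ->
  cdiff (fun w => phi (psi w)) w (m * l).
Proof.
move=> H1 H2 e e0.
have l0 : 0 < normc l + 1 by rewrite ltr_wpDl// normc_ge0.
have m0 : 0 < normc m + 1 by rewrite ltr_wpDl// normc_ge0.
have e1 : 0 < e / (2 * (normc m + 1)) by rewrite divr_gt0// mulr_gt0.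
have e2 : 0 < e / (2 * (normc l + 1)) by rewrite divr_gt0// mulr_gt0.
have [D1 D10 HD1] := H1 _ e1; have [D2 D20 HD2] := H2 _ e2.
have [D3 D30 HD3] := cdiff_lip H1.
exists (Num.min (Num.min D1 D3) (D2 / (normc l + 1))) => [|h].
  by rewrite !lt_min D10 D30 divr_gt0.
rewrite !lt_min => /andP[/andP[/HD1 h1 /HD3 h3]]; rewrite ltr_pdivlMr// mulrC => h2.
have {}h2 := HD2 _ (le_lt_trans h3 h2); rewrite subrKC in h2.
rewrite (_ : _ - _ - _ = (phi (psi (w + h)) - phi (psi w) - m * (psi (w + h) - psi w)) +
   m * (psi (w + h) - psi w - l * h)); last by ring.
apply: le_trans (le_normcD _ _) _.
apply: (@le_trans _ _ (e / 2 * normc h + e / 2 * normc h)); last by rewrite -mulrDl -splitr.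
apply: lerD.
  apply: le_trans h2 _; have := ler_wpM2l (ltW e2) h3; move/le_trans; apply.
  by rewrite le_eqVlt; apply/orP; left; apply/eqP; field; rewrite gt_eqF.
rewrite normcM; apply: (@le_trans _ _ ((normc m + 1) * (e / (2 * (normc m + 1)) * normc h))).
  by apply: ler_pM; rewrite ?normc_ge0// lerDl.
by rewrite le_eqVlt; apply/orP; left; apply/eqP; field; rewrite gt_eqF.
Qed.

Lemma cdiff_cexp w : cdiff (fun w => cexp w) w (cexp w).
Proof.
move=> e e0; have c0 : 0 < normc (cexp w) * expR 1 + 1.
  by rewrite ltr_wpDl// mulr_ge0 ?expR_ge0 ?normc_ge0.
exists (Num.min 1 (e / (normc (cexp w) * expR 1 + 1))) => [|h].
  by rewrite lt_min ltr01 divr_gt0.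
rewrite lt_min => /andP[h1]; rewrite ltr_pdivlMr// => h2.
rewrite cexpD (_ : _ - _ - _ = cexp w * (cexp h - 1 - h)); last by ring.
rewrite normcM; apply: (@le_trans _ _ (normc (cexp w) * (normc h ^+ 2 * expR 1))).
  rewrite ler_wpM2l ?normc_ge0//; apply: le_trans (cexp_taylor2 h) _.
  by rewrite ler_wpM2l ?exprn_ge0 ?normc_ge0// ler_expR ltW.
rewrite (_ : _ * _ = normc h * (normc (cexp w) * expR 1) * normc h); last by ring.
rewrite ler_wpM2r ?normc_ge0//; apply: le_trans (ltW h2).
by rewrite ler_wpM2l ?normc_ge0// lerDl.
Qed.

Lemma cdiff_unique phi w l m : cdiff phi w l -> cdiff phi w m -> l = m.
Proof.
move=> H1 H2; apply/eqP; rewrite -subr_eq0 -[_ == 0]negbK -normc_gt0 -leNgt.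
apply/ler_addgt0Pr => e e0; rewrite add0r; have e2 : 0 < e / 2 by rewrite divr_gt0.
have [D1 D10 HD1] := H1 _ e2; have [D2 D20 HD2] := H2 _ e2.
pose d := Num.min D1 D2 / 2.
have m0 : 0 < Num.min D1 D2 by rewrite lt_min D10.
have d0 : 0 < d by rewrite divr_gt0.
have dm : d < Num.min D1 D2 by rewrite /d; lra.
have nd : normc d%:C = d by rewrite normc_real ger0_norm// ltW.
move: dm; rewrite lt_min -nd => /andP[/HD1 h1 /HD2 h2].
rewrite -(ler_pM2r d0) -[X in _ * X <= _]nd -normcM.
rewrite (_ : _ * _ = (phi (w + d%:C) - phi w - m * d%:C) - (phi (w + d%:C) - phi w - l * d%:C)); last by ring.
apply: le_trans (le_normcD _ _) _; rewrite normcN; move: h1 h2; rewrite nd; lra.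
Qed.

Lemma normc_re_im (a b : R) : normc (a%:C + ci R * b%:C) <= `|a| + `|b|.
Proof.
apply: le_trans (le_normcD _ _) _; rewrite normcM !normc_real (_ : normc (ci R) = 1) ?mul1r//.
by rewrite /ci /= expr0n expr1n add0r sqrtr1.
Qed.

Lemma cdiff_line phi w h l (a : C) (t : R) : cdiff phi (w + t%:C * h) l ->
  is_derive t (1:R) (fun t : R => Re (a * phi (w + t%:C * h))) (Re (a * (l * h))).
Proof.
move=> H; have H' : cdiff (fun s => a * phi (w + s * h)) t%:C (a * (l * h)).
  have c1 : cdiff (fun s : C => w + s * h) t%:C h.
    by apply: cdiff_ext (cdiff_affine w h _) => s; rewrite mulrC.
  have := cdiffM (cdiff_affine a 0 t%:C) (cdiff_comp c1 H).
  rewrite !mul0r add0r addr0 => H2; apply: cdiff_ext H2 => s; by rewrite mul0r addr0.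
apply: is_derive1_eps => e e0; have [D D0 HD] := H' e e0.
exists D => // s sD; have := HD s%:C; rewrite !normc_real => /(_ sD); apply: le_trans.
apply: le_trans (ler_Re_normc _); rewrite [s + t]addrC rmorphD.
set u := phi _; set v := phi _; move: u v (l * h) => u v k.
by rewrite le_eqVlt; apply/orP; left; apply/eqP; congr (`|_|); case: (a) u v k => [? ?] [? ?] [? ?] [? ?] /=; ring.
Qed.

Lemma is_derive1_continuous (f : R -> R) (x l : R) : is_derive x (1:R) f l -> {for x, continuous f}.
Proof. by move=> df; apply/differentiable_continuous/derivable1_diffP; exact: ex_derive. Qed.

Lemma cdiff_line_continuous phi a w h : (forall w, exists l, cdiff phi w l) ->
  continuous (fun t : R => Re (a * phi (w + t%:C * h))).
Proof.
move=> dphi t; have [l H] := dphi (w + t%:C * h).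
exact: (is_derive1_continuous (cdiff_line a H)).
Qed.

Lemma cexp_2pi w : cexp (w + ci R * (2 * pi)%:C) = cexp w.
Proof.
rewrite cexpD [X in _ * X](_ : _ = 1) ?mulr1// /cexp /=.
have -> : 0 * (2 * pi) - 1 * 0 = 0 :> R by ring.
have -> : 0 * 0 + 1 * (2 * pi) = pi *+ 2 :> R by rewrite mulr2n; ring.
by rewrite expR0 cos2pi sin2pi !mul1r.
Qed.

Section entire1.
Variables (phi phi' : C -> C).
Hypothesis dphi : forall w, cdiff phi w (phi' w).

Lemma cdiff_lipschitz w h (B : R) :
  (forall t : R, 0 <= t <= 1 -> normc (phi' (w + t%:C * h)) <= B) ->
  normc (phi (w + h) - phi w) <= B * normc h.
Proof.
move=> HB; apply: normc_leP => a a1.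
have := @mvt_le R _ _ 0 1 (B * normc h) (fun t => cdiff_line a (dphi (w + t%:C * h))) ler01.
rewrite rmorph1 mul1r rmorph0 mul0r addr0 subr0 mulr1 mulrBr.
have -> : Re (a * phi (w + h) - a * phi w) = Re (a * phi (w + h)) - Re (a * phi w).
  by case: (a * phi (w + h)) (a * phi w) => [? ?] [? ?].
apply => t t01; apply: le_trans (Re_mul_le _ a1) _; rewrite normcM ler_wpM2r ?normc_ge0//.
exact: HB.
Qed.

Lemma polar_cdiff (a z0 r q w : C) :
  exists l, cdiff (fun w => a * (phi (z0 + r * cexp w) * (q * cexp (- w)))) w l.
Proof.
have c1 := cdiff_comp (cdiff_cexp w) (cdiff_affine z0 r (cexp w)).
have c2 : cdiff (fun w => - w) w (-1).
  by apply: cdiff_ext (cdiff_affine 0 (-1) w) => z; rewrite add0r mulN1r.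
have c3 := cdiff_comp (cdiff_comp c2 (cdiff_cexp (- w))) (cdiff_affine 0 q (cexp (- w))).
have c4 := cdiffM (cdiff_comp c1 (dphi (z0 + r * cexp w))) c3.
eexists; apply: cdiff_ext (cdiff_comp c4 (cdiff_affine 0 a _)) => z.
by rewrite !add0r.
Qed.

(** In the coordinate w = log (z - z0) circles become vertical segments of length 2 pi. The function
    G has period 2 pi i, so the horizontal sides of a rectangle cancel in [goursat] and the integral
    does not depend on the radius; shrinking the radius gives its value. *)
Lemma cauchy_derivative (a z0 : C) (r : R) : 0 < r ->
  prim_int 0 (2 * pi) (fun th : R => Re (a * (phi (z0 + r%:C * cexp (ci R * th%:C)) * ((r^-1)%:C * cexp (- (ci R * th%:C)))))) =
  2 * pi * Re (a * phi' z0).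
Proof.
pose G w : C := a * (phi (z0 + cexp w) * cexp (- w)).
have dG w : exists l, cdiff G w l.
  have [l H] := polar_cdiff a z0 1 1 w; exists l; apply: cdiff_ext H => v.
  by rewrite !mul1r.
have [G' dG'] := choice dG.
pose W (x y : R) : C := x%:C + ci R * y%:C.
(* P dx + Q dy is the imaginary part of G dw. *)
pose P (x y : R) := Im (G (W x y)); pose Q (x y : R) := Re (G (W x y)).
have QP (u v : R) : exists p px py q qy : R, forall e : R, 0 < e -> exists2 D : R, 0 < D &
     forall x y : R, `|x - u| < D -> `|y - v| < D ->
     `|P x y - p - (px * (x - u) + py * (y - v))| <= e * (`|x - u| + `|y - v|) /\
     `|Q x y - q - (py * (x - u) + qy * (y - v))| <= e * (`|x - u| + `|y - v|).
  exists (P u v), (Im (G' (W u v))), (Re (G' (W u v))), (Q u v), (- Im (G' (W u v))) => e e0.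
  have [D D0 HD] := dG' (W u v) e e0.
  exists (D / 2) => [|x y xu yv]; first by rewrite divr_gt0.
  have hb := normc_re_im (x - u) (y - v).
  have := HD ((x - u)%:C + ci R * (y - v)%:C) _.
  rewrite (_ : W u v + _ = W x y); last by rewrite /W !rmorphB; ring.
  move=> H; have {}H : normc (G (W x y) - G (W u v) - G' (W u v) * ((x - u)%:C + ci R * (y - v)%:C)) <= e * (`|x - u| + `|y - v|).
    apply: le_trans (H _) _; last by rewrite ler_wpM2l// ltW.
    by apply: le_lt_trans hb _; lra.
  split; (apply: le_trans H; rewrite /P /Q).
    apply: le_trans (ler_Im_normc _); rewrite le_eqVlt; apply/orP; left; apply/eqP; congr (`|_|).
    by case: (G (W x y)) (G (W u v)) (G' (W u v)) => [? ?] [? ?] [? ?] /=; ring.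
  apply: le_trans (ler_Re_normc _); rewrite le_eqVlt; apply/orP; left; apply/eqP; congr (`|_|).
  by case: (G (W x y)) (G (W u v)) (G' (W u v)) => [? ?] [? ?] [? ?] /=; ring.
have cP y : continuous (P^~ y).
  rewrite (_ : P^~ y = (fun x : R => Re (- ci R * G (ci R * y%:C + x%:C * 1)))).
    by apply: cdiff_line_continuous => w; exists (G' w).
  apply/funext => x; rewrite /P /W mulr1 addrC.
  by case: (G _) => [? ?] /=; ring.
have cQ x : continuous (Q x).
  rewrite (_ : Q x = (fun y : R => Re (1 * G (x%:C + y%:C * ci R)))).
    by apply: cdiff_line_continuous => w; exists (G' w).
  by apply/funext => y; rewrite /Q /W mul1r [y%:C * _]mulrC.
have pi0 : 0 <= 2 * pi :> R by rewrite mulr_ge0// pi_ge0.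
have per x : P x (2 * pi) = P x 0.
  have E : W x (2 * pi) = W x 0 + ci R * (2 * pi)%:C by rewrite /W rmorph0 mulr0 addr0.
  rewrite /P /G E cexp_2pi; congr (Im (_ * (_ * _))).
  by rewrite opprD -[LHS]cexp_2pi subrK.
have Kc x y : x <= y -> prim_int 0 (2 * pi) (Q x) = prim_int 0 (2 * pi) (Q y).
  move=> xy; have := goursat cP cQ xy pi0 QP; rewrite /circulation.
  have -> : P^~ (2 * pi) = P^~ 0 by apply/funext => t; exact: per.
  by move=> h; lra.
have WN x y : cexp (- W x y) = cexp (- x%:C) * cexp (- (ci R * y%:C)) by rewrite -cexpD -opprD.
have main x : prim_int 0 (2 * pi) (Q x) = 2 * pi * Re (a * phi' z0).
  apply/eqP; rewrite -subr_eq0 -normr_le0; apply/ler_addgt0Pr => e e0; rewrite add0r.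
  have A0 : 0 < 2 * pi * normc a + 1 by rewrite ltr_wpDl// mulr_ge0 ?normc_ge0.
  have e1 : 0 < e / (2 * pi * normc a + 1) by rewrite divr_gt0.
  have [D D0 HD] := dphi z0 e1.
  (* A radius e^y that exceeds neither e^x nor D / 2, small enough for the expansion of phi at
     z0. *)
  pose y := Num.min x (ln (D / 2)).
  have yx : y <= x by rewrite ge_min lexx.
  have D2 : 0 < D / 2 by rewrite divr_gt0.
  have yD : expR y < D.
    apply: (@le_lt_trans _ _ (D / 2)); last by lra.
    by rewrite -[leRHS]lnK ?posrE// ler_expR ge_min lexx orbT.
  rewrite -(Kc _ _ yx).
  (* The constant term phi z0 contributes a multiple of e^(-w); its primitive A in the angle takes
     the same value at 0 and 2 pi, so this contribution is 0. *)
  pose b := a * phi z0 * cexp (- y%:C).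
  pose A (th : R) := Re (b * ci R * cexp (th%:C * - ci R)).
  have dA (th : R) : is_derive th (1:R) A (Re (b * cexp (th%:C * - ci R))).
    have := is_derive_Re_cexp (b * ci R) (- ci R) th.
    by rewrite -[b * ci R * - ci R]mulrA [ci R * - ci R]mulrN ciM opprK mulr1.
  have perA : A (2 * pi) = A 0.
    rewrite /A rmorph0 mul0r; congr (Re (_ * _)).
    by rewrite -[LHS]cexp_2pi mulrN [ci R * _]mulrC addrC subrr.
  have dL (th : R) : is_derive th (1:R) (fun t : R => t * Re (a * phi' z0)) (Re (a * phi' z0)).
    have H := is_deriveM (is_derive_id th (1:R)) (is_derive_cst (Re (a * phi' z0)) th (1:R)).
    by apply: (is_derive_eq H); rewrite /GRing.scale /= mulr0 mulr1 add0r.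
  have dF (th : R) := is_deriveB (is_deriveB (prim_derive (cQ y) th) (dA th)) (dL th).
  have := mvt_abs (M := normc a * (e / (2 * pi * normc a + 1))) dF pi0.
  rewrite !fctE perA /prim_int subr0 mul0r subr0.
  rewrite (_ : prim (Q y) (2 * pi) - A 0 - _ - _ = prim (Q y) (2 * pi) - prim (Q y) 0 - 2 * pi * Re (a * phi' z0)); last by ring.
  move=> H; apply: le_trans (H _) _; last first.
    rewrite [normc a * (e / _)]mulrA mulrAC ler_pdivrMr//; move: (normc a) => c; lra.
  move=> th _; set zeta := cexp (W y th).
  have nz : normc zeta = expR y.
    by rewrite /zeta /W cexpD cexp_real normcM normc_real cexp_ci mulr1 ger0_norm// expR_ge0.
  have zn : normc zeta < D by rewrite nz.
  have := HD _ zn; have z0' : zeta != 0 by exact: cexp_neq0.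
  have -> : Q y th - Re (b * cexp (th%:C * - ci R)) - Re (a * phi' z0) =
    Re (a * ((phi (z0 + zeta) - phi z0 - phi' z0 * zeta) / zeta)).
    have -> : b * cexp (th%:C * - ci R) = a * (phi z0 / zeta).
      by rewrite -cexpN WN /b mulrN [th%:C * _]mulrC -!mulrA.
    rewrite /Q /G cexpN -/zeta [in RHS]mulrBl mulfK// [in RHS]mulrBl.
    by case: (a) (phi (z0 + zeta) / zeta) (phi z0 / zeta) (phi' z0) => [? ?] [? ?] [? ?] [? ?] /=; ring.
  move=> h; apply: le_trans (ler_Re_normc _) _; rewrite normcM ler_wpM2l ?normc_ge0//.
  rewrite normcM ComplexField.Normc.normcV ler_pdivrMr//.
  by rewrite nz expR_gt0.
move=> r0; rewrite -(main (ln r)); congr (prim_int _ _ _); apply/funext => th.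
rewrite /Q /G WN /W cexpD -rmorphN !cexp_real expRN lnK ?posrE//.
Qed.

Lemma cauchy_estimate (z0 : C) (r M : R) : 0 < r ->
  (forall w, normc (w - z0) = r -> normc (phi w) <= M) -> normc (phi' z0) <= M / r.
Proof.
move=> r0 HM; apply: normc_leP => a a1.
have pi0 : 0 < 2 * pi :> R by rewrite mulr_gt0// pi_gt0.
rewrite -(ler_pM2l pi0) -(cauchy_derivative a z0 r0).
set g := fun th : R => _.
have cg : continuous g.
  rewrite /g; under eq_fun => th do rewrite -[a * _]mul1r -[ci R * th%:C]add0r [ci R * _]mulrC.
  apply: (@cdiff_line_continuous (fun w => a * (phi (z0 + r%:C * cexp w) * ((r^-1)%:C * cexp (- w))))) => w.
  exact: polar_cdiff.
rewrite /prim_int; apply: le_trans (mvt_le (M := M / r) (prim_derive cg) (ltW pi0) _) _; last first.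
  by rewrite subr0 mulrC.
move=> th _; apply: le_trans (Re_mul_le _ a1) _.
rewrite [leLHS]normcM [normc (_ * cexp _)]normcM -mulrN -rmorphN normc_real cexp_ci mulr1 ger0_norm ?invr_ge0 ?(ltW r0)//.
rewrite ler_pM2r ?invr_gt0//; apply: HM.
by rewrite addrC addKr normcM normc_real cexp_ci mulr1 ger0_norm// ltW.
Qed.

End entire1.

(** The derivative is bounded by M / r up to distance 3 r. The derivative of w -> phi (w + v) - phi
    w at z0 is then bounded by M |v| / r^2, and the mean value inequality integrates this. Only
    first derivatives appear. *)
Lemma cdiff_taylor phi phi' (z0 h : C) (r M : R) : (forall w, cdiff phi w (phi' w)) ->
  0 < r -> normc h <= r ->
  (forall w, normc (w - z0) <= 4 * r -> normc (phi w) <= M) ->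
  normc (phi (z0 + h) - phi z0 - phi' z0 * h) <= M / r ^+ 2 * normc h ^+ 2.
Proof.
move=> dphi r0 hr HM.
have d1 w : normc (w - z0) <= 3 * r -> normc (phi' w) <= M / r.
  move=> wr; apply: (cauchy_estimate dphi) => // v vr; apply: HM.
  rewrite (_ : v - z0 = (v - w) + (w - z0)); last by ring.
  by apply: le_trans (le_normcD _ _) _; rewrite vr; lra.
have nt (t : R) (v : C) : 0 <= t <= 1 -> normc (t%:C * v) <= normc v.
  by move=> /andP[t0 t1]; rewrite normcM normc_real ger0_norm// ler_piMl ?normc_ge0.
have d2 v : normc v <= r -> normc (phi' (z0 + v) - phi' z0) <= M / r * normc v / r.
  move=> vr.
  have dd w : cdiff (fun w => phi (w + v) - phi w) w (phi' (w + v) - phi' w).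
    have c1 := cdiff_comp (cdiff_affine v 1 w) (dphi (v + 1 * w)).
    have c2 := cdiff_comp (dphi w) (cdiff_affine 0 (-1) (phi w)).
    have c3 := cdiffD c1 c2.
    rewrite mulr1 mulN1r mul1r addrC in c3; rewrite [w + v]addrC [_ - phi' w]addrC; apply: cdiff_ext c3 => z.
    by rewrite mul1r add0r mulN1r [v + z]addrC.
  apply: (cauchy_estimate dd) => // w wr; apply: (cdiff_lipschitz dphi) => t t01; apply: d1.
  rewrite (_ : w + _ - z0 = (w - z0) + t%:C * v); last by ring.
  by apply: le_trans (le_normcD _ _) _; rewrite wr; have := nt t v t01; lra.
have d3 w : cdiff (fun w => phi w - phi' z0 * w) w (phi' w - phi' z0).
  have c3 := cdiffD (dphi w) (cdiff_affine 0 (- phi' z0) w).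
  by apply: cdiff_ext c3 => z; rewrite add0r mulNr.
have := @cdiff_lipschitz _ _ d3 z0 h (M / r * normc h / r) _.
rewrite (_ : _ - _ - (_ - _) = phi (z0 + h) - phi z0 - phi' z0 * h); last by ring.
rewrite (_ : M / r ^+ 2 * normc h ^+ 2 = M / r * normc h / r * normc h); last by field; rewrite gt_eqF.
apply => t t01; apply: le_trans (d2 _ _) _; first by exact: le_trans (nt t h t01) hr.
rewrite ler_pM2r ?invr_gt0// ler_wpM2l ?nt//; apply: divr_ge0; last exact: ltW.
by apply: le_trans (HM z0 _); rewrite ?normc_ge0// subrr ComplexField.Normc.normc0 mulr_ge0// ltW.
Qed.

End cauchy.

(** * Entire functions of several variables *)

Lemma derive_row_sum (K : numFieldType) d (F : 'rV[K]_d -> K^o) (z v : 'rV[K]_d) :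
  differentiable F z -> 'D_v F z = \sum_j v ord0 j * 'D_(delta_mx ord0 j) F z.
Proof.
move=> dF; have vE : v = \sum_j v ord0 j *: delta_mx ord0 j.
  by rewrite [LHS]matrix_sum_delta big_ord1.
rewrite deriveE// {1}vE linear_sum.
by apply: eq_bigr => j _; rewrite linearZ deriveE.
Qed.

Lemma differentiable_eps (K : numFieldType) d (F : 'rV[K]_d -> K^o) (z v : 'rV[K]_d) (e : K) :
  differentiable F z -> 0 < e ->
  exists2 D : K, 0 < D & forall t : K, `|t| < D -> t != 0 ->
    `|(\sum_j v ord0 j * 'D_(delta_mx ord0 j) F z) - t^-1 * (F (t *: v + z) - F z)| <= e.
Proof.
move=> dF e0; have dv : derivable F z v by exact: diff_derivable.
have : (fun h : K => h^-1 *: ((F \o shift z) (h *: v) - F z)) @ (0 : K)^' --> ('D_v F z : K^o) by exact: dv.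
rewrite derive_row_sum// => /cvgrPdist_le /(_ e e0) /nbhs_ballP[/= D D0 HD].
exists D => // t tD t0; have := HD t; rewrite -ball_normE /= sub0r normrN.
by move=> /(_ tD t0).
Qed.

Section several_variables.
Variables (R : realType) (d : nat).
Local Notation C := (R[i]).
Local Notation Re := complex.Re.
Local Notation Im := complex.Im.
Local Notation normc := ComplexField.Normc.normc.
Local Notation normcM := ComplexField.Normc.normcM.
Implicit Types (F G : 'rV[R[i]]_d -> C^o) (z h v w : 'rV[R[i]]_d).

Definition Cbasis (j : 'I_d) : 'rV[R[i]]_d := delta_mx ord0 j.

Definition dC (j : 'I_d) F z : C := 'D_(Cbasis j) F z.

Lemma differentiable_cdiff F z v : entire F ->
  cdiff (fun t : C => F (z + t *: v)) 0 (\sum_j v ord0 j * dC j F z).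
Proof.
move=> eF e e0.
have eC : 0 < e%:C :> C by rewrite ltcR.
have [D D0 HD] := differentiable_eps v (eF z) eC.
have [D' DE] : exists D' : R, D = D'%:C.
  by move: D0; case: (D) => a b; rewrite ltcE /= => /andP[/eqP -> _]; exists a.
rewrite -/(dC _ F z) in HD; set l := \sum_j _.
rewrite DE in D0 HD; exists D' => [|t tD]; first by rewrite ltcR in D0.
rewrite add0r scale0r addr0.
have [->|t0] := eqVneq t 0.
  by rewrite scale0r addr0 subrr mulr0 subr0 ComplexField.Normc.normc0 mulr0.
have := HD t; rewrite normCE ltcR => /(_ tD t0).
rewrite normCE lecR => h.
rewrite (_ : F (z + t *: v) - F z - l * t = - (t * (l - t^-1 * (F (z + t *: v) - F z)))); last by field.
rewrite normcN normcM mulrC ler_wpM2r ?normc_ge0//.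
by move: h; rewrite /GRing.scale /= [t *: v + z]addrC.
Qed.

Lemma entire_cdiff F z v (t : C) : entire F ->
  cdiff (fun t : C => F (z + t *: v)) t (\sum_j v ord0 j * dC j F (z + t *: v)).
Proof.
move=> eF e e0; have [D D0 HD] := differentiable_cdiff (z + t *: v) v eF e0.
exists D => // s sD; have := HD s sD; rewrite add0r scale0r addr0.
by have -> : z + (t + s) *: v = z + t *: v + s *: v by rewrite scalerDl addrA.
Qed.

Lemma entire_cdiff_basis F j z : entire F -> forall t, cdiff (fun t : C => F (z + t *: Cbasis j)) t (dC j F (z + t *: Cbasis j)).
Proof.
move=> eF t; apply: cdiff_eq (entire_cdiff z (Cbasis j) t eF) _.
rewrite (bigD1 j)//= big1 ?addr0; last by move=> k kj; rewrite mxE eqxx (negPf kj) mul0r.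
by rewrite mxE !eqxx mul1r.
Qed.

Definition polydisc z (r : R) : set 'rV[R[i]]_d := [set w | forall j, normc (w ord0 j - z ord0 j) <= r].

Lemma polydiscD z r v s : (forall j, normc (v ord0 j) <= s) -> polydisc z r `<=` [set w | polydisc z (r + s) (w + v)].
Proof.
move=> vs w zw j; rewrite mxE addrAC; apply: le_trans (le_normcD _ _) _.
exact: lerD.
Qed.

Lemma normc_basis j k (t : C) : normc ((t *: Cbasis j) ord0 k) <= normc t.
Proof.
rewrite !mxE eqxx; case: eqP => _ /=; first by rewrite mulr1.
by rewrite mulr0 ComplexField.Normc.normc0 normc_ge0.
Qed.

Lemma dC_estimate F j z (r M : R) : entire F -> 0 < r ->
  (forall w, polydisc z r w -> normc (F w) <= M) -> normc (dC j F z) <= M / r.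
Proof.
move=> eF r0 HM; have := cauchy_estimate (z0 := 0) (M := M) (entire_cdiff_basis j z eF) r0.
rewrite scale0r addr0; apply => t; rewrite subr0 => tr; apply: HM => k.
rewrite (_ : _ - _ = (t *: Cbasis j) ord0 k) -?tr ?normc_basis//.
by rewrite [in LHS]mxE addrAC subrr add0r.
Qed.

(** Reduction to one variable along t -> z + t h / e, at t = e: the direction has coordinates of
    modulus at most 1, so the disc of radius 4 of [cdiff_taylor] stays in the polydisc. *)
Lemma entire_taylor F z h (M e : R) : entire F -> 0 <= e -> e <= 1 ->
  (forall j, normc (h ord0 j) <= e) -> (forall w, polydisc z 4 w -> normc (F w) <= M) ->
  normc (F (z + h) - F z - \sum_j h ord0 j * dC j F z) <= M * e ^+ 2.
Proof.
move=> eF e0 e1 he HM; move: e0; rewrite le_eqVlt => /predU1P[e0|e0].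
  have h0 : h = 0.
    apply/rowP => j; rewrite mxE; apply/eqP; rewrite -[_ == _]negbK -normc_gt0 -leNgt.
    by rewrite e0.
  rewrite h0 addr0 subrr sub0r normcN big1 ?ComplexField.Normc.normc0; last by move=> j _; rewrite mxE mul0r.
  by rewrite -e0 expr0n /= mulr0.
pose v : 'rV[R[i]]_d := (e^-1)%:C *: h.
have ne : normc e%:C = e by rewrite normc_real ger0_norm// ltW.
have hE : h = e%:C *: v by rewrite scalerA -rmorphM mulfV ?gt_eqF// rmorph1 scale1r.
have v1 j : normc (v ord0 j) <= 1.
  rewrite mxE normcM normc_real ger0_norm ?invr_ge0 ?(ltW e0)//.
  by rewrite mulrC ler_pdivrMr// mul1r.
have := cdiff_taylor (z0 := 0) (h := e%:C) (r := 1) (M := M) (fun t => entire_cdiff z v t eF) ltr01.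
rewrite ne => /(_ e1); rewrite add0r scale0r addr0 expr1n divr1 -hE.
have -> : (\sum_j v ord0 j * dC j F z) * e%:C = \sum_j h ord0 j * dC j F z.
  rewrite mulr_suml; apply: eq_bigr => j _.
  have -> : h ord0 j = e%:C * v ord0 j by rewrite {1}hE mxE.
  by move: (v ord0 j) => vj; ring.
apply => t; rewrite subr0 mulr1 => t4; apply: HM => j.
rewrite (_ : _ - _ = t * v ord0 j); last by rewrite [in LHS]mxE addrAC subrr add0r mxE.
by rewrite normcM; apply: le_trans (ler_pM _ _ t4 (v1 j)) _; rewrite ?normc_ge0// mulr1.
Qed.

Lemma entire_lip F z h (M e : R) : entire F -> 0 <= e -> e <= 1 ->
  (forall j, normc (h ord0 j) <= e) -> (forall w, polydisc z 2 w -> normc (F w) <= M) ->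
  normc (F (z + h) - F z) <= M * e.
Proof.
move=> eF e0 e1 he HM; move: e0; rewrite le_eqVlt => /predU1P[e0|e0].
  have h0 : h = 0.
    apply/rowP => j; rewrite mxE; apply/eqP; rewrite -[_ == _]negbK -normc_gt0 -leNgt.
    by rewrite e0.
  by rewrite h0 addr0 subrr -e0 mulr0 ComplexField.Normc.normc0.
pose v : 'rV[R[i]]_d := (e^-1)%:C *: h.
have ne : normc e%:C = e by rewrite normc_real ger0_norm// ltW.
have hE : h = e%:C *: v by rewrite scalerA -rmorphM mulfV ?gt_eqF// rmorph1 scale1r.
have v1 j : normc (v ord0 j) <= 1.
  rewrite mxE normcM normc_real ger0_norm ?invr_ge0 ?(ltW e0)//.
  by rewrite mulrC ler_pdivrMr// mul1r.
have dF := fun t => entire_cdiff z v t eF.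
have := cdiff_lipschitz (w := 0) (h := e%:C) (B := M) dF.
rewrite ne add0r scale0r addr0 -hE; apply => t /andP[t0 t1]; rewrite add0r.
rewrite -[leRHS]divr1; apply: (cauchy_estimate dF) => // s sr; apply: HM => j.
have s2 : normc s <= 2.
  rewrite -[s](subrK (t%:C * e%:C)); apply: le_trans (le_normcD _ _) _; rewrite sr -rmorphM normc_real ger0_norm; last by rewrite mulr_ge0// ltW.
  have : t * e <= 1 by rewrite -[leRHS]mulr1; apply: ler_pM => //; exact: ltW.
  by move: (t * e) => x; lra.
rewrite (_ : _ - _ = s * v ord0 j); last by rewrite [in LHS]mxE addrAC subrr add0r mxE.
by rewrite normcM; apply: le_trans (ler_pM _ _ s2 (v1 j)) _; rewrite ?normc_ge0// mulr1.
Qed.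

Lemma entire_translate F v : entire F -> entire (fun z => F (z + v)).
Proof.
move=> eF z; apply: (@differentiable_comp _ _ _ _ (fun z => z + v) F); last exact: eF.
by apply: differentiableD => //; exact: differentiable_cst.
Qed.

Lemma dC_unique F j z (l : C) : entire F -> cdiff (fun t : C => F (z + t *: Cbasis j)) 0 l -> dC j F z = l.
Proof.
move=> eF; apply: cdiff_unique; have := entire_cdiff_basis j z eF 0.
by rewrite scale0r addr0.
Qed.

Lemma dC_lin F G j z (a : C) : entire F -> entire G -> dC j (a *: F + G) z = a * dC j F z + dC j G z.
Proof.
move=> eF eG; apply: dC_unique; first exact: entire_lin.
have c1 := entire_cdiff_basis j z eF 0; have c2 := entire_cdiff_basis j z eG 0.
rewrite scale0r addr0 in c1 c2.
have c3 := cdiffD (cdiff_comp c1 (cdiff_affine 0 a _)) c2.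
by apply: cdiff_ext c3 => t; rewrite add0r.
Qed.

(** Cauchy's estimate for z -> F (z + h) - F z, whose size [entire_lip] controls. *)
Lemma dC_lip F j z h (M e : R) : entire F -> 0 <= e -> e <= 1 ->
  (forall j, normc (h ord0 j) <= e) -> (forall w, polydisc z 3 w -> normc (F w) <= M) ->
  normc (dC j F (z + h) - dC j F z) <= M * e.
Proof.
move=> eF e0 e1 he HM.
pose G : 'rV[R[i]]_d -> C^o := (-1) *: F + (fun z => F (z + h)).
have eG : entire G by apply: entire_lin => //; exact: entire_translate.
have E1 : dC j (fun z => F (z + h)) z = dC j F (z + h).
  apply: dC_unique; first exact: entire_translate.
  have := entire_cdiff_basis j (z + h) eF 0; rewrite scale0r addr0.
  by apply: cdiff_ext => t; rewrite addrAC.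
have E2 : dC j G z = dC j F (z + h) - dC j F z.
  by rewrite /G (dC_lin j z (-1) eF (entire_translate h eF)) E1 mulN1r addrC.
rewrite -E2.
rewrite -[leRHS]divr1; apply: dC_estimate => // w zw.
rewrite /G fctE /= scaleN1r addrC; apply: entire_lip => // u wu; apply: HM => k.
rewrite (_ : _ - _ = (u ord0 k - w ord0 k) + (w ord0 k - z ord0 k)); last by ring.
by apply: le_trans (le_normcD _ _) _; have := wu k; have := zw k; lra.
Qed.

(** * Circle integrals and the regularity of partial derivatives *)

Definition loclip (f : R -> C) := forall u : R, exists K D : R, [/\ 0 <= K, 0 < D &
  forall x : R, `|x - u| < D -> normc (f x - f u) <= K * `|x - u|].

Lemma loclip_continuous f (a : C) : loclip f -> continuous (fun x : R => Re (a * f x)).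
Proof.
move=> lf; apply: continuous_lip => u; have [K [D [K0 D0 HD]]] := lf u.
exists (normc a * K), D; split=> //; first by rewrite mulr_ge0 ?normc_ge0.
move=> x /HD h; rewrite -mulrA; apply: le_trans (ler_wpM2l (normc_ge0 a) h).
rewrite -normcM; apply: le_trans (ler_Re_normc _).
by rewrite le_eqVlt; apply/orP; left; apply/eqP; congr (`|_|); case: (a) (f x) (f u) => [? ?] [? ?] [? ?] /=; ring.
Qed.

Lemma loclipM f g : loclip f -> loclip g -> loclip (fun x => f x * g x).
Proof.
move=> lf lg u; have [K [D [K0 D0 HD]]] := lf u; have [L [E [L0 E0 HE]]] := lg u.
exists (K * (normc (g u) + L) + normc (f u) * L), (Num.min (Num.min D E) 1).
split; first by rewrite addr_ge0 ?mulr_ge0 ?addr_ge0 ?normc_ge0.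
  by rewrite !lt_min D0 E0 ltr01.
move=> x; rewrite !lt_min => /andP[/andP[/HD h1 /HE h2] /ltW h3].
rewrite (_ : _ - _ = (f x - f u) * (g u + (g x - g u)) + f u * (g x - g u)); last by ring.
apply: le_trans (le_normcD _ _) _; rewrite !normcM mulrDl; apply: lerD.
  rewrite mulrAC; apply: ler_pM => //; rewrite ?normc_ge0//.
  apply: le_trans (le_normcD _ _) _; rewrite lerD2l; apply: le_trans h2 _.
  by rewrite -[leRHS]mulr1 ler_wpM2l.
by rewrite -mulrA ler_wpM2l ?normc_ge0.
Qed.

Lemma loclipD f g : loclip f -> loclip g -> loclip (fun x => f x + g x).
Proof.
move=> lf lg u; have [K [D [K0 D0 HD]]] := lf u; have [L [E [L0 E0 HE]]] := lg u.
exists (K + L), (Num.min D E); split; rewrite ?addr_ge0 ?lt_min ?D0//.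
move=> x; rewrite lt_min => /andP[/HD h1 /HE h2].
rewrite (_ : _ - _ = (f x - f u) + (g x - g u)); last by ring.
by apply: le_trans (le_normcD _ _) _; rewrite mulrDl lerD.
Qed.

Lemma loclip_cst (a : C) : loclip (fun=> a).
Proof. by move=> u; exists 0, 1; split=> // x _; rewrite subrr ComplexField.Normc.normc0 mul0r. Qed.

Lemma loclip_sum (I : Type) (r : seq I) (f : I -> R -> C) : (forall i, loclip (f i)) ->
  loclip (fun x => \sum_(i <- r) f i x).
Proof.
move=> lf; elim: r => [|i r IH].
  by under eq_fun do rewrite big_nil; exact: loclip_cst.
by under eq_fun do rewrite big_cons; exact: loclipD.
Qed.

Lemma loclip_cexp (a : C) : loclip (fun th => cexp (a * th%:C)).
Proof.
move=> u; have H := cdiff_comp (cdiff_affine 0 a u%:C) (cdiff_cexp (0 + a * u%:C)).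
have [D D0 HD] := cdiff_lip H.
exists (normc (cexp (0 + a * u%:C) * a) + 1), D; split=> //; first by rewrite addr_ge0 ?normc_ge0.
move=> x xu; have := HD (x - u)%:C; rewrite normc_real => /(_ xu).
by rewrite -rmorphD subrKC !add0r.
Qed.

Definition circle_int (g : R -> C) : C :=
  prim_int 0 (2 * pi) (fun t => Re (g t)) +i* prim_int 0 (2 * pi) (fun t => Im (g t)).

Lemma prim_int_lin (f g : R -> R) (a b u v : R) : continuous f -> continuous g ->
  prim_int a b (fun t => u * f t + v * g t) = u * prim_int a b f + v * prim_int a b g.
Proof.
move=> cf cg; have H (t : R) := is_deriveD (is_deriveZ u (prim_derive cf t)) (is_deriveZ v (prim_derive cg t)).
transitivity ((u * prim f b + v * prim g b) - (u * prim f a + v * prim g a)).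
  apply: (prim_intE a b _ H).
  by apply: rcontD; apply: rcontM => //; exact: rcont_cst.
rewrite /prim_int; ring.
Qed.

Lemma loclip_Re f : loclip f -> continuous (fun t : R => Re (f t)).
Proof. by move=> /(loclip_continuous (a := 1)); under eq_fun do rewrite mul1r. Qed.

Lemma loclip_Im f : loclip f -> continuous (fun t : R => Im (f t)).
Proof.
move=> /(loclip_continuous (a := - ci R)).
rewrite (_ : (fun x : R => Re _) = (fun t : R => Im (f t)))//; apply/funext => t.
by case: (f t) => [? ?] /=; ring.
Qed.

Lemma Re_circle_int a g : loclip g -> Re (a * circle_int g) = prim_int 0 (2 * pi) (fun t => Re (a * g t)).
Proof.
move=> lg; have := prim_int_lin 0 (2 * pi) (Re a) (- Im a) (loclip_Re lg) (loclip_Im lg).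
rewrite /circle_int; case: (a) => [p q] /=; rewrite mulNr => <-; congr (prim_int _ _ _).
by apply/funext => t; case: (g t) => [? ?] /=; rewrite mulNr.
Qed.

Lemma eq_ReM (u v : C) : (forall a, Re (a * u) = Re (a * v)) -> u = v.
Proof.
move=> H; have := H 1; have := H (ci R); case: u v {H} => [p q] [p' q'] /=.
by rewrite !mul1r !mul0r !sub0r !subr0 => /oppr_inj -> ->.
Qed.

Lemma circle_int_lin a f g : loclip f -> loclip g -> circle_int (fun t => a * f t + g t) = a * circle_int f + circle_int g.
Proof.
move=> lf lg; apply: eq_ReM => b; rewrite mulrDr mulrA.
have ReD (x y : C) : Re (x + y) = Re x + Re y by case: x y => [? ?] [? ?].
rewrite Re_circle_int; last by apply: loclipD => //; apply: loclipM => //; exact: loclip_cst.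
rewrite ReD !Re_circle_int//.
have := prim_int_lin 0 (2 * pi) 1 1 (loclip_continuous (a := b * a) lf) (loclip_continuous (a := b) lg).
rewrite !mul1r => <-; congr (prim_int _ _ _); apply/funext => t.
by rewrite !mul1r mulrDr mulrA ReD.
Qed.

Lemma normc_circle_int g (M : R) : loclip g -> (forall t : R, normc (g t) <= M) -> normc (circle_int g) <= 2 * pi * M.
Proof.
move=> lg gM; apply: normc_leP => a a1; rewrite Re_circle_int//.
have pi0 : 0 <= 2 * pi :> R by rewrite mulr_ge0// pi_ge0.
have := mvt_le (M := M) (prim_derive (loclip_continuous (a := a) lg)) pi0.
rewrite subr0 [M * _]mulrC; apply => t _; apply: le_trans (Re_mul_le _ a1) (gM t).
Qed.

Definition cn2 z : R := \sum_j normc (z ord0 j) ^+ 2.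

Lemma cn2_ge0 z : 0 <= cn2 z.
Proof. by apply: sumr_ge0 => j _; exact: sqr_ge0. Qed.

Lemma sqr_normcD (u v : C) : normc (u + v) ^+ 2 <= 2 * normc u ^+ 2 + 2 * normc v ^+ 2.
Proof.
apply: (@le_trans _ _ ((normc u + normc v) ^+ 2)).
  by rewrite lerXn2r ?nnegrE ?addr_ge0 ?normc_ge0// le_normcD.
have := sqr_ge0 (normc u - normc v); move: (normc u) (normc v) => x y; nra.
Qed.

Lemma cn2D z w : cn2 (z + w) <= 2 * cn2 z + 2 * cn2 w.
Proof.
rewrite /cn2 !mulr_sumr -big_split; apply: ler_sum => j _ /=.
by rewrite mxE sqr_normcD.
Qed.

Lemma cn2Z (a : C) z : cn2 (a *: z) = normc a ^+ 2 * cn2 z.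
Proof. by rewrite /cn2 mulr_sumr; apply: eq_bigr => j _; rewrite mxE normcM exprMn. Qed.

Lemma cn2_polydisc z (r : R) w : 0 <= r -> polydisc z r w -> cn2 w <= 2 * cn2 z + 2 * (d%:R * r ^+ 2).
Proof.
move=> r0 zw; rewrite -[w](subrKC z); apply: le_trans (cn2D _ _) _.
rewrite lerD2l ler_wpM2l// /cn2 -[d in d%:R]card_ord -sum1_card natr_sum mulr_suml.
apply: ler_sum => j _; rewrite mul1r lerXn2r ?nnegrE ?normc_ge0// !mxE; exact: zw.
Qed.

(* Every growth space is made of tame functions, and tameness is stable under
   the operations needed below: d/dz_j, multiplication by z_j, affine changes of
   variable. *)
Definition tame F := entire F /\ forall b : R, 0 < b -> exists2 M : R, 0 <= M &
  forall z, normc (F z) <= M * expR (b * cn2 z).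

Lemma tame_local F z (r : R) : tame F -> 0 <= r ->
  exists2 M : R, 0 <= M & forall w, polydisc z r w -> normc (F w) <= M.
Proof.
move=> [_ /(_ 1 ltr01)[M M0 HM]] r0; exists (M * expR (2 * cn2 z + 2 * (d%:R * r ^+ 2))).
  by rewrite mulr_ge0 ?expR_ge0.
move=> w zw; apply: le_trans (HM w) _; rewrite ler_wpM2l// ler_expR mul1r.
exact: cn2_polydisc.
Qed.

Lemma polydisc_circle j z (t : C) : normc t <= 1 -> polydisc z 1 (z + t *: Cbasis j).
Proof.
move=> t1 k; rewrite (_ : _ - _ = (t *: Cbasis j) ord0 k); last by rewrite [in LHS]mxE addrAC subrr add0r.
exact: le_trans (normc_basis j k t) t1.
Qed.

Lemma polydisc_trans z w v (r s : R) : polydisc z r w -> polydisc w s v -> polydisc z (r + s) v.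
Proof.
move=> zw wv k; rewrite (_ : _ - _ = (w ord0 k - z ord0 k) + (v ord0 k - w ord0 k)); last by ring.
by apply: le_trans (le_normcD _ _) _; exact: lerD.
Qed.

Definition circle_pt j z (th : R) := z + cexp (ci R * th%:C) *: Cbasis j.

Lemma circle_pt_polydisc j z th : polydisc z 1 (circle_pt j z th).
Proof. by apply: polydisc_circle; rewrite cexp_ci. Qed.

Lemma loclip_circle_pt (f : 'rV[R[i]]_d -> C) j z (M : R) : 0 <= M ->
  (forall w h (e : R), polydisc z 1 w -> 0 <= e -> e <= 1 -> (forall j, normc (h ord0 j) <= e) ->
     normc (f (w + h) - f w) <= M * e) -> loclip (fun th => f (circle_pt j z th)).
Proof.
move=> M0 H u; have [K [D [K0 D0 HD]]] := loclip_cexp (ci R) u.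
have k0 : 0 < (K + 1)^-1 by rewrite invr_gt0 ltr_wpDl.
exists (M * K), (Num.min D (K + 1)^-1); split; rewrite ?mulr_ge0 ?lt_min ?D0//.
move=> x; rewrite lt_min => /andP[/HD h1 h2].
have e1 : K * `|x - u| <= 1.
  apply: (@le_trans _ _ ((K + 1) * `|x - u|)); first by rewrite ler_wpM2r// lerDl.
  by rewrite mulrC -ler_pdivlMr ?ltr_wpDl// div1r ltW.
have := H (circle_pt j z u) ((cexp (ci R * x%:C) - cexp (ci R * u%:C)) *: Cbasis j) (K * `|x - u|) (circle_pt_polydisc j z u) (mulr_ge0 K0 (normr_ge0 _)) e1.
rewrite /circle_pt -addrA -scalerDl subrKC mulrA; apply => k.
exact: le_trans (normc_basis j k _) h1.
Qed.

Lemma loclip_ext f g : (forall t : R, f t = g t) -> loclip f -> loclip g.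
Proof. by move=> /funext ->. Qed.

Lemma loclip_cexpN : loclip (fun th => cexp (- (ci R * th%:C))).
Proof. by apply: loclip_ext (loclip_cexp (- ci R)) => t; rewrite mulNr. Qed.

(** Cauchy's formula on the unit circle in the j-th variable. It expresses the derivative by values
    of F, so that the regularity of F passes to it. *)
Lemma dC_circle_int F j z : tame F ->
  (2 * pi)%:C * dC j F z = circle_int (fun th => F (circle_pt j z th) * cexp (- (ci R * th%:C))).
Proof.
move=> tF; have [M M0 HM] := @tame_local F z 3 tF (ler0n _ 3).
have lF : loclip (fun th => F (circle_pt j z th) * cexp (- (ci R * th%:C))).
  apply: loclipM; last exact: loclip_cexpN.
  have := @loclip_circle_pt F j z M M0; apply => w h e zw e0 e1 he.
  apply: (entire_lip tF.1) => // v wv; apply: HM.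
  by have := polydisc_trans zw wv; congr (polydisc z _ v); lra.
apply: eq_ReM => a; rewrite Re_circle_int//.
have := cauchy_derivative (entire_cdiff_basis j z tF.1) a 0 ltr01.
rewrite scale0r addr0 => H; transitivity (2 * pi * Re (a * dC j F z)).
  by case: (a) (dC j F z) => [? ?] [? ?] /=; ring.
rewrite -H; congr (prim_int _ _ _); apply/funext => th.
by rewrite add0r invr1 rmorph1 !mul1r.
Qed.

(** Cauchy's formula is differentiated under the circle integral: the Taylor expansions of F at the
    points of the circle have a common remainder bound and integrate to an expansion of [dC j F]. *)
Lemma entire_dC F j : tame F -> entire (dC j F).
Proof.
move=> tF; apply: entire_of_taylor => z.
(* Radius 6 leaves room for the unit circle, the shift h and the polydisc of radius 4 of
   [entire_taylor]. *)
have [M M0 HM] := @tame_local F z 6 tF (ler0n _ 6).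
(* P k is the mixed derivative in z_j and z_k, given by the circle integral of [dC k F]. *)
have [P PE] : exists P : 'I_d -> C, forall k, (2 * pi)%:C * P k =
    circle_int (fun th => dC k F (circle_pt j z th) * cexp (- (ci R * th%:C))).
  exists (fun k => ((2 * pi)^-1)%:C * circle_int (fun th => dC k F (circle_pt j z th) * cexp (- (ci R * th%:C)))) => k.
  by rewrite mulrA -rmorphM mulfV ?mul1r// mulf_neq0// gt_eqF// pi_gt0.
exists P, M; split=> // h e e0 e1 he.
have lF v : (forall j, normc (v ord0 j) <= 1) -> loclip (fun th => F (circle_pt j z th + v) * cexp (- (ci R * th%:C))).
  move=> v1; apply: loclipM; last exact: loclip_cexpN.
  have := @loclip_circle_pt (fun w => F (w + v)) j z M M0; apply => w k f zw f0 f1 kf.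
  apply: (entire_lip (entire_translate v tF.1)) => // u wu; apply: HM.
  have := polydiscD v1 (polydisc_trans zw wu) => /=.
  by move=> H i; apply: le_trans (H i) _; lra.
have l0 : loclip (fun th => F (circle_pt j z th) * cexp (- (ci R * th%:C))).
  by apply: loclip_ext (lF 0 _) => [t|i]; rewrite ?addr0// mxE ComplexField.Normc.normc0.
have lh := lF h (fun i => le_trans (he i) e1).
have ld k : loclip (fun th => dC k F (circle_pt j z th) * cexp (- (ci R * th%:C))).
  apply: loclipM; last exact: loclip_cexpN.
  have := @loclip_circle_pt (dC k F) j z M M0; apply => w v f zw f0 f1 vf.
  have := @dC_lip F k w v M f tF.1 f0 f1 vf; apply => u wu; apply: HM => i.
  by apply: le_trans (polydisc_trans zw wu i) _; lra.
have tFh : tame (fun z => F (z + h)).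
  split; first exact: entire_translate tF.1.
  move=> b b0; have [N N0 HN] := tF.2 (b / 2) (divr_gt0 b0 (ltr0Sn _ _)).
  exists (N * expR (b * cn2 h)); first by rewrite mulr_ge0 ?expR_ge0.
  move=> w; apply: le_trans (HN _) _; rewrite -[leRHS]mulrA ler_wpM2l// -expRD ler_expR.
  by have := ler_wpM2l (ltW b0) (cn2D w h); lra.
have E1 : dC j F (z + h) = dC j (fun z => F (z + h)) z.
  apply/esym/dC_unique; first exact: entire_translate tF.1.
  have := entire_cdiff_basis j (z + h) tF.1 0; rewrite scale0r addr0.
  by apply: cdiff_ext => t; rewrite addrAC.
have E : (2 * pi)%:C * (dC j F (z + h) - dC j F z - \sum_k h ord0 k * P k) =
    circle_int (fun th => (F (circle_pt j z th + h) - F (circle_pt j z th) - \sum_k h ord0 k * dC k F (circle_pt j z th)) * cexp (- (ci R * th%:C))).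
  have ls r : loclip (fun th => \sum_(k <- r) h ord0 k * (dC k F (circle_pt j z th) * cexp (- (ci R * th%:C)))).
    by apply: loclip_sum => k; apply: loclipM => //; exact: loclip_cst.
  have circle_int_scale r : circle_int (fun th => \sum_(k <- r) h ord0 k * (dC k F (circle_pt j z th) * cexp (- (ci R * th%:C)))) =
      (2 * pi)%:C * \sum_(k <- r) h ord0 k * P k.
    elim: r => [|k r IH].
      rewrite big_nil mulr0; under eq_fun do rewrite big_nil.
      by have := circle_int_lin (-1) (loclip_cst 0) (loclip_cst 0); under eq_fun do rewrite mulr0 addr0; rewrite mulN1r addNr.
    under eq_fun do rewrite big_cons; rewrite big_cons circle_int_lin// IH [RHS](mulrDr (2 * pi)%:C (h ord0 k * P k)); congr (_ + _).
    by rewrite [RHS]mulrCA PE.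
  have gen (p x y t a b c : C) : p * x = a -> p * y = b -> c = p * t -> p * (x - y - t) = a - b - c.
    by move=> <- <- ->; ring.
  have A1 := dC_circle_int j z tFh; rewrite -E1 in A1.
  etransitivity; first exact: (gen _ _ _ _ _ _ _ A1 (dC_circle_int j z tF) (circle_int_scale _)).
  have := circle_int_lin (-1) l0 lh; rewrite mulN1r addrC => <-.
  have l2 : loclip (fun th => -1 * (F (circle_pt j z th) * cexp (- (ci R * th%:C))) + F (circle_pt j z th + h) * cexp (- (ci R * th%:C))).
    by apply: loclipD => //; apply: loclipM => //; exact: loclip_cst.
  have := circle_int_lin (-1) (ls (index_enum _)) l2; rewrite mulN1r addrC => <-.
  congr circle_int; apply/funext => th; rewrite mulrBl mulr_suml.
  under [X in _ - X]eq_bigr do rewrite -mulrA.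
  by move: (\sum_k _) => S; ring.
have pi1 : 0 < 2 * pi :> R by rewrite mulr_gt0// pi_gt0.
rewrite -(ler_pM2l pi1) -[X in X * normc _ <= _](ger0_norm (ltW pi1)) -normc_real -normcM E.
apply: normc_circle_int.
  apply: loclip_ext (_ : loclip (fun th => F (circle_pt j z th + h) * cexp (- (ci R * th%:C)) + (-1 * (F (circle_pt j z th) * cexp (- (ci R * th%:C))) + -1 * \sum_k h ord0 k * (dC k F (circle_pt j z th) * cexp (- (ci R * th%:C)))))).
    move=> t; rewrite mulrBl mulr_suml; under [X in _ - X]eq_bigr do rewrite -mulrA.
    by move: (\sum_k _) => S; ring.
  apply: loclipD => //; apply: loclipD; apply: loclipM; rewrite //; try exact: loclip_cst.
  by apply: loclip_sum => k; apply: loclipM => //; exact: loclip_cst.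
move=> th; rewrite normcM -mulrN -rmorphN cexp_ci mulr1.
apply: (entire_taylor tF.1) => // w wp; apply: HM => i; apply: le_trans (polydisc_trans (circle_pt_polydisc j z th) wp i) _; lra.
Qed.

End several_variables.

(** * Gaussian averages of tame functions *)

Lemma differentiable_coordM (K : numFieldType) d (F : 'rV[K]_d -> K^o) (z : 'rV[K]_d) j :
  differentiable F z -> differentiable (fun z : 'rV[K]_d => z ord0 j * F z : K^o) z.
Proof.
move=> dF; have dc : differentiable (fun z : 'rV[K]_d => z ord0 j : K^o) z by exact: differentiable_coord.
exact: (differentiableM dc dF).
Qed.

Section tame_functions.
Variables (R : realType) (d : nat).
Local Notation C := (R[i]).
Local Notation Re := complex.Re.
Local Notation Im := complex.Im.
Local Notation normc := ComplexField.Normc.normc.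
Local Notation normcM := ComplexField.Normc.normcM.
Local Notation mu := (lebesgue_rV d).
Implicit Types (F G : 'rV[R[i]]_d -> C^o) (z h v w : 'rV[R[i]]_d) (x y xi : 'rV[R]_d).

Lemma tame_lin (a : C) F G : tame F -> tame G -> tame (a *: F + G).
Proof.
move=> [eF bF] [eG bG]; split; first exact: entire_lin.
move=> b b0; have [M M0 HM] := bF b b0; have [N N0 HN] := bG b b0.
exists (normc a * M + N); first by rewrite addr_ge0 ?mulr_ge0 ?normc_ge0.
move=> z; rewrite mulrDl -mulrA; apply: le_trans (le_normcD _ _) _; apply: lerD; last exact: HN.
by rewrite normcM ler_wpM2l ?normc_ge0.
Qed.

Lemma tame_cst (c : C) : tame ((fun=> c) : 'rV[R[i]]_d -> C^o).
Proof.
split; first by move=> z; exact: differentiable_cst.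
move=> b b0; exists (normc c); first exact: normc_ge0.
move=> z; rewrite ler_peMr ?normc_ge0// -expR0 ler_expR.
by apply: mulr_ge0; [exact: ltW|exact: cn2_ge0].
Qed.

Lemma tame_ext F G : (forall z, F z = G z) -> tame F -> tame G.
Proof. by move=> /funext ->. Qed.

Lemma tame_sum (I : Type) (r : seq I) (F : I -> 'rV[R[i]]_d -> C^o) :
  (forall i, tame (F i)) -> tame (fun z => \sum_(i <- r) F i z).
Proof.
move=> tF; elim: r => [|i r IH].
  by apply: tame_ext (tame_cst 0) => z; rewrite big_nil.
by apply: tame_ext (tame_lin 1 (tF i) IH) => z; rewrite big_cons fctE scale1r.
Qed.

Lemma normc_coord_le z j : normc (z ord0 j) ^+ 2 <= cn2 z.
Proof. by rewrite /cn2 (bigD1 j)//= lerDl sumr_ge0// => k _; exact: sqr_ge0. Qed.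

(** Half of the exponent b absorbs the factor |z_j|; as b is arbitrary, tameness survives. *)
Lemma tame_coordM j F : tame F -> tame (fun z => z ord0 j * F z).
Proof.
move=> [eF bF]; split; first by move=> z; exact: differentiable_coordM.
move=> b b0; have b2 : 0 < b / 2 by rewrite divr_gt0.
have [M M0 HM] := bF _ b2.
exists ((1 + (b / 2)^-1) * M); first by rewrite mulr_ge0 ?addr_ge0 ?invr_ge0 ?(ltW b2).
move=> z; have -> : expR (b * cn2 z) = expR (b / 2 * cn2 z) * expR (b / 2 * cn2 z).
  by rewrite -expRD -mulrDl -splitr.
rewrite normcM [leRHS](_ : _ = ((1 + (b / 2)^-1) * expR (b / 2 * cn2 z)) * (M * expR (b / 2 * cn2 z))); last by ring.
apply: ler_pM; rewrite ?normc_ge0//.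
have h1 := normc_coord_le z j; have h2 := expR_ge1Dx (b / 2 * cn2 z).
have h3 : 1 <= expR (b / 2 * cn2 z).
  by rewrite -[leLHS]expR0 ler_expR; apply: mulr_ge0; [exact: ltW|exact: cn2_ge0].
have h4 : normc (z ord0 j) ^+ 2 <= (b / 2)^-1 * expR (b / 2 * cn2 z).
  apply: le_trans h1 _; rewrite ler_pdivlMl//; apply: le_trans h2; by rewrite lerDr.
rewrite mulrDl mul1r; have := sqr_ge0 (normc (z ord0 j) - 1); nra.
Qed.

(** Cauchy's estimate on the unit polydisc, where |w|^2 <= 2 |z|^2 + 2 d; starting from the exponent
    b / 2 compensates the doubling. *)
Lemma tame_dC j F : tame F -> tame (dC j F).
Proof.
move=> tF; split; first exact: entire_dC.
move=> b b0; have b2 : 0 < b / 2 by rewrite divr_gt0.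
have [M M0 HM] := tF.2 _ b2.
exists (M * expR (b * d%:R)); first by rewrite mulr_ge0 ?expR_ge0.
move=> z; rewrite -[leRHS]divr1.
have := @dC_estimate R d F j z 1 (M * expR (b * d%:R) * expR (b * cn2 z)) tF.1 ltr01; apply => w wz; apply: le_trans (HM w) _.
rewrite -[leRHS]mulrA ler_wpM2l// -expRD ler_expR.
have := ler_wpM2l (ltW b2) (cn2_polydisc ler01 wz); rewrite expr1n mulr1; lra.
Qed.

Lemma dC_coordM j k F z : tame F -> dC k (fun z => z ord0 j * F z) z = (k == j)%:R * F z + z ord0 j * dC k F z.
Proof.
move=> tF; apply: dC_unique; first exact: (tame_coordM j tF).1.
have c1 := entire_cdiff_basis k z tF.1 0; have c2 := cdiffM (cdiff_affine (z ord0 j) (k == j)%:R 0) c1.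
rewrite scale0r addr0 mulr0 addr0 in c2; apply: cdiff_ext c2 => t.
have -> : (z + t *: Cbasis R k) ord0 j = z ord0 j + (k == j)%:R * t by rewrite !mxE eqxx eq_sym mulrC.
by [].
Qed.

Lemma entire_affine F z (l : R) : entire F -> entire (fun u => F (z + l%:C *: (u - z))).
Proof.
move=> eF u; apply: (@differentiable_comp _ _ _ _ (fun u => z + l%:C *: (u - z)) F); last exact: eF.
apply: differentiableD; first exact: differentiable_cst.
apply: differentiableZ; apply: differentiableD => //; exact: differentiable_cst.
Qed.

Lemma cn2_affine z u (l : C) : cn2 (z + l *: (u - z)) <= 2 * normc (1 - l) ^+ 2 * cn2 z + 2 * normc l ^+ 2 * cn2 u.
Proof.
have -> : z + l *: (u - z) = (1 - l) *: z + l *: u.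
  by rewrite scalerBr scalerBl scale1r addrA [_ - l *: z]addrC addrA [- (l *: z) + z]addrC addrAC.
by apply: le_trans (cn2D _ _) _; rewrite !cn2Z; lra.
Qed.

(** The dilation of F about the point z; moving l from 1 to 0 will deform F into the constant
    F(z). *)
Lemma tame_affine F z (l : R) : tame F -> tame (fun u => F (z + l%:C *: (u - z))).
Proof.
move=> tF; split; first exact: entire_affine tF.1.
move=> b b0; have q0 : 0 < 2 * l ^+ 2 + 1 by rewrite ltr_wpDl// mulr_ge0 ?sqr_ge0.
pose c := b / (2 * l ^+ 2 + 1); have c0 : 0 < c by rewrite divr_gt0.
have [M M0 HM] := tF.2 _ c0.
exists (M * expR (c * (2 * normc (1 - l%:C) ^+ 2 * cn2 z))); first by rewrite mulr_ge0 ?expR_ge0.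
move=> u; apply: le_trans (HM _) _; rewrite -[leRHS]mulrA ler_wpM2l// -expRD ler_expR.
apply: le_trans (ler_wpM2l (ltW c0) (cn2_affine z u l%:C)) _.
rewrite mulrDr lerD2l normc_real real_normK ?num_real// mulrA ler_wpM2r ?cn2_ge0//.
by rewrite /c mulrAC ler_pdivrMr// ler_wpM2l ?(ltW b0)// lerDl.
Qed.

(** [cdiff_taylor] with r = 2, since c will be sqrt 2 or i and so |t c| <= 2. This explains the
    radius 8 = 4 r, and 1 / r^2 compensates |c|^2 <= 4. *)
Lemma dir_taylor F w j (c : C) (t M : R) : entire F -> normc c <= 2 -> `|t| <= 1 ->
  (forall s : C, normc s <= 8 -> normc (F (w + s *: Cbasis R j)) <= M) ->
  normc (F (w + (t%:C * c) *: Cbasis R j) - F w - t%:C * (c * dC j F w)) <= M * t ^+ 2.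
Proof.
move=> eF c2 t1 HM.
have nt : normc (t%:C * c) <= `|t| * 2 by rewrite normcM normc_real ler_wpM2l.
have h2 : normc (t%:C * c) <= 2 by apply: le_trans nt _; rewrite ler_piMl.
have := cdiff_taylor (z0 := 0) (M := M) (entire_cdiff_basis j w eF) (ltr0Sn _ 1) h2.
rewrite add0r !scale0r !addr0 [_ * (t%:C * c)]mulrC => H.
rewrite [t%:C * (c * _)]mulrA; apply: le_trans (H _) _.
  by move=> s; rewrite subr0 => s8; apply: HM; apply: le_trans s8 _; rewrite -natrM.
have M0 : 0 <= M by apply: le_trans (HM 0 _); rewrite ?normc_ge0// ComplexField.Normc.normc0.
rewrite -mulrA ler_wpM2l// mulrC ler_pdivrMr ?exprn_gt0//.
by rewrite -[t ^+ 2]real_normK ?num_real// -exprMn lerXn2r ?nnegrE ?normc_ge0// mulr_ge0.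
Qed.

Definition gavg_arg y xi := (Num.sqrt 2)%:C *: complexify y + ci R *: complexify xi.

Lemma argE y xi j : gavg_arg y xi ord0 j = (Num.sqrt 2)%:C * (y ord0 j)%:C + ci R * (xi ord0 j)%:C.
Proof. by rewrite !mxE. Qed.

Lemma cn2_arg y xi : cn2 (gavg_arg y xi) = 2 * enorm2 y + enorm2 xi.
Proof.
rewrite /cn2 /enorm2 mulr_sumr -big_split; apply: eq_bigr => j _.
rewrite argE normc_sqr /= -[in RHS](sqr_sqrtr (ler0n R 2)); ring.
Qed.

Lemma arg_shift_y y xi j (t : R) : gavg_arg (t *: Rebasis R j + y) xi = gavg_arg y xi + (t%:C * (Num.sqrt 2)%:C) *: Cbasis R j.
Proof.
apply/rowP => k; rewrite [in RHS]mxE !argE coord_shift !mxE eqxx /= eq_sym.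
by case: eqP => _; rewrite ?mul1r ?mul0r ?add0r ?mulr1 ?mulr0 ?addr0// rmorphD; ring.
Qed.

Lemma arg_shift_xi y xi j (t : R) : gavg_arg y (t *: Rebasis R j + xi) = gavg_arg y xi + (t%:C * ci R) *: Cbasis R j.
Proof.
apply/rowP => k; rewrite [in RHS]mxE !argE coord_shift !mxE eqxx /= eq_sym.
by case: eqP => _; rewrite ?mul1r ?mul0r ?add0r ?mulr1 ?mulr0 ?addr0// rmorphD; ring.
Qed.

Lemma argD y y' xi xi' : gavg_arg (y + y') (xi + xi') = gavg_arg y xi + gavg_arg y' xi'.
Proof. by apply/rowP => k; rewrite [in RHS]mxE !argE !mxE !rmorphD; ring. Qed.

Lemma normc_ci : normc (ci R) = 1.
Proof. by rewrite /ci /= expr0n expr1n add0r sqrtr1. Qed.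

Lemma normc_sqrt2 : normc ((Num.sqrt 2)%:C : C) <= 2.
Proof. by rewrite normc_real ger0_norm ?sqrtr_ge0// sqrt2_le2. Qed.

Lemma cn2_basis (j : 'I_d) (s : C) : cn2 (s *: Cbasis R j) = normc s ^+ 2.
Proof.
rewrite cn2Z /cn2 (bigD1 j)//= big1 ?addr0; last first.
  by move=> k kj; rewrite mxE eqxx (negPf kj) ComplexField.Normc.normc0 expr0n.
by rewrite mxE !eqxx ComplexField.Normc.normc1 expr1n mulr1.
Qed.

Lemma near_rV (x : 'rV[R]_d) (D : R) : 0 < D ->
  \forall y \near x, forall j, `|(y - x) ord0 j| <= D.
Proof.
move=> D0; apply: (@filter_forall _ _ (fun j (y : 'rV[R]_d) => `|(y - x) ord0 j| <= D) (nbhs x)) => j.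
have /cvgrPdist_le /(_ D D0) := @coord_continuous R 1 d ord0 j x.
by apply: filterS => y; rewrite !mxE distrC.
Qed.

Lemma continuousC_lip (f : 'rV[R]_d -> C^o) :
  (forall x, exists K : R, forall (h : 'rV[R]_d) (e : R), 0 <= e -> e <= 1 / 2 -> (forall j, `|h ord0 j| <= e) ->
     normc (f (x + h) - f x) <= K * e) -> continuousC f.
Proof.
move=> H.
have key (g : 'rV[R]_d -> R) :
   (forall x y, `|g x - g y| <= normc (f x - f y)) -> continuous g.
  move=> gf x; have [K HK] := H x; apply/(@cvgrPdist_le R R^o 'rV[R]_d (nbhs x) _ g (g x)) => e e0.
  pose D := Num.min (1 / 2) (e / (`|K| + 1)).
  have K1 : 0 < `|K| + 1 by rewrite ltr_wpDl.
  have D0 : 0 < D by rewrite lt_min divr_gt0//= divr_gt0.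
  have N := near_rV x D0.
  apply: filterS N => y yx; rewrite distrC; apply: le_trans (gf _ _) _.
  have := HK (y - x) D (ltW D0); rewrite subrKC ge_min lexx => /(_ isT yx) /le_trans; apply.
  apply: (@le_trans _ _ ((`|K| + 1) * D)).
    by rewrite ler_wpM2r ?(ltW D0)//; have := ler_norm K; lra.
  by rewrite mulrC -ler_pdivlMr// ge_min lexx orbT.
split; apply: key => x y.
  by apply: le_trans (ler_Re_normc _); rewrite /re_part; case: (f x) (f y) => [? ?] [? ?].
by apply: le_trans (ler_Im_normc _); rewrite /im_part; case: (f x) (f y) => [? ?] [? ?].
Qed.

Lemma continuous_arg F y : tame F -> continuousC (fun xi => F (gavg_arg y xi)).
Proof.
move=> tF; apply: continuousC_lip => xi; have [M M0 HM] := @tame_local R d F (gavg_arg y xi) 2 tF (ler0n _ 2).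
exists M => h e e0 e1 he; rewrite -[y in X in normc X](addr0 y) argD.
rewrite addr0; apply: (entire_lip tF.1) => //; first by lra.
by move=> j; rewrite argE !mxE rmorph0 mulr0 add0r normcM normc_ci mul1r normc_real.
Qed.

Definition gavg F y : C := cint mu (fun xi => F (gavg_arg y xi) * groundC (1 / 2) xi).

(** At sqrt 2 y + i xi the bound reads e^(|y|^2 / 4) e^(|xi|^2 / 8): the Gaussian in xi keeps the
    rate 3/8, and the factor e^(-|y|^2 / 2) of [Qop] leaves decay of rate 1/4 in y. *)
Definition growth8 F (M : R) := forall z, normc (F z) <= M * expR (1 / 8 * cn2 z).

Lemma normc_gavg_integrand F (M : R) y xi : growth8 F M ->
  normc (F (gavg_arg y xi) * groundC (1 / 2) xi) <= M * expR (1 / 4 * enorm2 y) * gaussw (3 / 8) xi.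
Proof.
move=> HM; rewrite normcM normc_groundC.
apply: le_trans (ler_wpM2r (gaussw_ge0 _ _) (HM _)) _.
rewrite cn2_arg /gaussw -!mulrA -!expRD le_eqVlt; apply/orP; left; apply/eqP; congr (_ * expR _); lra.
Qed.

Lemma tame_growth8 F : tame F -> exists2 M, 0 <= M & growth8 F M.
Proof. by move=> [_ /(_ (1 / 8))[|M M0 HM]]; [lra|exists M]. Qed.

Lemma cinteg_gavg F y : tame F -> cinteg mu (fun xi => F (gavg_arg y xi) * groundC (1 / 2) xi).
Proof.
move=> tF; have [M M0 HM] := tame_growth8 tF.
have p : (0 : R) < 3 / 8 by lra.
have ig : integ mu (fun xi => (M * expR (1 / 4 * enorm2 y)) * gaussw (3 / 8) xi) by apply: integZ; exact: integ_gaussw.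
apply: (cinteg_dom _ ig); last by move=> xi; exact: normc_gavg_integrand.
by apply: cmeasM; apply: continuous_cmeas; [exact: continuous_arg|exact: continuous_groundC].
Qed.

Definition gauss_mass38 : R := \int[mu]_xi gaussw (3 / 8) xi.

Lemma normc_gavg F (M : R) y : tame F -> growth8 F M ->
  normc (gavg F y) <= M * expR (1 / 4 * enorm2 y) * gauss_mass38.
Proof.
move=> tF HM; have p : (0 : R) < 3 / 8 by lra.
have ig := integ_gaussw d p.
rewrite -(RintegralZl _ measurableT ig); apply: normc_cint; [exact: cinteg_gavg|exact: integZ|].
by move=> xi; exact: normc_gavg_integrand.
Qed.

Lemma gavg_lin (a : C) F G y : tame F -> tame G -> gavg (a *: F + G) y = a * gavg F y + gavg G y.
Proof.
move=> tF tG; rewrite /gavg -(cint_lin a (cinteg_gavg y tF) (cinteg_gavg y tG)).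
by apply: eq_cint => xi; rewrite !fctE mulrDl -scalerAl.
Qed.

Lemma gavg_sum (I : Type) (r : seq I) (F : I -> 'rV[R[i]]_d -> C^o) y : (forall i, tame (F i)) ->
  gavg (fun z => \sum_(i <- r) F i z) y = \sum_(i <- r) gavg (F i) y.
Proof.
move=> tF; rewrite /gavg -cint_sum; last by move=> i; exact: cinteg_gavg.
by apply: eq_cint => xi; rewrite mulr_suml.
Qed.

(** A displacement of modulus at most 8 is paid for by starting from half the exponent: [cn2D]
    doubles 1/16 to 1/8 and leaves the constant e^8, as 2 * 64 / 16 = 8. *)
Lemma tame_arg_bound F y j (c s : C) : tame F -> normc s <= 8 ->
  (forall (M : R), (forall z, normc (F z) <= M * expR (1 / 16 * cn2 z)) -> 0 <= M -> forall xi,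
   normc (F (gavg_arg y xi + s *: Cbasis R j)) <= (M * expR 8) * expR (1 / 8 * cn2 (gavg_arg y xi))).
Proof.
move=> tF s8 M HM M0 xi; apply: le_trans (HM _) _; rewrite -[leRHS]mulrA ler_wpM2l// -expRD ler_expR.
have h1 := cn2D (gavg_arg y xi) (s *: Cbasis R j); rewrite cn2_basis in h1.
have h2 : normc s ^+ 2 <= 8 ^+ 2 by rewrite lerXn2r ?nnegrE ?normc_ge0.
by move: h1 h2; rewrite (_ : 8 ^+ 2 = 64 :> R); [lra|rewrite expr2 -natrM].
Qed.

Lemma cderiv_gavg F j y : tame F ->
  cderiv j (gavg F : 'rV[R]_d -> C^o) y ((Num.sqrt 2)%:C * gavg (dC j F) y).
Proof.
move=> tF; have [|M M0 HM] := tF.2 (1 / 16); first by lra.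
have p : (0 : R) < 3 / 8 by lra.
have ig := integ_gaussw d p.
have tD := tame_dC j tF.
apply: (@cderiv_quad _ _ _ _ _ _ ((M * expR 8) * expR (1 / 4 * enorm2 y) * gauss_mass38)).
  by rewrite !mulr_ge0 ?expR_ge0//; apply: Rint_ge0 => xi; exact: gaussw_ge0.
move=> t t1.
pose D xi : C := F (gavg_arg (t *: Rebasis R j + y) xi) * groundC (1 / 2) xi - F (gavg_arg y xi) * groundC (1 / 2) xi -
  (t%:C * (Num.sqrt 2)%:C) * (dC j F (gavg_arg y xi) * groundC (1 / 2) xi).
have i1 := cinteg_gavg (t *: Rebasis R j + y) tF; have i0 := cinteg_gavg y tF; have i2 := cinteg_gavg y tD.
have -> : gavg F (t *: Rebasis R j + y) - gavg F y - t%:C * ((Num.sqrt 2)%:C * gavg (dC j F) y) = cint mu D.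
  have e1 := cintB (cintegB i1 i0) (cintegZ (t%:C * (Num.sqrt 2)%:C) i2).
  have e2 := cintB i1 i0; have e3 := cintZ (t%:C * (Num.sqrt 2)%:C) i2.
  rewrite /D; etransitivity; last by symmetry; exact: e1.
  by rewrite e2 e3 mulrA.
have -> : (M * expR 8) * expR (1 / 4 * enorm2 y) * gauss_mass38 * t ^+ 2 = (t ^+ 2 * (M * expR 8 * expR (1 / 4 * enorm2 y))) * gauss_mass38 by ring.
rewrite -(RintegralZl _ measurableT ig); apply: normc_cint; [|exact: integZ|].
  exact: (cintegB (cintegB i1 i0) (cintegZ (t%:C * (Num.sqrt 2)%:C) i2)).
move=> xi.
have -> : D xi = (F (gavg_arg y xi + (t%:C * (Num.sqrt 2)%:C) *: Cbasis R j) - F (gavg_arg y xi) -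
   t%:C * ((Num.sqrt 2)%:C * dC j F (gavg_arg y xi))) * groundC (1 / 2) xi.
  rewrite /D arg_shift_y.
  have alg (a b c g v u : C) : a * g - b * g - (u * v) * (c * g) = (a - b - u * (v * c)) * g by ring.
  exact: alg.
rewrite normcM normc_groundC.
have H := @dir_taylor F (gavg_arg y xi) j (Num.sqrt 2)%:C t ((M * expR 8) * expR (1 / 8 * cn2 (gavg_arg y xi))) tF.1 normc_sqrt2 t1 _.
apply: le_trans (ler_wpM2r (gaussw_ge0 _ _) (H _)) _.
  by move=> s s8; exact: tame_arg_bound.
rewrite cn2_arg /gaussw le_eqVlt; apply/orP; left; apply/eqP.
rewrite (_ : 1 / 8 * _ = 1 / 4 * enorm2 y + 1 / 8 * enorm2 xi); last by lra.
rewrite (_ : - (3 / 8 * enorm2 xi) = 1 / 8 * enorm2 xi - 1 / 2 * enorm2 xi); last by lra.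
by rewrite !expRD; ring.
Qed.

Lemma continuous_gavg F : tame F -> continuousC (gavg F : 'rV[R]_d -> C^o).
Proof.
move=> tF; have [|M M0 HM] := tF.2 (1 / 16); first by lra.
have p : (0 : R) < 3 / 8 by lra.
have ig := integ_gaussw d p.
apply: continuousC_lip => y; pose B := M * expR d%:R * expR (1 / 4 * enorm2 y).
exists (2 * B * gauss_mass38) => h e e0 e1 he.
have -> : gavg F (y + h) - gavg F y = cint mu (fun xi => F (gavg_arg (y + h) xi) * groundC (1 / 2) xi - F (gavg_arg y xi) * groundC (1 / 2) xi).
  by rewrite cintB//; exact: cinteg_gavg.
have -> : 2 * B * gauss_mass38 * e = (B * (2 * e)) * gauss_mass38 by ring.
rewrite -(RintegralZl _ measurableT ig); apply: normc_cint; [|exact: integZ|].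
  by apply: cintegB; exact: cinteg_gavg.
move=> xi; rewrite -mulrBl normcM normc_groundC -[xi in gavg_arg (y + h) xi]addr0 argD.
have H : normc (F (gavg_arg y xi + gavg_arg h 0) - F (gavg_arg y xi)) <= (M * expR d%:R * expR (1 / 8 * cn2 (gavg_arg y xi))) * (2 * e).
  apply: (entire_lip tF.1); [by rewrite mulr_ge0|by lra| |].
    move=> j; rewrite argE mxE rmorph0 mulr0 addr0 normcM normc_real.
    by apply: ler_pM; rewrite ?normc_ge0 ?normc_sqrt2.
  move=> w /(cn2_polydisc (ler0n _ 2)) h1; apply: le_trans (HM w) _.
  rewrite -[leRHS]mulrA ler_wpM2l// -expRD ler_expR.
  have d0 : (0 : R) <= d%:R by exact: ler0n.
  by move: h1; rewrite (_ : 2 ^+ 2 = 4 :> R); [lra|rewrite expr2 -natrM].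
apply: le_trans (ler_wpM2r (gaussw_ge0 _ _) H) _.
rewrite cn2_arg /gaussw /B le_eqVlt; apply/orP; left; apply/eqP.
rewrite (_ : 1 / 8 * _ = 1 / 4 * enorm2 y + 1 / 8 * enorm2 xi); last by lra.
rewrite (_ : - (3 / 8 * enorm2 xi) = 1 / 8 * enorm2 xi - 1 / 2 * enorm2 xi); last by lra.
by rewrite !expRD; ring.
Qed.

(** The coordinate is sqrt 2 y_j + i xi_j. As - xi_j times the Gaussian is its xi_j-derivative, and
    F (sqrt 2 y + i xi) has xi_j-derivative i dF/dz_j, integration by parts turns the part i xi_j
    into - dF/dz_j. *)
Lemma gavg_coordM F j y : tame F ->
  gavg (fun z => z ord0 j * F z) y = (Num.sqrt 2)%:C * (y ord0 j)%:C * gavg F y - gavg (dC j F) y.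
Proof.
move=> tF; have tD := tame_dC j tF; have tz := tame_coordM j tF.
have [M M0 HM] := tame_growth8 tF; have [N N0 HN] := tame_growth8 tD; have [P P0 HP] := tame_growth8 tz.
pose W xi : C^o := F (gavg_arg y xi) * groundC (1 / 2) xi.
pose W' xi : C^o := ci R * (dC j F (gavg_arg y xi) * groundC (1 / 2) xi) - (xi ord0 j)%:C * W xi.
have iF := cinteg_gavg y tF; have iD := cinteg_gavg y tD; have iz := cinteg_gavg y tz.
pose E := expR (1 / 4 * enorm2 y).
have E0 : 0 <= E by exact: expR_ge0.
have zE xi : gavg_arg y xi ord0 j * F (gavg_arg y xi) * groundC (1 / 2) xi =
   (Num.sqrt 2)%:C * (y ord0 j)%:C * W xi + ci R * ((xi ord0 j)%:C * W xi).
  by rewrite argE /W; ring.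
(* With xi_j expressed by z_j and y_j, integrability and bounds of xi_j W come from the tameness of
   z_j F and of F. *)
have xE xi : (xi ord0 j)%:C * W xi = - ci R * (gavg_arg y xi ord0 j * F (gavg_arg y xi) * groundC (1 / 2) xi) +
    ci R * ((Num.sqrt 2)%:C * (y ord0 j)%:C) * W xi.
  rewrite zE; transitivity (- (ci R * ci R) * ((xi ord0 j)%:C * W xi)); last by ring.
  by rewrite ciM opprK mul1r.
have bW xi : normc (W xi) <= M * E * gaussw (3 / 8) xi by exact: normc_gavg_integrand.
have ix : cinteg mu (fun xi => (xi ord0 j)%:C * W xi).
  by under eq_fun do rewrite xE; apply: cintegD; exact: cintegZ.
have W'0 : cint mu W' = 0.
  pose B := N * E + (P * E + 2 * `|y ord0 j| * (M * E)).
  have B1 : 0 <= 2 * `|y ord0 j| * (M * E) by rewrite !mulr_ge0.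
  apply: (@cint_partial_gauss R d j W W' (M * E + B) (3 / 8)).
  - by lra.
  - by rewrite /B !addr_ge0// mulr_ge0.
  - move=> xi; have dF : cderiv j (fun xi => F (gavg_arg y xi) : C^o) xi (ci R * dC j F (gavg_arg y xi)).
      have [K K0 HK] := @tame_local R d F (gavg_arg y xi) 8 tF (ler0n _ 8).
      apply: (@cderiv_quad _ _ _ _ _ _ K) => // t t1; rewrite arg_shift_xi.
      apply: dir_taylor => //; [exact: tF.1|by rewrite normc_ci; lra|].
      move=> s s8; apply: HK => k; rewrite (_ : _ - _ = (s *: Cbasis R j) ord0 k); last by rewrite [in LHS]mxE addrAC subrr add0r.
      exact: le_trans (normc_basis j k s) s8.
    have H := cderivM dF (cderiv_groundC (1 / 2) j xi).
    apply: (cderiv_eq H); rewrite /W' /W.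
    have -> : - (2 * (1 / 2) * xi ord0 j) = - xi ord0 j by lra.
    by rewrite rmorphN; ring.
  - by apply: continuousCM; [exact: continuous_arg|exact: continuous_groundC].
  - have -> : W' = (fun xi => ci R * (dC j F (gavg_arg y xi) * groundC (1 / 2) xi) + (-1) * ((xi ord0 j)%:C * W xi)).
      by apply/funext => xi; rewrite mulN1r.
    have c1 := continuousCM (continuous_arg y tD) (@continuous_groundC R d (1 / 2)).
    have c2 := continuousCM (continuous_arg y tF) (@continuous_groundC R d (1 / 2)).
    have c3 : continuousC (fun xi : 'rV[R]_d => (xi ord0 j)%:C : C^o) by apply: continuousC_real; exact: coord_continuous.
    exact: (continuousCD (continuousCM (continuousC_cst d (ci R)) c1) (continuousCM (continuousC_cst d (-1)) (continuousCM c3 c2))).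
  - move=> xi; apply: le_trans (bW xi) _; rewrite ler_wpM2r ?gaussw_ge0// lerDl.
    by rewrite /B !addr_ge0// mulr_ge0.
  - move=> xi; apply: le_trans (le_normcD _ _) _; rewrite normcN xE.
    rewrite [leRHS](_ : _ = M * E * gaussw (3 / 8) xi + (N * E * gaussw (3 / 8) xi +
      (P * E * gaussw (3 / 8) xi + 2 * `|y ord0 j| * (M * E * gaussw (3 / 8) xi)))); last by rewrite /B; ring.
    rewrite -[leLHS]add0r; apply: lerD; first by apply: mulr_ge0; [exact: mulr_ge0|exact: gaussw_ge0].
    apply: lerD; first by rewrite normcM normc_ci mul1r; exact: normc_gavg_integrand.
    apply: le_trans (le_normcD _ _) _; apply: lerD.
      by rewrite normcM normcN normc_ci mul1r; exact: (normc_gavg_integrand y xi HP).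
    rewrite normcM [normc (ci R * _)]normcM normc_ci mul1r [normc (_ * (y ord0 j)%:C)]normcM normc_real.
    by rewrite !ler_pM ?mulr_ge0 ?normc_ge0// normc_sqrt2.
have H : cint mu (fun xi => (xi ord0 j)%:C * W xi) = ci R * gavg (dC j F) y.
  by move: W'0; rewrite /W' cintB//; [rewrite cintZ// => /eqP; rewrite subr_eq0 => /eqP ->|exact: cintegZ].
rewrite /gavg (eq_cint mu zE) cintD; [|exact: cintegZ|exact: cintegZ].
by rewrite !cintZ// H mulrA ciM mulN1r.
Qed.

End tame_functions.

(** * The inverse transform *)

Section inverse_transform.
Variables (R : realType) (d : nat).
Local Notation C := (R[i]).
Local Notation Re := complex.Re.
Local Notation Im := complex.Im.
Local Notation normc := ComplexField.Normc.normc.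
Local Notation normcM := ComplexField.Normc.normcM.
Local Notation mu := (lebesgue_rV d).
Implicit Types (F G : 'rV[R[i]]_d -> C^o) (z h v w : 'rV[R[i]]_d) (x y xi : 'rV[R]_d).

Lemma bargmann_lin (a : C) (f g : 'rV[R]_d -> C^o) (A B : R) z : continuousC f -> continuousC g ->
  (forall y, normc (f y) <= A) -> (forall y, normc (g y) <= B) ->
  bargmann (a *: f + g) z = a * bargmann f z + bargmann g z.
Proof.
move=> cf cg fA gB; rewrite !bargmannE mulrCA -mulrDr; congr (_ * _).
rewrite -(cint_lin a (cinteg_bker cf fA z) (cinteg_bker cg gB z)); apply: eq_cint => y.
by rewrite !fctE mulrDr; congr (_ + _); exact: mulrCA.
Qed.

Definition gmass : R := \int[mu]_xi gaussw (1 / 2) xi.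

Lemma gmass_gt0 : 0 < gmass.
Proof.
have p2 : (0 : R) < 1 / 2 by lra.
have h : \int[mu]_y gaussw (1 : R) y <= gmass.
  apply: Rint_le; [exact: integ_gaussw|exact: integ_gaussw|].
  by move=> y; apply: gaussw_le; lra.
by apply: lt_le_trans h; rewrite Rint_gaussw1 exprn_gt0// sqrtr_gt0 pi_gt0.
Qed.

(* Normalized so that bargmann (Qop 1) = 1. *)
Definition q0 : C := (gmass%:C * (bcst R d * (Num.sqrt pi ^+ d)%:C))^-1.

Lemma q0K : q0 * (gmass%:C * (bcst R d * (Num.sqrt pi ^+ d)%:C)) = 1.
Proof.
rewrite /q0 mulVf// !mulf_neq0 ?bcst_neq0//.
  by rewrite -normc_gt0 normc_real normr_gt0 gt_eqF// gmass_gt0.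
by rewrite -normc_gt0 normc_real normr_gt0 expf_neq0// gt_eqF// sqrtr_gt0 pi_gt0.
Qed.

(* The inverse of the Bargmann transform. *)
Definition Qop F y : C := q0 * (groundC (1 / 2) y * gavg F y).

Lemma Qop_lin (a : C) F G y : tame F -> tame G -> Qop (a *: F + G) y = a * Qop F y + Qop G y.
Proof. by move=> tF tG; rewrite /Qop gavg_lin//; ring. Qed.

Lemma Qop_lin2 (a b : C) F G y : tame F -> tame G ->
  Qop (fun z => a * F z + b * G z) y = a * Qop F y + b * Qop G y.
Proof.
move=> tF tG; have t0 := tame_cst d (0 : C).
have e1 := Qop_lin a y tF (tame_lin b tG t0); have e2 := Qop_lin b y tG t0.
have e3 : Qop (fun=> 0) y = 0.
  rewrite /Qop /gavg (eq_cint mu (g := fun=> 0)) ?cint0 ?mulr0// => xi; by rewrite mul0r.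
transitivity (Qop (a *: F + (b *: G + (fun=> 0))) y).
  by congr (Qop _ y); apply/funext => z; rewrite !fctE addr0.
by rewrite e1 e2 e3 addr0.
Qed.

Lemma tame_lin2 (a b : C) F G : tame F -> tame G -> tame (fun z => a * F z + b * G z).
Proof.
move=> tF tG; apply: tame_ext (tame_lin a tF (tame_lin b tG (tame_cst d (0 : C)))) => z.
by rewrite !fctE addr0.
Qed.

Lemma dC_lin2 (a b : C) j F G z : tame F -> tame G ->
  dC j (fun z => a * F z + b * G z) z = a * dC j F z + b * dC j G z.
Proof.
move=> tF tG; apply: dC_unique; first exact: (tame_lin2 a b tF tG).1.
have c1 := entire_cdiff_basis j z tF.1 0; have c2 := entire_cdiff_basis j z tG.1 0.
rewrite scale0r addr0 in c1 c2.
have c3 := cdiffD (cdiff_comp c1 (cdiff_affine 0 a _)) (cdiff_comp c2 (cdiff_affine 0 b _)).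
by apply: cdiff_ext c3 => t; rewrite !add0r.
Qed.

Lemma Qop_sum (I : Type) (r : seq I) (F : I -> 'rV[R[i]]_d -> C^o) y : (forall i, tame (F i)) ->
  Qop (fun z => \sum_(i <- r) F i z) y = \sum_(i <- r) Qop (F i) y.
Proof. by move=> tF; rewrite /Qop gavg_sum// !mulr_sumr. Qed.

Lemma normc_Qop F (M : R) y : tame F -> growth8 F M ->
  normc (Qop F y) <= normc q0 * (M * gauss_mass38 R d * gaussw (1 / 4) y).
Proof.
move=> tF HM; rewrite /Qop normcM ler_wpM2l ?normc_ge0// normcM normc_groundC.
apply: le_trans (ler_wpM2l (gaussw_ge0 _ _) (normc_gavg y tF HM)) _.
rewrite /gaussw le_eqVlt; apply/orP; left; apply/eqP.
rewrite (_ : - (1 / 4 * enorm2 y) = - (1 / 2 * enorm2 y) + 1 / 4 * enorm2 y); last by lra.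
by rewrite expRD; ring.
Qed.

Lemma gauss_mass38_ge0 : 0 <= gauss_mass38 R d.
Proof. by apply: Rint_ge0 => y; exact: gaussw_ge0. Qed.

Lemma normc_Qop_le F (M : R) y : tame F -> 0 <= M -> growth8 F M ->
  normc (Qop F y) <= normc q0 * (M * gauss_mass38 R d).
Proof.
move=> tF M0 HM; apply: le_trans (normc_Qop y tF HM) _.
rewrite ler_wpM2l ?normc_ge0// ler_piMr ?mulr_ge0 ?gauss_mass38_ge0// gaussw_le1//; lra.
Qed.

Lemma continuous_Qop F : tame F -> continuousC (Qop F : 'rV[R]_d -> C^o).
Proof.
move=> tF; have c1 := continuousCM (@continuous_groundC R d (1 / 2)) (continuous_gavg tF).
exact: (continuousCM (continuousC_cst d q0) c1).
Qed.

Definition isqrt2 : C := ((Num.sqrt 2)^-1)%:C.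

Lemma isqrt2K : (Num.sqrt 2)%:C * isqrt2 = 1.
Proof. by rewrite /isqrt2 -rmorphM mulfV ?rmorph1// gt_eqF// sqrtr_gt0. Qed.

(* Qop intertwines Dop j with d/dy_j and Yop j with multiplication by y_j. *)
Definition Dop j F z : C := isqrt2 * dC j F z + - isqrt2 * (z ord0 j * F z).
Definition Yop j F z : C := isqrt2 * dC j F z + isqrt2 * (z ord0 j * F z).

Lemma tame_Dop j F : tame F -> tame (Dop j F).
Proof. by move=> tF; apply: tame_lin2; [exact: tame_dC|exact: tame_coordM]. Qed.

Lemma tame_Yop j F : tame F -> tame (Yop j F).
Proof. by move=> tF; apply: tame_lin2; [exact: tame_dC|exact: tame_coordM]. Qed.

Lemma Qop_coordM j F y : tame F -> Qop (fun z => z ord0 j * F z) y =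
  (Num.sqrt 2)%:C * (y ord0 j)%:C * Qop F y - Qop (dC j F) y.
Proof. by move=> tF; rewrite /Qop gavg_coordM//; ring. Qed.

Lemma Qop_Yop j F y : tame F -> Qop (Yop j F) y = (y ord0 j)%:C * Qop F y.
Proof.
move=> tF; rewrite (Qop_lin2 _ _ _ (tame_dC j tF) (tame_coordM j tF)) Qop_coordM//.
transitivity (((Num.sqrt 2)%:C * isqrt2) * ((y ord0 j)%:C * Qop F y)); first by ring.
by rewrite isqrt2K mul1r.
Qed.

Lemma cderiv_Qop j F y : tame F -> cderiv j (Qop F : 'rV[R]_d -> C^o) y (Qop (Dop j F) y).
Proof.
move=> tF; have H := cderivM (cderiv_groundC (1 / 2) j y) (cderiv_gavg j y tF).
have H2 := cderivZ q0 H; apply: (cderiv_eq H2).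
rewrite (Qop_lin2 _ _ _ (tame_dC j tF) (tame_coordM j tF)) Qop_coordM//.
have -> : - (2 * (1 / 2) * y ord0 j) = - y ord0 j by lra.
have alg (q g a b x u r : C) : u * u = 2 -> u * r = 1 ->
    q * (- x * g * a + g * (u * b)) = r * (q * (g * b)) + - r * (u * x * (q * (g * a)) - q * (g * b)).
  move=> uu ur; have rE : 2 * r = u by rewrite -uu -mulrA ur mulr1.
  transitivity (q * (g * ((2 * r) * b)) - (u * r) * x * q * g * a); last by ring.
  by rewrite rE ur; ring.
by rewrite rmorphN /Qop; exact: alg (sqrt2C R) isqrt2K.
Qed.

(** The functions [Qop G] with G tame form a class stable under partial derivatives, by
    [cderiv_Qop], so that [smooth_coind] applies. *)
Lemma smooth_Qop F : tame F -> smooth (Qop F : 'rV[R]_d -> C^o).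
Proof.
move=> tF.
apply: (@smooth_coind R d [set f | exists2 G, tame G & f = Qop G]); last by exists F.
move=> f [G tG ->]; split; first exact: continuous_Qop.
  apply: (cderiv_derivable (f' := fun j => Qop (Dop j G))) => j y; exact: cderiv_Qop.
move=> j; exists (Dop j G); first exact: tame_Dop.
by apply/funext => y; apply: cderiv_partial; exact: cderiv_Qop.
Qed.

Lemma partial_Qop j F : tame F -> partial j (Qop F : 'rV[R]_d -> C^o) = Qop (Dop j F).
Proof. by move=> tF; apply/funext => y; apply: cderiv_partial; exact: cderiv_Qop. Qed.

(* Qop intertwines numop with the harmonic oscillator. *)
Definition numop F z : C := \sum_j (F z + 2 * (z ord0 j * dC j F z)).

Lemma tame_num1 j F : tame F -> tame (fun z => F z + 2 * (z ord0 j * dC j F z)).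
Proof.
move=> tF; apply: tame_ext (tame_lin2 1 2 tF (tame_coordM j (tame_dC j tF))) => z.
by rewrite mul1r.
Qed.

Lemma tame_numop F : tame F -> tame (numop F).
Proof. by move=> tF; apply: tame_sum => j; exact: tame_num1. Qed.

(** In each variable y_j^2 - (d/dy_j)^2 corresponds to the square of [Yop j] minus that of [Dop j].
    This is the symmetric product of z_j and d/dz_j, which the commutator turns into 1 + 2 z_j
    d/dz_j. *)
Lemma harmonic_Qop F : tame F -> harmonic_oscillator (Qop F : 'rV[R]_d -> C^o) = Qop (numop F).
Proof.
move=> tF; apply/funext => y.
rewrite /harmonic_oscillator /laplacian /numop Qop_sum; last by move=> j; exact: tame_num1.
rewrite /enorm2 rmorph_sum mulr_suml -sumrB; apply: eq_bigr => j _.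
have tY := tame_Yop j tF; have tD := tame_Dop j tF.
rewrite (partial_Qop j tF) (partial_Qop j tD) rmorphXn expr2 -mulrA -(Qop_Yop j y tF) -(Qop_Yop j y tY).
rewrite -[X in X - _]mul1r -[Qop (Dop _ _) y]mul1r -mulNr -(Qop_lin2 _ _ _ (tame_Yop j tY) (tame_Dop j tD)).
congr (Qop _ y); apply/funext => z.
have tz := tame_coordM j tF; have td := tame_dC j tF.
have dz : dC j (fun z => z ord0 j * F z) z = F z + z ord0 j * dC j F z.
  by rewrite dC_coordM// eqxx mul1r.
rewrite {1}/Yop {1}/Dop (dC_lin2 _ _ j z td tz) (dC_lin2 _ _ j z td tz) dz.
have h2 : isqrt2 * isqrt2 * 2 = 1 :> C.
  by rewrite -(sqrt2C R) mulrACA [isqrt2 * _]mulrC isqrt2K mulr1.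
rewrite /Yop /Dop; move: isqrt2 h2 (dC j (dC j F) z) (dC j F z) (F z) (z ord0 j) => r h2 dd dF f x.
transitivity ((r * r * 2) * (f + 2 * (x * dF))); first by ring.
by rewrite h2 mul1r.
Qed.

Lemma tame_iter_numop N F : tame F -> tame (iter N numop F).
Proof. by move=> tF; elim: N => //= N IH; exact: tame_numop. Qed.

Lemma iter_harmonic_Qop N F : tame F ->
  iter N (@harmonic_oscillator R d) (Qop F) = Qop (iter N numop F).
Proof.
by move=> tF; elim: N => //= N ->; rewrite harmonic_Qop//; exact: tame_iter_numop.
Qed.

Lemma bargmann_Qop_lin (a : C) F G z : tame F -> tame G ->
  bargmann (Qop (a *: F + G)) z = a * bargmann (Qop F) z + bargmann (Qop G) z.
Proof.
move=> tF tG; have [M M0 HM] := tame_growth8 tF; have [N N0 HN] := tame_growth8 tG.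
have := bargmann_lin a z (continuous_Qop tF) (continuous_Qop tG)
  (fun y => normc_Qop_le y tF M0 HM) (fun y => normc_Qop_le y tG N0 HN).
move=> <-; congr (bargmann _ z); apply/funext => y; rewrite !fctE; exact: Qop_lin.
Qed.

(** Multiplication by z_j is [Yop j] minus [Dop j] over sqrt 2, that is, (y_j - d/dy_j) / sqrt 2
    after [Qop]. Integration by parts moves the derivative to the kernel, where d/dy_j gives the
    factor sqrt 2 z_j - y_j; the terms in y_j cancel and z_j is left. *)
Lemma bargmann_Qop_coordM j F z : tame F ->
  bargmann (Qop (fun z => z ord0 j * F z)) z = z ord0 j * bargmann (Qop F) z.
Proof.
move=> tF; have tD := tame_Dop j tF; have tY := tame_Yop j tF.
have [M M0 HM] := tame_growth8 tF; have [N N0 HN] := tame_growth8 tD; have [P P0 HP] := tame_growth8 tY.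
have cQ := continuous_Qop tF; have cD := continuous_Qop tD; have cY := continuous_Qop tY.
have bQ y := normc_Qop_le y tF M0 HM; have bD y := normc_Qop_le y tD N0 HN.
have bY y := normc_Qop_le y tY P0 HP.
have iQ := cinteg_bker cQ bQ z; have iD := cinteg_bker cD bD z; have iY := cinteg_bker cY bY z.
have [r r0 zr] := row_bound z.
pose W y : C^o := bker z y * Qop F y.
pose W' y : C^o := (Num.sqrt 2)%:C * z ord0 j * (bker z y * Qop F y) - bker z y * Qop (Yop j F) y
   + bker z y * Qop (Dop j F) y.
pose E := expR (3 * d%:R * r ^+ 2).
have E0 : 0 <= E by exact: expR_ge0.
pose A := normc q0 * (M * gauss_mass38 R d); pose B := normc q0 * (N * gauss_mass38 R d); pose D := normc q0 * (P * gauss_mass38 R d).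
have A0 : 0 <= A by rewrite !mulr_ge0 ?normc_ge0 ?gauss_mass38_ge0.
have B0 : 0 <= B by rewrite !mulr_ge0 ?normc_ge0 ?gauss_mass38_ge0.
have D0 : 0 <= D by rewrite !mulr_ge0 ?normc_ge0 ?gauss_mass38_ge0.
have bb (f : 'rV[R]_d -> C^o) (K : R) y : (forall y, normc (f y) <= K) -> normc (bker z y * f y) <= E * K * gaussw (1 / 4) y.
  move=> fK; rewrite normcM mulrAC; apply: ler_pM; rewrite ?normc_ge0//.
  exact: normc_bker.
have W'0 : cint mu W' = 0.
  pose S := E * A + 2 * r * (E * A) + E * D + E * B.
  have T0 : 0 <= 2 * r * (E * A) by apply: mulr_ge0; exact: mulr_ge0.
  apply: (@cint_partial_gauss R d j W W' S (1 / 4)).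
  - by lra.
  - by rewrite /S !addr_ge0// mulr_ge0.
  - move=> y; have H := cderivM (cderiv_bker j z y) (cderiv_Qop j y tF).
    apply: (cderiv_eq H); rewrite /W' Qop_Yop// /kfac.
    have alg (a b c u x : C) : (a - x) * b * u + b * c = a * (b * u) - b * (x * u) + b * c by ring.
    exact: alg.
  - by apply: continuousCM => //; exact: continuous_bker.
  - have cb := continuous_bker z.
    have -> : W' = (fun y => ((Num.sqrt 2)%:C * z ord0 j * (bker z y * Qop F y) + -1 * (bker z y * Qop (Yop j F) y))
       + bker z y * Qop (Dop j F) y) by apply/funext => y; rewrite mulN1r.
    exact: (continuousCD (continuousCD (continuousCM (continuousC_cst d _) (continuousCM cb cQ))
      (continuousCM (continuousC_cst d (-1)) (continuousCM cb cY))) (continuousCM cb cD)).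
  - move=> y; apply: le_trans (bb _ _ y bQ) _; rewrite ler_wpM2r ?gaussw_ge0// /S -!addrA lerDl.
    by rewrite !addr_ge0// mulr_ge0.
  - move=> y; rewrite [leRHS](_ : _ = E * A * gaussw (1 / 4) y + (2 * r * (E * A * gaussw (1 / 4) y) +
      E * D * gaussw (1 / 4) y + E * B * gaussw (1 / 4) y)); last by rewrite /S; ring.
    rewrite -[leLHS]add0r; apply: lerD; first by apply: mulr_ge0; [exact: mulr_ge0|exact: gaussw_ge0].
    apply: le_trans (le_normcD _ _) _; apply: lerD; last exact: bb.
    apply: le_trans (le_normcD _ _) _; rewrite normcN; apply: lerD; last exact: bb.
    rewrite normcM [normc (_ * z ord0 j)]normcM; apply: ler_pM; rewrite ?mulr_ge0 ?normc_ge0//; last exact: bb.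
    by apply: ler_pM; rewrite ?normc_ge0// normc_sqrt2.
have H : cint mu (fun y => bker z y * Qop (Yop j F) y) - cint mu (fun y => bker z y * Qop (Dop j F) y) =
   (Num.sqrt 2)%:C * z ord0 j * cint mu (fun y => bker z y * Qop F y).
  apply/eqP; rewrite -subr_eq0 -oppr_eq0; apply/eqP; rewrite -[RHS]W'0.
  have e1 := cintZ ((Num.sqrt 2)%:C * z ord0 j) iQ.
  have e2 := cintB (cintegZ ((Num.sqrt 2)%:C * z ord0 j) iQ) iY.
  have e3 := cintD (cintegB (cintegZ ((Num.sqrt 2)%:C * z ord0 j) iQ) iY) iD.
  have alg (a b c : C) : - (b - c - a) = a - b + c by ring.
  rewrite /W'; etransitivity; first exact: alg.
  symmetry; apply: (etrans e3); congr (_ + _).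
  by apply: (etrans e2); congr (_ - _); exact: e1.
have QE y : Qop (fun z => z ord0 j * F z) y = isqrt2 * (Qop (Yop j F) y - Qop (Dop j F) y).
  have -> : Qop (Yop j F) y - Qop (Dop j F) y = (Num.sqrt 2)%:C * Qop (fun z => z ord0 j * F z) y.
    have tz := tame_coordM j tF; have td := tame_dC j tF.
    rewrite !(Qop_lin2 _ _ _ td tz); have := sqrt2C R; have := isqrt2K.
    move: (Qop (dC j F) y) (Qop _ y) (Num.sqrt 2)%:C isqrt2 => a b v u vu vv.
    have rE : 2 * u = v by rewrite -vv -mulrA vu mulr1.
    by rewrite -rE; ring.
  by rewrite mulrA [isqrt2 * _]mulrC isqrt2K mul1r.
rewrite !bargmannE mulrCA; congr (_ * _).
rewrite (eq_cint mu (g := fun y => isqrt2 * (bker z y * Qop (Yop j F) y - bker z y * Qop (Dop j F) y))); last first.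
  have alg (b c x y : C) : b * (c * (x - y)) = c * (b * x - b * y) by ring.
  by move=> y; rewrite QE; exact: alg.
rewrite (cintZ _ (cintegB iY iD)) (cintB iY iD) H.
have alg (a b x y : C) : a * b = 1 -> b * (a * x * y) = x * y by move=> ab; transitivity ((a * b) * (x * y)); [ring|rewrite ab mul1r].
exact: alg isqrt2K.
Qed.

Lemma bargmann_Qop_cst (c : C) z : bargmann (Qop (fun=> c)) z = c.
Proof.
have g1 y : gaussw (1 / 2 : R) y <= 1 by apply: gaussw_le1; lra.
have A1 y : normc (groundC (1 / 2) y) <= 1 by rewrite normc_groundC.
have p2 : (0 : R) < 1 / 2 by lra.
have gE y : gavg ((fun=> c) : 'rV[R[i]]_d -> C^o) y = c * gmass%:C.
  rewrite /gavg /gmass -cint_real cintZ//; apply: cinteg_real; exact: integ_gaussw.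
have := bargmann_ground z; rewrite !bargmannE => H.
rewrite (eq_cint mu (g := fun y => (q0 * (c * gmass%:C)) * (bker z y * groundC (1 / 2) y))); last first.
  by move=> y; rewrite /Qop gE; ring.
have i1 := cinteg_bker (@continuous_groundC R d (1 / 2)) A1 z.
have e1 := cintZ (q0 * (c * gmass%:C)) i1.
rewrite e1 mulrCA H; transitivity (c * (q0 * (gmass%:C * (bcst R d * (Num.sqrt pi ^+ d)%:C)))); first by ring.
by rewrite q0K mulr1.
Qed.

Lemma path_taylor F z v (t h M : R) : entire F -> `|h| <= 1 ->
  (forall s : C, normc s <= 4 -> normc (F (z + (t%:C + s) *: v)) <= M) ->
  normc (F (z + (h + t)%:C *: v) - F (z + t%:C *: v) -
    h%:C * \sum_j v ord0 j * dC j F (z + t%:C *: v)) <= M * h ^+ 2.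
Proof.
move=> eF h1 HM; set w := z + t%:C *: v.
have nh : normc h%:C <= 1 by rewrite normc_real.
have := cdiff_taylor (z0 := 0) (M := M) (fun s => entire_cdiff w v s eF) ltr01 nh.
rewrite add0r scale0r addr0 expr1n divr1 normc_real (real_normK (num_real h)).
have -> : z + (h + t)%:C *: v = w + h%:C *: v.
  by rewrite /w -addrA -scalerDl -rmorphD [t + h]addrC.
rewrite [X in _ - X]mulrC; apply => s; rewrite subr0 mulr1 => s4.
by rewrite /w -addrA -scalerDl; exact: HM.
Qed.

Lemma bargmann_Qop_sum (I : Type) (r : seq I) (F : I -> 'rV[R[i]]_d -> C^o) z : (forall i, tame (F i)) ->
  bargmann (Qop (fun u => \sum_(i <- r) F i u)) z = \sum_(i <- r) bargmann (Qop (F i)) z.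
Proof.
move=> tF; elim: r => [|i r IH].
  rewrite big_nil -[RHS](bargmann_Qop_cst 0 z); congr (bargmann (Qop _) z).
  by apply/funext => u; rewrite big_nil.
rewrite big_cons -IH -[X in X + _]mul1r -(bargmann_Qop_lin 1 z (tF i) (tame_sum r tF)).
congr (bargmann (Qop _) z); apply/funext => u.
by rewrite big_cons !fctE scale1r.
Qed.

(** The exponent b is so small that a dilation of modulus at most |t| + 4 leaves at most 2 b (|t| +
    4)^2 <= 1/8 in front of |u|^2. The disc of radius 4 is the one [path_taylor] needs. *)
Lemma growth8_path F z (t M b : R) u (s : C) : 0 <= M -> 0 <= b ->
  (forall w, normc (F w) <= M * expR (b * cn2 w)) -> normc s <= 4 -> b * (16 * (`|t| + 4) ^+ 2) <= 1 ->
  normc (F (z + (t%:C + s) *: (u - z))) <=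
  M * expR (b * (2 * (`|t| + 5) ^+ 2 * cn2 z)) * expR (1 / 8 * cn2 u).
Proof.
move=> M0 b0 HM s4 bt; apply: le_trans (HM _) _; rewrite -[leRHS]mulrA ler_wpM2l// -expRD ler_expR.
apply: le_trans (ler_wpM2l b0 (cn2_affine z u _)) _; rewrite mulrDr; apply: lerD.
  apply: ler_wpM2l => //; apply: ler_wpM2r; first exact: cn2_ge0.
  apply: ler_wpM2l => //; rewrite lerXn2r ?nnegrE ?normc_ge0 ?addr_ge0//.
  apply: le_trans (le_normcD _ _) _; rewrite normcN ComplexField.Normc.normc1.
  have := le_normcD t%:C s; rewrite normc_real; lra.
rewrite mulrA; apply: ler_wpM2r; first exact: cn2_ge0.
have h : normc (t%:C + s) ^+ 2 <= (`|t| + 4) ^+ 2.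
  rewrite lerXn2r ?nnegrE ?normc_ge0 ?addr_ge0//.
  by have := le_normcD t%:C s; rewrite normc_real; lra.
have := ler_wpM2l b0 h; move: (normc _ ^+ 2) ((_ + 4) ^+ 2) bt => x y bt; lra.
Qed.

Lemma small_multiple (x : R) : 0 <= x -> exists b : R, 0 < b /\ b * x <= 1.
Proof.
move=> x0; have x1 : 0 < x + 1 by rewrite ltr_wpDl.
exists (x + 1)^-1; split; first by rewrite invr_gt0.
by rewrite ler_pdivrMl// mulr1 lerDl.
Qed.

(* The operator bargmann \o Qop commutes with multiplication by the
   coordinates, so that it kills at z any multiple of a coordinate of u - z;
   hence psi(t) = bargmann (Qop (F (z + t (u - z)))) z is constant. *)
Lemma bargmann_QopK F z : tame F -> bargmann (Qop F) z = F z.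
Proof.
move=> tF; pose Fl (l : R) u := F (z + l%:C *: (u - z)).
have tFl l : tame (Fl l) by exact: tame_affine.
pose Psi (l : R) := bargmann (Qop (Fl l)) z.
have P1 : Psi 1 = bargmann (Qop F) z.
  congr (bargmann (Qop _) z); apply/funext => u.
  by rewrite /Fl rmorph1 scale1r subrKC.
have P0 : Psi 0 = F z.
  rewrite -[RHS](bargmann_Qop_cst (F z) z); congr (bargmann (Qop _) z); apply/funext => u.
  by rewrite /Fl rmorph0 scale0r addr0.
rewrite -P1 -P0; apply: cst_quad => t.
have [b [b0 bt]] : exists b : R, 0 < b /\ b * (16 * (`|t| + 4) ^+ 2) <= 1.
  by apply: small_multiple; apply: mulr_ge0; [exact: ler0n|exact: sqr_ge0].
have [M M0 HM] := tF.2 b b0.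
have [K K0 HK] : exists2 K : R, 0 <= K & forall u (s : C), normc s <= 4 ->
    normc (F (z + (t%:C + s) *: (u - z))) <= K * expR (1 / 8 * cn2 u).
  exists (M * expR (b * (2 * (`|t| + 5) ^+ 2 * cn2 z))); first by rewrite mulr_ge0 ?expR_ge0.
  by move=> u s s4; exact: (growth8_path z u M0 (ltW b0) HM s4 bt).
have [r r0 zr] := row_bound z.
have I0 := gauss_mass38_ge0; have N0 := normc_ge0 (q0 : C).
(* At the fixed point z, [bargmann \o Qop] is bounded by the constant of [growth8]; a quadratic
   remainder in t therefore passes to [Psi]. *)
have [B B0 HB] : exists2 B : R, 0 <= B & forall G (e : R), 0 <= e -> tame G -> growth8 G (K * e) ->
    normc (bargmann (Qop G) z) <= B * e.
  have J0 : 0 <= \int[mu]_y gaussw (1 / 4 : R) y by apply: Rint_ge0 => y; exact: gaussw_ge0.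
  exists (normc (bcst R d) * (expR (3 * d%:R * r ^+ 2) * (normc (q0 : C) * (K * gauss_mass38 R d)) * \int[mu]_y gaussw (1 / 4) y)).
    exact: (mulr_ge0 (normc_ge0 _) (mulr_ge0 (mulr_ge0 (expR_ge0 _) (mulr_ge0 N0 (mulr_ge0 K0 I0))) J0)).
  move=> G e e0 tG HG.
  have := normc_bargmann (continuous_Qop tG) (fun y => normc_Qop_le y tG (mulr_ge0 K0 e0) HG) r0 zr.
  move=> /le_trans; apply; rewrite le_eqVlt; apply/orP; left; apply/eqP.
  by move: (normc q0) (gauss_mass38 R d) (\int[mu]_y _) (normc _) (expR _) => *; ring.
exists B; [exact: B0|move=> h h1].
clear r r0 zr I0 N0 M M0 HM b b0 bt.
pose G j u : C := dC j F (z + t%:C *: (u - z)).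
have tG j : tame (G j) by apply: (@tame_affine R d (dC j F)); exact: tame_dC.
pose L j : 'rV[R[i]]_d -> C^o := (- z ord0 j) *: (G j : 'rV[R[i]]_d -> C^o) + (fun u => u ord0 j * G j u).
have tL j : tame (L j) by apply: tame_lin; [exact: tG|exact: tame_coordM].
have L0 j : bargmann (Qop (L j)) z = 0.
  by rewrite (bargmann_Qop_lin _ z (tG j) (tame_coordM j (tG j))) (bargmann_Qop_coordM j z (tG j)) mulNr addNr.
pose S u := \sum_j L j u.
have tS : tame S by exact: tame_sum.
(* The remainder, as a function of u, of the first order expansion of F (z + t (u - z)) in t. Its
   linear term h S is killed by [L0], so V has the same image as the increment. *)
pose V : 'rV[R[i]]_d -> C^o := (- h%:C) *: (S : 'rV[R[i]]_d -> C^o) + ((-1) *: (Fl t : 'rV[R[i]]_d -> C^o) + Fl (h + t)).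
have tV : tame V by exact: (tame_lin _ tS (tame_lin _ (tFl t) (tFl (h + t)))).
have VE : bargmann (Qop V) z = Psi (h + t) - Psi t.
  rewrite (bargmann_Qop_lin (- h%:C) z tS (tame_lin (-1) (tFl t) (tFl (h + t)))).
  rewrite (bargmann_Qop_lin (-1) z (tFl t) (tFl (h + t))) (bargmann_Qop_sum _ z tL).
  by rewrite big1 ?mulr0 ?add0r ?mulN1r 1?addrC.
rewrite -VE; apply: HB; [exact: sqr_ge0|exact: tV|].
move=> u; have := @path_taylor F z (u - z) t h (K * expR (1 / 8 * cn2 u)) tF.1 h1 (HK u).
rewrite mulrAC; apply: le_trans; rewrite le_eqVlt; apply/orP; left; apply/eqP; congr normc.
rewrite /V !fctE /S; have -> : \sum_j L j u = \sum_j (u - z) ord0 j * dC j F (z + t%:C *: (u - z)).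
  apply: eq_bigr => j _; rewrite /L !fctE !mxE /G; move: (dC j F _) => q.
  by rewrite mulrDl addrC.
have alg (x y w q : C) : - x * y + (-1 * w + q) = q - w - x * y by ring.
exact: alg.
Qed.

End inverse_transform.

(** * Bounds for the inverse transform *)

Section estimates.
Variables (R : realType).
Local Notation C := (R[i]).
Local Notation Re := complex.Re.
Local Notation Im := complex.Im.
Local Notation normc := ComplexField.Normc.normc.
Local Notation normcM := ComplexField.Normc.normcM.

Lemma exprn_le_fact_expR (u : R) n : 0 <= u -> u ^+ n <= n`!%:R * expR u.
Proof.
move=> u0; have F0 : (0 : R) < n`!%:R by rewrite ltr0n fact_gt0.
rewrite mulrC -ler_pdivrMr//; case: n F0 => [|n] F0.
  by rewrite expr0 fact0 divr1 -expR0 ler_expR.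
by apply: le_trans (expR_ge1Dxn n u0); rewrite lerDr.
Qed.

(** For an integer n >= p one has u^p <= 1 + u^n and u^(n+1) <= (n+1)! expR u; beyond the threshold
    U = (n+1)! / e, dividing by u gives u^n <= e expR u. *)
Lemma powR_le_expR (p e : R) : 0 <= p -> 0 < e ->
  exists2 K : R, 0 <= K & forall u : R, 0 <= u -> u `^ p <= K + e * expR u.
Proof.
move=> p0 e0; pose n := (Num.truncn p).+1.
have pn : p <= n%:R by exact: ltW (truncnS_gt p).
pose U : R := n.+1`!%:R / e.
have U0 : 0 <= U by rewrite divr_ge0// ltW.
exists (1 + U ^+ n) => [|u u0]; first by rewrite addr_ge0// exprn_ge0.
have un : u `^ p <= 1 + u ^+ n.
  have [u1|u1] := leP u 1.
    apply: (@le_trans _ _ 1); last by rewrite lerDl exprn_ge0.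
    apply: (@le_trans _ _ (1 `^ p)); last by rewrite powR1.
    by apply: ge0_ler_powR; rewrite ?nnegrE.
  rewrite -powR_mulrn//; apply: (@le_trans _ _ (u `^ n%:R)); last by rewrite lerDr.
  by apply: ler_powR => //; exact: ltW.
apply: le_trans un _; rewrite -addrA lerD2l.
have [uU|uU] := leP u U.
  apply: (@le_trans _ _ (U ^+ n)); first by rewrite lerXn2r ?nnegrE.
  by rewrite lerDl mulr_ge0 ?expR_ge0// ltW.
apply: (@le_trans _ _ (e * expR u)); last by rewrite lerDr exprn_ge0.
have u1 : 0 < u by exact: le_lt_trans uU.
rewrite -(ler_pM2l u1) -exprS; apply: le_trans (exprn_le_fact_expR n.+1 u0) _.
rewrite mulrA ler_wpM2r ?expR_ge0//.
by move: (ltW uU); rewrite ler_pdivrMr.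
Qed.

(** K is the point where e u^(p-1) = 1; beyond it the power dominates u. *)
Lemma le_powR_linear (p e : R) : 1 < p -> 0 < e ->
  exists2 K : R, 0 <= K & forall u : R, 0 <= u -> u <= K + e * u `^ p.
Proof.
move=> p1 e0; pose K := (e^-1) `^ (p - 1)^-1.
have p10 : 0 < p - 1 by rewrite subr_gt0.
have ei : 0 < e^-1 by rewrite invr_gt0.
have K0 : 0 < K by rewrite powR_gt0.
exists K => [|u u0]; first exact: ltW.
have [uK|uK] := leP u K; first by apply: le_trans uK _; rewrite lerDl mulr_ge0 ?powR_ge0// ltW.
apply: (@le_trans _ _ (e * u `^ p)); last by rewrite lerDr ltW.
have u1 : 0 < u by exact: lt_trans uK.
have -> : u `^ p = u * u `^ (p - 1).
  by rewrite -{2}(powRr1 u0) -powRD ?subrKC// (gt_eqF u1) implybT.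
rewrite mulrCA ler_peMr// -ler_pdivrMl// mulr1.
have <- : K `^ (p - 1) = e^-1 by rewrite /K -powRrM mulVf ?gt_eqF// powRr1// ltW.
by apply: ge0_ler_powR; rewrite ?nnegrE ?ltW.
Qed.

Lemma powRD_le (p a b : R) : 0 <= p -> 0 <= a -> 0 <= b -> (a + b) `^ p <= 2 `^ p * (a `^ p + b `^ p).
Proof.
move=> p0 a0 b0; wlog ab : a b a0 b0 / a <= b.
  by move=> wl; have [/wl|/ltW /wl] := leP a b; [apply|rewrite addrC [a `^ p + _]addrC; apply].
apply: (@le_trans _ _ ((2 * b) `^ p)).
  by apply: ge0_ler_powR; rewrite ?nnegrE ?addr_ge0 ?mulr_ge0//; lra.
by rewrite powRM// ler_wpM2l ?powR_ge0// lerDr powR_ge0.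
Qed.

(** Each differentiation gives up a margin D of the disc and costs a factor 1 / D. *)
Lemma iter_cauchy (G : nat -> C -> C) (r M D : R) :
  (forall n t, cdiff (G n) t (G n.+1 t)) -> 0 < D ->
  (forall t, normc t <= r -> normc (G 0%N t) <= M) ->
  forall n t, normc t + n%:R * D <= r -> normc (G n t) <= M / D ^+ n.
Proof.
move=> dG D0 GM; elim=> [|n IH] t.
  by rewrite mul0r addr0 expr0 divr1; exact: GM.
move=> tr; rewrite exprSr invfM mulrA.
apply: (cauchy_estimate (dG n)) => // w wt; apply: IH.
rewrite -[w](subrK t); apply: le_trans (lerD (le_normcD _ _) (lexx _)) _.
by move: tr; rewrite wt -natr1; lra.
Qed.

Lemma powR_exprn (x a : R) n : 0 <= x -> (x ^+ n) `^ a = (x `^ a) ^+ n.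
Proof.
move=> x0; elim: n => [|n IH]; first by rewrite !expr0 powR1.
by rewrite !exprS powRM ?exprn_ge0// IH.
Qed.

(** The choice A r^p = n, D = r / n turns the left side into e^n (n^(2s) A^(1-2s))^n. Then n^n <= n!
    e^n, raised to the power 2s <= 1, leaves e^n e^(2sn) <= e^(2n), the origin of the factor
    [expR 2]. *)
Lemma cauchy_optimize (s A : R) (n : nat) : 0 < s -> s < 2^-1 -> 0 < A ->
  exists r D : R, [/\ 0 < D, 0 <= r, n%:R * D <= r &
    expR (A * r `^ (1 - 2 * s)^-1) / D ^+ n <= (expR 2 * A `^ (1 - 2 * s)) ^+ n * n`!%:R `^ (2 * s)].
Proof.
move=> s0 s2 A0; set q := 1 - 2 * s; have q0 : 0 < q by rewrite /q; lra.
(* For n = 0 the step r / n degenerates; r = 0 with any positive D will do. *)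
case: n => [|n].
  exists 0, 1; split=> //.
  by rewrite powR0 ?invr_eq0 ?gt_eqF// mulr0 expR0 !expr0 fact0 powR1 divr1 mul1r.
set x : R := n.+1%:R; have x0 : 0 < x by rewrite ltr0n.
have xA : 0 < x / A by rewrite divr_gt0.
pose r := (x / A) `^ q; have r0 : 0 < r by rewrite powR_gt0.
exists r, (r / x); split; [by rewrite divr_gt0|exact: ltW| |].
  by rewrite mulrC mulfVK ?gt_eqF.
have -> : A * r `^ q^-1 = x.
  by rewrite /r -powRrM mulfV ?gt_eqF// powRr1 ?(ltW xA)// mulrC mulfVK ?gt_eqF.
have F0 : (0 : R) < n.+1`!%:R by rewrite ltr0n fact_gt0.
have rE : (r / x)^-1 = x `^ (2 * s) * A `^ q.
  rewrite invf_div /r powRM ?invr_ge0 ?(ltW x0) ?(ltW A0)//.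
  have xE : x = x `^ (2 * s) * x `^ q.
    by rewrite -powRD ?(gt_eqF x0) ?implybT// /q subrKC powRr1// ltW.
  have AE : (A^-1) `^ q = (A `^ q)^-1 by rewrite -powR_inv1 ?ltW// -powRrM mulN1r powRN.
  rewrite AE invfM invrK {1}xE; have := powR_gt0 q x0; move: (x `^ q) (x `^ _) (A `^ q) => a b c a0.
  by field; rewrite gt_eqF.
rewrite -exprVn rE !exprMn [leLHS]mulrCA [leRHS]mulrAC mulrA [leLHS]mulrAC [leRHS]mulrAC.
rewrite [leRHS]mulrC [leLHS](_ : _ = A `^ q ^+ n.+1 * (expR x * (x `^ (2 * s)) ^+ n.+1)); last by ring.
rewrite [leRHS](_ : _ = A `^ q ^+ n.+1 * (expR 2 ^+ n.+1 * n.+1`!%:R `^ (2 * s))); last by ring.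
rewrite ler_wpM2l ?exprn_ge0 ?powR_ge0//.
have -> : (x `^ (2 * s)) ^+ n.+1 = (x ^+ n.+1) `^ (2 * s).
  by rewrite powR_exprn// ltW.
have -> : expR 2 ^+ n.+1 = expR x * expR x by rewrite -expRM_natl -expRD; congr expR; rewrite -/x; lra.
rewrite -mulrA ler_wpM2l ?expR_ge0//.
apply: (@le_trans _ _ ((n.+1`!%:R * expR x) `^ (2 * s))).
  have s20 : 0 <= 2 * s by rewrite mulr_ge0// ltW.
  apply: ge0_ler_powR; [exact: s20|by rewrite nnegrE exprn_ge0// ltW|by rewrite nnegrE mulr_ge0 ?expR_ge0//|].
  exact: exprn_le_fact_expR (ltW x0).
rewrite powRM ?expR_ge0// mulrC ler_wpM2r ?powR_ge0//.
rewrite /powR gt_eqF ?expR_gt0// expRK ler_expR ler_piMl ?(ltW x0)//; lra.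
Qed.

Section growth_estimates.
Variable d : nat.
Implicit Types (F : 'rV[R[i]]_d -> C^o) (z : 'rV[R[i]]_d).

Lemma japanese_cn2 z : japanese z = Num.sqrt (1 + cn2 z).
Proof. by []. Qed.

Lemma japanese_le_cn2 z : japanese z <= 1 + cn2 z.
Proof.
have c0 : 0 <= 1 + cn2 z by rewrite addr_ge0// cn2_ge0.
have h := japanese_ge1 z.
have : japanese z ^+ 2 = 1 + cn2 z by rewrite japanese_cn2 sqr_sqrtr.
by move=> <-; rewrite expr2 ler_peMl// (le_trans _ h).
Qed.

Lemma ln_japanese_ge0 z : 0 <= ln (japanese z).
Proof. by rewrite ln_ge0// japanese_ge1. Qed.

Lemma japaneseZ (a : C) z (r : R) : 0 <= r -> normc a <= expR r -> ln (japanese (a *: z)) <= r + ln (japanese z).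
Proof.
move=> r0 ar; have J z' : 0 < japanese z' by apply: lt_le_trans (japanese_ge1 z').
rewrite -ler_expR expRD !lnK ?posrE//.
have e1 : 1 <= expR r by rewrite -expR0 ler_expR.
have -> : expR r * japanese z = Num.sqrt (expR r ^+ 2 * (1 + cn2 z)).
  by rewrite sqrtrM ?sqr_ge0// sqrtr_sqr ger0_norm ?expR_ge0.
rewrite japanese_cn2 ler_sqrt; last by rewrite mulr_ge0 ?sqr_ge0 ?addr_ge0 ?cn2_ge0.
rewrite mulrDr mulr1 cn2Z; apply: lerD; first by rewrite exprn_ege1.
by rewrite ler_wpM2r ?cn2_ge0// lerXn2r ?nnegrE ?expR_ge0 ?normc_ge0.
Qed.

(** [powR_le_expR] at u = log <z>, together with <z> <= 1 + |z|^2. It makes the functions of the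
    growth spaces tame. *)
Lemma log_growth_gauss (p r b : R) : 0 <= p -> 0 <= r -> 0 < b ->
  exists2 K : R, 0 <= K & forall z, r * ln (japanese z) `^ p <= K + b * cn2 z.
Proof.
move=> p0 r0 b0; have c0 : 0 < b / (r + 1) by rewrite divr_gt0// ltr_wpDl.
have [K K0 HK] := powR_le_expR p0 c0.
exists (r * K + b); first by rewrite addr_ge0 ?mulr_ge0// ltW.
move=> z; have J0 : 0 < japanese z by apply: lt_le_trans (japanese_ge1 z).
have := HK _ (ln_japanese_ge0 z); rewrite lnK ?posrE// => h.
apply: le_trans (ler_wpM2l r0 h) _; rewrite mulrDr -addrA lerD2l.
apply: (@le_trans _ _ (b * japanese z)).
  rewrite mulrA ler_wpM2r ?(ltW J0)// mulrCA ler_piMr ?(ltW b0)//.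
  by rewrite ler_pdivrMr ?mul1r ?lerDl// ltr_wpDl.
by rewrite -[X in X + _]mulr1 -mulrDr ler_wpM2l ?(ltW b0)// japanese_le_cn2.
Qed.

Lemma tame_of_growth F (p r M : R) : 0 <= p -> 0 <= r -> 0 <= M -> entire F ->
  (forall z, normc (F z) <= M * expR (r * ln (japanese z) `^ p)) -> tame F.
Proof.
move=> p0 r0 M0 eF HF; split=> // b b0.
have [K K0 HK] := log_growth_gauss p0 r0 b0.
exists (M * expR K); first by rewrite mulr_ge0 ?expR_ge0.
by move=> z; apply: le_trans (HF z) _; rewrite -mulrA -expRD ler_wpM2l// ler_expR.
Qed.

(* The group generated by numop. *)
Definition dilated F z (t : C) : C := cexp (d%:R * t) * F (0 + cexp (2 * t) *: z).

Lemma cdiff_dilated F z t : entire F -> cdiff (dilated F z) t (dilated (numop F) z t).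
Proof.
move=> eF.
have c1 := cdiff_comp (cdiff_affine 0 d%:R t) (cdiff_cexp (0 + d%:R * t)).
have c2 := cdiff_comp (cdiff_affine 0 2 t) (cdiff_cexp (0 + 2 * t)).
have c3 := cdiff_comp c2 (entire_cdiff 0 z (cexp (0 + 2 * t)) eF).
have := cdiffM c1 c3; rewrite !add0r => H; apply: cdiff_eq (cdiff_ext _ H) _.
  by move=> w; rewrite /dilated !add0r.
have nE w : numop F w = d%:R * F w + 2 * \sum_j w ord0 j * dC j F w.
  by rewrite /numop big_split /= sumr_const card_ord -[X in X + _]mulr_natl mulr_sumr.
rewrite /dilated add0r nE.
have -> : \sum_j (cexp (2 * t) *: z) ord0 j * dC j F (cexp (2 * t) *: z) =
    cexp (2 * t) * \sum_j z ord0 j * dC j F (cexp (2 * t) *: z).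
  by rewrite mulr_sumr; apply: eq_bigr => j _; rewrite mxE mulrA.
have alg (a b c e k f : C) : a * e * f + a * (b * (c * k)) = a * (e * f + k * (c * b)) by ring.
exact: alg.
Qed.

(** The n-th derivative of the dilated function at 0 is [iter n numop F] at z, and n Cauchy
    estimates in the disc of radius t bound it. In that disc log <e^(2w) z> <= 2 t + log <z>. *)
Lemma numop_bound (s r : R) : 0 < s -> s < 2^-1 -> 0 < r ->
  let p := (1 - 2 * s)^-1 in
  exists2 K : R, 0 <= K & forall F (M : R), 0 <= M -> tame F ->
    (forall z, normc (F z) <= M * expR (r * ln (japanese z) `^ p)) ->
    forall n z, normc (iter n (@numop R d) F z) <= M * expR (K + 2 `^ p * r * ln (japanese z) `^ p) *
      ((expR 2 * (r * (4 `^ p + 1)) `^ (1 - 2 * s)) ^+ n * n`!%:R `^ (2 * s)).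
Proof.
move=> s0 s2 r0 p; have qp : 0 < 1 - 2 * s by lra.
have p0 : 0 <= p by rewrite invr_ge0 ltW.
have p1 : 1 < p by rewrite /p invf_gt1//; lra.
(* By [powRD_le], (2 t + log <z>)^p <= 4^p t^p + 2^p (log <z>)^p, which accounts for r 4^p. The
   summand 1 pays for the factor e^(d t), whose exponent is at most d K0 + r t^p by
   [le_powR_linear]. *)
set A := r * (4 `^ p + 1).
have A0 : 0 < A by rewrite mulr_gt0// ltr_wpDl// powR_ge0.
have rd0 : 0 < r / (d%:R + 1) by rewrite divr_gt0// ltr_wpDl.
have [K0 K00 HK0] := le_powR_linear p1 rd0.
exists (d%:R * K0); first by rewrite mulr_ge0.
move=> F M M0 tF HF n z.
have [t [D [D0 t0 nD HD]]] := cauchy_optimize n s0 s2 A0.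
rewrite -/p in HD.
pose G k := dilated (iter k (@numop R d) F) z.
have dG k w : cdiff (G k) w (G k.+1 w) by apply: cdiff_dilated; exact: (tame_iter_numop k tF).1.
have G0 w : normc w <= t -> normc (G 0%N w) <= M * expR (d%:R * K0 + 2 `^ p * r * ln (japanese z) `^ p) * expR (A * t `^ p).
  move=> wt; rewrite /G /= /dilated add0r normcM normc_cexp.
  have ReW : Re w <= t.
    by apply: le_trans wt; apply: le_trans (ler_Re_normc _); exact: ler_norm.
  have h1 : expR (Re (d%:R * w)) <= expR (d%:R * t).
    rewrite ler_expR -(rmorph_nat (real_complex R) d).
    have -> : Re ((d%:R)%:C * w) = d%:R * Re w by case: (w) => [? ?] /=; ring.
    by rewrite ler_wpM2l.
  have h2 : ln (japanese (cexp (2 * w) *: z)) <= 2 * t + ln (japanese z).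
    apply: japaneseZ; first by rewrite mulr_ge0.
    rewrite normc_cexp ler_expR -(rmorph_nat (real_complex R) 2).
    have -> : Re ((2%:R)%:C * w) = 2 * Re w by case: (w) => [? ?] /=; ring.
    by rewrite ler_wpM2l.
  apply: le_trans (ler_pM (expR_ge0 _) (normc_ge0 _) h1 (HF _)) _.
  rewrite mulrCA -!mulrA ler_wpM2l// -!expRD ler_expR.
  have h3 : ln (japanese (cexp (2 * w) *: z)) `^ p <= 2 `^ p * ((2 * t) `^ p + ln (japanese z) `^ p).
    apply: le_trans (powRD_le p0 _ (ln_japanese_ge0 z)); last by rewrite mulr_ge0.
    apply: ge0_ler_powR => //; rewrite ?nnegrE ?ln_japanese_ge0// addr_ge0 ?mulr_ge0 ?ln_japanese_ge0//.
  have h4 := ler_wpM2l (ltW r0) h3.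
  have E4 : 2 `^ p * (2 * t) `^ p = 4 `^ p * t `^ p.
    rewrite -powRM ?mulr_ge0// -[in RHS]powRM//; congr (_ `^ p); ring.
  rewrite mulrDr E4 in h4.
  have h5 := ler_wpM2l (ler0n R d) (HK0 t t0).
  have h6 : d%:R * (r / (d%:R + 1) * t `^ p) <= r * t `^ p.
    rewrite mulrA ler_wpM2r ?powR_ge0// mulrCA ler_piMr ?(ltW r0)//.
    by rewrite ler_pdivrMr ?mul1r ?lerDl// ltr_wpDl.
  rewrite mulrDr in h5; rewrite /A.
  have alg (a X Y T W E P k : R) : r * X <= r * (E * T + P * Y) -> a <= k + W -> W <= r * T ->
    a + r * X <= k + P * (r * Y) + r * ((E + 1) * T).
    move=> k4 k5 k6; have -> : k + P * (r * Y) + r * ((E + 1) * T) = (k + r * T) + r * (E * T + P * Y) by ring.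
    by apply: lerD => //; apply: le_trans k5 _; rewrite lerD2l.
  exact: alg h4 h5 h6.
have := @iter_cauchy G t _ D dG D0 G0 n 0; rewrite ComplexField.Normc.normc0 add0r => /(_ nD).
rewrite {1}/G /dilated !mulr0 cexp0 mul1r scale1r add0r => /le_trans; apply.
rewrite -mulrA ler_wpM2l// mulr_ge0 ?expR_ge0//.
Qed.

Lemma Qop_bound (s r : R) : 0 < s -> s < 2^-1 -> 0 < r ->
  let p := (1 - 2 * s)^-1 in
  exists2 K : R, 0 <= K & forall F (M : R), 0 <= M -> tame F ->
    (forall z, normc (F z) <= M * expR (r * ln (japanese z) `^ p)) ->
    forall n y, normc (iter n (@harmonic_oscillator R d) (Qop F) y) <= K * M *
      ((expR 2 * (r * (4 `^ p + 1)) `^ (1 - 2 * s)) ^+ n * n`!%:R `^ (2 * s)).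
Proof.
move=> s0 s2 r0 p; have qp : 0 < 1 - 2 * s by lra.
have p0 : 0 <= p by rewrite invr_ge0 ltW.
have [K K0 HK] := numop_bound s0 s2 r0; rewrite -/p in HK.
have p8 : (0 : R) < 1 / 8 by lra.
have r2 : 0 <= 2 `^ p * r by rewrite mulr_ge0 ?powR_ge0// ltW.
(* The growth 2^p r (log <z>)^p is absorbed by e^(|z|^2 / 8), so that [normc_Qop_le] applies to all
   iterates with the same loss. *)
have [L L0 HL] := log_growth_gauss p0 r2 p8.
exists (normc (q0 R d) * (expR (K + L) * gauss_mass38 R d)).
  by rewrite mulr_ge0 ?normc_ge0 ?mulr_ge0 ?expR_ge0 ?gauss_mass38_ge0.
move=> F M M0 tF HF n y; set c := _ ^+ n * _.
have c0 : 0 <= c by rewrite mulr_ge0 ?powR_ge0// exprn_ge0// mulr_ge0 ?expR_ge0 ?powR_ge0.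
rewrite iter_harmonic_Qop//.
have tn := tame_iter_numop n tF.
have g8 : growth8 (iter n (@numop R d) F) (M * expR (K + L) * c).
  move=> z; apply: le_trans (HK F M M0 tF HF n z) _; rewrite -/c.
  rewrite [leRHS]mulrAC; apply: ler_wpM2r => //; rewrite -[leRHS]mulrA; apply: ler_wpM2l => //.
  by rewrite -expRD ler_expR -addrA lerD2l.
have M1 : 0 <= M * expR (K + L) * c by apply: mulr_ge0 => //; rewrite mulr_ge0 ?expR_ge0.
apply: le_trans (normc_Qop_le y tn M1 g8) _.
by rewrite le_eqVlt; apply/orP; left; apply/eqP; ring.
Qed.

End growth_estimates.
End estimates.

(** * Topological isomorphisms from norm estimates *)

Section bounded_continuous.
Variables (R : realType) (V W : lmodType R[i]) (E : norm_scale V) (F : norm_scale W).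

(** Preimages of absolutely convex sets under a linear map are absolutely convex, so continuity on
    the inductive limit reduces to a norm bound on each step E_h. *)
Lemma roumieu_bounded_continuous (T : {linear roumieu_space E -> roumieu_space F}) :
  (forall h, 0 < h -> exists r c : R, [/\ 0 < r, 0 < c & forall f : roumieu_space E,
    (scale_norm F r (roumieu_val (T f)) <= c%:E * scale_norm E h (roumieu_val f))%E]) ->
  continuous T.
Proof.
move=> HT; apply/continuousP => O oO.
move=> f /oO[U [cU nU UO]]; exists (T @^-1` U); split.
- by move=> a b u v ab Uu Uv; rewrite /preimage /= linearD !linearZ; exact: cU.
- move=> h h0; have [r [c [r0 c0 Hc]]] := HT h h0; have [e e0 He] := nU r r0.
  exists (c^-1 * e); first by rewrite mulr_gt0 ?invr_gt0.
  move=> g Hg; apply: He; apply: le_lt_trans (Hc g) _.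
  by rewrite -lte_pdivlMl.
- by move=> g Ug; rewrite /preimage /= linearD; exact: UO.
Qed.

Lemma beurling_bounded_continuous (T : {linear beurling_space E -> beurling_space F}) :
  (forall r, 0 < r -> exists h c : R, [/\ 0 < h, 0 < c & forall f : beurling_space E,
    (scale_norm F r (beurling_val (T f)) <= c%:E * scale_norm E h (beurling_val f))%E]) ->
  continuous T.
Proof.
move=> HT; apply/continuousP => O oO.
move=> f /oO[r [e [r0 e0 HO]]]; have [h [c [h0 c0 Hc]]] := HT r r0.
exists h, (c^-1 * e); split; [exact: h0|by rewrite mulr_gt0 ?invr_gt0|].
move=> g Hg; apply: HO.
have -> : beurling_val (T g) - beurling_val (T f) = beurling_val (T (g - f)) by rewrite linearB.
by apply: le_lt_trans (Hc (g - f)) _; rewrite -lte_pdivlMl.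
Qed.

End bounded_continuous.

(** The algebraic hypotheses on the two maps are stated on the larger Roumieu spaces; through this
    inclusion they also serve for the Beurling spaces. *)
Lemma beurling_roumieu (R : realType) (V : lmodType R[i]) (E : norm_scale V) f : f \in beurling E -> f \in roumieu E.
Proof.
by move=> /set_mem[Df Hf]; apply/mem_set; split => //; exists 1; [exact: ltr01|exact: Hf].
Qed.

Section scale_isomorphism.
Variables (R : realType) (V W : lmodType R[i]) (E : norm_scale V) (F : norm_scale W).
Variables (T0 : V -> W) (S0 : W -> V).
Hypothesis T0_dom : {in roumieu E, forall f, scale_dom F (T0 f)}.
Hypothesis S0_dom : {in roumieu F, forall f, scale_dom E (S0 f)}.
Hypothesis T0_lin : forall a, {in roumieu E &, forall f g, T0 (a *: f + g) = a *: T0 f + T0 g}.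
Hypothesis T0K : {in roumieu E, cancel T0 S0}.
Hypothesis S0K : {in roumieu F, cancel S0 T0}.

Let bounded V1 V2 (E1 : norm_scale V1) (E2 : norm_scale V2) (L : V1 -> V2) (h r : R) := exists2 c : R,
  0 < c & {in roumieu E1, forall f, (scale_norm E2 r (L f) <= c%:E * scale_norm E1 h f)%E}.

Hypothesis T0_bounded : forall h, 0 < h -> exists2 r, 0 < r & bounded E F T0 h r.
Hypothesis S0_bounded : forall r, 0 < r -> exists2 h, 0 < h & bounded F E S0 r h.

Lemma roumieu_isomorphism : exists T : {linear roumieu_space E -> roumieu_space F},
  (forall f, roumieu_val (T f) = T0 (roumieu_val f)) /\ topological_isomorphism T.
Proof.
have TP f : f \in roumieu E -> T0 f \in roumieu F.
  move=> Ef; have /set_mem[_ [h h0 hf]] := Ef; apply/mem_set; split; first exact: T0_dom.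
  have [r r0 [c c0 Hc]] := T0_bounded h0; exists r => //; apply: le_lt_trans (Hc f Ef) _.
  by apply: lte_mul_pinfty; rewrite ?lee_fin ?ltW.
have SP f : f \in roumieu F -> S0 f \in roumieu E.
  move=> Ef; have /set_mem[_ [h h0 hf]] := Ef; apply/mem_set; split; first exact: S0_dom.
  have [r r0 [c c0 Hc]] := S0_bounded h0; exists r => //; apply: le_lt_trans (Hc f Ef) _.
  by apply: lte_mul_pinfty; rewrite ?lee_fin ?ltW.
pose T1 (f : roumieu_space E) := RoumieuSpace (TP _ (valP f)).
pose S1 (f : roumieu_space F) := RoumieuSpace (SP _ (valP f)).
have TK : cancel T1 S1 by move=> f; apply: val_inj; exact: T0K (valP f).
have SK : cancel S1 T1 by move=> f; apply: val_inj; exact: S0K (valP f).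
have Tlin : linear T1 by move=> a f g; apply: val_inj; exact: T0_lin (valP f) (valP g).
(* Linearity of the inverse is inherited from [T1] by injectivity. *)
have Slin : linear S1.
  by move=> a f g; apply: (can_inj TK); rewrite Tlin !SK.
pose T : {linear roumieu_space E -> roumieu_space F} := HB.pack T1 (GRing.isLinear.Build _ _ _ _ T1 Tlin).
pose S : {linear roumieu_space F -> roumieu_space E} := HB.pack S1 (GRing.isLinear.Build _ _ _ _ S1 Slin).
exists T; split; first by [].
split.
  apply: roumieu_bounded_continuous => h h0; have [r r0 [c c0 Hc]] := T0_bounded h0.
  by exists r, c; split => // f; exact: Hc (valP f).
exists S; split; [exact: TK|exact: SK|].
apply: roumieu_bounded_continuous => h h0; have [r r0 [c c0 Hc]] := S0_bounded h0.
by exists r, c; split => // f; exact: Hc (valP f).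
Qed.

(** For projective limits the parameters are chosen in the opposite order: the target norm is given,
    and a source norm has to control it. *)
Hypothesis T0_bounded_proj : forall r, 0 < r -> exists2 h, 0 < h & bounded E F T0 h r.
Hypothesis S0_bounded_proj : forall h, 0 < h -> exists2 r, 0 < r & bounded F E S0 r h.

Lemma beurling_isomorphism : exists T : {linear beurling_space E -> beurling_space F},
  (forall f, beurling_val (T f) = T0 (beurling_val f)) /\ topological_isomorphism T.
Proof.
have TP f : f \in beurling E -> T0 f \in beurling F.
  move=> Bf; have Ef := beurling_roumieu Bf; have /set_mem[_ hf] := Bf.
  apply/mem_set; split; first exact: T0_dom.
  move=> r r0; have [h h0 [c c0 Hc]] := T0_bounded_proj r0; apply: le_lt_trans (Hc f Ef) _.
  by apply: lte_mul_pinfty; rewrite ?lee_fin ?(ltW c0)//; exact: hf.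
have SP f : f \in beurling F -> S0 f \in beurling E.
  move=> Bf; have Ef := beurling_roumieu Bf; have /set_mem[_ hf] := Bf.
  apply/mem_set; split; first exact: S0_dom.
  move=> r r0; have [h h0 [c c0 Hc]] := S0_bounded_proj r0; apply: le_lt_trans (Hc f Ef) _.
  by apply: lte_mul_pinfty; rewrite ?lee_fin ?(ltW c0)//; exact: hf.
have vE (f : beurling_space E) := beurling_roumieu (valP f).
have vF (f : beurling_space F) := beurling_roumieu (valP f).
pose T1 (f : beurling_space E) := BeurlingSpace (TP _ (valP f)).
pose S1 (f : beurling_space F) := BeurlingSpace (SP _ (valP f)).
have TK : cancel T1 S1 by move=> f; apply: val_inj; exact: T0K (vE f).
have SK : cancel S1 T1 by move=> f; apply: val_inj; exact: S0K (vF f).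
have Tlin : linear T1 by move=> a f g; apply: val_inj; exact: T0_lin (vE f) (vE g).
have Slin : linear S1.
  by move=> a f g; apply: (can_inj TK); rewrite Tlin !SK.
pose T : {linear beurling_space E -> beurling_space F} := HB.pack T1 (GRing.isLinear.Build _ _ _ _ T1 Tlin).
pose S : {linear beurling_space F -> beurling_space E} := HB.pack S1 (GRing.isLinear.Build _ _ _ _ S1 Slin).
exists T; split; first by [].
split.
  apply: beurling_bounded_continuous => h h0; have [r r0 [c c0 Hc]] := T0_bounded_proj h0.
  by exists r, c; split => // f; exact: Hc (vE f).
exists S; split; [exact: TK|exact: SK|].
apply: beurling_bounded_continuous => h h0; have [r r0 [c c0 Hc]] := S0_bounded_proj h0.
by exists r, c; split => // f; exact: Hc (vF f).
Qed.

End scale_isomorphism.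

(** * The Bargmann transform between the scales *)

Section bargmann_isomorphism.
Variables (R : realType) (d : nat) (s : R).
Hypotheses (s_gt0 : 0 < s) (s_lt : s < 2^-1).
Local Notation C := (R[i]).
Local Notation normc := ComplexField.Normc.normc.
Local Notation p := ((1 - 2 * s)^-1).
Implicit Types (f g : 'rV[R]_d -> C^o) (F : 'rV[R[i]]_d -> C^o).
Local Notation H := (@harmonic_oscillator R d).

Let q_gt0 : 0 < 1 - 2 * s. Proof. by rewrite subr_gt0 mulrC -ltr_pdivlMr// div1r. Qed.

Lemma pilipovic_norm_leP h (M : R) f : 0 < h -> smooth f ->
  (pilipovic_norm s h f <= M%:E)%E <->
  (forall N y, normc (iter N H f y) <= M * (h ^+ N * (N`!%:R) `^ (2 * s))).
Proof.
move=> h0 sf.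
have c0 N : 0 < h ^+ N * (N`!%:R : R) `^ (2 * s).
  by rewrite mulr_gt0 ?exprn_gt0// powR_gt0// ltr0n fact_gt0.
have cN N : continuousC (iter N H f) := (smooth_iter_harmonic N sf [::]).1.
split=> [Hf N|Hf].
  apply/(Linfty_norm_leP _ (cN N)); rewrite mulrC EFinM -lee_pdivrMl//.
  by apply: le_trans Hf; apply: ereal_sup_ubound; exists N.
apply: ge_ereal_sup => _ [N _ <-]; rewrite lee_pdivrMl// -EFinM mulrC.
exact/(Linfty_norm_leP _ (cN N)).
Qed.

Lemma growth_norm_leP (r M : R) F : (growth_norm s r F <= M%:E)%E <->
  (forall z, normc (F z) <= M * expR (r * ln (japanese z) `^ p)).
Proof.
split=> HF.
  move=> z; rewrite -ler_pdivrMr ?expR_gt0// -expRN -lee_fin.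
  by apply: le_trans HF; apply: ereal_sup_ubound; exists z.
apply: ge_ereal_sup => _ [z _ <-].
by rewrite lee_fin expRN ler_pdivrMr ?expR_gt0//; exact: HF.
Qed.

Lemma pilipovic_norm_fin h f : 0 < h -> smooth f -> (pilipovic_norm s h f < +oo)%E ->
  exists2 M : R, 0 <= M & pilipovic_norm s h f = M%:E.
Proof.
move=> h0 sf; have n0 : (0 <= pilipovic_norm s h f)%E.
  apply: le_trans (ereal_sup_ubound _); last by exists 0%N.
  rewrite mule_ge0 ?Linfty_norm_ge0// lee_fin invr_ge0 mulr_ge0 ?powR_ge0//.
case: (pilipovic_norm s h f) n0 => [M|//|//] M0 _.
by exists M; first by rewrite -lee_fin.
Qed.

Lemma growth_norm_fin (r : R) F : (growth_norm s r F < +oo)%E ->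
  exists2 M : R, 0 <= M & growth_norm s r F = M%:E.
Proof.
have n0 : (0 <= growth_norm s r F)%E.
  apply: le_trans (ereal_sup_ubound _); last by exists 0.
  by rewrite lee_fin mulr_ge0 ?normc_ge0 ?expR_ge0.
case: (growth_norm s r F) n0 => [M|//|//] M0 _.
by exists M; first by rewrite -lee_fin.
Qed.

Lemma pilipovic_bounded f : f \in roumieu (pilipovic_scale d s) ->
  smooth f /\ exists2 A : R, 0 <= A & forall y, normc (f y) <= A.
Proof.
move=> /set_mem[sf [h h0 /(pilipovic_norm_fin h0 sf)[M M0 HM]]]; split; first exact: sf.
have /(pilipovic_norm_leP _ h0 sf) Hb : (pilipovic_norm s h f <= M%:E)%E by rewrite HM.
exists M => // y.
by apply: le_trans (Hb 0%N y) _; rewrite expr0 fact0 powR1 !mulr1.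
Qed.

Lemma entire_growth_tame F : F \in roumieu (growth_scale d s) -> tame F.
Proof.
move=> /set_mem[eF [r r0 /growth_norm_fin[M M0 HM]]].
have /growth_norm_leP Hb : (growth_norm s r F <= M%:E)%E by rewrite HM.
by apply: (tame_of_growth _ (ltW r0) M0 eF Hb); rewrite invr_ge0 (ltW q_gt0).
Qed.

(** The parameter h is sent to (1-2s) h^p, an increasing bijection of the positive reals, so the
    bound can be used with either parameter prescribed. *)
Lemma bargmann_pilipovic_bound h : 0 < h -> exists2 c : R, 0 < c &
  forall f, smooth f -> (growth_norm s ((1 - 2 * s) * h `^ p) (bargmann f) <= c%:E * pilipovic_norm s h f)%E.
Proof.
move=> h0.
set c1 := 3 * (normc (bcst R d) * (expR (3 * d%:R) * \int[lebesgue_rV d]_y gaussw (1 / 4) y)).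
exists (`|c1| + 1); first by rewrite ltr_wpDl.
move=> f sf; have [|] := ltP (pilipovic_norm s h f) +oo%E; last first.
  by rewrite leye_eq => /eqP ->; rewrite gt0_muley ?leey// lte_fin ltr_wpDl.
move=> /(pilipovic_norm_fin h0 sf)[M M0 HM]; rewrite HM -EFinM.
have /(pilipovic_norm_leP _ h0 sf) Hb : (pilipovic_norm s h f <= M%:E)%E by rewrite HM.
apply/growth_norm_leP => z; apply: le_trans (bargmann_growth s_gt0 s_lt h0 M0 sf Hb z) _.
by rewrite ler_wpM2r ?expR_ge0// ler_wpM2r// ler_wpDr// ler_norm.
Qed.

Lemma Qop_growth_bound (r : R) : 0 < r -> exists2 c : R, 0 < c &
  forall F, entire F ->
  (pilipovic_norm s (expR 2 * (r * (4 `^ p + 1)) `^ (1 - 2 * s)) (Qop F) <= c%:E * growth_norm s r F)%E.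
Proof.
move=> r0; have [K K0 HK] := @Qop_bound R d s r s_gt0 s_lt r0.
exists (K + 1); first by rewrite ltr_wpDl.
move=> F eF; have [|] := ltP (growth_norm s r F) +oo%E; last first.
  by rewrite leye_eq => /eqP ->; rewrite gt0_muley ?leey// lte_fin ltr_wpDl.
move=> /growth_norm_fin[M M0 HM]; rewrite HM -EFinM.
have /growth_norm_leP Hb : (growth_norm s r F <= M%:E)%E by rewrite HM.
have tF : tame F by apply: (tame_of_growth _ (ltW r0) M0 eF Hb); rewrite invr_ge0 (ltW q_gt0).
have h0 : 0 < expR 2 * (r * (4 `^ p + 1)) `^ (1 - 2 * s).
  by rewrite mulr_gt0 ?expR_gt0// powR_gt0// mulr_gt0// ltr_wpDl ?powR_ge0.
apply/(pilipovic_norm_leP _ h0 (smooth_Qop tF)) => N y.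
apply: le_trans (HK F M M0 tF Hb N y) _.
rewrite ler_wpM2r ?mulr_ge0 ?powR_ge0 ?exprn_ge0 ?(ltW h0)// ler_wpM2r// lerDl//.
Qed.

(** The difference of Q V f and f is continuous and bounded, and V annihilates it because V Q is the
    identity on tame functions; injectivity concludes. *)
Lemma Qop_bargmannK : {in roumieu (pilipovic_scale d s), cancel (@bargmann R d) (@Qop R d)}.
Proof.
move=> f Ef; have [sf [A A0 fA]] := pilipovic_bounded Ef.
have cf : continuousC f := (sf [::]).1.
have tF : tame (bargmann f).
  have /set_mem[_ [h h0 hf]] := Ef; have [c c0 Hc] := bargmann_pilipovic_bound h0.
  apply: entire_growth_tame; apply/mem_set; split; first exact: (entire_bargmann_bounded sf A0 fA).
  exists ((1 - 2 * s) * h `^ p); first by rewrite mulr_gt0// powR_gt0.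
  by apply: le_lt_trans (Hc f sf) _; apply: lte_mul_pinfty; rewrite ?lee_fin ?(ltW c0).
have cQ := continuous_Qop tF.
have [M M0 HM] := tame_growth8 tF.
have bQ y := normc_Qop_le y tF M0 HM.
apply/funext => x; apply/eqP; rewrite -subr_eq0; apply/eqP.
pose u : 'rV[R]_d -> C^o := (-1) *: f + Qop (bargmann f).
have -> : Qop (bargmann f) x - f x = u x by rewrite /u !fctE scaleN1r addrC.
have cu : continuousC u by exact: continuousC_lin.
apply: (bargmann_eq0 cu (A := A + normc (q0 R d) * (M * gauss_mass38 R d))).
  move=> y; rewrite /u !fctE; apply: le_trans (le_normcD _ _) _.
  by rewrite scaleN1r normcN lerD.
by move=> z; rewrite /u (bargmann_lin _ z cf cQ fA bQ) bargmann_QopK// mulN1r addNr.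
Qed.

Lemma bargmann_roumieu_lin a : {in roumieu (pilipovic_scale d s) &, forall f g,
  bargmann (a *: f + g) = a *: bargmann f + bargmann g}.
Proof.
move=> f g /pilipovic_bounded[sf [A A0 fA]] /pilipovic_bounded[sg [B B0 gB]].
apply/funext => z; exact: (bargmann_lin a z (sf [::]).1 (sg [::]).1 fA gB).
Qed.

Lemma bargmann_roumieu_entire : {in roumieu (pilipovic_scale d s), forall f, entire (bargmann f)}.
Proof.
move=> f /pilipovic_bounded[sf [A A0 fA]]; exact: (entire_bargmann_bounded sf A0 fA).
Qed.

Lemma Qop_roumieu_smooth : {in roumieu (growth_scale d s), forall F, smooth (Qop F : 'rV[R]_d -> C^o)}.
Proof. by move=> F /entire_growth_tame; exact: smooth_Qop. Qed.

Lemma bargmann_QopK_roumieu : {in roumieu (growth_scale d s), cancel (@Qop R d) (@bargmann R d)}.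
Proof. by move=> F /entire_growth_tame tF; apply/funext => z; exact: bargmann_QopK. Qed.

Lemma powR_pK (x : R) : 0 <= x -> (x `^ (1 - 2 * s)) `^ p = x.
Proof. by move=> x0; rewrite -powRrM mulfV ?(gt_eqF q_gt0)// powRr1. Qed.

Lemma powR_Kp (x : R) : 0 <= x -> (x `^ p) `^ (1 - 2 * s) = x.
Proof. by move=> x0; rewrite -powRrM mulVf ?(gt_eqF q_gt0)// powRr1. Qed.

End bargmann_isomorphism.

Theorem theorem10 (R : realType) (d : nat) (s : R)
    (s_gt0 : 0 < s) (s_lt : s < 2^-1) :
  (exists T : {linear pilipovic_S d s -> entire_A d s},
     (forall f, roumieu_val (T f) = bargmann (roumieu_val f)) /\
     topological_isomorphism T) /\
  (exists T : {linear pilipovic_Sigma d s -> entire_A0 d s},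
     (forall f, beurling_val (T f) = bargmann (beurling_val f)) /\
     topological_isomorphism T).
Proof.
have q0 : 0 < 1 - 2 * s by lra.
have f0 : 0 < 4 `^ (1 - 2 * s)^-1 + 1 :> R by rewrite ltr_wpDl ?powR_ge0.
have sdom f : f \in roumieu (pilipovic_scale d s) -> smooth f by move=> /set_mem[].
have gdom F : F \in roumieu (growth_scale d s) -> entire F by move=> /set_mem[].
split.
  apply: (roumieu_isomorphism (S0 := @Qop R d)).
  - exact: bargmann_roumieu_entire.
  - exact: Qop_roumieu_smooth.
  - exact: bargmann_roumieu_lin.
  - exact: Qop_bargmannK.
  - exact: bargmann_QopK_roumieu.
  - move=> h h0; exists ((1 - 2 * s) * h `^ (1 - 2 * s)^-1); first by rewrite mulr_gt0// powR_gt0.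
    have [c c0 Hc] := bargmann_pilipovic_bound d s_gt0 s_lt h0.
    by exists c => // f /sdom; exact: Hc.
  - move=> r r0; exists (expR 2 * (r * (4 `^ (1 - 2 * s)^-1 + 1)) `^ (1 - 2 * s)).
      by rewrite mulr_gt0 ?expR_gt0// powR_gt0// mulr_gt0.
    have [c c0 Hc] := Qop_growth_bound d s_gt0 s_lt r0.
    by exists c => // F /gdom; exact: Hc.
apply: (beurling_isomorphism (S0 := @Qop R d)).
- exact: bargmann_roumieu_entire.
- exact: Qop_roumieu_smooth.
- exact: bargmann_roumieu_lin.
- exact: Qop_bargmannK.
- exact: bargmann_QopK_roumieu.
(* This h solves (1-2s) h^p = r. *)
- move=> r r0; have h0 : 0 < (r / (1 - 2 * s)) `^ (1 - 2 * s) by rewrite powR_gt0// divr_gt0.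
  exists ((r / (1 - 2 * s)) `^ (1 - 2 * s)) => //.
  have [c c0 Hc] := bargmann_pilipovic_bound d s_gt0 s_lt h0.
  have E : (1 - 2 * s) * ((r / (1 - 2 * s)) `^ (1 - 2 * s)) `^ (1 - 2 * s)^-1 = r.
    by rewrite powR_pK// ?divr_ge0 ?(ltW r0) ?(ltW q0)// mulrC mulfVK ?gt_eqF.
  rewrite E in Hc; by exists c => // f /sdom; exact: Hc.
(* This r solves e^2 (r (4^p + 1))^(1-2s) = h. *)
- move=> h h0; pose r := (h / expR 2) `^ (1 - 2 * s)^-1 / (4 `^ (1 - 2 * s)^-1 + 1).
  have r0 : 0 < r by rewrite divr_gt0// powR_gt0// divr_gt0 ?expR_gt0.
  exists r => //; have [c c0 Hc] := Qop_growth_bound d s_gt0 s_lt r0.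
  have E : expR 2 * (r * (4 `^ (1 - 2 * s)^-1 + 1)) `^ (1 - 2 * s) = h.
    by rewrite mulfVK ?gt_eqF// powR_Kp// ?divr_ge0 ?expR_ge0 ?(ltW h0)// mulrC mulfVK ?gt_eqF ?expR_gt0.
  rewrite E in Hc; by exists c => // F /gdom; exact: Hc.
Qed.
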